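(* For $p=7$ and the Fischer group $Fi_{24}'$, with $\bar a=y_1^3+y_2^3$, $\bar b=y_1y_2v^2$, $\bar d=(y_1^3-y_2^3)v^3$, $\bar c'=C+\bar b^3/V=C+y_1^3y_2^3$ and $\bar c''=\bar a^2-2\bar c'$, there is an isomorphism $$H^*(BFi_{24}')\cong DA\{1,\bar b,\bar b^2,\bar a^2V,\bar c'\bar bV,\bar c'\bar b^2V\}\oplus CA\{\bar c'',\bar a\bar d\}.$$
   Context: Throughout $p=7$, and $BG$ is the $7$-completed classifying space. $E=7_+^{1+2}=\langle e_1,e_2,c\mid e_1^7=e_2^7=c^7=1,[e_1,e_2]=c,\ c\text{ central}\rangle$ is the Sylow $7$-subgroup. Notation: $H^*(X)=H^*(X;\mathbb Z)/(p,\sqrt0)$, where $\sqrt0$ is the ideal of nilpotent elements. It is known that $$H^*(BE)\cong\bigl(\mathbb Z/p[y_1,y_2]/(y_1^py_2-y_1y_2^p)\oplus\mathbb Z/p\{C\}\bigr)\otimes\mathbb Z/p[v],$$ $|y_i|=2$, $|C|=2p-2$, $|v|=2p$, $Cy_i=y_i^p$, $C^2=y_1^{2p-2}+y_2^{2p-2}-y_1^{p-1}y_2^{p-1}$. Put $V=v^{p-1}$, $CA=\mathbb Z/p[C,V]$, $D_1=C^p+V$, $D_2=CV$, $DA=\mathbb Z/p[D_1,D_2]\subset CA$. $R\{x_1,\dots\}$ denotes the free $R$-module on the listed elements; $x/V$ is the unique $z$ with $Vz=x$. $\mathrm{Out}(E)\cong GL_2(\mathbb F_7)$, where $g=\begin{pmatrix}\alpha&\beta\\\gamma&\delta\end{pmatrix}$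 acts by $e_1\mapsto e_1^\alpha e_2^\gamma$, $e_2\mapsto e_1^\beta e_2^\delta$, and $g^*y_1=\alpha y_1+\beta y_2$, $g^*y_2=\gamma y_1+\delta y_2$, $g^*v=\det(g)v$, $g^*C=C$. The subgroups isomorphic to $(\mathbb Z/7)^2$ up to $E$-conjugacy are $A_i=\langle c,e_1e_2^i\rangle$ ($i\in\mathbb F_7$) and $A_\infty=\langle c,e_2\rangle$. $H^*(BG)$ is regarded as a subring of $H^*(BE)$ by restriction. For $G=Fi_{24}'$ (sporadic simple group): $W_G(E)=N_G(E)/E\,C_G(E)=6S_3$, generated by $\{\mathrm{diag}(\lambda,\mu):\lambda^3=\mu^3=1\}$, $\begin{pmatrix}0&1\\1&0\end{pmatrix}$ and $\mathrm{diag}(-1,-1)$. The $F^{\mathrm{ec}}$-radical subgroups ($A\cong(\mathbb Z/7)^2$ with $W_G(A)=N_G(A)/C_G(A)\supset SL_2(\mathbb F_7)$) form two classes $\{A_1,A_2,A_4\}$ and $\{A_3,A_5,A_6\}$, with $W_G(A)=SL_2(\mathbb F_7):2$, the group of matrices of determinant $\pm1$; $\{A_0,A_\infty\}$ is a non-radical class. *)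

(* Defs.v *)
(* boolp makes membership in the defining ideal of HBE a boolean predicate. *)
From HB Require Import structures.
From mathcomp Require Import all_boot all_order all_fingroup all_algebra.
From mathcomp Require Import all_solvable.
From mathcomp Require Import ring_quotient.
From mathcomp Require Import boolp.
From mathcomp Require Import mpoly.

Set Implicit Arguments.
Unset Strict Implicit.
Unset Printing Implicit Defensive.

Import GRing.Theory.
Local Open Scope ring_scope.

(* Integral cohomology of BH for a subgroup H of a finite group, from the
   homogeneous bar complex: an n-cochain is an H-invariant function on
   sequences (g_0, ..., g_n) of elements of H.  A cochain is a function on all
   sequences over gT of which only the values on those sequences matter, so
   that restriction to a subgroup is the identity on representatives. *)
Section GroupCohomology.
Variable gT : finGroupType.
Implicit Types (H : {group gT}) (f g h : seq gT -> int) (s : seq gT) (n : nat).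

Definition cochain := seq gT -> int.

Definition simplex H n s : bool := (size s == n.+1) && all (mem H) s.

Definition is_cochain H n f : Prop :=
  forall x s, x \in H -> simplex H n s -> f [seq (x * y)%g | y <- s] = f s.

Definition cobord f : cochain :=
  fun s => \sum_(i < size s) (-1) ^+ i * f (take i s ++ drop i.+1 s).

Definition cocycle H n f : Prop :=
  is_cochain H n f /\ forall s, simplex H n.+1 s -> cobord f s = 0.

Definition coboundary H n f : Prop :=
  if n is m.+1 then
    exists g, is_cochain H m g /\ forall s, simplex H n s -> f s = cobord g s
  else forall s, simplex H n s -> f s = 0.

(* f in degree n, g in any degree *)
Definition cup n f g : cochain := fun s => f (take n.+1 s) * g (drop n s).

(* the k-th cup power of f of degree n, of degree k * n *)
Fixpoint cup_exp n f k : cochain :=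
  if k is k'.+1 then cup n f (cup_exp n f k') else fun=> 1.

Definition nilpotent_class H n f : Prop :=
  exists k, coboundary H (k * n) (cup_exp n f k).

(* The class of f lies in the ideal (p, sqrt 0) of H^*(BH; Z). *)
Definition in_p_nil (p : nat) H n f : Prop :=
  exists g h, [/\ cocycle H n g, cocycle H n h, nilpotent_class H n h
    & coboundary H n (fun s => f s - p%:R * g s - h s)].

End GroupCohomology.

(* The ring Z/7[y1,y2,C,v] modulo (y1^7 y2 - y1 y2^7, C y1 - y1^7, C y2 - y2^7,
   C^2 - (y1^12 + y2^12 - y1^6 y2^6)); the last three relations make
   (Z/7[y1,y2]/(y1^7 y2 - y1 y2^7) + Z/7{C}) (x) Z/7[v] its underlying
   vector space. *)
Section HBE.

Notation P := {mpoly 'F_7[4]}.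
Notation Y1 := ('X_(inord 0) : P).
Notation Y2 := ('X_(inord 1) : P).
Notation Cc := ('X_(inord 2) : P).

Definition HBE_rel : 'I_4 -> P := fun i => [::
  Y1 ^+ 7 * Y2 - Y1 * Y2 ^+ 7;
  Cc * Y1 - Y1 ^+ 7;
  Cc * Y2 - Y2 ^+ 7;
  Cc ^+ 2 - (Y1 ^+ 12 + Y2 ^+ 12 - Y1 ^+ 6 * Y2 ^+ 6)]`_i.

Definition HBE_ideal : {pred P} :=
  [pred q | `[< exists k : 'I_4 -> P, q = \sum_i k i * HBE_rel i >]].

Lemma HBE_idealP : idealr_closed HBE_ideal.
Proof.
split.
- apply/asboolP; exists (fun=> 0).
  by rewrite big1 // => i _; rewrite mul0r.
- apply/asboolP => -[k /(congr1 (meval (fun=> 0)))].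
  rewrite rmorph1 rmorph_sum big1 => [/eqP|i _]; first by rewrite oner_eq0.
  rewrite rmorphM /=; apply/eqP; rewrite mulf_eq0; apply/orP; right.
  apply/eqP.
  have X0 j m : ('X_j ^+ m.+1 : P).@[fun=> 0] = 0.
    by rewrite exprS mevalM mevalXU mul0r.
  have X1 j : ('X_j : P).@[fun=> 0] = 0 by rewrite mevalXU.
  have XM (p q : P) : p.@[fun=> 0] = 0 -> (p * q).@[fun=> 0] = 0.
    by rewrite mevalM => ->; rewrite mul0r.
  have XB (p q : P) : p.@[fun=> 0] = 0 -> q.@[fun=> 0] = 0 ->
      (p - q).@[fun=> 0] = 0.
    by rewrite mevalB => -> ->; rewrite subr0.
  have XD (p q : P) : p.@[fun=> 0] = 0 -> q.@[fun=> 0] = 0 ->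
      (p + q).@[fun=> 0] = 0.
    by rewrite mevalD => -> ->; rewrite addr0.
  case: i => [[|[|[|[|//]]]] lti]; rewrite /HBE_rel; cbn [nth nat_of_ord].
  + exact: (XB _ _ (XM _ _ (X0 _ 6)) (XM _ _ (X1 _))).
  + exact: (XB _ _ (XM _ _ (X1 _)) (X0 _ 6)).
  + exact: (XB _ _ (XM _ _ (X1 _)) (X0 _ 6)).
  + exact: (XB _ _ (X0 _ 1)
             (XB _ _ (XD _ _ (X0 _ 11) (X0 _ 11)) (XM _ _ (X0 _ 5)))).
- move=> a u w /asboolP[k ->] /asboolP[l ->]; apply/asboolP.
  exists (fun i => a * k i + l i).
  by rewrite mulr_sumr -big_split; apply: eq_bigr => i _; rewrite mulrDl mulrA.
Qed.

HB.instance Definition _ := isIdealr.Build P HBE_ideal HBE_idealP.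

Definition HBE : comNzRingType := {ideal_quot HBE_ideal}.

Definition cl (q : P) : HBE := \pi_({ideal_quot HBE_ideal})%qT q.

Definition cst (a : 'F_7) : HBE := cl a%:MP.

Definition y1 : HBE := cl 'X_(inord 0).
Definition y2 : HBE := cl 'X_(inord 1).
Definition C : HBE := cl 'X_(inord 2).
Definition v : HBE := cl 'X_(inord 3).

Definition V : HBE := v ^+ 6.
Definition D1 : HBE := C ^+ 7 + V.
Definition D2 : HBE := C * V.

Definition HBE_deg (m : 'X_{1..4}) : nat :=
  \sum_(i < 4) (nth 0 [:: 2; 2; 12; 14] i * m i)%N.

Definition homogeneous (n : nat) (r : HBE) : Prop :=
  exists q : P, r = cl q /\ {in msupp q, forall m, HBE_deg m = n}.

(* value of a polynomial over F_7 at elements of HBE *)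
Definition evalHBE k (s : k.-tuple HBE) (q : {mpoly 'F_7[k]}) : HBE :=
  mmap cst (tnth s) q.

(* the action g^* of GL_2(F_7) on the generators y1, y2, C, v *)
Definition gstar (g : 'M['F_7]_2) : 4.-tuple HBE :=
  [tuple cst (g 0 0) * y1 + cst (g 0 1) * y2;
         cst (g 1 0) * y1 + cst (g 1 1) * y2;
         C;
         cst (\det g) * v].

(* S is the free module DA{x} + CA{z}, where the coefficient rings
   DA = Z/7[D1,D2] and CA = Z/7[C,V] are polynomial rings. *)
Definition DA_CA_comb k l (x : k.-tuple HBE) (z : l.-tuple HBE)
    (a : {ffun 'I_k -> {mpoly 'F_7[2]}}) (b : {ffun 'I_l -> {mpoly 'F_7[2]}})
    : HBE :=
  \sum_(i < k) evalHBE [tuple D1; D2] (a i) * tnth x i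
  + \sum_(j < l) evalHBE [tuple C; V] (b j) * tnth z j.

Definition free_DA_CA k l (x : k.-tuple HBE) (z : l.-tuple HBE)
    (S : HBE -> Prop) : Prop :=
  (forall r, S r <-> exists a b, r = DA_CA_comb x z a b) /\
  (forall a b a' b', DA_CA_comb x z a b = DA_CA_comb x z a' b' ->
     a = a' /\ b = b').

End HBE.

Section LocalStructure.
Variable gT : finGroupType.
Implicit Types (G E : {group gT}) (e c : gT).

(* Having order 7^3, E is the group presented by these relations. *)
Definition extraspecial7 E e1 e2 c : Prop :=
  [/\ #|E| = (7 ^ 3)%N, E :=: <<[set e1; e2; c]>>%g,
      [/\ e1 ^+ 7 = 1%g, e2 ^+ 7 = 1%g & c ^+ 7 = 1%g]%g,
      [~ e1, e2]%g = c & c \in 'Z(E)%g].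

(* phi maps e1 to e1^alpha e2^gamma and e2 to e1^beta e2^delta modulo <c>
   (= modulo inner automorphisms). *)
Definition out_matrix e1 e2 c (phi : gT -> gT) (g : 'M['F_7]_2) : Prop :=
  let alpha := g 0 0 in let beta := g 0 1 in
  let gamma := g 1 0 in let delta := g 1 1 in
  phi e1 \in ((e1 ^+ alpha * e2 ^+ gamma) *: <[c]>)%g /\
  phi e2 \in ((e1 ^+ beta * e2 ^+ delta) *: <[c]>)%g.

(* Phi, given on cocycles, induces an isomorphism of graded rings from
   H^*(BE; Z)/(7, sqrt 0) to HBE. *)
Definition graded_ring_iso E (Phi : nat -> cochain gT -> HBE) : Prop :=
  [/\ forall n f, cocycle E n f -> homogeneous n (Phi n f),
      forall n f g, cocycle E n f -> cocycle E n g ->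
        Phi n (fun s => f s + g s) = Phi n f + Phi n g,
      Phi 0 (fun=> 1) = 1
        /\ (forall n m f g, cocycle E n f -> cocycle E m g ->
              Phi (n + m)%N (cup n f g) = Phi n f * Phi m g),
      forall n f, cocycle E n f -> (Phi n f = 0 <-> in_p_nil 7 E n f)
    & forall n r, homogeneous n r -> exists2 f, cocycle E n f & Phi n f = r].

Definition Out_equivariant E e1 e2 c (Phi : nat -> cochain gT -> HBE) : Prop :=
  forall (phi : {perm gT}) (g : 'M['F_7]_2),
    phi \in Aut E -> out_matrix e1 e2 c phi g ->
    forall n f q, cocycle E n f -> Phi n f = cl q ->
      Phi n (fun s => f (map phi s)) = evalHBE (gstar g) q.

(* Image of H^*(BG) in HBE under restriction to E followed by Phi. *)
Definition HBG_image G (Phi : nat -> cochain gT -> HBE) (r : HBE) : Prop :=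
  exists N (f : nat -> cochain gT),
    (forall n, cocycle G n (f n)) /\ r = \sum_(n < N) Phi n (f n).

Definition restriction_injective G (Phi : nat -> cochain gT -> HBE) : Prop :=
  forall n f, cocycle G n f -> Phi n f = 0 -> in_p_nil 7 G n f.

(* g is the matrix in Out(E) of an element of W_G(E) = N_G(E)/E C_G(E). *)
Definition W_E G E e1 e2 c (g : 'M['F_7]_2) : Prop :=
  exists2 x, x \in 'N_G(E)%g & out_matrix e1 e2 c (fun e => (e ^ x)%g) g.

Definition diag2 (l m : 'F_7) : 'M['F_7]_2 :=
  \matrix_(i, j) (if i == j then if i == 0 then l else m else 0).

Definition swap2 : 'M['F_7]_2 := \matrix_(i, j) (i != j)%:R.

Definition gens_6S3 : {set {'GL_2['F_7]}} :=
  [set g : {'GL_2['F_7]} | [|| [exists l : 'F_7, exists m : 'F_7,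
                 [&& l ^+ 3 == 1, m ^+ 3 == 1 & GLval g == diag2 l m]],
               GLval g == swap2
             | GLval g == diag2 (- 1) (- 1)]].

Definition W_6S3 : {set {'GL_2['F_7]}} := <<gens_6S3>>%g.

(* A_i is generated by c and a_i; the index None stands for infinity. *)
Definition a_ e1 e2 (i : option 'F_7) : gT :=
  if i is Some k then (e1 * e2 ^+ k)%g else e2.

Definition A_ e1 e2 c (i : option 'F_7) : {group gT} :=
  <<[set c; a_ e1 e2 i]>>%G.

(* g is the matrix, in the basis (c, a_i) of A_i, of an element of
   W_G(A_i) = N_G(A_i)/C_G(A_i). *)
Definition W_A G e1 e2 c (i : option 'F_7) (g : 'M['F_7]_2) : Prop :=
  let a := a_ e1 e2 i in
  let alpha := g 0 0 in let beta := g 0 1 in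
  let gamma := g 1 0 in let delta := g 1 1 in
  exists2 x, x \in 'N_G(A_ e1 e2 c i)%g &
    (c ^ x = c ^+ alpha * a ^+ gamma)%g /\
    (a ^ x = c ^+ beta * a ^+ delta)%g.

Definition radical G e1 e2 c (i : option 'F_7) : Prop :=
  forall g : 'M['F_7]_2, \det g = 1 -> W_A G e1 e2 c i g.

End LocalStructure.

Definition A_classes : seq (seq (option 'F_7)) :=
  [:: [:: Some 1; Some 2; Some 4];
      [:: Some 3; Some 5; Some 6];
      [:: Some 0; None]].

(* Fi_24' is the only simple group of this order. *)
Definition is_Fi24' (gT : finGroupType) (G : {group gT}) : Prop :=
  simple G /\
  #|G| = (2 ^ 21 * 3 ^ 16 * 5 ^ 2 * 7 ^ 3 * 11 * 13 * 17 * 23 * 29)%N.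

(* The 7-local structure of Fi_24' in terms of suitable generators of a
   Sylow 7-subgroup. *)
Definition Fi24'_local (gT : finGroupType) (G E : {group gT}) (e1 e2 c : gT)
    : Prop :=
  [/\ forall g : {'GL_2['F_7]}, W_E G E e1 e2 c (GLval g) <-> g \in W_6S3,
      forall i, i \in [:: Some 1; Some 2; Some 3; Some 4; Some 5; Some 6] ->
        forall g : 'M['F_7]_2,
          W_A G e1 e2 c i g <-> \det g = 1 \/ \det g = - 1,
      forall i, i \in [:: Some 0; None] -> ~ radical G e1 e2 c i
    & forall i j, (exists2 x, x \in G & A_ e1 e2 c j :=: (A_ e1 e2 c i :^ x)%g)
        <-> has (fun cls => (i \in cls) && (j \in cls)) A_classes].

(* Main.v *)
Require Import Defs.
From HB Require Import structures.
From mathcomp Require Import all_boot all_order all_fingroup all_algebra.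
From mathcomp Require Import all_solvable.
From mathcomp Require Import ring_quotient.
From mathcomp Require Import boolp.
From mathcomp Require Import mpoly.
From mathcomp Require Import zify ring.

(* By Sylow, transfer identifies H^*(BG) with the classes of H^*(BE) that are stable
   under fusion. A class of E is determined by its restrictions to the eight
   subgroups A_i, where H^*(BA_i) modulo 7 and nilpotents is F_7[y, u]; there y_1 and
   y_2 restrict to multiples of y, C to y^6, and v to a nonzero multiple of
   u^7 - y^6 u (Bockstein classes and the Gysin sequence of A_i < E). Invariance under
   W_G(E) leaves the CA-span of monomials such as 1, b, b^2, a^2, c'b, c'b^2, c'' and
   a d. Invariance under W_G(A_i) at the two representatives A_1, A_6 of the radical
   classes makes the restrictions Dickson invariants, in the coordinates
   L = y v and y^42 + v^6, and this cuts the coefficients of the first six generators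
   down to DA. Conversely the transfer to G of a class in this span restricts to
   |G : E| times the class on every A_i. *)

Set Implicit Arguments.
Unset Strict Implicit.
Unset Printing Implicit Defensive.

Import GRing.Theory.
Local Open Scope ring_scope.

(** * The differential graded ring of cochains *)

(** Cochains are taken on sequences over all of [gT]: this is a free [H]-set for every subgroup [H],
    so restriction, conjugation and transfer become operations on one ring. The main obstacle is
    that [Phi] is an abstract isomorphism: nothing says which cocycles go to y1, y2, C, v or how
    they restrict. Equivariance under W_G(E) and the relations of [HBE] determine the restrictions
    to A_i up to two nonzero scalars, a diagonal substitution. Conjugation by a diagonal matrix
    keeps determinants, so the conditions of determinant 1 or -1 survive this ambiguity. The two
    radical representatives A_k, k = 1 and k = -1, play different roles: a and c' restrict with a
    factor 1 + k^3, so A_(-1) shows the coefficients of 1, b, b^2 alone, and A_1 then puts C times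
    the other three coefficients into DA, which forces the factor V in the last three DA-generators.
    In the transfer only cosets fixed by A_i matter modulo 7; at the nonradical A_0 and A_inf no
    Dickson invariance is available, and a Frattini argument reduces N_G(A_i) to N_G(E) and the
    centralizer. *)

Section RawCochains.
Variable gT : finGroupType.
Implicit Types (f g h : seq gT -> int) (s : seq gT) (x : gT).

Definition face x f : seq gT -> int := fun s => f (x :: s).

Lemma cobord_nil f : cobord f [::] = 0.
Proof. by rewrite /cobord big_ord0. Qed.

(** Peeling off the first vertex turns the alternating sum into a recursion, the basis of the
    inductions below. *)
Lemma cobord_cons f x s : cobord f (x :: s) = f s - cobord (face x f) s.
Proof.
rewrite /cobord big_ord_recl /= drop0 expr0 mul1r; congr (_ + _).
by rewrite -sumrN; apply: eq_bigr => i _; rewrite /= exprS mulN1r mulNr.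
Qed.

Lemma cobordD f g s : cobord (fun s => f s + g s) s = cobord f s + cobord g s.
Proof. by rewrite /cobord -big_split; apply: eq_bigr => i _; rewrite mulrDr. Qed.

Lemma cobordN f s : cobord (fun s => - f s) s = - cobord f s.
Proof. by rewrite /cobord -sumrN; apply: eq_bigr => i _; rewrite mulrN. Qed.

Lemma cobordB f g s : cobord (fun s => f s - g s) s = cobord f s - cobord g s.
Proof. by rewrite cobordD cobordN. Qed.

Lemma face_cobord x f : face x (cobord f) = fun s => f s - cobord (face x f) s.
Proof. by apply: funext => s; rewrite /face cobord_cons. Qed.

Lemma cobordK f s : cobord (cobord f) s = 0.
Proof.
elim: s f => [|x s IHs] f; first exact: cobord_nil.
by rewrite !cobord_cons face_cobord cobordB IHs subr0 subrr.
Qed.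

(** The cup product for cochains of mixed degree: each vertex of [s] in turn ends the front face
    given to [f] and starts the back face given to [g]. *)
Fixpoint conv f g s {struct s} : int :=
  if s is x :: s' then f [:: x] * g s + conv (face x f) g s' else 0.

Lemma convDl f1 f2 g s :
  conv (fun s => f1 s + f2 s) g s = conv f1 g s + conv f2 g s.
Proof.
elim: s f1 f2 => [|x s IHs] f1 f2 /=; first by rewrite addr0.
by rewrite (IHs (face x f1) (face x f2)) mulrDl addrACA.
Qed.

Lemma convDr f g1 g2 s :
  conv f (fun s => g1 s + g2 s) s = conv f g1 s + conv f g2 s.
Proof.
elim: s f => [|x s IHs] f /=; first by rewrite addr0.
by rewrite IHs mulrDr addrACA.
Qed.

Lemma convZl a f g s : conv (fun s => a * f s) g s = a * conv f g s.
Proof.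
elim: s f => [|x s IHs] f /=; first by rewrite mulr0.
by rewrite (IHs (face x f)) mulrDr mulrA.
Qed.

Lemma convNl f g s : conv (fun s => - f s) g s = - conv f g s.
Proof.
elim: s f => [|x s IHs] f /=; first by rewrite oppr0.
by rewrite (IHs (face x f)) opprD mulNr.
Qed.

Lemma face_conv x f g :
  face x (conv f g) = fun s => f [:: x] * face x g s + conv (face x f) g s.
Proof. by apply: funext => s. Qed.

Lemma convA f g h s : conv f (conv g h) s = conv (conv f g) h s.
Proof.
elim: s f g => [|x s IHs] f g //=.
by rewrite IHs face_conv convDl convZl addr0 mulrDr mulrA addrA.
Qed.

Lemma eq_conv_l f1 f2 g s : (forall s, s != [::] -> f1 s = f2 s) ->
  conv f1 g s = conv f2 g s.
Proof.
elim: s f1 f2 => [|x s IHs] f1 f2 //= eqf.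
by rewrite eqf // (IHs (face x f1) (face x f2)) // => t _; apply: eqf.
Qed.

Lemma conv0l g s : conv (fun=> 0) g s = 0.
Proof. by elim: s => [|x s IHs] //=; rewrite mul0r add0r. Qed.

Lemma conv1l g s : g [::] = 0 -> conv (fun s => (size s == 1)%:R) g s = g s.
Proof.
case: s => [|x s] //= _; rewrite mul1r -[RHS]addr0; congr (_ + _).
by rewrite -[RHS](conv0l g s); apply: eq_conv_l => -[|y t].
Qed.

Lemma conv1r f s : f [::] = 0 -> conv f (fun s => (size s == 1)%:R) s = f s.
Proof.
case: s => [|x s] //= _; elim: s x f => [|y s IHs] x f /=.
  by rewrite mulr1 addr0.
by rewrite mulr0 add0r (IHs y (face x f)).
Qed.

(** A simplex with n vertices has degree n - 1, hence the extra minus in the usual sign. *)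
Definition altsign f : seq gT -> int := fun s => - (-1) ^+ size s * f s.

(** The Leibniz rule of the augmented complex. The last term comes from the empty sequence and
    disappears once cochains live on nonempty sequences. *)
Lemma cobord_conv f g s : g [::] = 0 ->
  cobord (conv f g) s =
    conv (cobord f) g s + conv (altsign f) (cobord g) s - f [::] * g s.
Proof.
move=> g0; elim: s f => [|x s IHs] f.
  by rewrite cobord_nil /= g0 mulr0 subr0 addr0.
rewrite cobord_cons face_conv cobordD.
have -> : cobord (fun s => f [:: x] * face x g s) s
          = f [:: x] * cobord (face x g) s.
  by rewrite /cobord mulr_sumr; apply: eq_bigr => i _; rewrite mulrCA.
rewrite IHs /= face_cobord cobord_cons cobord_nil subr0 cobord_cons.
have -> : conv (fun s => f s - cobord (face x f) s) g s
          = conv f g s - conv (cobord (face x f)) g s.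
  by rewrite (convDl f (fun s => - cobord (face x f) s)) convNl.
have -> : face x (altsign f) = fun s => - altsign (face x f) s.
  by apply: funext => t; rewrite /face /altsign /= exprS mulN1r !mulNr opprK.
rewrite convNl /altsign /= expr1 opprK mul1r /face.
ring.
Qed.

(** The prism operator: each vertex in turn is doubled, with [p] applied up to it and [q] from it
    on, and the terms alternate in sign. *)
Fixpoint prism (p q : gT -> gT) f s {struct s} : int :=
  if s is x :: s' then f (p x :: map q s) - prism p q (face (p x) f) s' else 0.

Lemma prismB p q f g s :
  prism p q (fun s => f s - g s) s = prism p q f s - prism p q g s.
Proof.
elim: s f g => [|x s IHs] f g /=; first by rewrite subr0.
by rewrite (IHs (face _ f) (face _ g)); ring.
Qed.

Lemma face_prism p q f x :
  face x (prism p q f) =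
    fun s => face (q x) (face (p x) f) (map q s) - prism p q (face (p x) f) s.
Proof. by apply: funext. Qed.

Lemma cobord_map (q : gT -> gT) f s :
  cobord (fun s => f (map q s)) s = cobord f (map q s).
Proof.
rewrite /cobord size_map; apply: eq_bigr => i _.
by rewrite map_cat map_take map_drop.
Qed.

Lemma prism_homotopy p q f s :
  cobord (prism p q f) s + prism p q (cobord f) s = f (map q s) - f (map p s).
Proof.
elim: s f => [|x s IHs] f; first by rewrite cobord_nil addr0 subrr.
rewrite cobord_cons face_prism cobordB cobord_map /= face_cobord prismB.
rewrite !cobord_cons; have := IHs (face (p x) f) => /(canRL (addrK _)) ->.
rewrite /face; ring.
Qed.

End RawCochains.

Arguments simplex {gT} H n%_N s.
Arguments coboundary {gT} H n%_N f.
Arguments cocycle {gT} H n%_N f.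

Section CochainRing.
Variable gT : finGroupType.

(** A first vertex and a tail encode a nonempty sequence. Without the empty simplex, cochains of all
    degrees form one ring, whose unit is the cochain constant 1 on vertices. *)
Definition coch : Type := (gT * seq gT)%type -> int.

HB.instance Definition _ := gen_eqMixin coch.
HB.instance Definition _ := gen_choiceMixin coch.

Implicit Types F G H : coch.

Definition tot (F : coch) : seq gT -> int :=
  fun s => if s is x :: s' then F (x, s') else 0.
Definition untot (f : seq gT -> int) : coch := fun p => f (p.1 :: p.2).

Lemma totK : cancel tot untot.
Proof. by move=> F; apply: funext => -[]. Qed.

Lemma untotK f : f [::] = 0 -> tot (untot f) = f.
Proof. by move=> f0; apply: funext => -[|x s]. Qed.

Lemma tot_inj : injective tot. Proof. exact: can_inj totK. Qed.

Let add (F G : coch) : coch := fun p => F p + G p.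
Let opp (F : coch) : coch := fun p => - F p.
Let zero : coch := fun=> 0.

Fact coch_addA : associative add.
Proof. by move=> F G H; apply: funext => p; apply: addrA. Qed.
Fact coch_addC : commutative add.
Proof. by move=> F G; apply: funext => p; apply: addrC. Qed.
Fact coch_add0 : left_id zero add.
Proof. by move=> F; apply: funext => p; apply: add0r. Qed.
Fact coch_addN : left_inverse zero opp add.
Proof. by move=> F; apply: funext => p; apply: addNr. Qed.

HB.instance Definition _ :=
  GRing.isZmodule.Build coch coch_addA coch_addC coch_add0 coch_addN.

Lemma totD (F G : coch) s : tot (F + G) s = tot F s + tot G s.
Proof. by case: s => //=; rewrite addr0. Qed.
Lemma totN (F : coch) s : tot (- F) s = - tot F s.
Proof. by case: s => //=; rewrite oppr0. Qed.
Lemma totB (F G : coch) s : tot (F - G) s = tot F s - tot G s.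
Proof. by rewrite totD totN. Qed.
Lemma tot0 s : tot 0 s = 0. Proof. by case: s. Qed.

Lemma totDE (F G : coch) : tot (F + G) = fun s => tot F s + tot G s.
Proof. by apply: funext => s; rewrite totD. Qed.
Lemma totNE (F : coch) : tot (- F) = fun s => - tot F s.
Proof. by apply: funext => s; rewrite totN. Qed.

Lemma tot_sum I (r : seq I) (P : pred I) (F : I -> coch) s :
  tot (\sum_(i <- r | P i) F i) s = \sum_(i <- r | P i) tot (F i) s.
Proof. by elim/big_rec2: _ => [|i y1 y2 _ <-]; rewrite ?tot0 ?totD. Qed.

Lemma totMn (F : coch) n s : tot (F *+ n) s = tot F s *+ n.
Proof. by elim: n => [|n IHn]; rewrite ?mulr0n ?tot0 // !mulrS totD IHn. Qed.

Let one : coch := untot (fun s => (size s == 1)%:R).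
Let mul (F G : coch) : coch := untot (conv (tot F) (tot G)).

Fact tot_mul F G : tot (mul F G) = conv (tot F) (tot G).
Proof. exact: untotK. Qed.
Fact tot_one : tot one = fun s => (size s == 1)%:R.
Proof. exact: untotK. Qed.

Fact coch_mulA : associative mul.
Proof.
move=> F G H; apply: tot_inj; apply: funext => s.
by rewrite !tot_mul convA.
Qed.
Fact coch_mul1 : left_id one mul.
Proof.
by move=> F; apply: tot_inj; apply: funext => s; rewrite tot_mul tot_one conv1l.
Qed.
Fact coch_mulr1 : right_id one mul.
Proof.
by move=> F; apply: tot_inj; apply: funext => s; rewrite tot_mul tot_one conv1r.
Qed.
Fact coch_mulDl : left_distributive mul +%R.
Proof.
move=> F G H; apply: tot_inj; apply: funext => s.
by rewrite totD !tot_mul totDE convDl.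
Qed.
Fact coch_mulDr : right_distributive mul +%R.
Proof.
move=> F G H; apply: tot_inj; apply: funext => s.
by rewrite totD !tot_mul totDE convDr.
Qed.
Fact coch_one_neq0 : one != 0.
Proof. by apply/eqP => /(congr1 (fun F : coch => F (1%g, [::]))). Qed.

HB.instance Definition _ := GRing.Zmodule_isNzRing.Build coch
  coch_mulA coch_mul1 coch_mulr1 coch_mulDl coch_mulDr coch_one_neq0.

Lemma totM (F G : coch) : tot (F * G) = conv (tot F) (tot G).
Proof. exact: tot_mul. Qed.
Lemma tot1 s : tot 1 s = (size s == 1)%:R.
Proof. by rewrite -[1]/one tot_one. Qed.

Definition d (F : coch) : coch := untot (cobord (tot F)).

Lemma tot_d F : tot (d F) = cobord (tot F).
Proof. by apply: untotK; rewrite cobord_nil. Qed.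

Fact d_is_zmod_morphism : zmod_morphism d.
Proof.
move=> F G; apply: tot_inj; apply: funext => s.
by rewrite totB !tot_d totDE totNE cobordB.
Qed.
HB.instance Definition _ :=
  GRing.isZmodMorphism.Build coch coch d d_is_zmod_morphism.

Lemma dd F : d (d F) = 0.
Proof.
by apply: tot_inj; apply: funext => s; rewrite !tot_d cobordK tot0.
Qed.

Definition hom n (F : coch) : Prop :=
  forall s, size s != n.+1 -> tot F s = 0.
Arguments hom n%_N F.

Lemma homD n F G : hom n F -> hom n G -> hom n (F + G).
Proof. by move=> hF hG s ns; rewrite totD hF ?hG ?addr0. Qed.
Lemma homN n F : hom n F -> hom n (- F).
Proof. by move=> hF s ns; rewrite totN hF ?oppr0. Qed.
Lemma homB n F G : hom n F -> hom n G -> hom n (F - G).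
Proof. by move=> hF hG; apply: homD => //; apply: homN. Qed.
Lemma hom0 n : hom n 0. Proof. by move=> s _; rewrite tot0. Qed.
Lemma hom_sum n I (r : seq I) (P : pred I) (F : I -> coch) :
  (forall i, P i -> hom n (F i)) -> hom n (\sum_(i <- r | P i) F i).
Proof. by move=> hF; elim/big_ind: _ => //; [exact: hom0|exact: homD]. Qed.
Lemma homMn n F k : hom n F -> hom n (F *+ k).
Proof. by move=> hF s ns; rewrite totMn hF ?mul0rn. Qed.
Lemma hom1 : hom 0 1.
Proof. by move=> s ns; rewrite tot1 (negPf ns). Qed.

(** A homogeneous left factor selects a single splitting of the simplex, so that the ring product
    becomes [cup]. *)
Lemma conv_hom (f g : seq gT -> int) n s : (forall s, size s != n.+1 -> f s = 0) ->
  conv f g s = f (take n.+1 s) * (if n < size s then g (drop n s) else 0)%N.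
Proof.
elim: n f s => [|n IHn] f [|x s] hf //=.
- by rewrite hf ?mul0r.
- rewrite take0 (@eq_conv_l gT _ (fun=> 0)) ?conv0l ?addr0 //.
  by move=> [|y t] // _; apply: hf.
- by rewrite hf ?mul0r.
- by rewrite hf // mul0r add0r IHn // => t nt; apply: hf.
Qed.

Lemma tot_mul_hom n F G : hom n F -> tot (F * G) = cup n (tot F) (tot G).
Proof.
move=> hF; apply: funext => s; rewrite totM (conv_hom _ _ hF) /cup.
case: ltnP => // les; rewrite mulr0 hF ?mul0r //.
by rewrite take_oversize ?(leq_trans les) // neq_ltn ltnS les.
Qed.

Lemma homM n m F G : hom n F -> hom m G -> hom (n + m) (F * G).
Proof.
move=> hF hG s; rewrite (tot_mul_hom _ hF) /cup => ns.
case: (ltnP n (size s)) => lts; last first.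
  by rewrite hF ?mul0r // take_oversize ?(leq_trans lts) // neq_ltn ltnS lts.
by rewrite [tot G _]hG ?mulr0 // size_drop; lia.
Qed.

Lemma hom_d n F : hom n F -> hom n.+1 (d F).
Proof.
move=> hF s ns; rewrite tot_d /cobord big1 // => i _.
rewrite hF ?mulr0 // size_cat size_take size_drop ltn_ord.
by move: (ltn_ord i) ns; lia.
Qed.

Lemma leibniz n F G : hom n F -> d (F * G) = d F * G + (-1) ^+ n * (F * d G).
Proof.
move=> hF; apply: tot_inj; apply: funext => s.
rewrite totD tot_d !totM cobord_conv // mul0r subr0 tot_d.
congr (_ + _).
have Ealt : altsign (tot F) = tot ((-1) ^+ n * F).
  apply: funext => t; rewrite /altsign.
  have [Et|nt] := eqVneq (size t) n.+1; last first.
    rewrite -(signr_odd _ n) mulr_sign.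
    by case: (odd n); rewrite ?totN hF ?mulr0 ?oppr0.
  rewrite Et exprS mulN1r opprK -!(signr_odd _ n) !mulr_sign.
  by case: (odd n); rewrite ?totN.
by rewrite Ealt convA -totM tot_d.
Qed.

Lemma d1 : d 1 = 0.
Proof.
have := leibniz 1 hom1; rewrite expr0 !mul1r mulr1 => /eqP.
by rewrite -subr_eq subrr => /eqP <-.
Qed.

Definition cone (F : coch) : coch := fun p => F (1%g, p.1 :: p.2).

Lemma cone_d n F : hom n.+1 F -> d F = 0 -> F = d (cone F).
Proof.
move=> hF dF; apply: tot_inj; apply: funext => -[|x s] //.
have := congr1 (fun F : coch => tot F (1%g :: x :: s)) dF.
rewrite tot0 tot_d cobord_cons => /eqP; rewrite subr_eq0 => /eqP ->.
rewrite tot_d; apply: eq_bigr => i _; congr (_ * _).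
rewrite /face; case Et: (take i _ ++ _) => [|y t] //=.
by rewrite -[LHS]/(tot F [:: 1%g]) hF.
Qed.

Lemma hom_cone n F : hom n.+1 F -> hom n (cone F).
Proof.
by move=> hF [|x s] //= ns; rewrite -[LHS]/(tot F (1%g :: x :: s)) hF //= eqSS.
Qed.

End CochainRing.
Arguments d {gT}.
Arguments hom {gT} n%_N F.

(** * Invariant cochains, restriction, conjugation and transfer *)

Section Invariant.
Variable gT : finGroupType.
Implicit Types (F N Q : coch gT) (H K L : {group gT}) (x y h : gT) (s : seq gT).

Definition pull (p : gT -> gT) F : coch gT := untot (fun s => tot F (map p s)).

Lemma tot_pull p F s : tot (pull p F) s = tot F (map p s).
Proof. by case: s. Qed.

Fact pull_is_zmod_morphism p : zmod_morphism (pull p).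
Proof.
by move=> F F1; apply: tot_inj; apply: funext => s; rewrite totB !tot_pull -totB.
Qed.
HB.instance Definition _ p :=
  GRing.isZmodMorphism.Build (coch gT) (coch gT) (pull p)
    (pull_is_zmod_morphism p).

Lemma pull_d p F : pull p (d F) = d (pull p F).
Proof.
apply: tot_inj; apply: funext => s; rewrite tot_pull !tot_d -cobord_map.
by congr (cobord _ _); apply: funext => t; rewrite tot_pull.
Qed.

Lemma pull_mul p F F' : pull p (F * F') = pull p F * pull p F'.
Proof.
apply: tot_inj; apply: funext => s; rewrite tot_pull !totM.
have -> : tot (pull p F) = fun s => tot F (map p s).
  by apply: funext => t; rewrite tot_pull.
have -> : tot (pull p F') = fun s => tot F' (map p s).
  by apply: funext => t; rewrite tot_pull.
elim: s (tot F) => [|x s IHs] f //=.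
by rewrite IHs.
Qed.

Lemma pull_1 p : pull p 1 = 1.
Proof.
by apply: tot_inj; apply: funext => s; rewrite tot_pull !tot1 size_map.
Qed.

Fact pull_is_monoid_morphism p : monoid_morphism (pull p).
Proof. by split; [exact: pull_1|exact: pull_mul]. Qed.
HB.instance Definition _ p :=
  GRing.isMonoidMorphism.Build (coch gT) (coch gT) (pull p)
    (pull_is_monoid_morphism p).

Definition act x : coch gT -> coch gT := pull (fun y => x * y)%g.
HB.instance Definition _ x := GRing.RMorphism.on (act x).

Lemma tot_act x F s : tot (act x F) s = tot F [seq (x * y)%g | y <- s].
Proof. exact: tot_pull. Qed.

Lemma actM x y F : act y (act x F) = act (x * y)%g F.
Proof.
apply: tot_inj; apply: funext => s; rewrite !tot_act -map_comp.
by congr tot; apply: eq_map => z /=; rewrite mulgA.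
Qed.

Lemma act1 F : act 1 F = F.
Proof.
apply: tot_inj; apply: funext => s; rewrite tot_act -[s in RHS]map_id.
by congr tot; apply: eq_map => z; rewrite mul1g.
Qed.

Lemma act_d x F : act x (d F) = d (act x F). Proof. exact: pull_d. Qed.

(** Counts vertices, one more than the degree. A primitive of a class of degree n then has index n,
    and degree 0 needs no separate clause in [cob], since [homp 0] leaves only 0. *)
Definition homp n F : Prop := forall s, size s != n -> tot F s = 0.

Arguments homp n%_N F.

Lemma homp_pull p n F : homp n F -> homp n (pull p F).
Proof. by move=> hF s ns; rewrite tot_pull hF // size_map. Qed.

Lemma homp_act x n F : homp n F -> homp n (act x F).
Proof. exact: homp_pull. Qed.

Lemma hom_act x n F : hom n F -> hom n (act x F).
Proof. exact: homp_act. Qed.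

Lemma homp0 F : homp 0 F -> F = 0.
Proof. by move=> hF; apply: tot_inj; apply: funext => -[|x s] //; exact: (hF (x :: s)). Qed.

(** Invariant cochains on the free [H]-set [gT] compute the cohomology of [H]. Restriction to a
    subgroup is then the identity on cochains, and conjugation is [act]. *)
Definition inv (H : {group gT}) F : Prop := forall h, h \in H -> act h F = F.
Definition Z H n F : Prop := [/\ inv H F, hom n F & d F = 0].
Definition cob H n F : Prop := exists Q, [/\ inv H Q, homp n Q & F = d Q].
Arguments Z H n%_N F.
Arguments cob H n%_N F.

Lemma invD H F F' : inv H F -> inv H F' -> inv H (F + F').
Proof. by move=> iF iF' h hH; rewrite rmorphD /= iF ?iF'. Qed.
Lemma invN H F : inv H F -> inv H (- F).
Proof. by move=> iF h hH; rewrite rmorphN /= iF. Qed.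
Lemma invB H F F' : inv H F -> inv H F' -> inv H (F - F').
Proof. by move=> iF iF'; apply: invD => //; apply: invN. Qed.
Lemma inv0 H : inv H 0. Proof. by move=> h _; rewrite rmorph0. Qed.
Lemma inv1 H : inv H 1. Proof. by move=> h _; rewrite rmorph1. Qed.
Lemma invM H F F' : inv H F -> inv H F' -> inv H (F * F').
Proof. by move=> iF iF' h hH; rewrite rmorphM /= iF ?iF'. Qed.
Lemma inv_d H F : inv H F -> inv H (d F).
Proof. by move=> iF h hH; rewrite act_d iF. Qed.
Lemma invS H K F : H \subset K -> inv K F -> inv H F.
Proof. by move=> /subsetP sHK iF h /sHK /iF. Qed.
Lemma invMn H F n : inv H F -> inv H (F *+ n).
Proof. by move=> iF h hH; rewrite rmorphMn /= iF. Qed.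
Lemma inv_sum H I (r : seq I) (P : pred I) (F : I -> coch gT) :
  (forall i, P i -> inv H (F i)) -> inv H (\sum_(i <- r | P i) F i).
Proof. by move=> hF; apply: (big_ind (inv H)); [exact: inv0|exact: invD|exact: hF]. Qed.

Lemma hompD n F F' : homp n F -> homp n F' -> homp n (F + F').
Proof. by move=> hF hF' s ns; rewrite totD hF ?hF' ?addr0. Qed.
Lemma hompN n F : homp n F -> homp n (- F).
Proof. by move=> hF s ns; rewrite totN hF ?oppr0. Qed.
Lemma hompMn n F k : homp n F -> homp n (F *+ k).
Proof. by move=> hF s ns; rewrite totMn hF ?mul0rn. Qed.
Lemma homp_sum n I (r : seq I) (P : pred I) (F : I -> coch gT) :
  (forall i, P i -> homp n (F i)) -> homp n (\sum_(i <- r | P i) F i).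
Proof.
by move=> hF; apply: (big_ind (homp n)); [move=> s _; rewrite tot0|exact: hompD|exact: hF].
Qed.

Lemma ZD H n F F' : Z H n F -> Z H n F' -> Z H n (F + F').
Proof.
by case=> i1 h1 d1 [i2 h2 d2]; split;
  [exact: invD|exact: homD|rewrite raddfD /= d1 d2 addr0].
Qed.
Lemma ZN H n F : Z H n F -> Z H n (- F).
Proof.
by case=> i1 h1 d1; split; [exact: invN|exact: homN|rewrite raddfN /= d1 oppr0].
Qed.
Lemma ZB H n F F' : Z H n F -> Z H n F' -> Z H n (F - F').
Proof. by move=> zF zF'; apply: ZD => //; apply: ZN. Qed.
Lemma Z0 H n : Z H n 0.
Proof. by split; [exact: inv0|exact: hom0|rewrite raddf0]. Qed.
Lemma ZMn H n F k : Z H n F -> Z H n (F *+ k).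
Proof.
by case=> i1 h1 d1; split; [exact: invMn|exact: homMn|rewrite raddfMn /= d1 mul0rn].
Qed.
Lemma Z1 H : Z H 0 1.
Proof. by split; [exact: inv1|exact: hom1|exact: d1]. Qed.
Lemma ZM H n m F F' : Z H n F -> Z H m F' -> Z H (n + m) (F * F').
Proof.
case=> i1 h1 d1 [i2 h2 d2]; split; [exact: invM|exact: homM|].
by rewrite (leibniz _ h1) d1 d2 mul0r mulr0 mulr0 addr0.
Qed.
Lemma ZX H n F k : Z H n F -> Z H (k * n) (F ^+ k).
Proof.
by move=> zF; elim: k => [|k IHk]; [exact: Z1|rewrite exprS mulSn; exact: ZM].
Qed.
Lemma ZS H K n F : H \subset K -> Z K n F -> Z H n F.
Proof. by move=> sHK [iF hF dF]; split=> //; apply: invS iF. Qed.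

Lemma cob_Z H n F : cob H n F -> Z H n F.
Proof.
case=> Q [iQ hQ ->]; split; [exact: inv_d| |exact: dd].
case: n hQ => [|n] hQ; last exact: hom_d.
by rewrite (homp0 hQ) raddf0; apply: hom0.
Qed.
Lemma cobD H n F F' : cob H n F -> cob H n F' -> cob H n (F + F').
Proof.
case=> Q [iQ hQ ->] [Q' [iQ' hQ' ->]]; exists (Q + Q').
by split; [exact: invD|exact: hompD|rewrite raddfD].
Qed.
Lemma cobN H n F : cob H n F -> cob H n (- F).
Proof.
by case=> Q [iQ hQ ->]; exists (- Q); split; [exact: invN|exact: hompN|rewrite raddfN].
Qed.
Lemma cobB H n F F' : cob H n F -> cob H n F' -> cob H n (F - F').
Proof. by move=> cF cF'; apply: cobD => //; apply: cobN. Qed.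
Lemma cob0 H n : cob H n 0.
Proof.
exists 0; split; [exact: inv0| |by rewrite raddf0].
by move=> s _; rewrite tot0.
Qed.
Lemma cobMn H n F k : cob H n F -> cob H n (F *+ k).
Proof.
case=> Q [iQ hQ ->]; exists (Q *+ k).
by split; [exact: invMn|exact: hompMn|rewrite raddfMn].
Qed.
Lemma cobS H K n F : H \subset K -> cob K n F -> cob H n F.
Proof. by move=> sHK [Q [iQ hQ ->]]; exists Q; split=> //; apply: invS iQ. Qed.
Lemma cob_deg0 H F : cob H 0 F -> F = 0.
Proof. by case=> Q [_ /homp0 -> ->]; rewrite raddf0. Qed.

Lemma d_sgn n F : d ((-1) ^+ n * F) = (-1) ^+ n * d F.
Proof. by rewrite -signr_odd !mulr_sign; case: (odd n); rewrite ?raddfN. Qed.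

Lemma cobMr H n m F F' : cob H n F -> Z H m F' -> cob H (n + m) (F * F').
Proof.
case: n => [/cob_deg0 ->|n]; first by rewrite mul0r => _; apply: cob0.
case=> Q [iQ hQ ->] [iF' hF' dF']; exists (Q * F').
split; [exact: invM|exact: homM|].
by rewrite (leibniz _ hQ) dF' mulr0 mulr0 addr0.
Qed.
Lemma cobMl H n m F F' : Z H n F -> cob H m F' -> cob H (n + m) (F * F').
Proof.
case: m => [_ /cob_deg0 ->|m]; first by rewrite mulr0; apply: cob0.
case=> iF hF dF [Q [iQ hQ ->]]; exists ((-1) ^+ n * (F * Q)).
split; first by move=> h hH; rewrite rmorphM rmorph_sign rmorphM /= iF ?iQ.
- rewrite -signr_odd mulr_sign addnS.
  have hFQ : homp (n + m).+1 (F * Q) by apply: homM.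
  by case: (odd n) => //; apply: hompN.
- by rewrite d_sgn (leibniz _ hF) dF mul0r add0r mulrA -expr2 sqrr_sign mul1r.
Qed.

Lemma inv_act H x F : inv H F -> inv (H :^ x)%G (act x F).
Proof.
by move=> iF _ /imsetP[h hH ->]; rewrite actM -conjgC -actM iF.
Qed.
Lemma Z_act H n x F : Z H n F -> Z (H :^ x)%G n (act x F).
Proof.
case=> iF hF dF; split; [exact: inv_act|exact: hom_act|].
by rewrite -act_d dF rmorph0.
Qed.
Lemma cob_act H n x F : cob H n F -> cob (H :^ x)%G n (act x F).
Proof.
case=> Q [iQ hQ ->]; exists (act x Q).
by split; [exact: inv_act|exact: homp_act|rewrite act_d].
Qed.

Definition equivar H (p : gT -> gT) : Prop :=
  forall h g, h \in H -> p (h * g)%g = (h * p g)%g.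

Lemma equivar_id H : equivar H id. Proof. by []. Qed.

Lemma inv_pull H p F : equivar H p -> inv H F -> inv H (pull p F).
Proof.
move=> ep iF h hH; apply: tot_inj; apply: funext => s.
rewrite tot_act !tot_pull -[in RHS](iF h hH) tot_act -!map_comp.
by congr tot; apply: eq_map => g /=; rewrite ep.
Qed.

(** [j] counts the vertices that [face] has already fixed along the induction. *)
Lemma prism_homp p q (f : seq gT -> int) j n s :
  (forall t, (size t + j != n)%N -> f t = 0) -> ((size s).+1 + j != n)%N ->
  prism p q f s = 0.
Proof.
elim: s f j => [|x s IHs] f j hf ns //=.
rewrite hf /= ?size_map // (IHs _ j.+1) ?subr0 //.
  by move=> t nt; apply: hf; rewrite /= addSnnS.
by move: ns; rewrite /= addSnnS.
Qed.

Lemma prism_map p q (k : gT -> gT) (f : seq gT -> int) s :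
  (forall g, p (k g) = k (p g)) -> (forall g, q (k g) = k (q g)) ->
  prism p q f (map k s) = prism p q (fun s => f (map k s)) s.
Proof.
move=> pk qk; elim: s f => [|x s IHs] f //=.
rewrite IHs pk qk -!map_comp; congr (f [:: _, _ & _] - _).
by apply: eq_map => g /=; rewrite qk.
Qed.

(** Equivariant vertex maps agree on cohomology, because the prism between them preserves
    invariance. *)
Lemma pull_homotopy H n p q F : equivar H p -> equivar H q -> Z H n F ->
  cob H n (pull q F - pull p F).
Proof.
move=> ep eq [iF hF dF]; exists (untot (prism p q (tot F))).
have EQ : tot (untot (prism p q (tot F))) = prism p q (tot F) by apply: untotK.
split=> [h hH|s ns|].
- apply: tot_inj; apply: funext => s; rewrite tot_act EQ prism_map.
  + congr (prism _ _ _ _); apply: funext => t.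
    by rewrite -[in RHS](iF h hH) tot_act.
  + by move=> g; rewrite ep.
  + by move=> g; rewrite eq.
- by rewrite EQ (@prism_homp p q _ 0 n.+1) ?addn0 ?eqSS // => t; rewrite addn0; apply: hF.
- apply: tot_inj; apply: funext => s.
  rewrite totB !tot_pull -prism_homotopy tot_d EQ -tot_d dF.
  have -> : prism p q (tot 0) s = 0; last by rewrite addr0.
  apply: (@prism_homp p q _ 0 (size s).+2); last by rewrite addn0; lia.
  by move=> t _; rewrite tot0.
Qed.

(* A retraction of the H-set gT onto H. *)
Definition rho H (g : gT) : gT := (g * (repr (H :* g))^-1)%g.

Lemma rho_equivar H : equivar H (rho H).
Proof.
by move=> h g hH; rewrite /rho rcosetM (rcoset_id hH) mulgA.
Qed.

Lemma rho_in H g : rho H g \in H.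
Proof.
rewrite /rho; have /rcosetP[k kH ->] := mem_repr g (rcoset_refl H g).
by rewrite invMg mulKVg groupV.
Qed.

Lemma rho_id H h : h \in H -> rho H h = h.
Proof. by move=> hH; rewrite /rho rcoset_id // repr_group invg1 mulg1. Qed.

Lemma map_rho_simplex H n s : size s = n.+1 -> simplex H n (map (rho H) s).
Proof.
rewrite /simplex size_map => ->; rewrite eqxx /=.
by apply/allP => _ /mapP[g _ ->]; apply: rho_in.
Qed.

Lemma map_rho_id H n s : simplex H n s -> map (rho H) s = s.
Proof.
case/andP=> _ /allP sH; rewrite -[RHS]map_id.
by apply/eq_in_map => g /sH; apply: rho_id.
Qed.

(** The bridge from the cochains of the statement, which matter only on sequences over [H], to
    invariant cochains on all of [gT]. *)
Definition extend H n (f : cochain gT) : coch gT :=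
  untot (fun s => if size s == n.+1 then f (map (rho H) s) else 0).

Lemma tot_extend H n f s :
  tot (extend H n f) s = if size s == n.+1 then f (map (rho H) s) else 0.
Proof. by case: s. Qed.

Lemma extend_simplex H n f s : simplex H n s -> tot (extend H n f) s = f s.
Proof.
by move=> sH; rewrite tot_extend (map_rho_id sH); case/andP: sH => ->.
Qed.

Lemma size_del i s : (i < size s)%N ->
  size (take i s ++ drop i.+1 s) = (size s).-1.
Proof. by move=> lti; rewrite size_cat size_take size_drop lti; lia. Qed.

Lemma hom_extend H n f : hom n (extend H n f).
Proof. by move=> s /negPf ns; rewrite tot_extend ns. Qed.

Lemma inv_extend H n f : is_cochain H n f -> inv H (extend H n f).
Proof.
move=> cf h hH; apply: tot_inj; apply: funext => s.
rewrite tot_act !tot_extend size_map; case: eqP => // Es.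
rewrite -(cf h (map (rho H) s)) ?map_rho_simplex // -!map_comp.
by congr f; apply: eq_map => g /=; rewrite rho_equivar.
Qed.

Lemma Z_extend H n f : cocycle H n f -> Z H n (extend H n f).
Proof.
move=> [cf df]; split; [exact: inv_extend|exact: hom_extend|].
apply: tot_inj; apply: funext => s; rewrite tot0.
case: (eqVneq (size s) n.+2) => [Es|]; last exact/hom_d/hom_extend.
rewrite tot_d -(df _ (map_rho_simplex H Es)) -cobord_map.
apply: eq_bigr => i _; congr (_ * _); rewrite tot_extend.
by rewrite size_del ?ltn_ord // (congr1 predn Es) eqxx.
Qed.

Lemma cocycle_tot H n F : Z H n F -> cocycle H n (tot F).
Proof.
case=> iF _ dF; split=> [x s xH _|s _]; last by rewrite -tot_d dF tot0.
by rewrite -[in RHS](iF x) // tot_act.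
Qed.

(** [F] is homotopic to its pull-back along [rho], which sees only simplices of [H]. *)
Lemma vanish_cob H n F : Z H n F -> (forall s, simplex H n s -> tot F s = 0) ->
  cob H n F.
Proof.
move=> zF F0; have := pull_homotopy (@rho_equivar H) (@equivar_id H) zF.
have -> : pull (rho H) F = 0.
  apply: tot_inj; apply: funext => s; rewrite tot_pull tot0.
  case: (eqVneq (size s) n.+1) => [Es|ns]; first exact/F0/map_rho_simplex.
  by case: zF => _ hF _; rewrite hF ?size_map.
rewrite subr0; have -> // : pull id F = F.
by apply: tot_inj; apply: funext => s; rewrite tot_pull map_id.
Qed.

Lemma tot_restrict_d H n F (f : cochain gT) s :
  (forall s, simplex H n s -> tot F s = f s) ->
  simplex H n.+1 s -> tot (d F) s = cobord f s.
Proof.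
move=> Ff /andP[/eqP Es /allP sH]; rewrite tot_d; apply: eq_bigr => i _.
rewrite Ff //; apply/andP; split.
  by rewrite size_del ?ltn_ord // (congr1 predn Es).
by apply/allP => g; rewrite mem_cat => /orP[/mem_take|/mem_drop]; apply: sH.
Qed.

Lemma coboundary_cob H n F : Z H n F -> coboundary H n (tot F) -> cob H n F.
Proof.
case: n => [|n] zF; first exact: vanish_cob.
case=> g [cg Fg]; pose Q := extend H n g.
have cQ : cob H n.+1 (d Q).
  by exists Q; split=> //; [exact: inv_extend|exact: hom_extend].
rewrite -(subrK (d Q) F); apply: cobD => //.
apply: vanish_cob; first by apply: ZB => //; apply: cob_Z.
move=> s sH; rewrite totB Fg // (@tot_restrict_d H n _ g) ?subrr //.
by move=> t; apply: extend_simplex.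
Qed.

Lemma cob_coboundary H n F (f : cochain gT) : cob H n F ->
  (forall s, simplex H n s -> f s = tot F s) -> coboundary H n f.
Proof.
case: n => [/cob_deg0 -> f0 s /f0 ->|n]; first by rewrite tot0.
case=> Q [iQ hQ ->] f0; exists (tot Q); split=> [x s xH _|s /f0 ->]; last first.
  by rewrite tot_d.
by rewrite -[in RHS](iQ x) // tot_act.
Qed.

Lemma coboundary_ext H n (f g : cochain gT) :
  (forall s, simplex H n s -> f s = g s) -> coboundary H n f -> coboundary H n g.
Proof.
case: n => [|n] fg /=; first by move=> f0 s sH; rewrite -fg ?f0.
by case=> q [cq fq]; exists q; split=> // s sH; rewrite -fg ?fq.
Qed.

Lemma simplex_take H n m s : simplex H (n + m) s -> simplex H n (take n.+1 s).
Proof.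
case/andP=> /eqP Es /allP sH; apply/andP; split; last first.
  by apply/allP => g /mem_take/sH.
by rewrite size_take Es; case: ifP => //; lia.
Qed.

Lemma simplex_drop H n m s : simplex H (n + m) s -> simplex H m (drop n s).
Proof.
case/andP=> /eqP Es /allP sH; apply/andP; split; last first.
  by apply/allP => g /mem_drop/sH.
by rewrite size_drop Es; apply/eqP; lia.
Qed.

Lemma tot_exp H n N (h : cochain gT) k s : hom n N ->
  (forall s, simplex H n s -> tot N s = h s) -> simplex H (k * n) s ->
  tot (N ^+ k) s = cup_exp n h k s.
Proof.
move=> hN Nh; elim: k s => [|k IHk] s sH.
  by case/andP: sH => /eqP Es _; rewrite expr0 tot1 Es.
rewrite exprS (tot_mul_hom _ hN) /= /cup; rewrite mulSn in sH.
by rewrite Nh ?IHk //; [exact: simplex_drop sH|exact: simplex_take sH].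
Qed.

Definition nil_class H n N : Prop := exists k, cob H (k * n) (N ^+ k).
Definition pnil H n F : Prop := exists G N,
  [/\ Z H n G, Z H n N, nil_class H n N & cob H n (F - G *+ 7 - N)].

Lemma in_p_nilP H n F : Z H n F -> in_p_nil 7 H n (tot F) <-> pnil H n F.
Proof.
move=> zF; split=> [[g [h [cg ch [k nh] E]]]|[G [N [zG zN [k nN] E]]]].
- have zG := Z_extend cg; have zN := Z_extend ch.
  exists (extend H n g), (extend H n h); split=> //.
    exists k; apply: coboundary_cob; first exact: ZX.
    apply: coboundary_ext nh => s sH; symmetry; apply: (@tot_exp H) sH.
      exact: hom_extend.
    by move=> t; apply: extend_simplex.
  apply: coboundary_cob; first by do 2?apply: ZB => //; apply: ZMn.
  apply: coboundary_ext E => s sH.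
  by rewrite !totB totMn !extend_simplex // mulr_natl.
- exists (tot G), (tot N); split; [exact: cocycle_tot|exact: cocycle_tot| |].
    exists k; apply: (cob_coboundary nN) => s sH; symmetry.
    by apply: (@tot_exp H) => //; case: zN.
  by apply: (cob_coboundary E) => s sH; rewrite !totB totMn mulr_natl.
Qed.

(** The transfer. On [H]-invariant cochains the choice of coset representatives does not matter, by
    [act_repr]. *)
Definition tr H K F : coch gT := \sum_(C in rcosets H K) act (repr C) F.

Lemma act_rcoset H F x y : inv H F -> (H :* x = H :* y)%g -> act x F = act y F.
Proof.
move=> iF Exy; have : x \in (H :* y)%g by rewrite -Exy rcoset_refl.
by case/rcosetP=> h hH ->; rewrite -actM iF.
Qed.

Lemma act_repr H F x : inv H F -> act (repr (H :* x)%g) F = act x F.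
Proof. by move=> iF; apply: (act_rcoset iF); rewrite rcoset_repr. Qed.

Lemma inv_tr H K F : inv H F -> inv K (tr H K F).
Proof.
move=> iF y yK; rewrite /tr rmorph_sum /=.
rewrite [RHS](reindex_inj (can_inj (rcosetK y))) /=.
rewrite (eq_bigl (fun C : {set gT} => C \in rcosets H K)); last first.
  move=> C; apply/idP/idP.
    case/rcosetsP=> x xK E; apply/rcosetsP; exists (x * y^-1)%g.
      by rewrite groupM ?groupV.
    by rewrite rcosetM -E rcosetK.
  case/rcosetsP=> x xK ->; apply/rcosetsP; exists (x * y)%g.
    by rewrite groupM.
  by rewrite rcosetM.
apply: eq_bigr => C /rcosetsP[x xK ->].
by rewrite actM -rcosetM act_repr // -actM act_repr // actM.
Qed.

Lemma tr_d H K F : tr H K (d F) = d (tr H K F).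
Proof. by rewrite /tr raddf_sum; apply: eq_bigr => C _; rewrite act_d. Qed.

Lemma homp_tr H K n F : homp n F -> homp n (tr H K F).
Proof. by move=> hF; apply: homp_sum => C _; apply: homp_act. Qed.

Lemma tr_inv H K F : H \subset K -> inv K F -> tr H K F = F *+ #|K : H|%g.
Proof.
move=> sHK iF; rewrite /tr -sumr_const; apply: eq_bigr => C.
by case/rcosetsP=> x xK ->; rewrite act_repr ?iF //; apply: invS iF.
Qed.

Lemma trB H K F F' : tr H K (F - F') = tr H K F - tr H K F'.
Proof. by rewrite /tr -sumrB; apply: eq_bigr => C _; rewrite rmorphB. Qed.

Lemma Z_tr H K n F : Z H n F -> Z K n (tr H K F).
Proof.
by case=> iF hF dF; split; [exact: inv_tr|exact: homp_tr|
  rewrite -tr_d dF /tr big1 // => C _; rewrite rmorph0].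
Qed.
Lemma cob_tr H K n F : cob H n F -> cob K n (tr H K F).
Proof.
by case=> Q [iQ hQ ->]; exists (tr H K Q); rewrite tr_d;
  split; [exact: inv_tr|exact: homp_tr|].
Qed.

Lemma cob_triv n F : hom n.+1 F -> d F = 0 -> cob 1%G n.+1 F.
Proof.
move=> hF dF; exists (cone F); split; [|exact: hom_cone|exact: cone_d hF dF].
by move=> h /set1P ->; rewrite act1.
Qed.

(** Multiplication by the order is restriction to the trivial group followed by transfer, and
    positive-degree classes of the trivial group vanish by the cone. *)
Lemma cob_order H n F : Z H n.+1 F -> cob H n.+1 (F *+ #|H|).
Proof.
case=> iF hF dF; rewrite -(indexg1 H) -(tr_inv (sub1G H) iF).
exact/cob_tr/cob_triv.
Qed.

End Invariant.
Arguments homp {gT} n%_N F.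
Arguments Z {gT} H n%_N F.
Arguments cob {gT} H n%_N F.

(** * Degree-two classes of characters and the Gysin sequence *)

Lemma F7_int (n : int) : (n%:~R == 0 :> 'F_7) = (7 %| n)%Z.
Proof.
have N7 m : ((m%:R : 'F_7) == 0) = (7 %| m)%N.
  by rewrite (dvdn_pcharf (pchar_Fp (isT : prime 7))).
case: n => m; first by rewrite -[Posz m]/(m%:Z) -pmulrn N7.
by rewrite NegzE mulrNz oppr_eq0 -pmulrn N7 dvdzE abszN.
Qed.

Definition F7z (x : 'F_7) : int := (x : nat)%:Z.

Lemma F7zK x : (F7z x)%:~R = x.
Proof. by rewrite /F7z -pmulrn natr_Zp. Qed.

Lemma F7z_lt x : (0 <= F7z x < 7)%R.
Proof. by have lt7 : (x < 7)%N := ltn_ord x; rewrite /F7z; lia. Qed.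

Section Bockstein.
Variable gT : finGroupType.
Implicit Types (F Q : coch gT) (H A B : {group gT}) (y : gT -> 'F_7)
  (chi : gT -> 'F_7).

(* y is a cochain extending the character chi of H from H to the H-set gT. *)
Definition qchar H chi y : Prop :=
  forall h g, h \in H -> y (h * g)%g = chi h + y g.

Lemma qcharS A B chi y : B \subset A -> qchar A chi y -> qchar B chi y.
Proof. by move=> /subsetP sBA qy h g /sBA; apply: qy. Qed.

Lemma qcharM H chi y : qchar H chi y -> {in H &, {morph chi : x z / (x * z)%g >-> x + z}}.
Proof.
move=> qy x z xH zH; apply: (addIr (y 1%g)).
by rewrite -qy ?groupM // -mulgA qy // qy // addrA.
Qed.

Lemma qchar1 H chi y : qchar H chi y -> chi 1%g = 0.
Proof.
by move=> qy; apply: (addIr (y 1%g)); rewrite -qy ?group1 // mulg1 add0r.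
Qed.

Lemma qcharX H chi y x n : qchar H chi y -> x \in H -> chi (x ^+ n)%g = chi x *+ n.
Proof.
move=> qy xH; elim: n => [|n IHn]; first by rewrite expg0 (qchar1 qy).
by rewrite expgS (qcharM qy) ?groupX // IHn mulrS.
Qed.

Definition iot y : coch gT :=
  fun p => if p.2 is [::] then F7z (y p.1) else 0.
(** The borrow when the representatives in 0..6 are subtracted: by [bdifE] the lift of a difference
    is the difference of the lifts plus 7 times [gam]. *)
Definition gam y : coch gT :=
  fun p => if p.2 is [:: g] then (F7z (y g) < F7z (y p.1))%R%:R else 0.
Definition bdif y : coch gT :=
  fun p => if p.2 is [:: g] then F7z (y g - y p.1) else 0.
(** Marks the value 6, where adding 1 wraps around. In the Gysin sequence it serves as an element of
    norm 1. *)
Definition eps y : coch gT :=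
  fun p => if p.2 is [::] then (y p.1 == -1)%:R else 0.
(** The integral Bockstein of the character: by [beta7] it is the coboundary of an integral lift,
    divided by 7. *)
Definition beta y : coch gT := d (gam y).

Lemma hom_iot y : hom 0 (iot y). Proof. by move=> [|x [|z s]]. Qed.
Lemma hom_gam y : hom 1 (gam y). Proof. by move=> [|x [|z [|u s]]]. Qed.
Lemma hom_bdif y : hom 1 (bdif y). Proof. by move=> [|x [|z [|u s]]]. Qed.
Lemma hom_eps y : hom 0 (eps y). Proof. by move=> [|x [|z s]]. Qed.

Lemma coch_eq_hom n F Q : hom n F -> hom n Q ->
  (forall s, size s = n.+1 -> tot F s = tot Q s) -> F = Q.
Proof.
move=> hF hQ FQ; apply: tot_inj; apply: funext => s.
by case: (eqVneq (size s) n.+1) => [/FQ //|ns]; rewrite hF ?hQ.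
Qed.

Lemma tot_d0 F x z : tot (d F) [:: x; z] = tot F [:: z] - tot F [:: x].
Proof. by rewrite tot_d !cobord_cons cobord_nil /face subr0. Qed.

Lemma bdifE y : bdif y = d (iot y) + gam y *+ 7.
Proof.
apply: (@coch_eq_hom 1); first exact: hom_bdif.
  by apply: homD; [apply: hom_d; exact: hom_iot|apply: homMn; exact: hom_gam].
move=> [|x [|z [|? ?]]] // _; rewrite totD totMn tot_d0 /= /bdif /iot /gam /=.
have := F7z_lt (y x); have := F7z_lt (y z); have := F7z_lt (y z - y x).
have : (7 %| F7z (y z - y x) - (F7z (y z) - F7z (y x)))%Z.
  by rewrite -F7_int !rmorphB /= !F7zK subrr.
case/dvdzP=> q Eq; move: (F7z _) (F7z _) (F7z _) Eq => a b c Eq ha hb hc.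
have {Eq} Ea : a = b - c + q * 7 by rewrite -Eq; ring.
by rewrite Ea; case: (boolP (b < c)%R) => hbc /=; lia.
Qed.

Lemma coch_torsionfree F n : F *+ n.+1 = 0 -> F = 0.
Proof.
move=> F0; apply: tot_inj; apply: funext => s.
have := congr1 (fun F => tot F s) F0; rewrite totMn tot0 => /eqP.
by rewrite Num.Theory.mulrn_eq0 => /eqP.
Qed.

Lemma beta7 y : beta y *+ 7 = d (bdif y).
Proof. by rewrite bdifE raddfD /= dd add0r raddfMn. Qed.

Lemma inv_bdif H chi y : qchar H chi y -> inv H (bdif y).
Proof.
move=> qy h hH; apply: (@coch_eq_hom 1); [apply: hom_act| |].
- exact: hom_bdif.
- exact: hom_bdif.
- move=> [|x [|z [|? ?]]] // _; rewrite tot_act /= /bdif /= !qy //.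
  by congr F7z; ring.
Qed.

(** [gam] need not be invariant. The invariance of its coboundary is seen after multiplication by 7,
    where [bdif] takes its place; integral cochains have no torsion. *)
Lemma Z_beta H chi y : qchar H chi y -> Z H 2 (beta y).
Proof.
move=> qy; split; [|by apply: hom_d; exact: hom_gam|exact: dd].
move=> h hH; apply/eqP; rewrite -subr_eq0; apply/eqP.
apply: (@coch_torsionfree _ 6); rewrite mulrnBl -rmorphMn /= beta7.
by rewrite act_d (inv_bdif qy) // subrr.
Qed.

Lemma coch_div7 H n F : inv H F -> hom n F -> (forall s, (7 %| tot F s)%Z) ->
  exists2 Q, inv H Q /\ hom n Q & F = Q *+ 7.
Proof.
move=> iF hF F7; pose Q : coch gT := untot (fun s => (tot F s %/ 7)%Z).
have EF : F = Q *+ 7.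
  apply: tot_inj; apply: funext => s; rewrite totMn untotK //.
  by rewrite -[RHS]mulr_natr natz divzK.
exists Q => //; split=> [h hH|s ns].
  apply/eqP; rewrite -subr_eq0; apply/eqP; apply: (@coch_torsionfree _ 6).
  by rewrite mulrnBl -rmorphMn /= -EF iF // subrr.
by rewrite untotK //= hF.
Qed.

(** The defect [c] of the linear relation is [H]-invariant. Once [d (iot c)] is subtracted, the
    combination of the [bdif] is divisible by 7, and the quotient is the required primitive. *)
Lemma beta_lin H chi y chi1 y1 chi2 y2 (n1 n2 : nat) :
  qchar H chi y -> qchar H chi1 y1 -> qchar H chi2 y2 ->
  (forall h, h \in H -> chi h = n1%:R * chi1 h + n2%:R * chi2 h) ->
  cob H 2 (beta y - (beta y1 *+ n1 + beta y2 *+ n2)).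
Proof.
move=> qy q1 q2 Echi; pose c g := y g - (n1%:R * y1 g + n2%:R * y2 g).
have ic : inv H (iot c).
  move=> h hH; apply: (@coch_eq_hom 0); [exact/hom_act/hom_iot|exact: hom_iot|].
  move=> [|x [|? ?]] // _; rewrite tot_act /= /iot /= /c qy // q1 // q2 // Echi //.
  by congr F7z; ring.
pose X := bdif y - (bdif y1 *+ n1 + bdif y2 *+ n2) - d (iot c).
have [|||Q [iQ hQ] EX] := @coch_div7 H 1 X.
- apply: invB; last exact: inv_d.
  apply: invB; first exact: (inv_bdif qy).
  by apply: invD; apply: invMn; [exact: (inv_bdif q1)|exact: (inv_bdif q2)].
- apply: homB; last exact/hom_d/hom_iot.
  by apply: homB; [|apply: homD; apply: homMn]; exact: hom_bdif.
- move=> s; case: (eqVneq (size s) 2) => [|ns]; last first.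
    rewrite /X !totB totD !totMn !hom_bdif // !mul0rn.
    by rewrite (hom_d (@hom_iot c)) // subrr.
  case: s => [|x [|z [|? ?]]] // _.
  rewrite /X !totB totD !totMn tot_d0 /= /bdif /iot /= -F7_int !(rmorphB, rmorphD, rmorphMn) /=.
  rewrite !F7zK /c -!(mulr_natl (_ - _)); apply/eqP; ring.
exists Q; split=> //; apply/eqP; rewrite -subr_eq0; apply/eqP.
apply: (@coch_torsionfree _ 6).
have := congr1 d EX; rewrite raddfMn /X !raddfB raddfD !raddfMn /= dd subr0.
rewrite -!beta7 => E; rewrite mulrnBl -E mulrnBl mulrnDl.
by rewrite !(mulrnAC _ _ 7) subrr.
Qed.

End Bockstein.

(** * The Gysin sequence of a kernel of index 7 *)

Section Gysin.
Variables (gT : finGroupType) (A B : {group gT}) (chi y : gT -> 'F_7) (t : gT).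
Hypotheses (qy : qchar A chi y) (tA : t \in A) (chit : chi t = 1)
  (kerB : forall a, (a \in B) = (a \in A) && (chi a == 0)).
Implicit Types (F Q : coch gT).

Let sBA : B \subset A.
Proof. by apply/subsetP => a; rewrite kerB => /andP[]. Qed.

Let chitX n : chi (t ^+ n)%g = n%:R.
Proof. by rewrite (qcharX _ qy) // chit. Qed.

Lemma inv_gysin F : inv B F -> act t F = F -> inv A F.
Proof.
move=> iF tF a aA; pose n : nat := chi a.
have tnF m : act (t ^+ m)%g F = F.
  by elim: m => [|m IHm]; rewrite ?expg0 ?act1 // expgS -actM tF.
have: (a * t ^- n)%g \in B.
  rewrite kerB groupM ?groupV ?groupX //=.
  apply/eqP/(addIr (chi (t ^+ n)%g)).
  rewrite -(qcharM qy) ?groupM ?groupV ?groupX // mulgKV chitX /n natr_Zp.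
  by rewrite add0r.
by move/iF => E; rewrite -[a](mulgKV (t ^+ n)%g) -actM E tnF.
Qed.

(** t - 1 and the norm of the cyclic quotient A / B, the two differentials of its periodic
    resolution. *)
Let T F : coch gT := act t F - F.
Let N F : coch gT := \sum_(i < 7) act (t ^+ i)%g F.

Let inv_act_tX n F : inv B F -> inv B (act (t ^+ n)%g F).
Proof.
move=> iF b bB; rewrite actM -[(_ * b)%g](mulgKV (t ^+ n)%g) -actM iF //.
have bA := subsetP sBA _ bB.
rewrite kerB !groupM ?groupV ?groupX //=.
apply/eqP/(addIr (chi (t ^+ n)%g)).
rewrite -(qcharM qy) ?groupM ?groupV ?groupX // mulgKV.
rewrite (qcharM qy) ?groupX // add0r.
by move: bB; rewrite kerB => /andP[_ /eqP ->]; rewrite addr0.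
Qed.

Let act_t7 F : inv B F -> act (t ^+ 7)%g F = F.
Proof. by move=> iF; rewrite iF // kerB groupX //= chitX pchar_Zp. Qed.

Let inv_T F : inv B F -> inv B (T F).
Proof. by move=> iF; apply: invB => //; rewrite -[t]expg1; apply: inv_act_tX. Qed.

Let act_tN F : inv B F -> act t (N F) = N F.
Proof.
move=> iF; rewrite /N rmorph_sum [LHS]big_ord_recr [RHS]big_ord_recl /=.
rewrite expg0 act1 actM -expgSr act_t7 // addrC; congr (_ + _).
by apply: eq_bigr => i _; rewrite actM -expgSr.
Qed.

Let inv_N F : inv B F -> inv A (N F).
Proof.
move=> iF; apply: inv_gysin; last exact: act_tN.
by apply: inv_sum => i _; apply: inv_act_tX.
Qed.

Let NT F : inv B F -> N (T F) = 0.
Proof.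
move=> iF; have -> : N (T F) = act t (N F) - N F; last by rewrite act_tN ?subrr.
rewrite /N rmorph_sum -sumrB; apply: eq_bigr => i _.
by rewrite rmorphB /= !actM -expgS -expgSr.
Qed.

Let d_N F : d (N F) = N (d F).
Proof. by rewrite /N raddf_sum; apply: eq_bigr => i _; rewrite act_d. Qed.
Let d_T F : d (T F) = T (d F). Proof. by rewrite /T raddfB /= act_d. Qed.
Let homp_T n F : homp n F -> homp n (T F).
Proof. by move=> hF; apply: hompD; [exact: homp_act|exact: hompN]. Qed.
Let homp_N n F : homp n F -> homp n (N F).
Proof. by move=> hF; apply: homp_sum => i _; apply: homp_act. Qed.
Let N_sub F Q : N (F - Q) = N F - N Q.
Proof. by rewrite /N -sumrB; apply: eq_bigr => i _; rewrite rmorphB. Qed.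
Let T_sub F Q : T (F - Q) = T F - T Q.
Proof. by rewrite /T rmorphB /= opprD addrACA -opprD. Qed.
Let T_add F Q : T (F + Q) = T F + T Q.
Proof. by rewrite /T rmorphD /= opprD addrACA. Qed.
Let N_T0 F : inv A F -> T F = 0.
Proof. by move=> iF; rewrite /T iF ?subrr. Qed.
Let T_mulr F Q : inv A Q -> T (F * Q) = T F * Q.
Proof. by move=> iQ; rewrite /T rmorphM /= (iQ t) // mulrBl. Qed.
Let N_mulr F Q : inv A Q -> N (F * Q) = N F * Q.
Proof.
move=> iQ; rewrite /N mulr_suml; apply: eq_bigr => i _.
by rewrite rmorphM /= [act _ Q]iQ ?groupX.
Qed.

Let e := eps (gT := gT) y.
Let g0 := gam (gT := gT) y.

Let yB b g : b \in B -> y (b * g)%g = y g.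
Proof. by rewrite kerB => /andP[bA /eqP b0]; rewrite qy // b0 add0r. Qed.

Let inv_e : inv B e.
Proof.
move=> b bB; apply: (@coch_eq_hom _ 0); [exact/hom_act/hom_eps|exact: hom_eps|].
by move=> [|x [|? ?]] // _; rewrite tot_act /= /e /eps /= yB.
Qed.

Let inv_g0 : inv B g0.
Proof.
move=> b bB; apply: (@coch_eq_hom _ 1); [exact/hom_act/hom_gam|exact: hom_gam|].
by move=> [|x [|z [|? ?]]] // _; rewrite tot_act /= /g0 /gam /= !yB.
Qed.

(** Exactly one of the seven translates of a vertex has [y] equal to -1. *)
Let Ne : N e = 1.
Proof.
apply: (@coch_eq_hom _ 0); [exact/homp_N/hom_eps|exact: hom1|].
move=> [|x [|? ?]] // _; rewrite /N tot_sum tot1.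
under eq_bigr => i _ do rewrite tot_act /= /e /eps /= qy ?groupX // chitX.
pose i0 : 'F_7 := -1 - y x.
have lt7 : (i0 < 7)%N := ltn_ord i0.
have E0 : (nat_of_ord (Ordinal lt7))%:R = i0 by exact: (natr_Zp i0).
rewrite (bigD1 (Ordinal lt7)) // E0 /i0 subrK eqxx big1 => [|i /=]; first by [].
move=> ni; case: eqP => // Ei; case/eqP: ni; apply: val_inj.
have Ei0 : i0 = i%:R by rewrite /i0 -Ei addrK.
by rewrite -[RHS]/(nat_of_ord i0) Ei0 val_Fp_nat // modn_small.
Qed.

(** Translation by [t] raises the lift [iot y] by 1 except at the wrap, so T (iot y) = 1 - 7 e.
    Applying T to [bdifE] and dividing by 7 gives the claim. *)
Let Te : d e = T g0.
Proof.
apply/eqP; rewrite -subr_eq0; apply/eqP/(@coch_torsionfree _ _ 6).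
have Ti : T (iot y) = 1 - e *+ 7.
  apply: (@coch_eq_hom _ 0).
  - exact/homp_T/hom_iot.
  - by apply: homB; [exact: hom1|apply: homMn; exact: hom_eps].
  move=> [|x [|? ?]] // _; rewrite !totB tot_act tot1 totMn /= /iot /e /eps /= qy // chit.
  have [->|n1] := eqVneq (y x) (-1); first by [].
  have n6 : F7z (y x) != 6.
    by apply: contraNneq n1 => E6; rewrite -[y x]F7zK E6.
  have : (7 %| F7z (1 + y x) - (1 + F7z (y x)))%Z.
    by rewrite -F7_int rmorphB rmorphD /= !F7zK subrr.
  have := F7z_lt (y x); have := F7z_lt (1 + y x); move: n6.
  by move: (F7z _) (F7z (y x)) => a b ? ? ? /dvdzP[q Eq]; rewrite mul0rn; lia.
have := congr1 T (bdifE y); rewrite N_T0; last exact: inv_bdif qy.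
rewrite T_add -d_T Ti raddfB /= d1 sub0r raddfMn /=.
have -> : T (gam y *+ 7) = T g0 *+ 7 by rewrite /T rmorphMn /= mulrnBl.
by move=> E; apply: oppr_inj; rewrite oppr0 [RHS]E mulrnBl opprB [LHS]addrC.
Qed.

(* Hilbert 90: N e = 1 makes the invariant cochains cohomologically trivial
   for A / B. *)
Let ker_N n F : inv B F -> homp n.+1 F -> N F = 0 ->
  exists Q, [/\ inv B Q, homp n.+1 Q & F = T Q].
Proof.
move=> iF hF NF.
pose S i := \sum_(i.+1 <= j < 7) act (t ^+ j)%g F.
pose E i := act (t ^+ i)%g e.
have iS i : inv B (S i) by apply: inv_sum => j _; apply: inv_act_tX.
(* The tails satisfy t (S i) = S (i + 1) + F, so T of this weighted sum telescopes to (N e) F =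
   F. *)
exists (\sum_(i < 7) E i * S i); split.
- by apply: inv_sum => i _; apply: invM => //; apply: inv_act_tX.
- apply: hom_sum => i _; rewrite -[n]add0n; apply: homM.
    exact/hom_act/hom_eps.
  by rewrite /S; apply: hom_sum => j _; apply: (@homp_act _ _ n.+1).
have tS i : (i < 6)%N -> act t (S i) = S i.+1 + F.
  move=> lti; rewrite /S rmorph_sum /= (big_nat_recr 6) //=.
  rewrite actM -expgSr act_t7 //; congr (_ + _).
  rewrite [RHS]big_add1 /=.
  by apply: eq_bigr => j _; rewrite actM -expgSr.
have S6 : S 6 = 0 by rewrite /S big_geq.
have S0 : S 0 = - F.
  apply/eqP; rewrite -addr_eq0 addrC -NF /N /S -(big_mkord xpredT (fun i => act (t ^+ i)%g F)).
  by rewrite [X in _ == X]big_ltn //= expg0 act1.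
rewrite /T rmorph_sum [X in X - _]big_ord_recr [X in _ - X]big_ord_recl /=.
rewrite S6 mulr0 rmorph0 addr0 S0 mulrN opprD opprK.
have -> : \sum_(i < 6) act t (E i * S i) =
          \sum_(i < 6) E i.+1 * S i.+1 + \sum_(i < 6) E i.+1 * F.
  rewrite -big_split; apply: eq_bigr => i _ /=.
  by rewrite rmorphM /= tS // mulrDr /E actM -expgSr.
rewrite (_ : \sum_(i < 6) E (bump 0 i) * S (bump 0 i) =
  \sum_(i < 6) E i.+1 * S i.+1); last by apply: eq_bigr.
rewrite [RHS]addrC addrA subrK -[LHS]mul1r -Ne /N big_ord_recl mulrDl.
by rewrite mulr_suml.
Qed.

(** Two steps along the periodic resolution. The norm w of k is A-invariant, k - e w has norm 0 and
    hence is T Q, and then g - g0 w - d Q is an A-invariant primitive of f - beta w. *)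
Lemma gysin_core m f g k : inv A f ->
  inv B g -> hom m.+1 g -> f = d g ->
  inv B k -> hom m k -> act t g - g = d k ->
  exists2 w, Z A m w & cob A m.+2 (f - beta y * w).
Proof.
move=> iF iG hG fg iK hK Tg; pose w := N k.
have iw : inv A w by apply: inv_N.
have hw : hom m w by apply: homp_N.
have dw : d w = 0 by rewrite d_N -Tg NT.
have [|||Q [iQ hQ EQ]] := @ker_N m (k - e * w).
- by apply: invB => //; apply: invM => //; apply: invS iw.
- by apply: homB => //; rewrite -[m]add0n; apply: homM => //; apply: hom_eps.
- by rewrite N_sub N_mulr // Ne mul1r subrr.
exists w => //; exists (g - g0 * w - d Q); split.
- apply: inv_gysin.
    apply: invB; [apply: invB => //; apply: invM => //|exact: inv_d].
    exact: invS iw.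
  apply/eqP; rewrite -subr_eq0 -[_ - _]/(T _) !T_sub {1}/T Tg -d_T -EQ.
  rewrite T_mulr // -Te raddfB /= (leibniz _ (@hom_eps _ y)) dw !mulr0 addr0.
  by rewrite subrr.
- by do 2?apply: homB => //; [rewrite -addn1 addnC; apply: homM => //; apply: hom_gam|apply: hom_d].
- by rewrite !raddfB /= dd subr0 -fg (leibniz _ (@hom_gam _ y)) dw !mulr0 addr0.
Qed.

Lemma cob_norm n F : cob B n F -> cob A n (\sum_(i < 7) act (t ^+ i)%g F).
Proof.
case=> Q [iQ hQ ->]; exists (N Q); split; [exact: inv_N|exact: homp_N|].
by rewrite d_N.
Qed.

Lemma gysin_div m f : (forall z, Z B m.+1 z -> cob B m.+1 z) ->
  Z A m.+2 f -> cob B m.+2 f -> exists2 w, Z A m w & cob A m.+2 (f - beta y * w).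
Proof.
move=> B0 [iF hF dF] [g [iG hG fg]].
have [|k [iK hK Ek]] := B0 (T g).
  split; [exact: inv_T|exact: homp_T|].
  by rewrite d_T -fg N_T0.
exact: (gysin_core iF iG hG fg iK hK Ek).
Qed.

(** Nothing is assumed about the cohomology of [B] here: T g is a cocycle, so T (g f) = (T g) (d g)
    is, up to sign, the coboundary of (T g) g. *)
Lemma gysin_square m f : Z A m.+1 f -> cob B m.+1 f ->
  exists2 w, Z A (m + m) w & cob A (m + m).+2 (f * f - beta y * w).
Proof.
move=> [iF hF dF] [g [iG hG fg]].
have hff : hom (m + m).+1 (g * f) by rewrite -addnS; apply: homM.
apply: (@gysin_core (m + m) (f * f) (g * f) ((-1) ^+ m * (T g * g))) => //.
- exact: invM.
- by apply: invM => //; apply: invS iF.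
- by rewrite (leibniz _ hG) dF !mulr0 addr0 fg.
- rewrite -signr_odd mulr_sign; have iTg := inv_T iG.
  by case: ifP => _; [apply: invN|]; apply: invM.
- rewrite -signr_odd mulr_sign; have hTg := homp_T hG.
  by case: ifP => _; [apply: homN|]; apply: homM.
- rewrite d_sgn (leibniz _ (homp_T hG)) d_T -fg N_T0 // mul0r add0r.
  by rewrite mulrA -expr2 sqrr_sign mul1r -[LHS]/(T (g * f)) T_mulr.
Qed.

(** If beta w = d q with q A-invariant, then g0 w - q is a B-cocycle, hence d Q, and e w - T Q is a
    B-cocycle of norm w. *)
Lemma gysin_ann m w : (forall z, Z B m.+1 z -> cob B m.+1 z) ->
  Z A m w -> cob A m.+2 (beta y * w) ->
  exists2 w', Z B m w' & w = \sum_(i < 7) act (t ^+ i)%g w'.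
Proof.
move=> B0 [iw hw dw] [q [iq hq Eq]].
have iwB := invS sBA iw.
have [|Q [iQ hQ EQ]] := B0 (g0 * w - q).
  split.
  - by apply: invB; [apply: invM|apply: invS iq].
  - by apply: homB => //; rewrite -addn1 addnC; apply: homM => //; apply: hom_gam.
  - by rewrite raddfB /= -Eq (leibniz _ (@hom_gam _ y)) dw !mulr0 addr0 subrr.
exists (e * w - T Q); last first.
  by rewrite -/(N _) N_sub NT // N_mulr // Ne mul1r subr0.
split.
- by apply: invB; [apply: invM|apply: inv_T].
- apply: homB; last exact: homp_T.
  by rewrite -[m]add0n; apply: homM => //; apply: hom_eps.
- rewrite raddfB /= d_T -EQ (leibniz _ (@hom_eps _ y)) dw !mulr0 addr0.
  by rewrite T_sub Te T_mulr // (N_T0 iq) subr0 subrr.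
Qed.

End Gysin.

(** * Cohomology modulo 7 of elementary abelian groups of rank at most two *)

Section Mod7.
Variable gT : finGroupType.
Implicit Types (F G : coch gT) (H K : {group gT}).

Definition nul H n F : Prop := exists2 G, Z H n G & cob H n (F - G *+ 7).
Arguments nul H n%_N F.

Lemma nul_cob H n F : cob H n F -> nul H n F.
Proof. by move=> cF; exists 0; [exact: Z0|rewrite mul0rn subr0]. Qed.
Lemma nul7 H n F : Z H n F -> nul H n (F *+ 7).
Proof. by move=> zF; exists F => //; rewrite subrr; apply: cob0. Qed.
Lemma nul0 H n : nul H n 0. Proof. exact/nul_cob/cob0. Qed.
Lemma nul_Z H n F : nul H n F -> Z H n F.
Proof.
by case=> G zG cF; rewrite -(subrK (G *+ 7) F); apply: ZD; [exact: cob_Z|exact: ZMn].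
Qed.
Lemma nulD H n F G : nul H n F -> nul H n G -> nul H n (F + G).
Proof.
case=> F1 zF cF [G1 zG cG]; exists (F1 + G1); first exact: ZD.
by rewrite mulrnDl opprD addrACA; apply: cobD.
Qed.
Lemma nulN H n F : nul H n F -> nul H n (- F).
Proof.
case=> F1 zF cF; exists (- F1); first exact: ZN.
by rewrite mulNrn -opprD; apply: cobN.
Qed.
Lemma nulB H n F G : nul H n F -> nul H n G -> nul H n (F - G).
Proof. by move=> nF nG; apply: nulD => //; apply: nulN. Qed.
Lemma nulMr H n m F G : nul H n F -> Z H m G -> nul H (n + m) (F * G).
Proof.
case=> F1 zF cF zG; exists (F1 * G); first exact: ZM.
by rewrite -mulrnAl -mulrBl; apply: cobMr.
Qed.
Lemma nulMl H n m F G : Z H n F -> nul H m G -> nul H (n + m) (F * G).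
Proof.
move=> zF [G1 zG cG]; exists (F * G1); first exact: ZM.
by rewrite -mulrnAr -mulrBr; apply: cobMl.
Qed.
Lemma nulS H K n F : H \subset K -> nul K n F -> nul H n F.
Proof.
by move=> sHK [G zG cF]; exists G; [exact: ZS zG|exact: cobS cF].
Qed.
Lemma nul_act H n x F : nul H n F -> nul (H :^ x)%G n (act x F).
Proof.
case=> G zG cF; exists (act x G); first exact: Z_act.
by rewrite -rmorphMn -rmorphB; apply: cob_act.
Qed.

Lemma tot_int (m : int) s : tot (m%:~R : coch gT) s = tot 1 s * m.
Proof.
case: m => m; rewrite /intmul ?totN totMn ?NegzE ?mulrN; last congr (- _);
  by rewrite -mulr_natr natz.
Qed.

Lemma Z_int H (m : int) : Z H 0 m%:~R.
Proof. by case: m => m; rewrite /intmul; [|apply: ZN]; apply/ZMn/Z1. Qed.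

Lemma deg0_const H F : Z H 0 F -> exists m : int, F = m%:~R.
Proof.
case=> _ hF dF; exists (tot F [:: 1%g]); apply: tot_inj; apply: funext => s.
rewrite tot_int tot1; case: s => [|x [|x' s]]; [by rewrite mul0r| |by rewrite mul0r hF].
rewrite mul1r; have := congr1 (fun F => tot F [:: 1%g; x]) dF; rewrite tot_d0 tot0 => /eqP.
by rewrite subr_eq0 => /eqP.
Qed.

Lemma int_mod7 (m : int) : exists n : nat, exists q : int, m = n%:Z + q *+ 7.
Proof.
exists `|(m %% 7)%Z|%N, (m %/ 7)%Z.
rewrite -mulr_natr natz gez0_abs ?modz_ge0 // {1}(divz_eq m 7); lia.
Qed.

Lemma deg0_mod H F : Z H 0 F -> exists n : nat, nul H 0 (F - n%:R).
Proof.
move=> /deg0_const[m ->]; have [n [q ->]] := int_mod7 m; exists n.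
rewrite rmorphD /= -pmulrn addrC addKr rmorphMn /=; exact/nul7/Z_int.
Qed.

Lemma nat_nul H n : nul H 0 n%:R -> (7 %| n)%N.
Proof.
case=> G /deg0_const[q ->] /cob_deg0 /(congr1 (fun F => tot F [:: 1%g])).
rewrite totB !totMn tot_int tot1 tot0 /= mul1r => /eqP; rewrite subr_eq0 => /eqP E.
suff : (7 %| n%:Z)%Z by rewrite dvdzE.
by apply/dvdzP; exists q; rewrite -[LHS]natz [LHS]E -[LHS]mulr_natr natz.
Qed.

(** The cone gives a primitive, to which each h adds an integer constant. As h has finite order, the
    integer is 0. *)
Lemma H1_trivial H F : Z H 1 F -> cob H 1 F.
Proof.
case=> iF hF dF; pose g := cone F.
have Fg : F = d g by apply: cone_d hF dF.
have hg : hom 0 g by apply: hom_cone.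
exists g; split=> // h hH.
have [m Em] : exists m : int, act h g - g = m%:~R.
  apply: (@deg0_const 1%G); split.
  - by move=> _ /set1P ->; rewrite act1.
  - by apply: homB => //; apply: hom_act.
  - by rewrite raddfB /= -act_d -Fg iF // subrr.
have act_m x (q : int) : act x (q%:~R : coch gT) = q%:~R.
  by rewrite rmorph_int.
have actX k : act (h ^+ k)%g g = g + m%:~R *+ k.
  elim: k => [|k IHk]; first by rewrite expg0 act1 addr0.
  rewrite expgSr -actM IHk rmorphD rmorphMn /= act_m.
  by rewrite -[act h g](subrK g) Em mulrS addrA [_ + g]addrC.
have := actX #[h]%g; rewrite expg_order act1 -{1}[g]addr0 => /addrI/esym.
have := order_gt0 h; case: #[h]%g => // k _ /coch_torsionfree m0.
by apply/eqP; rewrite -subr_eq0 Em m0.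
Qed.

Lemma cob_beta7 H chi y : qchar H chi y -> cob H 2 (beta y *+ 7).
Proof.
by move=> qy; exists (bdif y); split; [exact: inv_bdif qy|exact: hom_bdif|exact: beta7].
Qed.

Lemma beta_triv H chi y : qchar H chi y -> (forall h, h \in H -> chi h = 0) ->
  cob H 2 (beta y).
Proof.
move=> qy chi0.
have E : cob H 2 (beta y - (beta y *+ 0 + beta y *+ 0)).
  by apply: (beta_lin qy qy qy) => h hH; rewrite !mul0r addr0 chi0.
by rewrite !mulr0n addr0 ?subr0 in E.
Qed.

Lemma ker_group H chi y : qchar H chi y ->
  exists B : {group gT}, forall a, (a \in B) = (a \in H) && (chi a == 0).
Proof.
move=> qy; have gB : group_set [set a in H | chi a == 0].
  apply/group_setP; split=> [|x z]; first by rewrite !inE group1 (qchar1 qy) /=.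
  rewrite !inE => /andP[xH /eqP x0] /andP[zH /eqP z0].
  by rewrite groupM // (qcharM qy) // x0 z0 addr0 /=.
by exists (Group gB) => a; rewrite inE.
Qed.

End Mod7.
Arguments nul {gT} H n%_N F.

(** * Groups of order 7 *)

Section Cyclic.
Variables (gT : finGroupType) (A : {group gT}) (chi y : gT -> 'F_7) (t : gT).
Hypotheses (qy : qchar A chi y) (tA : t \in A) (chit : chi t = 1)
  (injA : forall a, a \in A -> chi a = 0 -> a = 1%g).
Implicit Types (F G : coch gT).

Let kerA a : (a \in 1%G) = (a \in A) && (chi a == 0).
Proof.
apply/set1P/andP => [->|[aA /eqP]]; last exact: injA.
by rewrite group1 (qchar1 qy).
Qed.

Let triv m (z : coch gT) : Z 1%G m.+1 z -> cob 1%G m.+1 z.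
Proof. by case=> _; apply: cob_triv. Qed.

(** Positive-degree classes restrict to 0 on the trivial group, so [beta y] can be divided out down
    to degree 1, and likewise to degree 0 in the even case. *)
Lemma cyclic_odd k F : Z A k.*2.+1 F -> cob A k.*2.+1 F.
Proof.
elim: k F => [|k IHk] F zF; first exact: H1_trivial.
have [|w zw cw] := gysin_div qy tA chit kerA (@triv _) zF.
  by apply: triv; apply: ZS zF; apply: sub1G.
rewrite -(subrK (beta y * w) F); apply: cobD => //.
by apply: (@cobMl _ _ 2); [exact: Z_beta qy|exact: IHk].
Qed.

Lemma cyclic_even k F : Z A k.+1.*2 F ->
  exists n : nat, cob A k.+1.*2 (F - beta y ^+ k.+1 *+ n).
Proof.
elim: k F => [|k IHk] F zF.
  have [|w zw cw] := gysin_div qy tA chit kerA (@triv _) zF.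
    by apply: triv; apply: ZS zF; apply: sub1G.
  have [n [q zq cq]] := deg0_mod zw; exists n.
  rewrite -(subrK (beta y * w) F) -addrA; apply: cobD => //.
  rewrite expr1 -mulr_natr -mulrBr -(subrK (q *+ 7) (w - n%:R)) mulrDr.
  apply: cobD; first by rewrite (cob_deg0 cq) mulr0; apply: cob0.
  rewrite mulrnAr -mulrnAl.
  by apply: (@cobMr _ _ 2 0) => //; exact: cob_beta7 qy.
have [|w zw cw] := gysin_div qy tA chit kerA (@triv _) zF.
  by apply: triv; apply: ZS zF; apply: sub1G.
have [n cn] := IHk _ zw; exists n.
rewrite -(subrK (beta y * w) F) -addrA; apply: cobD => //.
rewrite exprS -mulrnAr -mulrBr.
by apply: (@cobMl _ _ 2) => //; exact: Z_beta qy.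
Qed.

Lemma card_cyclic7 : #|A| = 7%N.
Proof.
have chi_inj : {in A &, injective chi}.
  move=> a b aA bA Eab; apply/eqP; rewrite eq_mulgV1; apply/eqP.
  apply: injA; first by rewrite groupM ?groupV.
  by apply: (addIr (chi b)); rewrite -(qcharM qy) ?groupM ?groupV // mulgKV Eab add0r.
rewrite -(card_in_imset chi_inj) -[RHS]card_ord; apply: eq_card => i.
rewrite [RHS]inE; apply/imsetP; exists (t ^+ (i : nat))%g; first exact: groupX.
by rewrite (qcharX _ qy) // chit natr_Zp.
Qed.

(** 7 = |A| kills positive degrees, so vanishing modulo 7 is vanishing there. What [beta y]
    annihilates is a norm from the trivial group: 0 in positive degree, a multiple of 7 in degree
    0. *)
Lemma cyclic_nonzero k n : nul A k.*2 (beta y ^+ k *+ n) -> (7 %| n)%N.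
Proof.
elim: k => [|k IHk]; first by rewrite expr0; apply: nat_nul.
case=> G zG cG.
have {}cG : cob A k.+1.*2 (beta y * (beta y ^+ k *+ n)).
  rewrite mulrnAr -exprS -(subrK (G *+ 7) (_ *+ n)); apply: cobD => //.
  by rewrite -card_cyclic7; apply: cob_order.
clear G zG; have zk : Z A k.*2 (beta y ^+ k *+ n).
  by rewrite -muln2; apply/ZMn/ZX/(Z_beta qy).
have [w' zw' Ew] := gysin_ann qy tA chit kerA (@triv _) zk cG.
case: k => [|k] in IHk zk cG zw' Ew *; last first.
  apply: IHk; apply: nul_cob; rewrite Ew.
  by apply: (cob_norm qy tA chit kerA); apply: triv.
move: Ew; rewrite expr0; have [m ->] := deg0_const zw'.
rewrite (eq_bigr (fun=> m%:~R)) => [|i _]; last by rewrite rmorph_int.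
rewrite sumr_const card_ord => Ew; apply: (@nat_nul _ A); rewrite Ew.
exact/nul7/Z_int.
Qed.

End Cyclic.

Lemma ZX2 (gT : finGroupType) (H : {group gT}) (F : coch gT) k :
  Z H 2 F -> Z H k.*2 (F ^+ k).
Proof. by rewrite -muln2; apply: ZX. Qed.

(** * Elementary abelian groups of rank two *)

Section Rank2.
Variables (gT : finGroupType) (A : {group gT}) (chiY Y chiU U : gT -> 'F_7).
Variables (s t : gT).
Hypotheses (qY : qchar A chiY Y) (qU : qchar A chiU U)
  (sA : s \in A) (Ys : chiY s = 1) (Us : chiU s = 0)
  (tA : t \in A) (Yt : chiY t = 0) (Ut : chiU t = 1)
  (injA : forall a, a \in A -> chiY a = 0 -> chiU a = 0 -> a = 1%g).
Implicit Types (F G : coch gT).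

Lemma kerU_cyclic (B : {group gT}) :
  (forall a, (a \in B) = (a \in A) && (chiU a == 0)) ->
  [/\ B \subset A, qchar B chiY Y, s \in B
    & forall b, b \in B -> chiY b = 0 -> b = 1%g].
Proof.
move=> kB; have sBA : B \subset A by apply/subsetP => b; rewrite kB => /andP[].
split=> //; first exact: qcharS qY.
  by rewrite kB sA Us eqxx.
by move=> b; rewrite kB => /andP[bA /eqP] /[swap]; apply: injA.
Qed.

(** On the kernel of chiU, which is cyclic, the class is a multiple of a power of [beta Y]. The
    difference dies there and is divisible by [beta U]. *)
Lemma rank2_split k F : Z A k.+1.*2 F -> exists (n : nat) (w : coch gT),
  Z A k.*2 w /\ cob A k.+1.*2 (F - (beta Y ^+ k.+1 *+ n + beta U * w)).
Proof.
move=> zF; have [B kB] := ker_group qU; have [sBA qB sB injB] := kerU_cyclic kB.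
have [n cn] := cyclic_even qB sB Ys injB (ZS sBA zF).
have zY : Z A k.+1.*2 (beta Y ^+ k.+1 *+ n).
  exact/ZMn/ZX2/(Z_beta qY).
have B0 (z : coch gT) : Z B k.*2.+1 z -> cob B k.*2.+1 z.
  exact: (cyclic_odd qB sB Ys injB).
have [|w zw cw] := gysin_div qU tA Ut kB B0 (ZB zF zY); first exact: cn.
by exists n, w; split=> //; rewrite opprD addrA.
Qed.

Lemma rank2_cob7 k F : Z A k.+1.*2 F -> cob A k.+1.*2 (F *+ 7).
Proof.
move=> /rank2_split[n [w [zw cw]]].
rewrite -(subrK (beta Y ^+ k.+1 *+ n + beta U * w) F) mulrnDl.
apply: cobD; first exact: cobMn.
rewrite mulrnDl; apply: cobD; last first.
  by rewrite -mulrnAl; apply: (@cobMr _ _ 2) => //; exact: cob_beta7 qU.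
rewrite mulrnAC exprS -mulrnAl; apply/cobMn/(@cobMr _ _ 2).
  exact: cob_beta7 qY.
exact: (ZX2 k (Z_beta qY)).
Qed.

Lemma nul_cob2 k F : nul A k.+1.*2 F -> cob A k.+1.*2 F.
Proof.
case=> G zG cG; rewrite -(subrK (G *+ 7) F); apply: cobD => //.
exact: rank2_cob7.
Qed.

Let zY := Z_beta qY.
Let zU := Z_beta qU.

(** On a cyclic subgroup where chiY = c chiU, the form becomes (c n + m) times the square of
    [beta U]. *)
Lemma restrict_YU (D : {group gT}) d (n m : nat) : D \subset A -> d \in D ->
    chiU d = 1 -> (forall a, a \in D -> chiU a = 0 -> a = 1%g) ->
  nul D 4 (beta U * (beta Y *+ n) + beta U * (beta U *+ m)) ->
  (forall c : nat, (forall a, a \in D -> chiY a = c%:R * chiU a) ->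
    (7 %| c * n + m)%N).
Proof.
move=> sDA dD Ud injD nulD4 c Yc.
have qUD := qcharS sDA qU; have qYD := qcharS sDA qY.
apply: (cyclic_nonzero qUD dD Ud injD (k := 2)).
rewrite mulrnDr [(c * n)%N]mulnC mulrnA expr2 -!mulrnAr.
have -> : beta U * (beta U *+ n *+ c) + beta U * (beta U *+ m) =
  (beta U * (beta Y *+ n) + beta U * (beta U *+ m)) -
  beta U * ((beta Y - (beta U *+ c + beta U *+ 0)) *+ n).
  by rewrite mulr0n addr0 mulrnBl mulrBr opprB [RHS]addrC [RHS]addrA subrK mulrnAC.
apply: nulB => //; apply/nul_cob/(@cobMl _ _ 2 2); first exact: ZS zU.
apply/cobMn/(beta_lin qYD qUD qUD) => h hD.
by rewrite Yc // mul0r addr0.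
Qed.

(** Cochains do not commute, so this needs a proof. The commutator dies on the kernel of chiU, hence
    is [beta U] times a combination n Y + m U modulo 7. Restriction to the kernel of chiY gives m =
    0, and restriction to the kernel of chiY - chiU gives n + m = 0. *)
Lemma YU_comm : cob A 4 (beta Y * beta U - beta U * beta Y).
Proof.
have zf : Z A 4 (beta Y * beta U - beta U * beta Y).
  by apply: ZB; apply: (@ZM _ _ 2 2).
have cB (B : {group gT}) : (forall a, (a \in B) = (a \in A) && (chiU a == 0)) ->
    cob B 4 (beta Y * beta U - beta U * beta Y).
  move=> kB; have [sBA _ _ _] := kerU_cyclic kB.
  have cU : cob B 2 (beta U).
    apply: (beta_triv (qcharS sBA qU)) => b.
    by rewrite kB => /andP[_ /eqP].
  by apply: cobB; [apply: (@cobMl _ _ 2 2)|apply: (@cobMr _ _ 2 2)] => //; apply: ZS zY.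
have [B kB] := ker_group qU; have [sBA qB sB injB] := kerU_cyclic kB.
have B0 (z : coch gT) : Z B 3 z -> cob B 3 z by exact: (@cyclic_odd _ _ _ _ _ qB sB Ys injB 1).
have [w zw cw] := gysin_div qU tA Ut kB B0 zf (cB _ kB).
have [n [w0 [zw0 cw0]]] := @rank2_split 0 w zw.
have [m nm] := deg0_mod zw0.
have E4 : nul A 4 (beta Y * beta U - beta U * beta Y -
    (beta U * (beta Y *+ n) + beta U * (beta U *+ m))).
  rewrite -(subrK (beta U * w) (_ - beta U * beta Y)) -addrA.
  apply: nulD; first exact: nul_cob.
  rewrite opprD addrA -mulrBr -mulrBr; apply: (@nulMl _ _ 2 2) => //.
  rewrite -(subrK (beta Y ^+ 1 *+ n + beta U * w0) w) expr1.
  rewrite addrAC -[_ + _ - _]addrA -addrA; apply: nulD; first exact: nul_cob.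
  rewrite [X in nul _ _ X]addrC [X in nul _ _ X]addrA subrK [X in nul _ _ X]addrC.
  rewrite -mulr_natr -mulrBr.
  exact: (@nulMl _ _ 2 0).
have sub_test (D : {group gT}) d c : D \subset A -> d \in D -> chiU d = 1 ->
    (forall a, a \in D -> chiU a = 0 -> a = 1%g) ->
    (forall a, a \in D -> chiY a = c%:R * chiU a) -> (7 %| c * n + m)%N.
  move=> sDA dD Ud injD Yc; apply: (restrict_YU sDA dD Ud injD _ Yc).
  rewrite -[X in nul _ _ X](subKr (beta Y * beta U - beta U * beta Y)).
  apply: nulB; last exact: nulS E4.
  have qUD := qcharS sDA qU; have qYD := qcharS sDA qY.
  have cY : cob D 2 (beta Y - (beta U *+ c + beta U *+ 0)).
    by apply: (beta_lin qYD qUD qUD) => h hD; rewrite Yc // mul0r addr0.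
  move: cY; rewrite mulr0n addr0 => cY.
  rewrite -(subrK (beta U *+ c) (beta Y)) mulrDl mulrDr opprD addrACA.
  rewrite [beta U *+ c * _]mulrnAl [beta U * (_ *+ c)]mulrnAr subrr addr0.
  have zUD := ZS sDA zU.
  by apply/nul_cob/cobB; [apply: (@cobMr _ _ 2 2)|apply: (@cobMl _ _ 2 2)].
have [C kC] := ker_group qY.
have sCA : C \subset A by apply/subsetP => b; rewrite kC => /andP[].
have m7 : (7 %| m)%N.
  apply: (sub_test C t 0) => //; first by rewrite kC tA Yt eqxx.
    by move=> a; rewrite kC => /andP[aA /eqP Ya] /(injA aA Ya).
  by move=> a; rewrite kC mul0r => /andP[_ /eqP].
have qYU : qchar A (fun a => chiY a - chiU a) (fun g => Y g - U g).
  by move=> h g hA; rewrite qY // qU // opprD addrACA.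
have [D kD] := ker_group qYU.
have sDA : D \subset A by apply/subsetP => b; rewrite kD => /andP[].
have : (7 %| 1 * n + m)%N.
  apply: (sub_test D (s * t)%g 1) => //.
  - by rewrite kD groupM //= !(qcharM qY, qcharM qU) // Ys Yt Us Ut addr0 add0r subrr.
  - by rewrite (qcharM qU) // Us Ut add0r.
  - move=> a; rewrite kD subr_eq0 => /andP[aA /eqP Eya] Ua.
    by apply: injA; rewrite ?Eya.
  - by move=> a; rewrite kD mul1r subr_eq0 => /andP[_ /eqP].
rewrite mul1n dvdn_addl // => n7.
apply: (@nul_cob2 1); rewrite -(subrK (beta U * (beta Y *+ n) + beta U * (beta U *+ m)) (_ - _)).
apply: nulD => //.
have Z4 : Z A 4 (beta U * beta Y) by apply: (@ZM _ _ 2 2).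
have Z4' : Z A 4 (beta U * beta U) by apply: (@ZM _ _ 2 2).
have /dvdnP[a ->] := n7; have /dvdnP[b ->] := m7.
by apply: nulD; rewrite mulrnAr mulrnA; apply/nul7/ZMn.
Qed.

Section Reps.
Variables (T : comNzRingType) (yT uT : T).
Hypothesis T7 : 7%:R = 0 :> T.

(* reps k F P: modulo 7, the class of F in degree 2k is the polynomial P in the
   classes of Y and U. *)
Inductive reps : nat -> coch gT -> T -> Prop :=
| reps1 : reps 0 1 1
| reps0 k : reps k 0 0
| repsY k F P : reps k F P -> reps k.+1 (beta Y * F) (yT * P)
| repsU k F P : reps k F P -> reps k.+1 (beta U * F) (uT * P)
| repsD k F F' P P' : reps k F P -> reps k F' P' -> reps k (F + F') (P + P')
| reps_nul k F F' P : reps k F P -> nul A k.*2 (F' - F) -> reps k F' P.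

Lemma reps_Z k F P : reps k F P -> Z A k.*2 F.
Proof.
elim=> {k F P} [|k|k F P _ IH|k F P _ IH|k F F' P P' _ IH _ IH'|k F F' P _ IH nF].
- exact: Z1.
- exact: Z0.
- exact: (@ZM _ _ 2).
- exact: (@ZM _ _ 2).
- exact: ZD.
- by rewrite -(subrK F F'); apply: ZD => //; apply: nul_Z.
Qed.

Lemma repsM k l F G P Q : reps k F P -> reps l G Q -> reps (k + l) (F * G) (P * Q).
Proof.
move=> rF rG; elim: rF => {k F P}
  [|k|k F P _ IH|k F P _ IH|k F F' P P' _ IH _ IH'|k F F' P _ IH nF].
- by rewrite !mul1r.
- by rewrite !mul0r; apply: reps0.
- by rewrite -!mulrA; apply: repsY.
- by rewrite -!mulrA; apply: repsU.
- by rewrite !mulrDl; apply: repsD.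
- apply: reps_nul IH _; rewrite -mulrBl doubleD; apply: nulMr => //.
  exact: reps_Z rG.
Qed.

Lemma repsX k F P n : reps k F P -> reps (n * k) (F ^+ n) (P ^+ n).
Proof.
move=> rF; elim: n => [|n IHn]; first exact: reps1.
by rewrite !exprS mulSn; apply: repsM.
Qed.

Lemma repsMn k F P n : reps k F P -> reps k (F *+ n) (P *+ n).
Proof.
move=> rF; elim: n => [|n IHn]; first exact: reps0.
by rewrite !mulrS; apply: repsD.
Qed.

Lemma T7n (P : T) : P *+ 7 = 0.
Proof. by rewrite -mulr_natr T7 mulr0. Qed.

Lemma repsN k F P : reps k F P -> reps k (- F) (- P).
Proof.
move=> rF; have -> : - P = P *+ 6.
  by apply/eqP; rewrite eq_sym -addr_eq0 addrC -mulrS T7n.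
apply: reps_nul (repsMn 6 rF) _; rewrite -opprD -mulrS.
exact/nulN/nul7/(reps_Z rF).
Qed.

Lemma repsB k F F' P P' : reps k F P -> reps k F' P' -> reps k (F - F') (P - P').
Proof. by move=> rF rF'; apply: repsD => //; apply: repsN. Qed.

Lemma reps_sum k I (r : seq I) (p : pred I) (F : I -> coch gT) (P : I -> T) :
  (forall i, p i -> reps k (F i) (P i)) ->
  reps k (\sum_(i <- r | p i) F i) (\sum_(i <- r | p i) P i).
Proof.
by move=> rF; elim/big_rec2: _ => [|i F1 P1 pi r1]; [exact: reps0|apply: repsD => //; exact: rF].
Qed.

Lemma reps_Y : reps 1 (beta Y) yT.
Proof. by rewrite -[beta Y]mulr1 -[yT]mulr1; apply/repsY/reps1. Qed.
Lemma reps_U : reps 1 (beta U) uT.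
Proof. by rewrite -[beta U]mulr1 -[uT]mulr1; apply/repsU/reps1. Qed.

Lemma reps_ex k F : Z A k.*2 F -> exists P, reps k F P.
Proof.
elim: k F => [|k IHk] F zF.
  have [n nF] := deg0_mod zF; exists n%:R.
  by apply: (reps_nul (k := 0) _ nF); apply/repsMn/reps1.
have [n [w [zw cw]]] := rank2_split zF; have [P rP] := IHk _ zw.
exists (yT ^+ k.+1 *+ n + uT * P); apply: (reps_nul (k := k.+1) _ (nul_cob cw)).
apply: repsD; last exact: repsU.
apply: repsMn; rewrite -[X in reps X]muln1; apply: repsX; exact: reps_Y.
Qed.

(** Brings cochain and polynomial simultaneously to the form of [rank2_split]; the case of [repsY]
    moves [beta Y] past [beta U] by [YU_comm]. *)
Lemma reps_decomp k F P : reps k F P ->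
  if k is l.+1 then exists (n : nat) F' P', [/\ reps l F' P',
    P = yT ^+ k *+ n + uT * P' & nul A k.*2 (F - (beta Y ^+ k *+ n + beta U * F'))]
  else exists2 n : nat, P = n%:R & nul A 0 (F - n%:R).
Proof.
elim=> {k F P} [|k|k F P rF IH|k F P rF IH|k F F' P P' rF IH rF' IH'|k F F' P rF IH nF].
- by exists 1%N => //; rewrite subrr; apply: nul0.
- case: k => [|k]; first by exists 0%N => //; rewrite subrr; apply: nul0.
  exists 0%N, 0, 0; rewrite !mulr0n !mulr0 !addr0.
  by split=> //; [exact: reps0|rewrite ?subrr; exact: nul0].
- case: k rF IH => [|k] rF.
    case=> n -> nF; exists n, 0, 0; rewrite !mulr0 !addr0 !expr1 mulr_natr.
    split=> //; first exact: reps0.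
    by rewrite -mulr_natr -mulrBr; apply: (@nulMl _ _ 2 0).
  case=> n [F' [P' [rF' -> nF']]]; exists n, (beta Y * F'), (yT * P').
  split; [exact: repsY| |].
    by rewrite mulrDr mulrnAr -exprS mulrCA.
  have : nul A k.+2.*2 (beta Y * (F - (beta Y ^+ k.+1 *+ n + beta U * F'))).
    exact: (@nulMl _ _ 2).
  rewrite mulrBr => nY; rewrite -(subrK (beta Y * (beta Y ^+ k.+1 *+ n + beta U * F')) (beta Y * F)).
  rewrite -addrA; apply: nulD => //; rewrite mulrDr mulrnAr -exprS opprD.
  rewrite addrACA subrr add0r !mulrA -mulrBl; apply/nul_cob.
  apply: (@cobMr _ _ 4); first exact: YU_comm.
  exact: reps_Z rF'.
- case: k rF IH => [|k] rF IH.
    by exists 0%N, F, P; rewrite !mulr0n !add0r subrr; split=> //; apply: nul0.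
  by exists 0%N, F, P; rewrite !mulr0n !add0r subrr; split=> //; apply: nul0.
- case: k rF rF' IH IH' => [|k] rF rF'.
    case=> n -> nF [n' -> nF']; exists (n + n')%N; rewrite natrD //.
    by rewrite opprD addrACA; apply: nulD.
  case=> n [F1 [P1 [r1 -> n1]]] [n' [F2 [P2 [r2 -> n2]]]].
  exists (n + n')%N, (F1 + F2), (P1 + P2); split; first exact: repsD.
    by rewrite mulrDr mulrnDr addrACA.
  by rewrite mulrDr mulrnDr [X in _ - X]addrACA opprD addrACA; apply: nulD.
- case: k rF nF IH => [|k] rF nF.
    case=> n -> nF1; exists n => //.
    by rewrite -(subrK F F') -addrA; apply: nulD.
  case=> n [F1 [P1 [r1 -> n1]]]; exists n, F1, P1; split=> //.
  by rewrite -(subrK F F') -addrA; apply: nulD.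
Qed.

(** Restriction to the kernel of chiU shows that 7 divides the coefficient of Y^k. Then [beta U]
    annihilates F', so F' is a norm from that kernel, and such norms vanish modulo 7 because classes
    of the kernel extend to [A]. *)
Lemma reps_uniq k F P : reps k F P -> nul A k.*2 F -> P = 0.
Proof.
elim: k F P => [|k IHk] F P rF nF; have := reps_decomp rF.
  case=> n -> nn; have /nat_nul/dvdnP[q ->] : nul A 0 n%:R.
    by rewrite -(subKr F n%:R); apply: nulB.
  by rewrite mulrnA T7n.
case=> n [F' [P' [rF' -> nF']]].
have nYU : nul A k.+1.*2 (beta Y ^+ k.+1 *+ n + beta U * F').
  by rewrite -(subKr F (_ + _)); apply: nulB.
have zF' := reps_Z rF'.
have [B kB] := ker_group qU; have [sBA qB sB injB] := kerU_cyclic kB.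
have B0 (z : coch gT) : Z B k.*2.+1 z -> cob B k.*2.+1 z.
  exact: (cyclic_odd qB sB Ys injB).
have n7 : (7 %| n)%N.
  apply: (cyclic_nonzero qB sB Ys injB (k := k.+1)).
  rewrite -(addrK (beta U * F') (_ *+ n)); apply: nulB; first exact: nulS nYU.
  apply/nul_cob/(@cobMr _ _ 2); last exact: ZS zF'.
  apply: (beta_triv (qcharS sBA qU)) => b.
  by rewrite kB => /andP[_ /eqP].
have nU : nul A k.+1.*2 (beta U * F').
  rewrite -(addKr (beta Y ^+ k.+1 *+ n) (beta U * F')); apply: nulD => //.
  apply: nulN; have /dvdnP[q ->] := n7; rewrite mulrnA; apply/nul7/ZMn.
  exact/ZX2.
have [w' zw' Ew] := gysin_ann qU tA Ut kB B0 zF' (nul_cob2 nU).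
have -> : P' = 0.
  apply: IHk rF' _; rewrite Ew.
  case: k zw' {rF nF nF' nYU n7 nU B0 zF' Ew} => [|k] zw'.
    have [m ->] := deg0_const zw'.
    rewrite (eq_bigr (fun=> m%:~R)) => [|i _]; last by rewrite rmorph_int.
    by rewrite sumr_const card_ord; apply/nul7/Z_int.
  have [m cm] := cyclic_even qB sB Ys injB zw'.
  have zYk : Z A k.+1.*2 (beta Y ^+ k.+1 *+ m).
    exact/ZMn/ZX2.
  rewrite (_ : \sum_(i < 7) act (t ^+ i)%g w' =
      \sum_(i < 7) act (t ^+ i)%g (w' - beta Y ^+ k.+1 *+ m) +
      \sum_(i < 7) act (t ^+ i)%g (beta Y ^+ k.+1 *+ m)); last first.
    by rewrite -big_split; apply: eq_bigr => i _; rewrite rmorphB /= subrK.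
  apply: nulD; first exact/nul_cob/(cob_norm qU tA Ut kB).
  rewrite (eq_bigr (fun=> beta Y ^+ k.+1 *+ m)) => [|i _].
    by rewrite sumr_const card_ord; apply: nul7.
  by case: zYk => iY _ _; rewrite iY ?groupX.
by have /dvdnP[q ->] := n7; rewrite mulr0 addr0 mulrnA T7n.
Qed.

Lemma reps_inj k F F' P P' : reps k F P -> reps k F' P' ->
  nul A k.*2 (F - F') -> P = P'.
Proof.
by move=> rF rF' nF; apply/eqP; rewrite -subr_eq0; apply/eqP; apply: (reps_uniq (repsB rF rF')).
Qed.

Lemma nul_reps0 k F : nul A k.*2 F -> reps k F 0.
Proof. by move=> nF; apply: (reps_nul (reps0 k)); rewrite subr0. Qed.

End Reps.

Lemma reps_lin (T : comNzRingType) (yT uT : T) chi y (n1 n2 : nat) :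
  qchar A chi y ->
  (forall h, h \in A -> chi h = n1%:R * chiY h + n2%:R * chiU h) ->
  reps yT uT 1 (beta y) (yT *+ n1 + uT *+ n2).
Proof.
move=> qy Echi; apply: (@reps_nul _ _ _ 1 (beta Y *+ n1 + beta U *+ n2)).
  by apply: repsD; apply: repsMn; [exact: reps_Y|exact: reps_U].
exact/nul_cob/(beta_lin qy qY qU).
Qed.

Lemma char_power chi y x : qchar A chi y -> x \in A -> chi x != 0 ->
  exists k, chi (x ^+ k)%g = 1.
Proof.
move=> qy xA nx; exists ((chi x)^-1 : 'F_7).
by rewrite (qcharX _ qy) // -mulr_natr natr_Zp mulfV.
Qed.

(** A proper subgroup is trivial or cyclic, and on a cyclic one each class is a multiple of a power
    of a restricted [beta]. In the last case [D] contains two independent elements and would be all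
    of [A]. *)
Lemma ext_class (D : {group gT}) k F : D \proper A -> Z D k.+1.*2 F ->
  exists2 G, Z A k.+1.*2 G & cob D k.+1.*2 (F - G).
Proof.
case/properP=> sDA [a aA aD] zF; have inD := subsetP sDA.
have ext chi y d : qchar A chi y -> d \in D -> chi d != 0 ->
    (forall b, b \in D -> chi b = 0 -> b = 1%g) ->
    exists2 G, Z A k.+1.*2 G & cob D k.+1.*2 (F - G).
  move=> qy dD nd inj; have [j Ej] := char_power qy (inD _ dD) nd.
  have [n cn] := cyclic_even (qcharS sDA qy) (groupX j dD) Ej inj zF.
  by exists (beta y ^+ k.+1 *+ n) => //; apply/ZMn/ZX2/(Z_beta qy).
have [/existsP[d /andP[dD Ud]]|/existsPn noU] :=
    boolP [exists d, (d \in D) && (chiU d != 0)]; last first.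
  have Ub b : b \in D -> chiU b = 0.
    by move=> bD; apply/eqP; have := noU b; rewrite bD negbK.
  have [/existsP[b /andP[bD Yb]]|/existsPn noY] :=
      boolP [exists b, (b \in D) && (chiY b != 0)].
    by apply: (ext chiY Y b) => // b' b'D Yb'; apply: injA; rewrite ?Ub ?inD.
  have D1 : D :=: 1%g.
    apply/trivgP/subsetP => b bD; rewrite inE; apply/eqP/injA; [exact: inD| |exact: Ub].
    by apply/eqP; have := noY b; rewrite bD negbK.
  exists 0; first exact: Z0.
  rewrite subr0; case: zF => iF hF dF.
  have [Q [iQ hQ EQ]] := cob_triv hF dF.
  by exists Q; split=> // h; rewrite D1; apply: iQ.
have [/existsP[b /and3P[bD Ub Yb]]|/existsPn noB] :=
    boolP [exists b, [&& b \in D, chiU b == 0 & chiY b != 0]]; last first.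
  apply: (ext chiU U d) => // b bD Ub; apply: injA => //; first exact: inD.
  by apply/eqP; have := noB b; rewrite bD Ub eqxx negbK.
have [i Ei] := char_power qY (inD _ bD) Yb.
have [j Ej] := char_power qU (inD _ dD) Ud.
case/negP: aD; pose b1 := (b ^+ i)%g; pose d1 := (d ^+ j)%g.
have b1A : b1 \in A by rewrite groupX ?inD.
have d1A : d1 \in A by rewrite groupX ?inD.
have Ub1 : chiU b1 = 0 by rewrite (qcharX _ qU) ?inD // (eqP Ub) mul0rn.
pose d2 := (d1 ^+ (chiU a : nat))%g.
pose e : 'F_7 := chiY a - chiY d2; pose b2 := (b1 ^+ e)%g.
have d2A : d2 \in A by rewrite groupX.
have b2A : b2 \in A by rewrite groupX.
suff -> : a = (b2 * d2)%g by rewrite groupM ?groupX.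
apply/eqP; rewrite eq_mulgV1; apply/eqP/injA.
- by rewrite !(groupM, groupV).
- apply: (addIr (chiY (b2 * d2)%g)).
  rewrite -(qcharM qY) ?mulgKV ?(groupM, groupV) // (qcharM qY) //.
  by rewrite (qcharX _ qY) // Ei natr_Zp /e subrK add0r.
- apply: (addIr (chiU (b2 * d2)%g)).
  rewrite -(qcharM qU) ?mulgKV ?(groupM, groupV) // (qcharM qU) //.
  by rewrite (qcharX e qU b1A) Ub1 mul0rn (qcharX _ qU d1A) Ej natr_Zp !add0r.
Qed.

End Rank2.

Section Functoriality.
Variable gT : finGroupType.
Implicit Types (F : coch gT) (A : {group gT}).

Lemma reps_act (T T' : comNzRingType) (phi : {rmorphism T -> T'})
    (A A' : {group gT}) (Y U chiY' Y' chiU' U' : gT -> 'F_7) (yT uT : T) (yT' uT' : T') x k F P :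
  qchar A' chiY' Y' -> qchar A' chiU' U' -> A' \subset (A :^ x)%g ->
  reps A' Y' U' yT' uT' 1 (act x (beta Y)) (phi yT) ->
  reps A' Y' U' yT' uT' 1 (act x (beta U)) (phi uT) ->
  reps A Y U yT uT k F P ->
  reps A' Y' U' yT' uT' k (act x F) (phi P).
Proof.
move=> qY' qU' sA' rY rU; elim=> {k F P}
  [|k|k F P _ IH|k F P _ IH|k F F' P P' _ IH _ IH'|k F F' P _ IH nF].
- by rewrite !rmorph1; apply: reps1.
- by rewrite !rmorph0; apply: reps0.
- by rewrite !rmorphM; apply: (repsM qY' qU' rY IH).
- by rewrite !rmorphM; apply: (repsM qY' qU' rU IH).
- by rewrite !rmorphD; apply: repsD.
- apply: (reps_nul IH); rewrite -rmorphB; apply: nulS sA' _; exact: nul_act.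
Qed.

Lemma qchar_act A chi y x :
  qchar A chi y ->
  qchar (A :^ x)%G (fun g => chi (g ^ x^-1)%g) (fun g => y (x * g)%g).
Proof.
move=> qy h g; rewrite mem_conjg => hA.
by rewrite -qy // conjgE invgK !mulgA mulgKV.
Qed.

Lemma act_beta x y : act x (beta y) = beta (fun g => y (x * g)%g) :> coch gT.
Proof.
rewrite /beta act_d; congr (d _); apply: (@coch_eq_hom _ 1).
- exact/hom_act/hom_gam.
- exact: hom_gam.
- by move=> [|u [|w [|? ?]]] // _; rewrite tot_act.
Qed.

End Functoriality.

(** * Extraspecial groups of order 343 and exponent 7 *)

Section Groups.
Local Open Scope group_scope.

(** The quotient has order 7 and is generated by the coset of t; the character is the discrete
    logarithm to that base. *)
Lemma char_ex (gT : finGroupType) (A B : {group gT}) (t : gT) :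
  B <| A -> #|A : B|%g = 7%N -> t \in A -> t \notin B ->
  exists chi y : gT -> 'F_7, [/\ qchar A chi y, chi t = 1%R
    & forall a, a \in A -> (chi a == 0) = (a \in B)].
Proof.
move=> nBA iAB tA tB; have sAN := normal_norm nBA.
have oAB : #|(A / B)%g| = 7%N by rewrite card_quotient.
pose T := coset B t.
have TAB : T \in (A / B)%g by apply: mem_quotient.
have oT : #[T]%g = 7%N.
  have : (#[T]%g %| 7)%N by rewrite -oAB order_dvdG.
  case/primeP: (isT : prime 7) => _ h /h /orP[|/eqP //]; rewrite order_eq1.
  by move/eqP => T1; case/negP: tB; apply: coset_idr => //; apply: (subsetP sAN).
have defAB : (A / B)%g = <[T]>%g.
  apply/esym/eqP; rewrite eqEcard cycle_subG TAB oAB -[#|<[T]>%g|]/(#[T]%g).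
  by rewrite oT leqnn.
pose chi a : 'F_7 := if [pick i : 'F_7 | coset B a == T ^+ i]%g is Some i then i else 0.
have chiE a : a \in A -> coset B a = (T ^+ chi a)%g.
  move=> aA; rewrite /chi; case: pickP => [i /eqP //|noi].
  have : coset B a \in <[T]>%g by rewrite -defAB mem_quotient.
  case/cycleP=> n En; have := noi (n%:R); rewrite En val_Fp_nat // eq_expg_mod_order.
  by rewrite oT modn_mod eqxx.
have chi_eq a (i : nat) : a \in A -> coset B a = (T ^+ i)%g -> chi a = i%:R.
  move=> aA Ei; have := Ei; rewrite chiE // => /eqP; rewrite eq_expg_mod_order oT.
  move=> /eqP E; apply: val_inj; rewrite /= val_Fp_nat // -E modn_small //.
have inN a : a \in A -> a \in 'N(B)%g by apply: (subsetP sAN).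
have chiM : {in A &, {morph chi : x z / (x * z)%g >-> x + z}}.
  move=> x z xA zA; rewrite (@chi_eq _ (chi x + chi z)%N) ?groupM //.
    by rewrite natrD !natr_Zp.
  by rewrite morphM ?inN //= !chiE // expgD.
exists chi, (fun g => chi (rho A g)); split.
- by move=> h g hA; rewrite rho_equivar // chiM // rho_in.
- by rewrite (@chi_eq _ 1%N) ?expg1.
- move=> a aA; apply/eqP/idP => [Ea|aB].
    by apply: coset_idr; [exact: inN|rewrite chiE // Ea expg0].
  by rewrite (@chi_eq _ 0%N) // expg0; apply: coset_id.
Qed.

Lemma cards_setU2_gen (gT : finGroupType) (a c : gT) : commute c a ->
  <<[set c; a]>>%g = (<[c]> * <[a]>)%g.
Proof.
move=> cca; rewrite -norm_joinEr ?cycle_subG.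
  by rewrite joing_idl joing_idr.
apply: (subsetP (cent_sub _)); rewrite cent_cycle; apply/cent1P.
exact: commute_sym.
Qed.

Section RankOneStep.
Variables (gT : finGroupType) (E : {group gT}) (a b c : gT).
Hypotheses (oE : #|E| = 343%N) (gE : E \subset <<[set c; a]>> * <[b]>)
  (a7 : (a ^+ 7 = 1)%g) (b7 : (b ^+ 7 = 1)%g) (c7 : (c ^+ 7 = 1)%g)
  (aE : a \in E) (bE : b \in E) (cE : c \in E) (cZ : c \in 'Z(E)%g)
  (dE : (E^`(1) \subset <[c]>)%g).
Let A := <<[set c; a]>>%G.

Let cca : commute c a.
Proof. by case/centerP: cZ => _; apply. Qed.

Let le7 (x : gT) : (x ^+ 7 = 1)%g -> (#[x]%g <= 7)%N.
Proof. by move=> x7; apply: dvdn_leq => //; rewrite order_dvdn x7. Qed.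

(** E is covered by the product of A and <b>, so |A| is at least 49, while |A| times the order of
    the intersection of <c> and <a> is |c| |a|, at most 49. Hence equality everywhere. *)
Lemma step_orders : [/\ #|A| = 49%N, #[c]%g = 7%N, #[a]%g = 7%N
  & (<[c]> :&: <[a]> = 1)%g].
Proof.
have oA := mul_cardG <[c]> <[a]>; rewrite -cards_setU2_gen // in oA.
have : (343 <= #|A| * 7)%N.
  rewrite -oE; apply: leq_trans (subset_leq_card gE) _.
  apply: leq_trans (dvdn_leq _ (dvdn_cardMg A <[b]>%G)) _.
    by rewrite muln_gt0 !cardG_gt0.
  by rewrite leq_mul2l le7 ?orbT.
move=> hA; have key (x y z i : nat) : (y * z = x * i)%N -> (0 < i)%N ->
    (y <= 7)%N -> (z <= 7)%N -> (343 <= x * 7)%N -> [/\ x = 49, y = 7, z = 7 & i = 1]%N.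
  move=> e i0 y7 z7 x7; have yz : (y * z <= 49)%N by rewrite (@leq_mul _ _ 7 7).
  have x49 : (49 <= x)%N by lia.
  have i1 : i = 1%N by nia.
  by rewrite i1 muln1 in e; split=> //; nia.
have [] := key _ _ _ _ oA (cardG_gt0 _) (le7 c7) (le7 a7) hA.
by move=> E1 E2 E3 E4; split=> //; apply/card1_trivg.
Qed.

Let sAE : A \subset E.
Proof. by rewrite gen_subG subUset !sub1set cE aE. Qed.

Lemma step_index : #|E : A|%g = 7%N.
Proof. by have [oA _ _ _] := step_orders; rewrite -divgS // oE oA. Qed.

Lemma step_notin : b \notin A.
Proof.
apply/negP => bA; have [oA _ _ _] := step_orders.
have : (343 <= 49)%N; last by [].
rewrite -oE -oA subset_leq_card //; apply: subset_trans gE _.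
by rewrite mul_subG ?cycle_subG.
Qed.

Lemma step_chars : exists chiY Y chiU U : gT -> 'F_7,
  [/\ qchar A chiY Y, qchar A chiU U, chiY a = 1%R /\ chiY c = 0,
     chiU a = 0 /\ chiU c = 1%R
   & forall g, g \in A -> chiY g = 0 -> chiU g = 0 -> g = 1%g].
Proof.
have [oA oc oa TI] := step_orders.
have aA : a \in A by rewrite mem_gen // !inE eqxx orbT.
have cA : c \in A by rewrite mem_gen // !inE eqxx.
have abA : abelian A.
  by rewrite -[A : {set gT}]/(gval _) /= cards_setU2_gen // abelianM !cycle_abelian cent_cycle cycle_subG; apply/cent1P.
have nA (B : {group gT}) : B \subset A -> B <| A.
  by move=> sBA; rewrite -sub_abelian_normal.
have ix x : x \in A -> #[x]%g = 7%N -> #|A : <[x]>|%g = 7%N.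
  by move=> xA ox; rewrite -divgS ?cycle_subG // oA -[#|<[x]>%g|]/(#[x]%g) ox.
have ntr x z : #[x]%g = 7%N -> (<[x]> :&: <[z]> = 1)%g -> x \notin <[z]>%g.
  move=> ox tI; apply/negP => xz; have : x \in (<[x]> :&: <[z]>)%g by rewrite inE cycle_id.
  by rewrite tI => /set1gP x1; rewrite x1 order1 in ox.
have [||chiY [Y [qY Ya kY]]] := @char_ex _ A <[c]>%G a _ (ix c cA oc) aA.
- by apply: nA; rewrite cycle_subG.
- by apply: ntr; rewrite // setIC.
have [||chiU [U [qU Uc kU]]] := @char_ex _ A <[a]>%G c _ (ix a aA oa) cA.
- by apply: nA; rewrite cycle_subG.
- exact: ntr.
exists chiY, Y, chiU, U; split=> //.
- by split=> //; apply/eqP; rewrite kY // cycle_id.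
- by split=> //; apply/eqP; rewrite kU // cycle_id.
- move=> g gA /eqP; rewrite kY // => gc /eqP; rewrite kU // => ga.
  by apply/set1gP; rewrite -TI inE gc ga.
Qed.

End RankOneStep.

Section Extraspecial.
Variables (gT : finGroupType) (E : {group gT}) (e1 e2 c : gT).
Hypothesis hE : extraspecial7 E e1 e2 c.

Let oE : #|E| = 343%N. Proof. by case: hE. Qed.
Let gE : E :=: <<[set e1; e2; c]>>%g. Proof. by case: hE. Qed.
Lemma e1E : e1 \in E. Proof. by rewrite gE mem_gen // !inE eqxx. Qed.
Lemma e2E : e2 \in E. Proof. by rewrite gE mem_gen // !inE eqxx orbT. Qed.
Lemma cinE : c \in E. Proof. by rewrite gE mem_gen // !inE eqxx !orbT. Qed.
Let e17 : (e1 ^+ 7 = 1)%g. Proof. by case: hE => _ _ []. Qed.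
Let e27 : (e2 ^+ 7 = 1)%g. Proof. by case: hE => _ _ []. Qed.
Lemma c7 : (c ^+ 7 = 1)%g. Proof. by case: hE => _ _ []. Qed.
Let e12 : [~ e1, e2]%g = c. Proof. by case: hE. Qed.
Lemma cZE : c \in 'Z(E)%g. Proof. by case: hE. Qed.

Lemma cE_comm x : x \in E -> commute c x.
Proof. by have /centerP[_] := cZE; apply. Qed.

Lemma derE : (E^`(1) \subset <[c]>)%g.
Proof.
have nCE : E \subset 'N(<[c]>)%g.
  apply: subset_trans (cent_sub _); rewrite cent_cycle.
  by apply/subsetP => x /cE_comm cx; apply/cent1P/commute_sym.
apply: der1_min => //.
have sX : [set e1; e2; c] \subset 'N(<[c]>)%g.
  by apply: subset_trans nCE; rewrite !subUset !sub1set e1E e2E cinE.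
rewrite gE quotient_gen // abelian_gen.
have inN x : x \in E -> x \in 'N(<[c]>)%g by apply: (subsetP nCE).
apply/centsP => _ /morphimP[x _ xX ->] _ /morphimP[z _ zX ->].
have XE w : w \in [set e1; e2; c] -> w \in E.
  by rewrite !inE => /orP[/orP[]|] /eqP ->; [exact: e1E|exact: e2E|exact: cinE].
have xE := XE _ xX; have zE := XE _ zX.
apply/commgP; rewrite -morphR ?inN //; apply/eqP/coset_id.
have comm1 w w' : commute w w' -> [~ w, w'] \in <[c]>.
  by move=> /commgP/eqP ->; apply: group1.
have cc1 := cE_comm e1E; have cc2 := cE_comm e2E.
have cin : [~ e1, e2] \in <[c]> by rewrite e12 cycle_id.
move: xX zX; rewrite !inE => /orP[/orP[]|] /eqP -> /orP[/orP[]|] /eqP -> //;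
  try by apply: comm1 => //; apply: commute_sym.
by rewrite -invg_comm groupV.
Qed.

End Extraspecial.

End Groups.

Section ExtraspecialSubgroups.
Local Open Scope group_scope.
Variables (gT : finGroupType) (E : {group gT}) (e1 e2 c : gT).
Hypothesis hE : extraspecial7 E e1 e2 c.
Notation A i := (A_ e1 e2 c i).
Notation a i := (a_ e1 e2 i).
Implicit Types (i j : option 'F_7).

Let e1E := e1E hE.
Let e2E := e2E hE.
Let cE := cinE hE.
Let oE : #|E| = 343%N. Proof. by case: hE. Qed.

(** A generator of [E] outside A_i. *)
Definition b_ i : gT := if i is Some _ then e2 else e1.

Lemma a_E i : a i \in E.
Proof. by case: i => [k|] //=; rewrite groupM ?groupX. Qed.
Lemma b_E i : b_ i \in E. Proof. by case: i. Qed.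

Lemma c_A i : c \in A i. Proof. by rewrite mem_gen // !inE eqxx. Qed.
Lemma a_A i : a i \in A i. Proof. by rewrite mem_gen // !inE eqxx orbT. Qed.

(** The commutator is central, so it enters the seventh power of the product with exponent 'C(7, 2)
    = 21, a multiple of 7. *)
Lemma a_X7 i : a i ^+ 7 = 1.
Proof.
have [_ _ [e17 e27 _] e12 _] := hE.
case: i => [k|] //=.
have cR : [~ e2 ^+ k, e1] \in <[c]>.
  apply: (subsetP (derE hE)); rewrite mem_commg //; exact: groupX.
have com x : x \in E -> commute x [~ e2 ^+ k, e1].
  move=> xE; case/cycleP: cR => n ->; apply: commuteX.
  exact/commute_sym/(cE_comm hE).
rewrite expMg_Rmul; [|exact/com/groupX|exact: com].
rewrite e17 -expgM mulnC expgM e27 expg1n !mul1g.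
by case/cycleP: cR => n ->; rewrite -expgM mulnC expgM (_ : 'C(7, 2) = 7 * 3)%N // expgM (c7 hE) !expg1n.
Qed.

Lemma b_X7 i : b_ i ^+ 7 = 1.
Proof. by have [_ _ [e17 e27 _] _ _] := hE; case: i. Qed.

Lemma A_sub i : A i \subset E.
Proof. by rewrite gen_subG subUset !sub1set cE a_E. Qed.

Lemma A_normal i : A i <| E.
Proof.
apply: (sub_der1_normal _ (A_sub i)); apply: subset_trans (derE hE) _.
by rewrite cycle_subG c_A.
Qed.

Lemma E_gen i : E \subset <<[set c; a i]>> * <[b_ i]>.
Proof.
have nA : <[b_ i]> \subset 'N(A i).
  by rewrite cycle_subG; apply: (subsetP (normal_norm (A_normal i))); apply: b_E.
have [_ gE _ _ _] := hE.
rewrite -[<<_>>]/(A i : {set gT}) -norm_joinEr // {1}gE gen_subG !subUset !sub1set.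
have cJ : c \in A i <*> <[b_ i]> by apply: (subsetP (joing_subl _ _)); apply: c_A.
have aJ : a i \in A i <*> <[b_ i]> by apply: (subsetP (joing_subl _ _)); apply: a_A.
have bJ : b_ i \in A i <*> <[b_ i]> by apply: (subsetP (joing_subr _ _)); apply: cycle_id.
rewrite cJ andbT; case: i {nA cJ} aJ bJ => [k|] /= aJ bJ; last by rewrite bJ.
by rewrite bJ andbT -(groupMr _ (groupX k bJ)).
Qed.

Local Hint Resolve a_E b_E c_A a_A a_X7 b_X7 E_gen A_sub : core.
Let c7' := c7 hE.
Let cZ' := cZE hE.
Let dE' := derE hE.
Let orders i : [/\ #|A i| = 49%N, #[c] = 7%N, #[a i] = 7%N & <[c]> :&: <[a i]> = 1].
Proof. by apply: (step_orders (E := E) (b := b_ i)). Qed.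

Lemma card_A i : #|A i| = 49%N. Proof. by case: (orders i). Qed.
Lemma order_c : #[c] = 7%N. Proof. by case: (orders None). Qed.

Lemma A_index i : #|E : A i| = 7%N.
Proof. by apply: (step_index (b := b_ i)). Qed.

Lemma b_notA i : b_ i \notin A i.
Proof. by apply: (step_notin (E := E)). Qed.

Lemma A_chars i : exists chiY Y chiU U : gT -> 'F_7,
  [/\ qchar (A i) chiY Y, qchar (A i) chiU U, chiY (a i) = 1%R /\ chiY c = 0,
     chiU (a i) = 0 /\ chiU c = 1%R
   & forall g, g \in A i -> chiY g = 0 -> chiU g = 0 -> g = 1%g].
Proof. by apply: (step_chars (E := E) (b := b_ i)). Qed.

Lemma A_kernel i : exists chi y : gT -> 'F_7, [/\ qchar E chi y, chi (b_ i) = 1%R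
  & forall g, g \in E -> (chi g == 0) = (g \in A i)].
Proof.
by apply: char_ex; rewrite ?A_normal ?A_index ?b_E ?b_notA.
Qed.

Lemma chi_c chi y : qchar E chi y -> chi c = 0.
Proof.
move=> qy; have [_ _ _ <- _] := hE.
apply: (addrI (chi (e2 * e1))); rewrite addr0 -(qcharM qy) ?groupM ?groupR ?groupV //.
by rewrite -commgC !(qcharM qy) // addrC.
Qed.

Lemma A_a0 : e1 \in A (Some 0).
Proof. by have := a_A (Some 0); rewrite /= expg0 mulg1. Qed.

(** The basis of characters dual to e1, e2; their kernels are A_inf and A_0. *)
Lemma eps_ex : exists ep1 Ep1 ep2 Ep2 : gT -> 'F_7,
  [/\ qchar E ep1 Ep1, qchar E ep2 Ep2, ep1 e1 = 1%R /\ ep1 e2 = 0,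
    ep2 e1 = 0 /\ ep2 e2 = 1%R
  & forall x, x \in E -> ep1 x = 0 -> ep2 x = 0 -> x \in <[c]> ].
Proof.
have [ep1 [Ep1 [q1 E1 k1]]] := A_kernel None.
have [ep2 [Ep2 [q2 E2 k2]]] := A_kernel (Some 0).
exists ep1, Ep1, ep2, Ep2; split=> //.
- by split=> //; apply/eqP; rewrite k1 // (a_A None).
- by split=> //; apply/eqP; rewrite k2 // A_a0.
- move=> x xE /eqP; rewrite k1 // => xA /eqP; rewrite k2 // => xA0.
  have : x \in <[c]> * <[e2]>.
    by rewrite -cards_setU2_gen //; apply: (cE_comm hE).
  case/mulsgP=> y z yc /cycleP[n ->] Ex; rewrite Ex in xA0 *.
  have : ep2 (y * e2 ^+ n) = 0 by apply/eqP; rewrite k2 // -Ex.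
  case/cycleP: (yc) => m Ey.
  rewrite (qcharM q2) ?groupX ?Ey ?groupX // !(qcharX _ q2) // (chi_c q2) mul0rn add0r E2.
  move/eqP; rewrite -(dvdn_pcharf (pchar_Fp (isT : prime 7))) => /dvdnP[q ->].
  by have [_ _ [_ e27 _] _ _] := hE; rewrite mulnC expgM e27 expg1n mulg1 -Ey.
Qed.

End ExtraspecialSubgroups.

(** * Matrices of size two and the group 6S3 *)

Section Matrices2.

Definition mx2 (p q r s : 'F_7) : 'M['F_7]_2 :=
  \matrix_(i, j) (if i == 0 then if j == 0 then p else q
                  else if j == 0 then r else s).

Lemma mx2P (g h : 'M['F_7]_2) : g 0 0 = h 0 0 -> g 0 1 = h 0 1 ->
  g 1 0 = h 1 0 -> g 1 1 = h 1 1 -> g = h.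
Proof.
move=> E00 E01 E10 E11; apply/matrixP => i j.
have I2 (k : 'I_2) : k = 0 \/ k = 1.
  by case: k => -[|[|//]] lt; [left|right]; apply: val_inj.
by case: (I2 i) => ->; case: (I2 j) => ->.
Qed.

Lemma mx2E (g : 'M['F_7]_2) : g = mx2 (g 0 0) (g 0 1) (g 1 0) (g 1 1).
Proof. by apply: mx2P; rewrite mxE. Qed.

Lemma mulmx2 (g h : 'M['F_7]_2) i j : (g *m h) i j = g i 0 * h 0 j + g i 1 * h 1 j.
Proof.
rewrite mxE big_ord_recl big_ord1; congr (_ + g i _ * h _ j); exact: val_inj.
Qed.

Lemma mul_mx2 p q r s p' q' r' s' : mx2 p q r s *m mx2 p' q' r' s' =
  mx2 (p * p' + q * r') (p * q' + q * s') (r * p' + s * r') (r * q' + s * s').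
Proof. by apply: mx2P; rewrite mulmx2 !mxE. Qed.

Lemma det2 (g : 'M['F_7]_2) : \det g = g 0 0 * g 1 1 - g 0 1 * g 1 0.
Proof.
rewrite (expand_det_row _ 0) big_ord_recl big_ord1 /cofactor !det_mx11 !mxE /=.
rewrite expr0 mul1r expr1 mulN1r mulrN.
by congr (g _ _ * g _ _ - g _ _ * g _ _); apply: val_inj.
Qed.

Lemma det_mx2 p q r s : \det (mx2 p q r s) = p * s - q * r.
Proof. by rewrite det2 !mxE. Qed.

Lemma mx2_1 : mx2 1 0 0 1 = 1%:M.
Proof. by apply: mx2P; rewrite !mxE. Qed.

(* A set of matrices containing the upper transvections and a matrix that moves
   the line they fix contains SL_2. *)
Lemma SL2_gen (W : 'M['F_7]_2 -> Prop) (x x' : 'M['F_7]_2) :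
  (forall g h, W g -> W h -> W (g *m h)) ->
  (forall k, W (mx2 1 k 0 1)) -> W x -> W x' -> x *m x' = 1%:M -> x 1 0 != 0 ->
  forall g, \det g = 1 -> W g.
Proof.
move=> WM WT Wx Wx' xx' nx.
have WL r : W (mx2 1 0 r 1).
  have dx : \det x * \det x' = 1 by rewrite -det_mulmx xx' det1.
  have n1 : \det x != 0 by apply: contra_eqN dx => /eqP ->; rewrite mul0r eq_sym oner_eq0.
  pose f := x 1 0; pose k := - x 0 0 / f; pose l := - x 1 1 / f.
  pose q := - (\det x / f).
  (* Upper transvections on both sides clear the diagonal of x, as its lower left entry is a unit.
     Conjugation by the antidiagonal result turns upper transvections into lower ones. *)
  have Ew : mx2 1 k 0 1 *m x *m mx2 1 l 0 1 = mx2 0 q f 0.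
    rewrite [x]mx2E !mul_mx2 /k /l /q det2.
    by apply: mx2P; rewrite !mxE /=; rewrite /f; field.
  have Ww : W (mx2 0 q f 0) by rewrite -Ew; exact: (WM _ _ (WM _ _ (WT k) Wx) (WT l)).
  (* W is closed under products only, so the inverse of the antidiagonal matrix is assembled from
     x'. *)
  have Ww' : W (mx2 0 f^-1 q^-1 0).
    have -> : mx2 0 f^-1 q^-1 0 = mx2 1 (- l) 0 1 *m x' *m mx2 1 (- k) 0 1.
      have qn : q != 0 by rewrite oppr_eq0 mulf_neq0 // invr_eq0.
      have E1 : mx2 0 f^-1 q^-1 0 *m mx2 0 q f 0 = 1%:M.
        by rewrite mul_mx2 -mx2_1; apply: mx2P; rewrite !mxE /=; field; rewrite ?qn ?nx.
      have Tinv m : mx2 1 m 0 1 *m mx2 1 (- m) 0 1 = 1%:M.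
        by rewrite mul_mx2 -mx2_1; apply: mx2P; rewrite !mxE /=; ring.
      have E2 : mx2 0 q f 0 *m (mx2 1 (- l) 0 1 *m x' *m mx2 1 (- k) 0 1) = 1%:M.
        rewrite -Ew -!mulmxA (mulmxA (mx2 1 l 0 1)) Tinv mul1mx (mulmxA x) xx' mul1mx.
        exact: Tinv.
      by rewrite -[LHS]mulmx1 -E2 mulmxA E1 mul1mx.
    exact: (WM _ _ (WM _ _ (WT _) Wx') (WT _)).
  have qn : q != 0 by rewrite oppr_eq0 mulf_neq0 // invr_eq0.
  have -> : mx2 1 0 r 1 = mx2 0 q f 0 *m mx2 1 (r * q / f) 0 1 *m mx2 0 f^-1 q^-1 0.
    rewrite !mul_mx2; apply: mx2P; rewrite !mxE /=; field; by rewrite ?qn ?nx.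
  exact: (WM _ _ (WM _ _ Ww (WT _)) Ww').
(* In the big Bruhat cell an element of SL_2 is an upper, a lower and an upper transvection
   multiplied together. *)
have key g : \det g = 1 -> g 1 0 != 0 -> W g.
  move=> dg ng; pose r := g 1 0.
  have -> : g = mx2 1 ((g 0 0 - 1) / r) 0 1 *m mx2 1 0 r 1 *m mx2 1 ((g 1 1 - 1) / r) 0 1.
    have E01 : g 0 1 = (g 0 0 * g 1 1 - 1) / r.
      by rewrite -dg det2 /r; field.
    by rewrite !mul_mx2; apply: mx2P; rewrite !mxE /= ?E01 /r; field.
  exact: (WM _ _ (WM _ _ (WT _) (WL _)) (WT _)).
move=> g dg; have [g0|] := eqVneq (g 1 0) 0; last exact: key.
have -> : g = (g *m mx2 1 0 1 1) *m mx2 1 0 (-1) 1.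
  rewrite -mulmxA mul_mx2 (_ : mx2 _ _ _ _ = 1%:M) ?mulmx1 // -mx2_1.
  by apply: mx2P; rewrite !mxE /=; ring.
apply: WM => //; apply: key.
  by rewrite det_mulmx dg det_mx2; ring.
rewrite mulmx2 !mxE /= g0 mul0r add0r mulr1.
by apply: contra_eqN dg => /eqP g1; rewrite det2 g0 g1 !mulr0 subrr eq_sym oner_eq0.
Qed.

Definition anti2 (l m : 'F_7) : 'M['F_7]_2 := mx2 0 l m 0.

Lemma diag2E l m : diag2 l m = mx2 l 0 0 m.
Proof. by apply: mx2P; rewrite !mxE. Qed.
Lemma swap2E : swap2 = mx2 0 1 1 0.
Proof. by apply: mx2P; rewrite !mxE. Qed.

(** The nonzero entries of an element of 6S3: two cube roots of 1, or the negatives of two. *)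
Definition cube_pair (l m : 'F_7) : bool :=
  (l ^+ 3 == m ^+ 3) && ((l ^+ 3 == 1) || (l ^+ 3 == - 1)).

Lemma cube_pairM l m l' m' : cube_pair l m -> cube_pair l' m' ->
  cube_pair (l * l') (m * m').
Proof.
rewrite /cube_pair !exprMn => /andP[/eqP <- h] /andP[/eqP <- h'].
rewrite eqxx /=; case/orP: h => /eqP ->; case/orP: h' => /eqP ->;
  by rewrite ?(mul1r, mulr1, mulrNN, mulN1r, opprK, eqxx, orbT).
Qed.
Lemma cube_pairC l m : cube_pair l m -> cube_pair m l.
Proof. by rewrite /cube_pair => /andP[/eqP -> ->]; rewrite eqxx. Qed.

Lemma W_6S3P (g : {'GL_2['F_7]}) : g \in W_6S3 -> exists l m,
  cube_pair l m /\ (GLval g = diag2 l m \/ GLval g = anti2 l m).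
Proof.
pose P (g : 'M['F_7]_2) := [exists l, exists m,
  cube_pair l m && ((g == diag2 l m) || (g == anti2 l m))].
have PM g1 h1 : P g1 -> P h1 -> P (g1 *m h1).
  case/existsP=> l /existsP[m /andP[lm g1E]] /existsP[l' /existsP[m' /andP[lm' h1E]]].
  case/orP: g1E => /eqP ->; case/orP: h1E => /eqP ->; rewrite ?diag2E /anti2 mul_mx2;
    rewrite !(mul0r, mulr0, addr0, add0r).
  - apply/existsP; exists (l * l'); apply/existsP; exists (m * m').
    by rewrite cube_pairM // diag2E eqxx.
  - apply/existsP; exists (l * l'); apply/existsP; exists (m * m').
    by rewrite cube_pairM // /anti2 eqxx orbT.
  - apply/existsP; exists (l * m'); apply/existsP; exists (m * l').
    by rewrite cube_pairM ?(cube_pairC lm') // /anti2 eqxx orbT.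
  - apply/existsP; exists (l * m'); apply/existsP; exists (m * l').
    by rewrite cube_pairM ?(cube_pairC lm') // diag2E eqxx.
have gP : group_set [set g : {'GL_2['F_7]} | P (GLval g)].
  apply/group_setP; split=> [|x y]; rewrite !inE; last exact: PM.
  apply/existsP; exists 1; apply/existsP; exists 1.
  rewrite /cube_pair !expr1n !eqxx /= diag2E.
  by apply/orP; left; apply/eqP; rewrite mx2_1.
have : W_6S3 \subset Group gP.
  rewrite gen_subG; apply/subsetP => h; rewrite !inE => /or3P[|/eqP Eh|/eqP Eh].
  - case/existsP=> l /existsP[m /and3P[l3 m3 /eqP ->]].
    apply/existsP; exists l; apply/existsP; exists m.
    by rewrite /cube_pair l3 (eqP l3) eq_sym m3 /= eqxx.
  - apply/existsP; exists 1; apply/existsP; exists 1.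
    by rewrite /cube_pair !expr1n !eqxx /= Eh swap2E /anti2 eqxx orbT.
  - apply/existsP; exists (-1); apply/existsP; exists (-1).
    by rewrite (_ : cube_pair (-1) (-1)) // Eh eqxx.
move/subsetP/[apply]; rewrite inE => /existsP[l /existsP[m /andP[lm /orP[] /eqP E]]].
  by exists l, m; split=> //; left.
by exists l, m; split=> //; right.
Qed.

End Matrices2.

(** * The normalizer of E acting on E / <c> *)

Section LocalFusion.
Local Open Scope group_scope.
Variables (gT : finGroupType) (G E : {group gT}) (e1 e2 c : gT).
Hypothesis hE : extraspecial7 E e1 e2 c.
Variables (ep1 Ep1 ep2 Ep2 : gT -> 'F_7).
Hypotheses (q1 : qchar E ep1 Ep1) (q2 : qchar E ep2 Ep2)
  (E11 : ep1 e1 = 1%R) (E12 : ep1 e2 = 0) (E21 : ep2 e1 = 0) (E22 : ep2 e2 = 1%R)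
  (Ec : forall x, x \in E -> ep1 x = 0 -> ep2 x = 0 -> x \in <[c]>).
Notation A i := (A_ e1 e2 c i).
Notation a i := (a_ e1 e2 i).
Implicit Types (i j : option 'F_7) (x n : gT).

Let e1E := e1E hE.
Let e2E := e2E hE.
Let cE := cinE hE.
Let oE : #|E| = 343%N. Proof. by case: hE. Qed.

Let c0 k : ep1 (c ^+ k) = 0 /\ ep2 (c ^+ k) = 0.
Proof.
by rewrite (qcharX _ q1) // (qcharX _ q2) // (chi_c hE q1) (chi_c hE q2) !mul0rn.
Qed.

Lemma ep_word (p q : nat) z : z \in <[c]> ->
  ep1 (e1 ^+ p * e2 ^+ q * z) = p%:R /\ ep2 (e1 ^+ p * e2 ^+ q * z) = q%:R.
Proof.
case/cycleP=> k ->; have [h1 h2] := c0 k.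
rewrite !(qcharM q1) ?(groupM, groupX) // !(qcharM q2) ?(groupM, groupX) //.
rewrite h1 h2 !(qcharX _ q1) // !(qcharX _ q2) // E11 E12 E21 E22 !mul0rn.
by rewrite !addr0 add0r.
Qed.

Lemma ep_eq x z : x \in E -> z \in E -> ep1 x = ep1 z -> ep2 x = ep2 z ->
  x * z^-1 \in <[c]>.
Proof.
move=> xE zE h1 h2; apply: Ec; first by rewrite groupM ?groupV.
  by apply: (addIr (ep1 z)); rewrite -(qcharM q1) ?mulgKV ?groupM ?groupV // add0r.
by apply: (addIr (ep2 z)); rewrite -(qcharM q2) ?mulgKV ?groupM ?groupV // add0r.
Qed.

Lemma E_word x : x \in E -> exists2 z, z \in <[c]> &
  x = e1 ^+ ep1 x * e2 ^+ ep2 x * z.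
Proof.
move=> xE; pose w := e1 ^+ ep1 x * e2 ^+ ep2 x.
have wE : w \in E by rewrite groupM ?groupX.
have [w1 w2] := ep_word (ep1 x) (ep2 x) (group1 <[c]>).
rewrite mulg1 -/w !natr_Zp in w1 w2.
exists (w^-1 * x); last by rewrite mulKVg.
have zE : w^-1 * x \in E by rewrite groupM ?groupV.
apply: Ec => //.
  by apply: (addrI (ep1 w)); rewrite -(qcharM q1) // mulKVg addr0.
by apply: (addrI (ep2 w)); rewrite -(qcharM q2) // mulKVg addr0.
Qed.

Lemma chi_word chi y x : qchar E chi y -> x \in E ->
  chi x = ep1 x * chi e1 + ep2 x * chi e2 :> 'F_7.
Proof.
move=> qy xE; have [z /cycleP[k ->] Ex] := E_word xE.
rewrite {1}Ex !(qcharM qy) ?(groupM, groupX) // !(qcharX _ qy) // (chi_c hE qy).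
by rewrite mul0rn addr0 -!(mulr_natl (chi _)) !natr_Zp.
Qed.

Lemma a_ep i : ep1 (a i) = (if i is Some _ then 1 else 0)%R /\
  ep2 (a i) = (if i is Some k then k else 1)%R.
Proof.
case: i => [k|] /=; last by rewrite E12 E22.
by have := ep_word 1 k (group1 <[c]>); rewrite expg1 mulg1 natr_Zp.
Qed.

Lemma mem_a (B : {group gT}) i x : c \in B -> x \in B -> x \in E ->
  ep1 x = ep1 (a i) -> ep2 x = ep2 (a i) -> a i \in B.
Proof.
move=> cB xB xE h1 h2; have h := ep_eq (a_E hE i) xE (esym h1) (esym h2).
by rewrite -(mulgKV x (a i)) groupM // (subsetP _ _ h) // cycle_subG.
Qed.

(** Index 7 makes [B] normal with abelian quotient, so it contains the commutator c. An element of
    [B] outside <c> has a power congruent to some a_i modulo <c>. *)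
Lemma ord49_A (B : {group gT}) : B \subset E -> #|B| = 49%N -> exists i, B = A i.
Proof.
move=> sBE oB; have iB : #|E : B| = 7%N by rewrite -divgS // oE oB.
have pE : 7.-group E by rewrite /pgroup oE.
have nB : B <| E by apply: (p_maximal_normal pE); apply: p_index_maximal; rewrite ?iB.
have cB : c \in B.
  have [_ _ _ <- _] := hE; apply: (subsetP (_ : E^`(1) \subset B)).
    apply: der1_min; first exact: normal_norm.
    apply: cyclic_abelian; apply: prime_cyclic.
    by rewrite card_quotient ?normal_norm // iB.
  exact: mem_commg.
have [x xB xc] : exists2 x, x \in B & x \notin <[c]>.
  apply/subsetPn; apply: contraL isT => /subset_leq_card.
  by rewrite oB -[#|<[c]>|]/(#[c]) (order_c hE).
have xE := subsetP sBE _ xB.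
suff [i ai] : exists i, a i \in B.
  exists i; apply/eqP; rewrite eq_sym -val_eqE eqEcard oB (card_A hE) leqnn andbT.
  by rewrite gen_subG subUset !sub1set cB.
have [x1|x1] := eqVneq (ep1 x) 0.
  have [x2|x2] := eqVneq (ep2 x) 0; first by case/negP: xc; apply: Ec.
  have [k Ek] := char_power q2 xE x2.
  exists None; apply: (@mem_a B None (x ^+ k)); rewrite ?groupX //.
    by rewrite (qcharX _ q1) // x1 mul0rn /= E12.
  by rewrite Ek /= E22.
have [k Ek] := char_power q1 xE x1.
exists (Some (ep2 (x ^+ k))); apply: (@mem_a B _ (x ^+ k)); rewrite ?groupX //.
  by have [-> _] := a_ep (Some (ep2 (x ^+ k))); rewrite Ek.
by have [_ ->] := a_ep (Some (ep2 (x ^+ k))).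
Qed.

Lemma NE_conj n x : n \in 'N_G(E) -> x \in E -> x ^ n \in E.
Proof. by case/setIP=> _ nN xE; rewrite memJ_norm. Qed.

Lemma c_conj n : n \in 'N_G(E) -> c ^ n \in <[c]>.
Proof.
move=> nN; apply: (subsetP (derE hE)); have [_ _ _ <- _] := hE.
by rewrite conjRg mem_commg ?(NE_conj nN).
Qed.

Lemma qchar_conj n chi y : n \in 'N_G(E) -> qchar E chi y ->
  qchar E (fun x => chi (x ^ n)) (fun g => y (n^-1 * g)).
Proof.
move=> nN qy h g hE'; rewrite -qy ?(NE_conj nN) //.
by rewrite conjgE !mulgA mulgK.
Qed.

Definition NE_mx n : 'M['F_7]_2 :=
  mx2 (ep1 (e1 ^ n)) (ep1 (e2 ^ n)) (ep2 (e1 ^ n)) (ep2 (e2 ^ n)).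

Lemma NE_out n : n \in 'N_G(E) -> out_matrix e1 e2 c (fun e => e ^ n) (NE_mx n).
Proof.
move=> nN; rewrite /out_matrix !mxE /=.
split; apply/lcosetP.
  by have [z zc Ez] := E_word (NE_conj nN e1E); exists z.
by have [z zc Ez] := E_word (NE_conj nN e2E); exists z.
Qed.

Lemma out_ep n (g : 'M['F_7]_2) x : out_matrix e1 e2 c (fun e => e ^ n) g ->
  n \in 'N_G(E) -> x \in E ->
  ep1 (x ^ n) = (g 0 0 * ep1 x + g 0 1 * ep2 x)%R /\
  ep2 (x ^ n) = (g 1%R 0 * ep1 x + g 1%R 1%R * ep2 x)%R.
Proof.
case=> /lcosetP[z1 z1c h1] /lcosetP[z2 z2c h2] nN xE.
rewrite (chi_word (qchar_conj nN q1) xE) (chi_word (qchar_conj nN q2) xE) h1 h2.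
have [-> ->] := ep_word (g 0 0) (g 1%R 0) z1c.
have [-> ->] := ep_word (g 0 1%R) (g 1%R 1%R) z2c.
by rewrite !natr_Zp ![(ep1 x * _)%R]mulrC ![(ep2 x * _)%R]mulrC.
Qed.

Lemma NE_GL n : n \in 'N_G(E) -> exists g : {'GL_2['F_7]}, GLval g = NE_mx n.
Proof.
move=> nN; have nN' : n^-1 \in 'N_G(E) by rewrite groupV.
have M1 : NE_mx n *m NE_mx n^-1 = 1%:M.
  rewrite mul_mx2 -mx2_1.
  have [h1 h2] := out_ep (NE_out nN) nN (NE_conj nN' e1E).
  have [h3 h4] := out_ep (NE_out nN) nN (NE_conj nN' e2E).
  move: h1 h2 h3 h4; rewrite !conjgKV !mxE /= E11 E12 E21 E22.
  by move=> <- <- <- <-.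
have [U _] := mulmx1_unit M1.
by exists (Sub (NE_mx n) U); rewrite SubK.
Qed.

Lemma A_conj n i j : n \in 'N_G(E) -> a i ^ n \in A j -> A i :^ n = A j.
Proof.
move=> nN aj; apply/eqP; rewrite eqEcard cardJg !(card_A hE) leqnn andbT.
rewrite /= -genJ gen_subG conjUg !conjg_set1 subUset !sub1set.
rewrite {}aj andbT; apply: (subsetP _ _ (c_conj nN)).
by rewrite cycle_subG c_A.
Qed.

(** Conjugation by b_i fixes c and multiplies a_i by c^r with r = 1 or -1; a power of b_i with
    exponent k / r therefore gives c^k. *)
Lemma transvection i (k : 'F_7) : exists2 x, x \in E & c ^ x = c /\ a i ^ x = a i * c ^+ k.
Proof.
have [r Er] : exists r : 'F_7, [~ a i, b_ e1 e2 i] = c ^+ r /\ r != 0%R.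
  have [_ _ _ e12 _] := hE; case: i => [m|] /=; last first.
    exists (-1)%R; split=> //; rewrite -invg_comm e12; apply/eqP.
    by rewrite eq_invg_mul -expgS -[X in _ == X](c7 hE).
  exists 1%R; split=> //; rewrite commMgJ (_ : [~ e2 ^+ m, e2] = 1) ?mulg1; last first.
    by apply/eqP/commgP/commute_sym/commuteX.
  by rewrite e12 conjgE (cE_comm hE (groupX m e2E)) mulKg.
have [Er1 r0] := Er; have bE := b_E hE i.
have cb : c ^ b_ e1 e2 i = c by rewrite conjgE (cE_comm hE bE) mulKg.
have ab m : a i ^ (b_ e1 e2 i ^+ m) = a i * c ^+ (r * m).
  elim: m => [|m IHm]; first by rewrite muln0 conjg1 mulg1.
  rewrite expgSr conjgM IHm conjMg conjXg cb [a i ^ _]conjg_mulR Er1 -mulgA -expgD.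
  by rewrite mulnS.
exists (b_ e1 e2 i ^+ (k / r)%R); first exact: groupX.
split; first by elim: (nat_of_ord _) => [|m IHm]; rewrite ?conjg1 // expgSr conjgM IHm.
rewrite ab; congr (_ * _); apply/eqP; rewrite eq_expg_mod_order (order_c hE).
apply/eqP; have := @natr_Zp 5; rewrite -!(val_Fp_nat (isT : prime 7)).
by rewrite natrM !natr_Zp mulrC divfK // => _; rewrite val_Fp_nat // modn_small // (ltn_ord k).
Qed.

End LocalFusion.

(** * Fusion of the subgroups A_i in G *)

Section Frattini.
Local Open Scope group_scope.
Variables (gT : finGroupType) (G E : {group gT}) (e1 e2 c : gT).
Hypotheses (hE : extraspecial7 E e1 e2 c) (sylE : 7.-Sylow(G) E)
  (hW : forall g : {'GL_2['F_7]}, W_E G E e1 e2 c (GLval g) <-> g \in W_6S3).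
Variables (ep1 Ep1 ep2 Ep2 : gT -> 'F_7).
Hypotheses (q1 : qchar E ep1 Ep1) (q2 : qchar E ep2 Ep2)
  (E11 : ep1 e1 = 1%R) (E12 : ep1 e2 = 0) (E21 : ep2 e1 = 0) (E22 : ep2 e2 = 1%R)
  (Ec : forall x, x \in E -> ep1 x = 0 -> ep2 x = 0 -> x \in <[c]>).
Notation A i := (A_ e1 e2 c i).
Notation a i := (a_ e1 e2 i).
Implicit Types (i j : option 'F_7) (x n : gT).

Lemma sEG : E \subset G. Proof. exact: pHall_sub sylE. Qed.

Lemma NE_W n : n \in 'N_G(E) -> exists l m, cube_pair l m /\
  (out_matrix e1 e2 c (fun e => e ^ n) (diag2 l m) \/
   out_matrix e1 e2 c (fun e => e ^ n) (anti2 l m)).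
Proof.
move=> nN; have [g Eg] := NE_GL hE q1 q2 E11 E12 E21 E22 Ec nN.
have hout := NE_out hE q1 q2 E11 E12 E21 E22 Ec nN.
have gW : g \in W_6S3 by apply/hW; rewrite Eg; exists n.
have [l [m [lm Elm]]] := W_6S3P gW; exists l, m; split=> //.
by case: Elm => <-; [left|right]; rewrite Eg.
Qed.

Lemma W_lift (g : 'M['F_7]_2) : \det g != 0 ->
  (forall h : {'GL_2['F_7]}, GLval h = g -> h \in gens_6S3) ->
  exists2 n, n \in 'N_G(E) & out_matrix e1 e2 c (fun e => e ^ n) g.
Proof.
move=> dg hg; have U : g \in unitmx by rewrite unitmxE unitfE.
pose h : {'GL_2['F_7]} := Sub g U.
have Eh : GLval h = g by rewrite SubK.
have : h \in W_6S3 by rewrite mem_gen // hg.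
by move/hW; rewrite Eh.
Qed.

Lemma diag_lift (l m : 'F_7) : (l ^+ 3 = 1)%R -> (m ^+ 3 = 1)%R ->
  exists2 n, n \in 'N_G(E) & out_matrix e1 e2 c (fun e => e ^ n) (diag2 l m).
Proof.
move=> l3 m3; apply: W_lift.
  rewrite diag2E det_mx2 mulr0 subr0 mulf_neq0 //.
    by apply: contra_eqN l3 => /eqP ->; rewrite expr0n eq_sym oner_eq0.
  by apply: contra_eqN m3 => /eqP ->; rewrite expr0n eq_sym oner_eq0.
move=> h Eh; rewrite inE Eh; apply/orP; left; apply/existsP; exists l.
by apply/existsP; exists m; rewrite l3 m3 !eqxx.
Qed.

Lemma swap_lift : exists2 n, n \in 'N_G(E) & out_matrix e1 e2 c (fun e => e ^ n) swap2.
Proof.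
apply: W_lift => [|h Eh]; last by rewrite inE Eh eqxx orbT.
by rewrite swap2E det_mx2 mulr0 mulr1 sub0r oppr_eq0 oner_eq0.
Qed.

Lemma neg_lift : exists2 n, n \in 'N_G(E) & out_matrix e1 e2 c (fun e => e ^ n) (diag2 (-1) (-1)).
Proof.
apply: W_lift => [|h Eh]; last by rewrite inE Eh eqxx !orbT.
by rewrite diag2E det_mx2 mulr0 subr0 mulrNN mulr1 oner_eq0.
Qed.

Lemma A_move i j n : n \in 'N_G(E) -> ep1 (a i ^ n) = ep1 (a j) ->
  ep2 (a i ^ n) = ep2 (a j) -> A i :^ n = A j.
Proof.
move=> nN h1 h2; apply: (A_conj hE nN).
have xE := NE_conj nN (a_E hE i).
have h := ep_eq q1 q2 Ec xE (a_E hE j) h1 h2.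
rewrite -(mulgKV (a j) (a i ^ n)) groupM ?a_A //.
by apply: (subsetP _ _ h); rewrite cycle_subG c_A.
Qed.

(** If k and l have the same cube, diag(1, l / k) lies in 6S3 and carries A_k to A_l; the cubes are
    1 on 1, 2, 4 and -1 on 3, 5, 6. The swap exchanges A_0 and A_inf. *)
Lemma class_conj i j : has (fun cls => (i \in cls) && (j \in cls)) A_classes ->
  exists2 n, n \in 'N_G(E) & A i :^ n = A j.
Proof.
have key (k l : 'F_7) : k != 0 -> (l ^+ 3 = k ^+ 3)%R ->
    exists2 n, n \in 'N_G(E) & A (Some k) :^ n = A (Some l).
  move=> k0 lk; have [||n nN hn] := @diag_lift 1%R (l / k)%R.
  - by rewrite expr1n.
  - by rewrite expr_div_n lk divff // expf_neq0.
  exists n => //; apply: A_move => //.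
    have [-> _] := out_ep hE q1 q2 E11 E12 E21 E22 Ec hn nN (a_E hE (Some k)).
    have [-> ->] := a_ep hE q1 q2 E11 E12 E21 E22 (Some k).
    have [-> _] := a_ep hE q1 q2 E11 E12 E21 E22 (Some l).
    by rewrite diag2E !mxE /= mulr1 mul0r addr0.
  have [_ ->] := out_ep hE q1 q2 E11 E12 E21 E22 Ec hn nN (a_E hE (Some k)).
  have [-> ->] := a_ep hE q1 q2 E11 E12 E21 E22 (Some k).
  have [_ ->] := a_ep hE q1 q2 E11 E12 E21 E22 (Some l).
  by rewrite diag2E !mxE /= mulr1 add0r divfK.
have one k : exists2 n, n \in 'N_G(E) & A k :^ n = A k.
  by exists 1; rewrite ?group1 ?conjsg1.
have sw : (exists2 n, n \in 'N_G(E) & A (Some 0) :^ n = A None) /\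
          (exists2 n, n \in 'N_G(E) & A None :^ n = A (Some 0)).
  have [n nN hn] := swap_lift.
  have hep i0 := out_ep hE q1 q2 E11 E12 E21 E22 Ec hn nN (a_E hE i0).
  have hae := a_ep hE q1 q2 E11 E12 E21 E22.
  split; exists n => //; apply: A_move => //.
  - have [-> _] := hep (Some 0); have [-> ->] := hae (Some 0); have [-> _] := hae None.
    by rewrite swap2E !mxE /= mul0r mulr0 addr0.
  - have [_ ->] := hep (Some 0); have [-> ->] := hae (Some 0); have [_ ->] := hae None.
    by rewrite swap2E !mxE /= mul1r mulr0 addr0.
  - have [-> _] := hep None; have [-> ->] := hae None; have [-> _] := hae (Some 0).
    by rewrite swap2E !mxE /= mul0r mul1r add0r.
  - have [_ ->] := hep None; have [-> ->] := hae None; have [_ ->] := hae (Some 0).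
    by rewrite swap2E !mxE /= mul0r mulr0 addr0.
rewrite /A_classes /= orbF !inE.
case/orP=> [|/orP[]] /andP[].
- by move=> /or3P[] /eqP -> /or3P[] /eqP ->; apply: key => //; apply: val_inj.
- by move=> /or3P[] /eqP -> /or3P[] /eqP ->; apply: key => //; apply: val_inj.
- by move=> /orP[] /eqP -> /orP[] /eqP ->; try exact: one; case: sw.
Qed.

Section FixedSubgroup.
Variables (i : option 'F_7) (chiY Y chiU U : gT -> 'F_7).
Hypotheses (qY : qchar (A i) chiY Y) (qU : qchar (A i) chiU U)
  (Ya : chiY (a i) = 1%R) (Yc : chiY c = 0) (Ua : chiU (a i) = 0) (Uc : chiU c = 1%R)
  (injA : forall g, g \in A i -> chiY g = 0 -> chiU g = 0 -> g = 1).

Let cA := c_A e1 e2 c i.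
Let aA := a_A e1 e2 c i.

Lemma chi_exp (p q : nat) : chiU (c ^+ p * a i ^+ q) = p%:R /\
  chiY (c ^+ p * a i ^+ q) = q%:R.
Proof.
rewrite (qcharM qU) ?groupX // (qcharM qY) ?groupX // !(qcharX _ qU) // !(qcharX _ qY) //.
by rewrite Ya Yc Ua Uc !mul0rn; split; [apply: addr0|apply: add0r].
Qed.

Lemma A_word h : h \in A i -> h = c ^+ chiU h * a i ^+ chiY h.
Proof.
move=> hA; have [h1 h2] := chi_exp (chiU h) (chiY h).
rewrite !natr_Zp in h1 h2; move: h1 h2; set w := _ * _ => h1 h2.
have wA : w \in A i by rewrite groupM ?groupX.
clearbody w; apply/eqP; rewrite eq_mulgV1; apply/eqP/injA; first by rewrite groupM ?groupV.
  by apply: (addIr (chiY w)); rewrite -(qcharM qY) ?mulgKV ?groupM ?groupV // add0r.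
by apply: (addIr (chiU w)); rewrite -(qcharM qU) ?mulgKV ?groupM ?groupV // add0r.
Qed.

Definition NA_mx x : 'M['F_7]_2 :=
  mx2 (chiU (c ^ x)) (chiU (a i ^ x)) (chiY (c ^ x)) (chiY (a i ^ x)).

Lemma NA_conj x h : x \in 'N_G(A i) -> h \in A i -> h ^ x \in A i.
Proof. by case/setIP=> _ nx hA; rewrite memJ_norm. Qed.

Lemma W_AP (g : 'M['F_7]_2) : W_A G e1 e2 c i g <-> exists2 x, x \in 'N_G(A i) & g = NA_mx x.
Proof.
split=> [[x xN [hc ha]]|[x xN ->]]; exists x => //.
  rewrite [g]mx2E /NA_mx hc ha; have [-> ->] := chi_exp (g 0 0) (g 1%R 0).
  by have [-> ->] := chi_exp (g 0 1%R) (g 1%R 1%R); rewrite !natr_Zp.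
by rewrite !mxE /=; split; apply: A_word; apply: NA_conj.
Qed.

Lemma chi_conj x h : x \in 'N_G(A i) -> h \in A i ->
  chiU (h ^ x) = (chiU (c ^ x) * chiU h + chiU (a i ^ x) * chiY h)%R /\
  chiY (h ^ x) = (chiY (c ^ x) * chiU h + chiY (a i ^ x) * chiY h)%R.
Proof.
move=> xN hA; have cx := NA_conj xN cA; have ax := NA_conj xN aA.
have -> : h ^ x = (c ^ x) ^+ chiU h * (a i ^ x) ^+ chiY h.
  by rewrite {1}(A_word hA) conjMg !conjXg.
rewrite (qcharM qU) ?groupX // (qcharM qY) ?groupX // !(qcharX _ qU) // !(qcharX _ qY) //.
by rewrite -(mulr_natr (chiU (c ^ x))) -(mulr_natr (chiU (a i ^ x)))
  -(mulr_natr (chiY (c ^ x))) -(mulr_natr (chiY (a i ^ x))) !natr_Zp.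
Qed.

(** Conjugation is a right action, hence the reversed order. *)
Lemma NA_mxM x z : x \in 'N_G(A i) -> z \in 'N_G(A i) ->
  NA_mx (z * x) = NA_mx x *m NA_mx z.
Proof.
move=> xN zN; rewrite mul_mx2 /NA_mx !conjgM.
have [-> ->] := chi_conj xN (NA_conj zN cA).
by have [-> ->] := chi_conj xN (NA_conj zN aA).
Qed.

Lemma EN_A : E \subset 'N_G(A i).
Proof. by rewrite subsetI sEG normal_norm ?A_normal. Qed.

(** E already induces the transvections that fix c, so by [SL2_gen] an element moving the line <c>
    would make A_i radical. *)
Lemma nonradical_fix_c x : ~ radical G e1 e2 c i -> x \in 'N_G(A i) -> c ^ x \in <[c]>.
Proof.
move=> nrad xN; case: (boolP (chiY (c ^ x) == 0)) => [/eqP Y0|nY].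
  by rewrite (A_word (NA_conj xN cA)) Y0 expg0 mulg1 mem_cycle.
case: nrad => g dg; apply: (SL2_gen (x := NA_mx x) (x' := NA_mx x^-1)) dg.
- move=> g1 g2 /W_AP[x1 n1 ->] /W_AP[x2 n2 ->]; apply/W_AP.
  by exists (x2 * x1); rewrite ?groupM // NA_mxM.
- move=> k; have [z zE [hc ha]] := transvection hE i k; apply/W_AP.
  exists z; first exact: (subsetP EN_A).
  rewrite /NA_mx hc ha Yc Uc (qcharM qU) ?groupX // (qcharM qY) ?groupX //.
  rewrite !(qcharX _ qU) // !(qcharX _ qY) // Ya Yc Ua Uc mul0rn addr0 add0r.
  by rewrite natr_Zp.
- by apply/W_AP; exists x.
- by apply/W_AP; exists x^-1; rewrite ?groupV.
- rewrite -NA_mxM ?groupV // mulVg /NA_mx !conjg1 Ya Yc Ua Uc; exact: mx2_1.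
- by rewrite mxE.
Qed.

(** E normalizes C_G(A_i), and both E and E^x are Sylow subgroups of the product C_G(A_i) E.
    Conjugating one to the other inside this product splits x. *)
Lemma frattini_A x : ~ radical G e1 e2 c i -> x \in 'N_G(A i) ->
  exists n z, [/\ n \in 'N_G(E), z \in 'C(A i) & x = n * z].
Proof.
move=> nrad xN; have [xG xNA] := setIP xN.
have nCE : E \subset 'N('C_G(A i)).
  apply: subset_trans EN_A _; exact: (normal_norm (subcent_normal _ _)).
pose K := ('C_G(A i) <*> E)%G.
have defK : K :=: 'C_G(A i) * E by rewrite /= norm_joinEr.
have sKG : K \subset G by rewrite join_subG subsetIl sEG.
have sEK : E \subset K by apply: joing_subr.
(* An element of E^x fixes c and moves a_i by a power of c. Some element of E acts on A_i in the
   same way, and the two differ by an element that centralizes A_i. *)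
have sExK : E :^ x \subset K.
  apply/subsetP => _ /imsetP[e eE ->].
  have cx := nonradical_fix_c nrad xN.
  have cx' : c ^ x^-1 \in <[c]> by apply: nonradical_fix_c; rewrite ?groupV.
  have fix_c z : z \in <[c]> -> z ^ e = z.
    case/cycleP=> k ->; rewrite conjXg conjgE.
    by rewrite (cE_comm hE eE) mulKg.
  have hc : c ^ (e ^ x) = c by rewrite [e ^ x]conjgE !conjgM fix_c // conjgKV.
  pose h := a i ^ x^-1; have hA : h \in A i by rewrite /h NA_conj // groupV.
  have ha : exists k : 'F_7, a i ^ (e ^ x) = a i * c ^+ k.
    have : [~ h, e] ^ x \in <[c]>.
      have : [~ h, e] \in <[c]>.
        by apply: (subsetP (derE hE)); rewrite mem_commg // (subsetP (A_sub hE i)).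
      by case/cycleP=> k ->; rewrite conjXg groupX.
    case/cycleP=> k Ek; exists (k%:R)%R.
    rewrite [e ^ x]conjgE !conjgM -/h [h ^ e]conjg_mulR conjMg conjgKV Ek.
    by rewrite val_Fp_nat // expg_mod // (c7 hE).
  have [k Ek] := ha; have [e' e'E [hc' ha']] := transvection hE i k.
  rewrite -(mulgKV e' (e ^ x)) defK mem_mulg //.
  have eG : e \in G by apply: (subsetP sEG).
  have e'G : e' \in G by apply: (subsetP sEG).
  rewrite inE groupM ?groupJ ?groupV //=.
  have fixw (w : gT) : w ^ (e ^ x) = w ^ e' -> w ^ (e ^ x * e'^-1) = w.
    by move=> Ew; rewrite conjgM Ew conjgK.
  rewrite /= -[<<_>>]/(generated _) cent_gen; apply/centP => w.
  rewrite !inE => /orP[] /eqP ->; apply/commute_sym/commgP/conjg_fixP/fixw.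
    by rewrite hc hc'.
  by rewrite Ek ha'.
have sylK : 7.-Sylow(K) E := pHall_subl sEK sKG sylE.
have sylKx : 7.-Sylow(K) (E :^ x).
  by apply: pHall_subl sExK sKG _; rewrite pHallJ.
have [k kK Ek] := Sylow_trans sylK sylKx.
move: kK; rewrite defK -(normC nCE) => /mulsgP[e z eE zC Ekz].
have [zG zA] := setIP zC.
exists (x * z^-1), z; split=> //; last by rewrite mulgKV.
rewrite inE groupM ?groupV //=; apply/normP.
rewrite conjsgM Ek Ekz conjsgM (conjGid eE) conjsgK //.
Qed.

End FixedSubgroup.

End Frattini.


(** * Dickson invariants of rank two *)

Lemma F7_rmorph_eq (T : nzRingType) (f g : {rmorphism 'F_7 -> T}) : f =1 g.
Proof. by move=> x; rewrite -[x]natr_Zp !rmorph_nat. Qed.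

Notation F7yu := {poly {poly 'F_7}}.
Notation Yv := ('X%:P : {poly {poly 'F_7}}).
Notation Uv := ('X : {poly {poly 'F_7}}).

Section Evaluation.
Variables (T : comNzRingType) (k : {rmorphism 'F_7 -> T}).

Definition ev1 (x : T) : {poly 'F_7} -> T := horner_morph (fun a => mulrC x (k a)).
HB.instance Definition _ x := GRing.RMorphism.on (ev1 x).

(** The target is arbitrary because the same polynomials are read in [HBE], in the variables y and
    u, and in one variable. *)
Definition ev (x y : T) : F7yu -> T := horner_morph (fun p => mulrC y (ev1 x p)).
HB.instance Definition _ x y := GRing.RMorphism.on (ev x y).

Lemma ev1X x : ev1 x 'X = x. Proof. exact: horner_morphX. Qed.
Lemma ev1C x a : ev1 x a%:P = k a. Proof. exact: horner_morphC. Qed.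
Lemma evY x y : ev x y Yv = x.
Proof. by rewrite /ev [LHS]horner_morphC; apply: ev1X. Qed.
Lemma evU x y : ev x y Uv = y. Proof. exact: horner_morphX. Qed.
Lemma evP x y p : ev x y p%:P = ev1 x p. Proof. exact: horner_morphC. Qed.
Lemma evC x y a : ev x y a%:P%:P = k a. Proof. by rewrite evP ev1C. Qed.
End Evaluation.

Lemma poly_rmorph_eq (R T : nzRingType) (f g : {rmorphism {poly R} -> T}) :
  (forall a, f a%:P = g a%:P) -> f 'X = g 'X -> f =1 g.
Proof.
move=> EC EX; elim/poly_ind => [|p a IH]; first by rewrite !rmorph0.
by rewrite !rmorphD !rmorphM /= IH EC EX.
Qed.

Lemma F7X_rmorph_eq (T : nzRingType) (f g : {rmorphism {poly 'F_7} -> T}) :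
  f 'X = g 'X -> f =1 g.
Proof.
apply: poly_rmorph_eq => a.
exact: (F7_rmorph_eq (f \o polyC) (g \o polyC)).
Qed.

Lemma F7yu_rmorph_eq (T : nzRingType) (f g : {rmorphism F7yu -> T}) :
  f Yv = g Yv -> f Uv = g Uv -> f =1 g.
Proof.
move=> EY EU; apply: poly_rmorph_eq => // p.
exact: (F7X_rmorph_eq (f := f \o polyC) (g := g \o polyC)).
Qed.

Lemma rmorph_ev (T T' : comNzRingType) (k : {rmorphism 'F_7 -> T})
    (k' : {rmorphism 'F_7 -> T'}) (f : {rmorphism T -> T'}) x y P :
  f (ev k x y P) = ev k' (f x) (f y) P.
Proof.
by apply: (F7yu_rmorph_eq (f := f \o ev k x y)); rewrite /= ?evY ?evU.
Qed.

Lemma rmorph_ev1 (T T' : comNzRingType) (k : {rmorphism 'F_7 -> T})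
    (k' : {rmorphism 'F_7 -> T'}) (f : {rmorphism T -> T'}) x p :
  f (ev1 k x p) = ev1 k' (f x) p.
Proof. by apply: (F7X_rmorph_eq (f := f \o ev1 k x)); rewrite /= !ev1X. Qed.

Section TwoVariables.

Definition kS : {rmorphism 'F_7 -> F7yu} := polyC \o polyC.
Definition kX : {rmorphism 'F_7 -> {poly 'F_7}} := polyC.
Notation evS := (ev kS).
Notation evX := (ev kX).

Lemma kS_0 : kS 0 = 0. Proof. exact: rmorph0. Qed.
Lemma kS_1 : kS 1 = 1. Proof. exact: rmorph1. Qed.

Lemma F7yu7 : 7%:R = 0 :> F7yu.
Proof. by have := rmorph_nat kS 7; rewrite pchar_Zp // rmorph0. Qed.

Lemma F7yu_frob (x y : F7yu) : (x + y) ^+ 7 = x ^+ 7 + y ^+ 7.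
Proof.
have h : 7 \in [pchar F7yu] by rewrite inE /= F7yu7 eqxx.
by rewrite exprDn_pchar // (pnatE _ (isT : prime 7)).
Qed.

Lemma ev_id P : evS Yv Uv P = P.
Proof. by apply: (F7yu_rmorph_eq (g := idfun)); rewrite /= ?evY ?evU. Qed.

Lemma ev1_comp x p : ev1 kX x p = p \Po x.
Proof.
by apply: (F7X_rmorph_eq (g := comp_poly x)); rewrite /= ev1X comp_polyX.
Qed.

Lemma comp_Xn_inj n : injective (fun p : {poly 'F_7} => p \Po 'X ^+ n.+1).
Proof.
move=> p q /= /eqP; rewrite -subr_eq0 -comp_polyB => /eqP E.
apply/eqP; rewrite -subr_eq0; apply/eqP; move: {p q}(p - q) E.
elim/poly_ind => // p a IH; rewrite comp_polyD comp_polyM comp_polyX comp_polyC => E.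
have a0 : a = 0.
  by have := congr1 (horner^~ 0) E; rewrite hornerD hornerM hornerXn expr0n mulr0 add0r hornerC horner0.
move: E; rewrite a0 !addr0 => /eqP; rewrite mulf_eq0 (negPf (expf_neq0 _ _)) ?polyX_eq0 // orbF.
by move/eqP/IH ->; rewrite mul0r.
Qed.

(* A pair x, y is algebraically independent if some specialization kills y but
   not the polynomials in x. *)
Lemma alg_indep (T : idomainType) (T' : comNzRingType) (k : {rmorphism 'F_7 -> T})
    (k' : {rmorphism 'F_7 -> T'}) (f : {rmorphism T -> T'}) x y :
  y != 0 -> f y = 0 -> (forall p, ev1 k' (f x) p = 0 -> p = 0) ->
  forall P, ev k x y P = 0 -> P = 0.
Proof.
move=> y0 fy fx; elim/poly_ind => // P p IH.
rewrite rmorphD rmorphM /= evU evP => E.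
have p0 : p = 0.
  apply: fx; rewrite -(rmorph_ev1 k k' f) -[LHS]add0r -{1}[0](mulr0 (f (ev k x y P))).
  by rewrite -fy -rmorphM -rmorphD /= E rmorph0.
move: E; rewrite p0 rmorph0 addr0 => /eqP; rewrite mulf_eq0 (negPf y0) orbF.
by move=> /eqP/IH ->; rewrite mul0r addr0.
Qed.

(* In the coordinates y, v the Dickson invariants of F_7[y, u], with
   v = u^7 - y^6 u, are L = y v and y^42 + v^6. *)
Definition th : F7yu -> F7yu := evS Yv (Uv ^+ 7 - Yv ^+ 6 * Uv).
HB.instance Definition _ := GRing.RMorphism.on th.
(** The restriction of CA to an A_i, with the two variables standing for C and V. *)
Definition sub6 : F7yu -> F7yu := evS (Yv ^+ 6) (Uv ^+ 6).
HB.instance Definition _ := GRing.RMorphism.on sub6.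
(** The inclusion of DA into CA, with the two variables standing for D1 and D2. *)
Definition dic : F7yu -> F7yu := evS (Yv ^+ 7 + Uv) (Yv * Uv).
HB.instance Definition _ := GRing.RMorphism.on dic.

Definition Lp : F7yu := Yv * Uv.

Lemma Yv0 : Yv != 0. Proof. by rewrite polyC_eq0 polyX_eq0. Qed.
Lemma Uv0 : Uv != 0. Proof. by rewrite polyX_eq0. Qed.
Lemma Lp0 : Lp != 0. Proof. by rewrite mulf_neq0 ?Yv0 ?Uv0. Qed.

Lemma ev_sub6 (T : comNzRingType) (k : {rmorphism 'F_7 -> T}) (x y : T) P :
  ev k x y (sub6 P) = ev k (x ^+ 6) (y ^+ 6) P.
Proof. by rewrite /sub6 (rmorph_ev kS k) !rmorphXn /= evY evU. Qed.

Lemma ev_dic (T : comNzRingType) (k : {rmorphism 'F_7 -> T}) (x y : T) P :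
  ev k x y (dic P) = ev k (x ^+ 7 + y) (x * y) P.
Proof. by rewrite /dic (rmorph_ev kS k) rmorphM rmorphD rmorphXn /= evY evU. Qed.

Lemma sub6_eq0 P : sub6 P = 0 -> P = 0.
Proof.
apply: (@alg_indep _ _ kS kX (evX 'X 0)); first by rewrite expf_neq0 ?Uv0.
- by rewrite rmorphXn /= evU expr0n.
- move=> p; rewrite rmorphXn /= evY ev1_comp => E; apply: (@comp_Xn_inj 5).
  by rewrite E comp_poly0.
Qed.

Lemma dic_eq0 P : dic P = 0 -> P = 0.
Proof.
apply: (@alg_indep _ _ kS kX (evX 0 'X)); first exact: Lp0.
- by rewrite rmorphM /= evY mul0r.
- move=> p; rewrite rmorphD rmorphXn /= evY evU expr0n add0r ev1_comp.
  by rewrite comp_polyXr.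
Qed.

(* The substitution y -> 2y fixes y^6 and multiplies L^2 by 4. *)
Lemma CA_L2_uniq f0 f1 f2 :
  sub6 f0 + sub6 f1 * Lp ^+ 2 + sub6 f2 * Lp ^+ 4 = 0 ->
  [/\ f0 = 0, f1 = 0 & f2 = 0].
Proof.
move=> E; pose s : {rmorphism F7yu -> F7yu} := evS (2%:R * Yv) Uv.
have sf f : s (sub6 f) = sub6 f.
  rewrite /s /= ev_sub6 /sub6 exprMn -natrX (_ : 2 ^ 6 = 7 * 9 + 1)%N // natrD natrM.
  by rewrite F7yu7 mul0r add0r mul1r.
have sL : s Lp = 2%:R * Lp by rewrite /s rmorphM /= evY evU mulrA.
have sX f n : s (sub6 f * Lp ^+ n) = sub6 f * (2%:R * Lp) ^+ n.
  by rewrite rmorphM rmorphXn sf sL.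
have sc m x : s (m%:R * x) = m%:R * s x by rewrite rmorphM rmorph_nat.
have E1 : sub6 f0 + 4%:R * (sub6 f1 * Lp ^+ 2) + 16%:R * (sub6 f2 * Lp ^+ 4) = 0.
  have := congr1 s E; rewrite !rmorphD rmorph0 !sX sf => <-; ring.
have E2 : sub6 f0 + 16%:R * (sub6 f1 * Lp ^+ 2) + 256%:R * (sub6 f2 * Lp ^+ 4) = 0.
  have := congr1 s E1; rewrite !rmorphD rmorph0 !sc !sX sf => <-; ring.
move: E E1 E2; set a := sub6 f0; set b := _ * Lp ^+ 2; set c := _ * Lp ^+ 4 => E E1 E2.
have z7 (x : F7yu) : 7%:R * x = 0 by rewrite F7yu7 mul0r.
have a0 : a = 0.
  (* Modulo 7 the substitution scales the three terms by the cube roots of unity 1, 4 and 16 = 2, so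
     weighted sums of the three equations project onto each term. The factor 5 inverts 3, and the
     subtracted part collects the multiples of 7. *)
  transitivity (5%:R * ((a + b + c) + (a + 4%:R * b + 16%:R * c)
    + (a + 16%:R * b + 256%:R * c)) - 7%:R * (2%:R * a + 15%:R * b + 195%:R * c)).
    by ring.
  by rewrite E E1 E2 z7 !addr0 mulr0 subr0.
have b0 : b = 0.
  transitivity (5%:R * ((a + b + c) + 2%:R * (a + 4%:R * b + 16%:R * c)
    + 4%:R * (a + 16%:R * b + 256%:R * c)) - 7%:R * (5%:R * a + 52%:R * b + 755%:R * c)).
    by ring.
  by rewrite E E1 E2 z7 !mulr0 !addr0 mulr0 subr0.
have c0 : c = 0 by rewrite -E a0 b0 !add0r.
have cancel f n : sub6 f * Lp ^+ n = 0 -> f = 0.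
  move=> /eqP; rewrite mulf_eq0 (negPf (expf_neq0 n Lp0)) orbF => /eqP.
  exact: sub6_eq0.
by split; [exact: sub6_eq0|exact: cancel b0|exact: cancel c0].
Qed.

Lemma ev1_0 p : ev1 kX 0 p = (p.[0])%:P.
Proof.
by apply: (F7X_rmorph_eq (g := polyC \o horner_eval 0)); rewrite /= ev1X horner_evalE hornerX.
Qed.

Lemma ev1_idX p : ev1 kX 'X p = p.
Proof. by rewrite ev1_comp comp_polyXr. Qed.

Lemma root0_factor (p : {poly 'F_7}) : p.[0] = 0 -> exists q, p = q * 'X.
Proof.
elim/poly_ind: p => [|p a _]; first by exists 0; rewrite mul0r.
by rewrite hornerD hornerM hornerX mulr0 add0r hornerC => ->; exists p; rewrite addr0.
Qed.

Lemma factor_Y P : evX 0 'X P = 0 -> exists Q, P = Yv * Q.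
Proof.
elim/poly_ind: P => [|P p IH]; first by exists 0; rewrite mulr0.
rewrite rmorphD rmorphM /= evU evP ev1_0 => E.
have p0 : p.[0] = 0.
  by have := congr1 (horner^~ 0) E; rewrite hornerD hornerM hornerX mulr0 add0r hornerC horner0.
have [q ->] := root0_factor p0.
move: E; rewrite p0 addr0 => /eqP; rewrite mulf_eq0 polyX_eq0 orbF => /eqP/IH[Q ->].
by exists (Q * Uv + q%:P); rewrite polyCM mulrDr mulrA [Yv * q%:P]mulrC.
Qed.

Lemma factor_YU P : evX 'X 0 P = 0 -> evX 0 'X P = 0 -> exists Q, P = Lp * Q.
Proof.
elim/poly_ind: P => [|P p _]; first by exists 0; rewrite mulr0.
rewrite !rmorphD !rmorphM /= !evU !evP mulr0 add0r ev1_idX => ->.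
rewrite rmorph0 addr0 => /eqP; rewrite mulf_eq0 polyX_eq0 orbF => /eqP/factor_Y[Q ->].
by exists Q; rewrite polyC0 addr0 /Lp -!mulrA [Q * _]mulrC.
Qed.

Definition lin (a b c d : 'F_7) : F7yu -> F7yu :=
  evS (kS a * Yv + kS b * Uv) (kS c * Yv + kS d * Uv).
HB.instance Definition _ a b c d := GRing.RMorphism.on (lin a b c d).

Lemma linY a b c d : lin a b c d Yv = kS a * Yv + kS b * Uv.
Proof. exact: evY. Qed.
Lemma linU a b c d : lin a b c d Uv = kS c * Yv + kS d * Uv.
Proof. exact: evU. Qed.

Lemma F7_exp7 (a : 'F_7) : a ^+ 7 = a.
Proof. by move: a; apply/eqfunP; rewrite /= /FiniteQuant.quant0b; apply/pred0P => -[[|[|[|[|[|[|[|?]]]]]]] ?]. Qed.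

Lemma kS_lin7 a b (x y : F7yu) : (kS a * x + kS b * y) ^+ 7 = kS a * x ^+ 7 + kS b * y ^+ 7.
Proof. by rewrite F7yu_frob !exprMn -!rmorphXn !F7_exp7. Qed.

Definition D1p : F7yu := Yv ^+ 42 + Uv ^+ 6.

Lemma thY : th Yv = Yv. Proof. exact: evY. Qed.
Lemma thU : th Uv = Uv ^+ 7 - Yv ^+ 6 * Uv. Proof. exact: evU. Qed.

Lemma thL : th Lp = Yv * Uv ^+ 7 - Yv ^+ 7 * Uv.
Proof. rewrite rmorphM /= thY thU; ring. Qed.

Lemma thU0 : th Uv != 0.
Proof.
apply/eqP => /(congr1 (evX 0 'X)); rewrite thU !(rmorphB, rmorphXn, rmorphM) rmorph0 /= evY evU.
by rewrite expr0n mul0r subr0 => /eqP; rewrite expf_eq0 polyX_eq0.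
Qed.

Lemma thL0 : th Lp != 0.
Proof. by rewrite rmorphM mulf_neq0 ?thU0 //= thY Yv0. Qed.

(** [th Lp] is the Moore determinant y u^7 - y^7 u, and seventh powers are linear over F_7. *)
Lemma lin_thL a b c d : lin a b c d (th Lp) = kS (a * d - b * c) * th Lp.
Proof.
rewrite thL !(rmorphB, rmorphXn, rmorphM) /= linY linU !kS_lin7.
ring.
Qed.

(** Another Moore-type determinant, with 49th powers. It scales by the same factor as [th Lp], so
    the quotient [th D1p] is invariant. *)
Lemma thL_D1 : th (Lp * D1p) = Yv * Uv ^+ 49 - Yv ^+ 49 * Uv.
Proof.
have v7 : th Uv ^+ 7 = Uv ^+ 49 - Yv ^+ 42 * Uv ^+ 7.
  rewrite thU F7yu_frob; ring.
transitivity (Yv ^+ 43 * th Uv + Yv * th Uv ^+ 7).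
  rewrite /Lp /D1p !(rmorphD, rmorphXn, rmorphM) /= !thY; ring.
rewrite v7 thU; ring.
Qed.

Lemma lin_th_inv a b c d : (a * d - b * c) ^+ 2 = 1 ->
  lin a b c d (th (Lp ^+ 2)) = th (Lp ^+ 2) /\ lin a b c d (th D1p) = th D1p.
Proof.
move=> det2; split.
  by rewrite rmorphXn rmorphXn /= lin_thL exprMn -rmorphXn det2 rmorph1 mul1r.
have det0 : kS (a * d - b * c) != 0.
  rewrite !polyC_eq0; apply: contra_eqN det2 => /eqP ->.
  by rewrite expr0n eq_sym oner_eq0.
have E7 x : x ^+ 49 = (x ^+ 7) ^+ 7 :> F7yu by rewrite -exprM.
have E : lin a b c d (th (Lp * D1p)) = kS (a * d - b * c) * th (Lp * D1p).
  rewrite thL_D1 !(rmorphB, rmorphXn, rmorphM) /= linY linU !E7 !kS_lin7.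
  ring.
move: E; rewrite rmorphM rmorphM /= lin_thL -mulrA => /(mulfI det0)/(mulfI thL0).
by [].
Qed.

(** Only the swap of y and u is tested: polynomials in y and v are already fixed by the shifts of u
    by multiples of y. *)
Definition sym P := lin 0 1 1 0 (th P) = th P.

Lemma symD P Q : sym P -> sym Q -> sym (P + Q).
Proof. by rewrite /sym !rmorphD /= => -> ->. Qed.
Lemma symN P : sym P -> sym (- P).
Proof. by rewrite /sym !rmorphN /= => ->. Qed.
Let det01 : (0 * 0 - 1 * 1) ^+ 2 = 1 :> 'F_7. Proof. exact: val_inj. Qed.
Lemma symL2 : sym (Lp ^+ 2). Proof. exact: (lin_th_inv det01).1. Qed.
Lemma sym_div Q P : sym Q -> th Q != 0 -> sym (Q * P) -> sym P.
Proof. by rewrite /sym !rmorphM /= => -> Q0 /(mulfI Q0). Qed.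
Lemma sym_divL2 P : sym (Lp ^+ 2 * P) -> sym P.
Proof. by apply: sym_div symL2 _; rewrite rmorphXn expf_neq0 // thL0. Qed.

Lemma sub6_dic P : sub6 (dic P) = evS D1p (Lp ^+ 6) P.
Proof.
rewrite /dic (rmorph_ev kS kS) rmorphM rmorphD rmorphXn /= /sub6 evY evU -exprM.
by rewrite -exprMn.
Qed.

Lemma fix_ev (f : {rmorphism F7yu -> F7yu}) x y P : f x = x -> f y = y ->
  f (evS x y P) = evS x y P.
Proof. by move=> fx fy; rewrite (rmorph_ev kS kS) fx fy. Qed.

Lemma lin_dic a b c d P : (a * d - b * c) ^+ 2 = 1 ->
  lin a b c d (th (sub6 (dic P))) = th (sub6 (dic P)).
Proof.
move=> det2; have [h1 h2] := lin_th_inv det2; rewrite sub6_dic.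
have -> : th (evS D1p (Lp ^+ 6) P) = evS (th D1p) (th (Lp ^+ 6)) P.
  exact: (rmorph_ev kS kS th).
apply: (fix_ev (f := lin a b c d)) => //.
have -> : Lp ^+ 6 = (Lp ^+ 2) ^+ 3 by rewrite -exprM.
by rewrite [th _]rmorphXn [LHS]rmorphXn /= h1.
Qed.

Lemma sym_dic P : sym (sub6 (dic P)).
Proof. exact: (lin_dic _ det01). Qed.

(** Setting u = 0 kills v, setting y = 0 turns v into u^7, and the swap exchanges the two
    specializations. *)
Lemma sym_ends P : sym P -> evX 'X 0 P = evX 0 ('X ^+ 7) P.
Proof.
move=> /(congr1 (evX 'X 0)).
have -> : evX 'X 0 (th P) = evX 'X 0 P.
  rewrite /th (rmorph_ev kS kX) !(rmorphB, rmorphXn, rmorphM) /= evY evU.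
  by rewrite expr0n mulr0 subr0.
move=> <-; rewrite /lin (rmorph_ev kS kX) !(rmorphD, rmorphM) /= evY evU !evC.
rewrite rmorph0 rmorph1 !mulr0 !addr0 mul0r mul1r /th (rmorph_ev kS kX).
rewrite !(rmorphB, rmorphXn, rmorphM) /= evY evU.
by rewrite expr0n mul0r subr0.
Qed.

Lemma size_ev0X P : (size (evX 0 'X P) <= size P)%N.
Proof.
have -> : evX 0 'X P = map_poly (horner_eval 0) P; last exact: size_poly.
apply: (F7yu_rmorph_eq (g := map_poly (horner_eval 0))) => /=.
  by rewrite evY map_polyC /= horner_evalE hornerX.
by rewrite evU map_polyX.
Qed.

Lemma size_ev_D1p (h : {poly 'F_7}) :
  (size (ev1 kS D1p h) <= size (h \Po 'X ^+ 6))%N.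
Proof.
have -> : ev1 kS D1p h = map_poly polyC h \Po D1p.
  apply: (F7X_rmorph_eq (g := comp_poly D1p \o map_poly polyC)) => /=.
  by rewrite ev1X map_polyX comp_polyX.
have [->|h0] := eqVneq h 0; first by rewrite map_poly0 !comp_poly0 size_poly0.
apply: leq_trans (size_comp_poly_leq _ _) _.
have -> : size D1p = 7.
  have Y42 : (size (Yv ^+ 42) <= 1)%N by rewrite -polyC_exp size_polyC leq_b1.
  by rewrite /D1p addrC size_polyDl size_polyXn // (leq_ltn_trans Y42).
rewrite size_map_polyC.
have := size_comp_poly h ('X ^+ 6); rewrite size_polyXn /= => <-.
rewrite prednK // size_poly_gt0; apply: contraNneq h0 => E.
by apply/eqP/(@comp_Xn_inj 5); rewrite E comp_poly0.
Qed.

(** Induction on the degree in v. By [sym_ends], f0 agrees on both axes with a polynomial h in D1,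
    so the difference is divisible by C V, which [sub6] sends to L^6. Dividing P - h(D1) by L^2
    gives an expression of the same shape and smaller degree, with coefficients f1, f2 and the
    quotient f'. *)
Lemma dickson n f0 f1 f2 :
  let P := sub6 f0 + sub6 f1 * Lp ^+ 2 + sub6 f2 * Lp ^+ 4 in
  (size P <= n)%N -> sym P ->
  exists g0 g1 g2, [/\ f0 = dic g0, f1 = dic g1 & f2 = dic g2].
Proof.
elim: n f0 f1 f2 => [|n IH] f0 f1 f2 P.
  rewrite leqn0 size_poly_eq0 => /eqP/CA_L2_uniq[-> -> ->] _.
  by exists 0, 0, 0; rewrite rmorph0.
move=> sP symP; pose h := evX 0 'X f0.
have evP0 x y : x * y = 0 -> evX x y P = evX (x ^+ 6) (y ^+ 6) f0.
  move=> xy; have eL : evX x y Lp = 0 by rewrite rmorphM /= evY evU.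
  rewrite /P !rmorphD (rmorphM _ (sub6 f1)) (rmorphM _ (sub6 f2)) !rmorphXn /= eL.
  by rewrite ev_sub6 !expr0n !mulr0 !addr0.
have hE : evX 'X 0 f0 = ev1 kX ('X ^+ 7) h.
  apply: (@comp_Xn_inj 5); rewrite -!ev1_comp /h.
  rewrite !(rmorph_ev kX kX) !(rmorph_ev1 kX kX) !rmorph0 !rmorphXn /= !ev1X.
  by have := sym_ends symP; rewrite !evP0 ?mulr0 ?mul0r // !expr0n /= -!exprM.
have [||f' Ef'] := @factor_YU (f0 - dic (ev1 kS Yv h)).
- rewrite rmorphB /= hE ev_dic (rmorph_ev1 kS kX) /= evY addr0.
  by rewrite subrr.
- rewrite rmorphB /= ev_dic (rmorph_ev1 kS kX) /= evY expr0n add0r ev1_idX.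
  by rewrite subrr.
have Ef0 : f0 = dic (ev1 kS Yv h) + Lp * f' by rewrite -Ef' addrC subrK.
have E : P = sub6 (dic (ev1 kS Yv h)) + Lp ^+ 2 * (sub6 f1 + sub6 f2 * Lp ^+ 2 + sub6 f' * Lp ^+ 4).
  rewrite /P Ef0 rmorphD rmorphM /= /Lp rmorphM /= /sub6 evY evU; ring.
set P' := _ + _ * Lp ^+ 4 in E.
have sP' : sym P'.
  apply: sym_divL2; rewrite -[X in sym X](addKr (sub6 (dic (ev1 kS Yv h)))) -E.
  by apply: symD => //; apply: symN; apply: sym_dic.
have szP' : (size P' <= n)%N.
  have : (size (Lp ^+ 2 * P')%R <= n.+1)%N.
    rewrite -(addKr (sub6 (dic (ev1 kS Yv h))) (Lp ^+ 2 * P')) -E addrC.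
    apply: leq_trans (size_polyD _ _) _; rewrite size_polyN geq_max sP /=.
    apply: leq_trans sP; apply: leq_trans (size_ev0X P).
    rewrite evP0 ?mul0r // expr0n /=.
    have -> : evX 0 ('X ^+ 6) f0 = h \Po 'X ^+ 6.
      by rewrite -ev1_comp /h (rmorph_ev kX kX) rmorph0 /= ev1X.
    rewrite sub6_dic (rmorph_ev1 kS kS) /= evY; exact: size_ev_D1p.
  have [P0|P0] := eqVneq P' 0; first by rewrite P0 size_poly0.
  clearbody P'; rewrite size_mul // ?expf_neq0 ?Lp0 // /Lp exprMn -polyC_exp mul_polyC.
  rewrite size_scale ?expf_neq0 ?polyX_eq0 // size_polyXn /= => h3.
  exact: (ltnW h3).
have [g1 [g2 [g' [E1 E2 E']]]] := IH f1 f2 f' szP' sP'.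
exists (ev1 kS Yv h + Uv * g'), g1, g2; split=> //.
by rewrite Ef0 E' rmorphD rmorphM /= /dic evU.
Qed.

End TwoVariables.

(** * The ring HBE and its restrictions to the subgroups of rank two *)

Lemma mpoly_rmorph_eq n (T : comNzRingType) (f g : {rmorphism {mpoly 'F_7[n]} -> T}) :
  (forall i, f 'X_i = g 'X_i) -> f =1 g.
Proof.
move=> EX p; rewrite [p]mpolyE !rmorph_sum; apply: eq_bigr => m _.
rewrite -mul_mpolyC !rmorphM /= mpolyXE_id !rmorph_prod.
congr (_ * _).
  exact: (F7_rmorph_eq (f \o @mpolyC n _) (g \o @mpolyC n _) p@_m).
by apply: eq_bigr => i _; rewrite !rmorphXn /= EX.
Qed.

HB.instance Definition _ := GRing.RMorphism.copy cl (\pi_({ideal_quot HBE_ideal})%qT).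
HB.instance Definition _ := GRing.RMorphism.copy cst (cl \o @mpolyC 4 _).
HB.instance Definition _ k s := GRing.RMorphism.copy (@evalHBE k s) (mmap cst (tnth s)).

Lemma cl_surj r : exists q, r = cl q.
Proof. by exists (generic_quotient.repr r); rewrite /cl generic_quotient.reprK. Qed.

Lemma HBE_rmorph_eq (T : comNzRingType) (f g : {rmorphism HBE -> T}) :
  f y1 = g y1 -> f y2 = g y2 -> f C = g C -> f v = g v -> f =1 g.
Proof.
move=> E1 E2 E3 E4 r; have [q ->] := cl_surj r.
apply: (mpoly_rmorph_eq (f := f \o cl) (g := g \o cl)) => i.
by case: i => -[|[|[|[|//]]]] lti; [move: E1|move: E2|move: E3|move: E4];
  rewrite /y1 /y2 /C /v (_ : inord _ = Ordinal lti) //; apply: val_inj; rewrite /= inordK.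
Qed.

Definition HBE_sat (T : comNzRingType) (x1 x2 xC : T) :=
  [/\ x1 ^+ 7 * x2 = x1 * x2 ^+ 7, xC * x1 = x1 ^+ 7,
  xC * x2 = x2 ^+ 7 & xC ^+ 2 = x1 ^+ 12 + x2 ^+ 12 - x1 ^+ 6 * x2 ^+ 6].

(* Over an abstract ring, where unification does not unfold the products of
   multivariate polynomials. *)
Lemma rmorph_sat (R T : comNzRingType) (f : {rmorphism R -> T}) p1 p2 p3 :
  HBE_sat (f p1) (f p2) (f p3) <-> [/\ f (p1 ^+ 7 * p2 - p1 * p2 ^+ 7) = 0,
    f (p3 * p1 - p1 ^+ 7) = 0, f (p3 * p2 - p2 ^+ 7) = 0
  & f (p3 ^+ 2 - (p1 ^+ 12 + p2 ^+ 12 - p1 ^+ 6 * p2 ^+ 6)) = 0].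
Proof.
have E p q : f (p - q) = 0 <-> f p = f q.
  by rewrite rmorphB; split=> [/eqP|->]; [rewrite subr_eq0 => /eqP|rewrite subrr].
split=> [[s1 s2 s3 s4]|[]].
  by split; apply/E; rewrite !(rmorphB, rmorphD, rmorphXn, rmorphM).
move=> /E s1 /E s2 /E s3 /E s4.
by split; [move: s1|move: s2|move: s3|move: s4]; rewrite !(rmorphB, rmorphD, rmorphXn, rmorphM).
Qed.

Lemma HBE_rel_sat (T : comNzRingType) (f : {rmorphism {mpoly 'F_7[4]} -> T}) i :
  HBE_sat (f 'X_(inord 0)) (f 'X_(inord 1)) (f 'X_(inord 2)) -> f (HBE_rel i) = 0.
Proof.
case: i => [[|[|[|[|//]]]] lti] /rmorph_sat[r0 r1 r2 r3]; rewrite /HBE_rel; cbn [nth nat_of_ord].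
- exact: r0.
- exact: r1.
- exact: r2.
- exact: r3.
Qed.

Section Lift.
Variables (T : comNzRingType) (k : {rmorphism 'F_7 -> T}) (x1 x2 xC xv : T).
Hypothesis sat : HBE_sat x1 x2 xC.

Let m := mmap k (tnth [tuple x1; x2; xC; xv]).

Let mX i lti : m 'X_(inord i) = tnth [tuple x1; x2; xC; xv] (@Ordinal 4 i lti).
Proof.
rewrite /m mmapX mmap1U; congr tnth; apply: val_inj.
by rewrite /= inordK.
Qed.

Let m1 : m 'X_(inord 0) = x1. Proof. exact: (@mX 0 isT). Qed.
Let m2 : m 'X_(inord 1) = x2. Proof. exact: (@mX 1 isT). Qed.
Let mC : m 'X_(inord 2) = xC. Proof. exact: (@mX 2 isT). Qed.
Let mv : m 'X_(inord 3) = xv. Proof. exact: (@mX 3 isT). Qed.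

Let m_rel i : m (HBE_rel i) = 0.
Proof. 
have : HBE_sat (m 'X_(inord 0)) (m 'X_(inord 1)) (m 'X_(inord 2)) by rewrite m1 m2 mC.
exact: (HBE_rel_sat (f := mmap k (tnth [tuple x1; x2; xC; xv]))).
Qed.

Let m_ideal q : q \in HBE_ideal -> m q = 0.
Proof.
move/asboolP => [l ->]; rewrite /m rmorph_sum big1 // => i _.
by transitivity (m (l i) * m (HBE_rel i)); [exact: rmorphM|rewrite m_rel mulr0].
Qed.

Definition hlift (_ : HBE_sat x1 x2 xC) (r : HBE) : T := m (generic_quotient.repr r).

Lemma hlift_cl q : hlift sat (cl q) = mmap k (tnth [tuple x1; x2; xC; xv]) q.
Proof.
apply/eqP; rewrite -subr_eq0 /hlift -[_ - _](rmorphB m); apply/eqP/m_ideal.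
by rewrite (Quotient.idealrBE HBE_ideal) generic_quotient.reprK.
Qed.

Fact hlift_is_zmod_morphism : zmod_morphism (hlift sat).
Proof.
move=> r s; have [p ->] := cl_surj r; have [q ->] := cl_surj s.
by rewrite -rmorphB !hlift_cl rmorphB.
Qed.
Fact hlift_is_monoid_morphism : monoid_morphism (hlift sat).
Proof.
split; first by rewrite -(rmorph1 cl) hlift_cl rmorph1.
move=> r s; have [p ->] := cl_surj r; have [q ->] := cl_surj s.
by rewrite -rmorphM !hlift_cl rmorphM.
Qed.
HB.instance Definition _ :=
  GRing.isZmodMorphism.Build HBE T (hlift sat) hlift_is_zmod_morphism.
HB.instance Definition _ :=
  GRing.isMonoidMorphism.Build HBE T (hlift sat) hlift_is_monoid_morphism.

Lemma hlift_y1 : hlift sat y1 = x1. Proof. exact: etrans (hlift_cl _) m1. Qed.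
Lemma hlift_y2 : hlift sat y2 = x2. Proof. exact: etrans (hlift_cl _) m2. Qed.
Lemma hlift_C : hlift sat C = xC. Proof. exact: etrans (hlift_cl _) mC. Qed.
Lemma hlift_v : hlift sat v = xv. Proof. exact: etrans (hlift_cl _) mv. Qed.
End Lift.

Lemma HBE_relE : HBE_sat y1 y2 C.
Proof.
have rel i : cl (HBE_rel i) = 0.
  apply/eqP; rewrite -(rmorph0 cl) -Quotient.idealrBE subr0; apply/asboolP.
  exists (fun j => (j == i)%:R); rewrite (bigD1 i) //= eqxx mul1r big1 ?addr0 // => j /negPf ->.
  by rewrite mul0r.
apply/rmorph_sat; split.
- exact: (rel (@Ordinal 4 0 isT)).
- exact: (rel (@Ordinal 4 1 isT)).
- exact: (rel (@Ordinal 4 2 isT)).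
- exact: (rel (@Ordinal 4 3 isT)).
Qed.

Lemma prod4 (T : comNzRingType) (F : 'I_4 -> T) :
  \prod_i F i = F (inord 0) * F (inord 1) * F (inord 2) * F (inord 3).
Proof.
rewrite !big_ord_recl big_ord0 mulr1 !mulrA.
by congr (F _ * F _ * F _ * F _); apply: val_inj; rewrite /= inordK.
Qed.

Lemma HBE_ind (P : HBE -> Prop) : P 0 -> (forall r s, P r -> P s -> P (r + s)) ->
  (forall a i j k l, P (cst a * v ^+ l * (y1 ^+ i * y2 ^+ j * C ^+ k))) ->
  forall r, P r.
Proof.
move=> P0 PD PX r; have [q ->] := cl_surj r.
rewrite [q]mpolyE rmorph_sum; apply: (big_ind P) => // m _.
rewrite -mul_mpolyC rmorphM /= -/(cst _) mpolyXE_id; set p0 := mcoeff _ _.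
rewrite prod4 !rmorphM !rmorphXn /= -/y1 -/y2 -/C -/v.
have -> : cst p0 * (y1 ^+ m (inord 0) * y2 ^+ m (inord 1) * C ^+ m (inord 2) * v ^+ m (inord 3)) =
  cst p0 * v ^+ m (inord 3) * (y1 ^+ m (inord 0) * y2 ^+ m (inord 1) * C ^+ m (inord 2)) by ring.
exact: PX.
Qed.

Section Restriction.
Local Open Scope ring_scope.
Notation evS := (ev kS).

(** The values of y1 and y2 on a_i, a point (1 : k) or (0 : 1) of the projective line. *)
Definition pt1 (i : option 'F_7) : 'F_7 := if i is Some _ then 1 else 0.
Definition pt2 (i : option 'F_7) : 'F_7 := if i is Some k then k else 1.

Lemma line_sat (T : comNzRingType) (a b y : T) : a ^+ 7 = a -> b ^+ 7 = b ->
  a = 1 \/ a = 0 /\ b = 1 -> HBE_sat (a * y) (b * y) (y ^+ 6).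
Proof.
move=> a7 b7 ab; split; rewrite !exprMn ?a7 ?b7; try by ring.
rewrite (exprD b 7 5) b7 -exprS; case: ab => [->|[-> ->]].
  by rewrite !expr1n; ring.
by rewrite !expr1n !expr0n /=; ring.
Qed.

Lemma pt_sat i : HBE_sat (kS (pt1 i) * Yv) (kS (pt2 i) * Yv) (Yv ^+ 6).
Proof.
have k7 a : kS a ^+ 7 = kS a by rewrite -rmorphXn F7_exp7.
by apply: line_sat => //; case: i => [k|]; [left|right]; rewrite ?rmorph0 ?rmorph1.
Qed.

(** Restriction to A_i with v kept as a free variable; [th] later substitutes u^7 - y^6 u for it. *)
Definition psi i : HBE -> F7yu := hlift kS Uv (pt_sat i).
HB.instance Definition _ i := GRing.RMorphism.on (psi i).

Lemma psi_y1 i : psi i y1 = kS (pt1 i) * Yv. Proof. exact: hlift_y1. Qed.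
Lemma psi_y2 i : psi i y2 = kS (pt2 i) * Yv. Proof. exact: hlift_y2. Qed.
Lemma psi_C i : psi i C = Yv ^+ 6. Proof. exact: hlift_C. Qed.
Lemma psi_v i : psi i v = Uv. Proof. exact: hlift_v. Qed.

(** Normal form: the first relation bounds by 6 the degree in y2 of monomials divisible by y1. C
    survives only next to powers of v, because C y_i = y_i^7 and C^2 is a polynomial in y1 and
    y2. *)
Definition nf (r : HBE) : Prop := exists (al : nat -> F7yu) (be : F7yu) (ga : {poly 'F_7}),
  r = \sum_(j < 7) y2 ^+ j * ev cst y1 v (al j) + y2 ^+ 7 * ev cst y2 v be
      + C * ev1 cst v ga.

Lemma nfD r s : nf r -> nf s -> nf (r + s).
Proof.
case=> al [be [ga ->]] [al' [be' [ga' ->]]].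
exists (fun j => al j + al' j), (be + be'), (ga + ga'); rewrite !rmorphD /=.
under [X in _ = X + _ + _]eq_bigr => j _ do rewrite rmorphD mulrDr.
rewrite big_split /=; ring.
Qed.

Lemma nf0 : nf 0.
Proof.
exists (fun=> 0), 0, 0; rewrite !rmorph0 !mulr0 !addr0 big1 // => j _.
by rewrite ?rmorph0 mulr0.
Qed.

Lemma nfN r : nf r -> nf (- r).
Proof.
case=> al [be [ga ->]]; exists (fun j => - al j), (- be), (- ga); rewrite !rmorphN /=.
under [X in _ = X + _ + _]eq_bigr => j _ do rewrite rmorphN mulrN.
rewrite sumrN; ring.
Qed.

Lemma y12_shift i j : y1 ^+ i.+1 * y2 ^+ j.+4.+3 = y1 ^+ (i + 7) * y2 ^+ j.+1.
Proof.
case: HBE_relE => e _ _ _; move: y1 y2 e => x1 x2 e.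
rewrite -[j.+4.+3]/(7 + j)%N !exprD !exprS.
transitivity (x1 ^+ i * x2 ^+ j * (x1 * x2 ^+ 7)); first by ring.
by rewrite -e; ring.
Qed.

Section Monomials.
Variables (a : 'F_7) (l : nat).
Let g := cst a * v ^+ l.

Let gE x : g = ev cst x v (a%:P%:P * Uv ^+ l).
Proof. by rewrite rmorphM rmorphXn /= evC evU. Qed.

Let nf_mon0 j i : nf (g * (y1 ^+ i * y2 ^+ j)).
Proof.
elim/ltn_ind: j i => j IH i; case: (ltnP j 7) => j7.
  exists (fun n => if n == j then a%:P%:P * Uv ^+ l * Yv ^+ i else 0), 0, 0.
  rewrite !rmorph0 !mulr0 !addr0 (bigD1 (Ordinal j7)) //= eqxx big1 ?addr0.
    by rewrite (rmorphM (ev cst y1 v)) /= -gE rmorphXn /= evY [RHS]mulrCA [y2 ^+ j * _]mulrC.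
  by move=> n; rewrite -val_eqE /= => /negPf ->; rewrite rmorph0 mulr0.
case: i => [|i].
  exists (fun=> 0), (a%:P%:P * Uv ^+ l * Yv ^+ (j - 7)), 0.
  rewrite !rmorph0 mulr0 addr0 big1 ?add0r; last by move=> n _; rewrite ?rmorph0 mulr0.
  rewrite (rmorphM (ev cst y2 v)) /= -gE rmorphXn /= evY [RHS]mulrCA -exprD addnC subnK // expr0 mul1r.
  by [].
have -> : j = (j - 7).+4.+3 by lia.
by rewrite y12_shift; apply: IH; lia.
Qed.

Lemma nf_mon k i j : nf (g * (y1 ^+ i * y2 ^+ j * C ^+ k)).
Proof.
elim/ltn_ind: k i j => k IH i j; case: HBE_relE => _ e1 e2 eC.
case: k IH => [|k] IH; first by rewrite mulr1.
case: i => [|i]; last first.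
  have -> : y1 ^+ i.+1 * y2 ^+ j * C ^+ k.+1 = y1 ^+ (i + 7) * y2 ^+ j * C ^+ k.
    by rewrite exprD -e1 !exprS; ring.
  exact: IH.
case: j => [|j]; last first.
  have -> : y1 ^+ 0 * y2 ^+ j.+1 * C ^+ k.+1 = y1 ^+ 0 * y2 ^+ (j + 7) * C ^+ k.
    by rewrite exprD -e2 !exprS; ring.
  exact: IH.
case: k IH => [|k] IH.
  exists (fun=> 0), 0, (a%:P * 'X ^+ l).
  rewrite !rmorph0 !mulr0 !addr0 big1 ?add0r; last by move=> n _; rewrite ?rmorph0 mulr0.
  by rewrite rmorphM rmorphXn /= ev1C ev1X !mul1r mulrC.
have -> : g * (y1 ^+ 0 * y2 ^+ 0 * C ^+ k.+2) =
    g * (y1 ^+ 12 * y2 ^+ 0 * C ^+ k) + g * (y1 ^+ 0 * y2 ^+ 12 * C ^+ k)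
    - g * (y1 ^+ 6 * y2 ^+ 6 * C ^+ k).
  by rewrite -addn2 exprD eC; ring.
by apply: nfD; [apply: nfD|apply: nfN]; apply: IH.
Qed.
End Monomials.

Lemma nfP r : nf r.
Proof. by move: r; apply: HBE_ind; [exact: nf0|exact: nfD|move=> *; exact: nf_mon]. Qed.

Lemma vandermonde7 (c : nat -> F7yu) :
  (forall k : 'F_7, \sum_(j < 7) kS k ^+ j * c j = 0) -> forall j, (j < 7)%N -> c j = 0.
Proof.
move=> E j j7; pose G := \poly_(j < 7) c j.
have G0 : G = 0.
  apply/eqP/negPn/negP => nG; have := @max_poly_roots _ G [seq kS k | k <- enum 'F_7] nG.
  have -> : all (root G) [seq kS k | k <- enum 'F_7].
    apply/allP => _ /mapP[k _ ->]; apply/rootP; rewrite horner_poly -[RHS](E k).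
    by apply: eq_bigr => i _; rewrite mulrC.
  rewrite map_inj_uniq ?enum_uniq; last by move=> x y /polyC_inj/polyC_inj.
  rewrite size_map -cardE card_ord => /(_ isT isT).
  by rewrite ltnNge size_poly.
by rewrite -[RHS](coef0 _ j) -G0 coef_poly j7.
Qed.
(** A_inf kills y1 and shows that the y2^7 part is 0; there C and y2^6 have the same restriction.
    The seven A_k give a Vandermonde system in k that separates the powers of y2, and with the y2^6
    part gone the C part vanishes too. *)
Lemma psi_inj r : (forall i, psi i r = 0) -> r = 0.
Proof.
have [al [be [ga Er]]] := nfP r; move=> psi0.
have psiE i : psi i r = \sum_(j < 7) (kS (pt2 i) * Yv) ^+ j * evS (kS (pt1 i) * Yv) Uv (al j)
    + (kS (pt2 i) * Yv) ^+ 7 * evS (kS (pt2 i) * Yv) Uv be + Yv ^+ 6 * ev1 kS Uv ga.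
  have hX x n : psi i (x ^+ n) = psi i x ^+ n by rewrite rmorphXn.
  have hM x y : psi i (x * y) = psi i x * psi i y by rewrite rmorphM.
  have hev x P : psi i (ev cst x v P) = evS (psi i x) Uv P.
    by rewrite (rmorph_ev cst kS) /= psi_v.
  rewrite Er !rmorphD rmorph_sum /=; congr (_ + _ + _).
  - by apply: eq_bigr => j _; rewrite hM hX psi_y2 hev psi_y1.
  - by rewrite hM hX psi_y2 hev psi_y2.
  - by rewrite hM psi_C (rmorph_ev1 cst kS) /= psi_v.
pose d j := ev kX 0 'X (al j); pose B := evS Uv Yv be.
have E0 : \sum_(j < 7) Uv ^+ j * (d j)%:P + Uv ^+ 7 * B + Uv ^+ 6 * ga%:P = 0.
  have cE P : evS 0 Yv P = (ev kX 0 'X P)%:P.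
    by rewrite (rmorph_ev kX kS polyC) /= polyC0.
  have c1 p : ev1 kS Yv p = p%:P.
    by apply: (F7X_rmorph_eq (g := polyC)); rewrite /= ev1X.
  have := psi0 None; rewrite psiE /pt1 /pt2 kS_0 kS_1 mul0r mul1r.
  move=> /(congr1 (evS Uv Yv)); rewrite rmorph0 => E1; rewrite -[RHS]E1.
  have hM x y : evS Uv Yv (x * y) = evS Uv Yv x * evS Uv Yv y by rewrite rmorphM.
  have hX n : evS Uv Yv (Yv ^+ n) = Uv ^+ n by rewrite rmorphXn /= evY.
  rewrite !rmorphD rmorph_sum /=; congr (_ + _ + _).
  - apply: eq_bigr => j _; rewrite hM hX (rmorph_ev kS kS) rmorph0 /= evU.
    by rewrite cE.
  - by rewrite hM hX (rmorph_ev kS kS) /= evY evU.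
  - by rewrite hM hX (rmorph_ev1 kS kS) /= evU c1.
have be0 : be = 0.
  have B0 : B = 0.
    apply/polyP => n.
    have h6 : (n + 7 < 6)%N = false by apply/negbTE; lia.
    have h60 : (n + 7 - 6 == 0)%N = false by apply/negbTE; lia.
    have := congr1 (fun P : F7yu => P`_(n + 7)) E0.
    rewrite !coefD coef_sum !coefXnM !coef0 addnK [(n + 7 < 7)%N]ltnNge leq_addl /=.
    rewrite big1 ?add0r => [|j _]; last first.
      rewrite coefMC coefXn (_ : (n + 7 == j)%N = false) ?mul0r //.
      by apply/negbTE; move: (ltn_ord j); lia.
    by rewrite h6 coefC h60 addr0.
  have := congr1 (evS Uv Yv) B0; rewrite /B (rmorph_ev kS kS) rmorph0 /= evY evU.
  by rewrite ev_id.
have c6 : d 6 + ga = 0.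
  have := congr1 (fun P : F7yu => P`_6) E0.
  rewrite !coefD coef_sum !coefXnM !coef0 /= coefC /= addr0 => E1; rewrite -[RHS]E1; congr (_ + _).
  rewrite (bigD1 (@Ordinal 7 6 isT)) //= coefMC coefXn /= mul1r big1 ?addr0 // => j.
  rewrite -val_eqE /= => nj; rewrite coefMC coefXn eq_sym (negPf nj) mul0r //.
have {}E j : (j < 7)%N -> Yv ^+ j * al j + (if j == 0 then Yv ^+ 6 * ev1 kS Uv ga else 0) = 0.
  apply: (vandermonde7 (c := fun j => _)) => k.
  have := psi0 (Some k); rewrite psiE /pt1 /pt2 be0 rmorph0 mulr0 addr0 kS_1 mul1r => E1; rewrite -[RHS]E1.
  under eq_bigr => i _ do rewrite mulrDr.
  rewrite big_split /=; congr (_ + _).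
    by apply: eq_bigr => i _; rewrite ev_id exprMn mulrA.
  rewrite (bigD1 (@Ordinal 7 0 isT)) //= expr0 mul1r big1 ?addr0 // => i.
  by rewrite -val_eqE /= => /negPf ->; rewrite mulr0.
have al0 j : (0 < j < 7)%N -> al j = 0.
  case/andP=> j0 /E; rewrite eqn0Ngt j0 addr0 => /eqP.
  by rewrite mulf_eq0 (negPf (expf_neq0 _ Yv0)) => /eqP.
have ga0 : ga = 0 by rewrite -[RHS]c6 /d al0 // rmorph0 add0r.
have al00 : al 0 = 0.
  by have := E 0 isT; rewrite ga0 rmorph0 mulr0 addr0 expr0 mul1r.
rewrite Er be0 ga0 !rmorph0 !mulr0 !addr0 big1 // => j _.
case: (posnP j) => [->|j0]; first by rewrite al00 rmorph0 mulr0.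
by rewrite al0 ?rmorph0 ?mulr0 // j0 ltn_ord.
Qed.

Lemma psi_eq r s : (forall i, psi i r = psi i s) -> r = s.
Proof.
move=> E; apply/eqP; rewrite -subr_eq0; apply/eqP/psi_inj => i.
by rewrite rmorphB /= E subrr.
Qed.
End Restriction.

(** * Monomial matrices acting on HBE *)

Section MonomialAction.

Lemma diag_sat (l m : 'F_7) : l ^+ 6 = 1 -> m ^+ 6 = 1 ->
  HBE_sat (cst l * y1) (cst m * y2) C.
Proof.
move=> l6 m6; case: HBE_relE => e0 e1 e2 eC.
have k6 a : a ^+ 6 = 1 -> cst a ^+ 6 = 1 by move=> a6; rewrite -rmorphXn a6 rmorph1.
have := k6 _ l6; have := k6 _ m6; move: (cst l) (cst m) => {l m l6 m6 k6} m l m6 l6.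
have E7 a : a ^+ 6 = 1 -> a ^+ 7 = a :> HBE by move=> a6; rewrite exprS a6 mulr1.
have E12 a : a ^+ 6 = 1 -> a ^+ 12 = 1 :> HBE by move=> a6; rewrite (exprM a 6 2) a6 expr1n.
split; rewrite !exprMn ?(E7 l) ?(E7 m) ?(E12 l) ?(E12 m) ?l6 ?m6 ?mul1r //.
- by rewrite mulrACA e0 mulrACA.
- by rewrite mulrCA e1.
- by rewrite mulrCA e2.
Qed.

Lemma swap_sat : HBE_sat y2 y1 C.
Proof.
case: HBE_relE => e0 e1 e2 eC; split=> //; first by rewrite mulrC -e0 mulrC.
by rewrite eC [y2 ^+ 12 + _]addrC [y2 ^+ 6 * _]mulrC.
Qed.

Variables (l m : 'F_7) (l6 : l ^+ 6 = 1) (m6 : m ^+ 6 = 1).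
Definition gd : HBE -> HBE :=
  hlift cst (cst (l * m) * v) (diag_sat l6 m6).
HB.instance Definition _ := GRing.RMorphism.on gd.
(** The sign at v is the determinant of the swap. *)
Definition gs : HBE -> HBE := hlift cst (- v) swap_sat.
HB.instance Definition _ := GRing.RMorphism.on gs.

Lemma gd_y1 : gd y1 = cst l * y1. Proof. exact: hlift_y1. Qed.
Lemma gd_y2 : gd y2 = cst m * y2. Proof. exact: hlift_y2. Qed.
Lemma gd_C : gd C = C. Proof. exact: hlift_C. Qed.
Lemma gd_v : gd v = cst (l * m) * v. Proof. exact: hlift_v. Qed.
Lemma gs_y1 : gs y1 = y2. Proof. exact: hlift_y1. Qed.
Lemma gs_y2 : gs y2 = y1. Proof. exact: hlift_y2. Qed.
Lemma gs_C : gs C = C. Proof. exact: hlift_C. Qed.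
Lemma gs_v : gs v = - v. Proof. exact: hlift_v. Qed.

Lemma gstar_diag q : evalHBE (gstar (diag2 l m)) q = gd (cl q).
Proof.
apply: (mpoly_rmorph_eq (f := evalHBE _) (g := gd \o cl)) => i.
rewrite /= /evalHBE mmapX mmap1U.
have -> : cl 'X_i = tnth [tuple y1; y2; C; v] i.
  case: i => -[|[|[|[|//]]]] lti; rewrite /tnth /= /y1 /y2 /C /v;
  by congr (cl 'X__); apply: val_inj; rewrite /= inordK.
case: i => -[|[|[|[|//]]]] lti; rewrite /tnth /= ?diag2E ?mxE /= ?det_mx2.
- by rewrite gd_y1 rmorph0 mul0r addr0.
- by rewrite gd_y2 rmorph0 mul0r add0r.
- by rewrite gd_C.
- by rewrite gd_v mulr0 subr0.
Qed.

Lemma gstar_anti q : evalHBE (gstar (anti2 l m)) q = gs (gd (cl q)).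
Proof.
apply: (mpoly_rmorph_eq (f := evalHBE _) (g := gs \o (gd \o cl))) => i.
rewrite /= /evalHBE mmapX mmap1U.
have -> : cl 'X_i = tnth [tuple y1; y2; C; v] i.
  case: i => -[|[|[|[|//]]]] lti; rewrite /tnth /= /y1 /y2 /C /v;
  by congr (cl 'X__); apply: val_inj; rewrite /= inordK.
have hc a : gs (cst a) = cst a by exact: (F7_rmorph_eq (gs \o cst)).
case: i => -[|[|[|[|//]]]] lti; rewrite /tnth /= /anti2 ?mxE /= ?det_mx2.
- by rewrite gd_y1 rmorphM /= hc gs_y1 rmorph0 mul0r add0r.
- by rewrite gd_y2 rmorphM /= hc gs_y2 rmorph0 mul0r addr0.
- by rewrite gd_C gs_C.
- by rewrite gd_v rmorphM /= hc gs_v mul0r sub0r rmorphN mulrN mulNr.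
Qed.
End MonomialAction.

Definition ba : HBE := y1 ^+ 3 + y2 ^+ 3.
Definition bb : HBE := y1 * y2 * v ^+ 2.
Definition bd : HBE := (y1 ^+ 3 - y2 ^+ 3) * v ^+ 3.
Definition bc' : HBE := C + y1 ^+ 3 * y2 ^+ 3.
Definition bc'' : HBE := ba ^+ 2 - 2%:R * bc'.

(** * The invariants of 6S3 as a CA-module *)

Section CASpan.

Definition gen8 (j : nat) : HBE :=
  nth 0 [:: 1; bb; bb ^+ 2; ba ^+ 2; bc' * bb; bc' * bb ^+ 2; bc''; ba * bd] j.

Definition MCA (r : HBE) : Prop :=
  exists f : nat -> F7yu, r = \sum_(j < 8) ev cst C V (f j) * gen8 j.

Lemma MCA0 : MCA 0.
Proof. by exists (fun=> 0); rewrite big1 // => j _; rewrite rmorph0 mul0r. Qed.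

Lemma MCAD r s : MCA r -> MCA s -> MCA (r + s).
Proof.
case=> f -> [g ->]; exists (fun j => f j + g j); rewrite -big_split.
by apply: eq_bigr => j _; rewrite rmorphD mulrDl.
Qed.

Lemma MCAZ P r : MCA r -> MCA (ev cst C V P * r).
Proof.
case=> f ->; exists (fun j => P * f j); rewrite mulr_sumr.
by apply: eq_bigr => j _; rewrite rmorphM mulrA.
Qed.

Lemma MCAc a r : MCA r -> MCA (cst a * r).
Proof. by move=> /(MCAZ a%:P%:P); rewrite evC. Qed.
Lemma MCAC r : MCA r -> MCA (C * r).
Proof. by move=> /(MCAZ Yv); rewrite evY. Qed.
Lemma MCAV r : MCA r -> MCA (V * r).
Proof. by move=> /(MCAZ Uv); rewrite evU. Qed.
Lemma MCAN r : MCA r -> MCA (- r).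
Proof. by move=> /(MCAc (-1)); rewrite rmorphN rmorph1 mulN1r. Qed.
Lemma MCAB r s : MCA r -> MCA s -> MCA (r - s).
Proof. by move=> mr ms; apply: MCAD => //; apply: MCAN. Qed.

Lemma MCA_gen j : (j < 8)%N -> MCA (gen8 j).
Proof.
move=> j8; exists (fun i => (i == j)%:R); rewrite (bigD1 (Ordinal j8)) //= eqxx rmorph1 mul1r.
by rewrite big1 ?addr0 // => i; rewrite -val_eqE /= => /negPf ->; rewrite rmorph0 mul0r.
Qed.

Let M0 : MCA 1. Proof. exact: (@MCA_gen 0). Qed.
Let M1 : MCA bb. Proof. exact: (@MCA_gen 1). Qed.
Let M2 : MCA (bb ^+ 2). Proof. exact: (@MCA_gen 2). Qed.
Let M3 : MCA (ba ^+ 2). Proof. exact: (@MCA_gen 3). Qed.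
Let M4 : MCA (bc' * bb). Proof. exact: (@MCA_gen 4). Qed.
Let M5 : MCA (bc' * bb ^+ 2). Proof. exact: (@MCA_gen 5). Qed.
Let M6 : MCA bc''. Proof. exact: (@MCA_gen 6). Qed.
Let M7 : MCA (ba * bd). Proof. exact: (@MCA_gen 7). Qed.

(** A monomial plus its image under the swap, which sends v to - v. *)
Definition bal l i j : HBE := v ^+ l * (y1 ^+ i * y2 ^+ j + (-1) ^+ l * (y2 ^+ i * y1 ^+ j)).

Let CA_small :
  [/\ bal 0 0 0 = 1 + 1, bal 0 3 3 = ba ^+ 2 - bc'' - (C * 1 + C * 1),
      bal 0 6 0 = bc'' + (C * 1 + C * 1), bal 0 0 6 = bc'' + (C * 1 + C * 1)
    & bal 0 6 6 = C * bc'' + C * bc'' + C * (C * 1 + C * 1)] /\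
  [/\ bal 2 1 1 = bb + bb, bal 2 4 4 = bc' * bb + bc' * bb - (C * bb + C * bb),
      bal 4 2 2 = bb ^+ 2 + bb ^+ 2
    & bal 4 5 5 = bc' * bb ^+ 2 + bc' * bb ^+ 2 - (C * bb ^+ 2 + C * bb ^+ 2)] /\
  [/\ bal 3 6 0 = ba * bd, bal 3 0 6 = - (ba * bd)
    & forall l i, odd l -> bal l i i = 0].
Proof.
case: HBE_relE => _ e1 e2 eC; rewrite /bal /bb /bc'' /bc' /ba /bd.
move: y1 y2 C v e1 e2 eC => x1 x2 xC w e1 e2 eC.
split; [|split]; split; try ring; last first.
  by move=> l i lo; rewrite -signr_odd lo mulN1r [x2 ^+ i * _]mulrC subrr mulr0.
have E : xC ^+ 2 = xC * x1 ^+ 6 + xC * x2 ^+ 6 - x1 ^+ 6 * x2 ^+ 6.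
  rewrite eC; congr (_ + _ - _).
    by transitivity (x1 ^+ 7 * x1 ^+ 5); [ring|rewrite -e1; ring].
  by transitivity (x2 ^+ 7 * x2 ^+ 5); [ring|rewrite -e2; ring].
have E6 : x1 ^+ 6 * x2 ^+ 6 = xC * x1 ^+ 6 + xC * x2 ^+ 6 - xC ^+ 2 by rewrite E; ring.
transitivity (x1 ^+ 6 * x2 ^+ 6 + x1 ^+ 6 * x2 ^+ 6); first by ring.
rewrite E6; ring.
Qed.

(** The conditions express invariance of the monomial under diag(2, 1), diag(1, 2) and -1. V brings
    l below 6 and C y_i = y_i^7 brings i and j below 7, which leaves the finite list of
    [CA_small]. *)
Lemma MCA_bal l i j : (3 %| i + l)%N -> (3 %| j + l)%N -> ~~ odd (i + j) -> MCA (bal l i j).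
Proof.
have [n] := ubnP (i + j + l); elim: n l i j => // n IH l i j lt h1 h2 h3.
case: HBE_relE => _ e1 e2 _.
case: (ltnP l 6) => l6; last first.
  have -> : bal l i j = V * bal (l - 6) i j.
    rewrite /bal /V mulrA -exprD subnKC //; congr (_ * (_ + _ * _)).
    by rewrite -(signr_odd _ l) -(signr_odd _ (l - 6)) oddB //= addbF.
  apply: MCAV; apply: IH; move: h1 h2 h3; lia.
have sh x i' : C * x = x ^+ 7 -> (6 < i')%N -> x ^+ i' = C * x ^+ (i' - 6) :> HBE.
  move=> ex li; have {1}-> : i' = (7 + (i' - 7))%N by lia.
  by rewrite exprD -ex -mulrA -exprS; congr (_ * _ ^+ _); lia.
case: (ltnP i 7) => i7; last first.
  have -> : bal l i j = C * bal l (i - 6) j.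
    rewrite /bal !(sh _ i) //; ring.
  apply: MCAC; apply: IH; move: h1 h2 h3; lia.
case: (ltnP j 7) => j7; last first.
  have -> : bal l i j = C * bal l i (j - 6).
    rewrite /bal !(sh _ j) //; ring.
  apply: MCAC; apply: IH; move: h1 h2 h3; lia.
have [[b1 b2 b3 b4 b5] [[b6 b7 b8 b9] [b10 b11 bo]]] := CA_small.
have : [|| [&& odd l & i == j], [&& l == 0, i == 0 & j == 0], [&& l == 0, i == 3 & j == 3],
  [&& l == 0, i == 6 & j == 0], [&& l == 0, i == 0 & j == 6], [&& l == 0, i == 6 & j == 6],
  [&& l == 2, i == 1 & j == 1], [&& l == 2, i == 4 & j == 4], [&& l == 4, i == 2 & j == 2],
  [&& l == 4, i == 5 & j == 5], [&& l == 3, i == 6 & j == 0] | [&& l == 3, i == 0 & j == 6]]%N.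
  have i6 : (i < 7)%N by []. clear -l6 i7 j7 h1 h2 h3.
  move: l6 i7 j7 h1 h2 h3; case: l => [|[|[|[|[|[|l]]]]]] //;
  by case: i => [|[|[|[|[|[|[|i]]]]]]] //; case: j => [|[|[|[|[|[|[|j]]]]]]].
case/orP=> [/andP[lo /eqP ->]|]; first by rewrite bo //; exact: MCA0.
have fin P : MCA P -> forall Q, Q = P -> MCA Q by move=> mP Q ->.
case/orP=> [/and3P[/eqP -> /eqP -> /eqP ->]|]; first exact: fin (MCAD M0 M0) _ b1.
have MC2 := MCAD (MCAC M0) (MCAC M0).
case/orP=> [/and3P[/eqP -> /eqP -> /eqP ->]|]; first exact: fin (MCAB (MCAB M3 M6) MC2) _ b2.
case/orP=> [/and3P[/eqP -> /eqP -> /eqP ->]|]; first exact: fin (MCAD M6 MC2) _ b3.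
case/orP=> [/and3P[/eqP -> /eqP -> /eqP ->]|]; first exact: fin (MCAD M6 MC2) _ b4.
case/orP=> [/and3P[/eqP -> /eqP -> /eqP ->]|].
  exact: fin (MCAD (MCAD (MCAC M6) (MCAC M6)) (MCAC MC2)) _ b5.
case/orP=> [/and3P[/eqP -> /eqP -> /eqP ->]|]; first exact: fin (MCAD M1 M1) _ b6.
case/orP=> [/and3P[/eqP -> /eqP -> /eqP ->]|].
  exact: fin (MCAB (MCAD M4 M4) (MCAD (MCAC M1) (MCAC M1))) _ b7.
case/orP=> [/and3P[/eqP -> /eqP -> /eqP ->]|]; first exact: fin (MCAD M2 M2) _ b8.
case/orP=> [/and3P[/eqP -> /eqP -> /eqP ->]|].
  exact: fin (MCAB (MCAD M5 M5) (MCAD (MCAC M2) (MCAC M2))) _ b9.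
case/orP=> [/and3P[/eqP -> /eqP -> /eqP ->]|/and3P[/eqP -> /eqP -> /eqP ->]].
  exact: fin M7 _ b10.
exact: fin (MCAN M7) _ b11.
Qed.
End CASpan.

(** * Averaging over 6S3 *)

Section OrbitSums.
Variable T : comNzRingType.
Definition orb3 (f : T -> T) x := x + f x + f (f x).
Definition orb2 (f : T -> T) x := x + f x.

Lemma orb3D (f : {rmorphism T -> T}) x y : orb3 f (x + y) = orb3 f x + orb3 f y.
Proof. by rewrite /orb3 !rmorphD /=; ring. Qed.
Lemma orb2D (f : {rmorphism T -> T}) x y : orb2 f (x + y) = orb2 f x + orb2 f y.
Proof. by rewrite /orb2 !rmorphD /=; ring. Qed.
Lemma orb30 (f : {rmorphism T -> T}) : orb3 f 0 = 0.
Proof. by rewrite /orb3 !rmorph0 !addr0. Qed.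
Lemma orb20 (f : {rmorphism T -> T}) : orb2 f 0 = 0.
Proof. by rewrite /orb2 !rmorph0 !addr0. Qed.

(** 2 has order 3 modulo 7, so this is the sum of a nontrivial character of a group of order 3. *)
Lemma pow2_mod3 n : ~~ (3 %| n)%N -> 1 + 2 ^+ n + 2 ^+ n * 2 ^+ n = 0 :> 'F_7.
Proof.
rewrite {2 3 4}(divn_eq n 3) /dvdn => h; rewrite exprD mulnC exprM.
have -> : 2 ^+ 3 = 1 :> 'F_7 by apply: val_inj.
rewrite expr1n mul1r; have := ltn_pmod n (isT : 0 < 3)%N.
have c1 : 1 + 2 + 2 * 2 = 0 :> 'F_7 by apply: val_inj.
have c2 : 1 + 2 ^+ 2 + 2 ^+ 2 * 2 ^+ 2 = 0 :> 'F_7 by apply: val_inj.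
case: (n %% 3)%N h => [|[|[|?]]] h lt; [by []|exact: c1|exact: c2|by []].
Qed.


Lemma orbit_monomial (k : {rmorphism 'F_7 -> T}) (t1 t2 t3 : T -> T) (X : T) (e f : nat) a :
  (forall b, t1 (k b * X) = k (2 ^+ e * b) * X) ->
  (forall b, t2 (k b * X) = k (2 ^+ f * b) * X) ->
  (forall b, t3 (k b * X) = k ((-1) ^+ (e + f) * b) * X) ->
  exists b, orb2 t3 (orb3 t2 (orb3 t1 (k a * X))) = k b * X /\
    (b = 0 \/ [/\ 3 %| e, 3 %| f & ~~ odd (e + f)]%N).
Proof.
move=> h1 h2 h3; pose c3 n : 'F_7 := 1 + 2 ^+ n + 2 ^+ n * 2 ^+ n.
have o3 t n b : (forall b, t (k b * X) = k (2 ^+ n * b) * X) -> orb3 t (k b * X) = k (c3 n * b) * X.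
  move=> ht; rewrite /orb3 !ht -!mulrDl -!rmorphD; congr (k _ * X).
  by rewrite /c3 !mulrDl mul1r mulrA.
have o2 b : orb2 t3 (k b * X) = k ((1 + (-1) ^+ (e + f)) * b) * X.
  by rewrite /orb2 h3 -!mulrDl -!rmorphD; congr (k _ * X); rewrite mulrDl mul1r.
eexists; rewrite (o3 t1 e) // (o3 t2 f) // o2; split; first by [].
have [he|/pow2_mod3 he] := boolP (3 %| e)%N; last first.
  by left; rewrite /c3 he mul0r !mulr0.
have [hf|/pow2_mod3 hf] := boolP (3 %| f)%N; last first.
  by left; rewrite /c3 hf mul0r !mulr0.
have [ho|ho] := boolP (odd (e + f)); last by right.
by left; rewrite -signr_odd ho expr1 subrr mul0r.
Qed.

Lemma orbit_fixed (t1 t2 t3 t4 : {rmorphism T -> T}) r : 7%:R = 0 :> T ->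
  t1 r = r -> t2 r = r -> t3 r = r -> t4 r = r ->
  orb2 t4 (orb2 t3 (orb3 t2 (orb3 t1 r))) = r.
Proof.
move=> T7 h1 h2 h3 h4; rewrite /orb2 /orb3 !(rmorphD, h1, h2, h3, h4).
(* There are 3 * 3 * 2 * 2 = 36 terms and 36 = 1 + 7 * 5, so the orbit sum itself fixes invariants,
   without a division. *)
transitivity (r + 7%:R * (5%:R * r)); first by ring.
by rewrite T7 mul0r addr0.
Qed.
End OrbitSums.

Section Averaging.

Let u2 : (2 : 'F_7) ^+ 6 = 1. Proof. exact: val_inj. Qed.
Let u1 : (1 : 'F_7) ^+ 6 = 1. Proof. exact: val_inj. Qed.
Let uN : (-1 : 'F_7) ^+ 6 = 1. Proof. exact: val_inj. Qed.

Definition mon a i j k l : HBE := cst a * v ^+ l * (y1 ^+ i * y2 ^+ j * C ^+ k).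

Lemma gd_mon (s t : 'F_7) (s6 : s ^+ 6 = 1) (t6 : t ^+ 6 = 1) a i j k l :
  gd s6 t6 (mon a i j k l) = mon (s ^+ (i + l) * t ^+ (j + l) * a) i j k l.
Proof.
have gc b : gd s6 t6 (cst b) = cst b by exact: (F7_rmorph_eq (gd s6 t6 \o cst)).
rewrite /mon !(rmorphXn, rmorphM) /= gc gd_v gd_y1 gd_y2 gd_C.
rewrite !(rmorphXn, rmorphM) /= !exprMn !exprD.
move: (cst s) (cst t) (cst a) y1 y2 C v => *; ring.
Qed.

Definition orbsum r :=
  orb2 gs (orb2 (gd uN uN) (orb3 (gd u1 u2) (orb3 (gd u2 u1) r))).

Lemma MCA_orbsum_mon a i j k l : MCA (orbsum (mon a i j k l)).
Proof.
have hmon b : mon b i j k l = cst b * mon 1 i j k l by rewrite /mon rmorph1 mul1r -!mulrA.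
have [b [Eb hb]] : exists b, orb2 (gd uN uN) (orb3 (gd u1 u2) (orb3 (gd u2 u1) (mon a i j k l)))
    = mon b i j k l /\ (b = 0 \/ [/\ 3 %| i + l, 3 %| j + l & ~~ odd (i + l + (j + l))]%N).
  have [|||b [Eb hb]] := @orbit_monomial _ cst (gd u2 u1) (gd u1 u2) (gd uN uN)
    (mon 1 i j k l) (i + l) (j + l) a.
  - by move=> b; rewrite -!hmon gd_mon expr1n mulr1.
  - by move=> b; rewrite -!hmon gd_mon expr1n mul1r.
  - by move=> b; rewrite -!hmon gd_mon -exprD.
  by exists b; rewrite (hmon a) (hmon b); split; [exact: Eb|exact: hb].
rewrite /orbsum Eb; case: hb => [->|[h1 h2 h3]].
  by rewrite /mon rmorph0 !mul0r orb20; apply: MCA0.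
have hc : gs (cst b) = cst b by exact: (F7_rmorph_eq (gs \o cst)).
have -> : orb2 gs (mon b i j k l) = cst b * (ev cst C V (Yv ^+ k) * bal l i j).
  rewrite /orb2 /mon /bal rmorphXn /= evY !(rmorphXn, rmorphM) /= hc gs_v gs_y1 gs_y2 gs_C.
  rewrite [(- v) ^+ l]exprNn; move: ((-1) ^+ l) (cst b) => s t.
  move: y1 y2 C v => *; ring.
have h4 : ~~ odd (i + j) by move: h3; rewrite addnACA addnn oddD odd_double addbF.
exact: (MCAc b (MCAZ (Yv ^+ k) (MCA_bal h1 h2 h4))).
Qed.

Lemma MCA_orbsum r : MCA (orbsum r).
Proof.
move: r; apply: HBE_ind.
- by rewrite /orbsum !(orb30, orb20); apply: MCA0.
- move=> r s mr ms; suff -> : orbsum (r + s) = orbsum r + orbsum s by apply: MCAD.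
  by rewrite /orbsum (orb3D (gd u2 u1) r s) (orb3D (gd u1 u2) (orb3 _ r) (orb3 _ s))
    (orb2D (gd uN uN) (orb3 _ (orb3 _ r)) (orb3 _ (orb3 _ s)))
    (orb2D gs (orb2 _ (orb3 _ (orb3 _ r))) (orb2 _ (orb3 _ (orb3 _ s)))).
- move=> a i j k l; exact: MCA_orbsum_mon.
Qed.

Lemma MCA_inv r :
  (forall l m (l6 : l ^+ 6 = 1) (m6 : m ^+ 6 = 1), cube_pair l m -> gd l6 m6 r = r) ->
  gs r = r -> MCA r.
Proof.
move=> hd hs; have T7 : 7%:R = 0 :> HBE.
  by rewrite -(rmorph_nat cst) (_ : 7%:R = 0 :> 'F_7) ?rmorph0 //; apply: val_inj.
have := orbit_fixed T7 (hd _ _ u2 u1 isT) (hd _ _ u1 u2 isT) (hd _ _ uN uN isT) hs.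
by rewrite -/(orbsum r) => <-; apply: MCA_orbsum.
Qed.
End Averaging.

(** * Coefficients as multivariate and as iterated polynomials *)

Section MainAlgebra.

Definition toS : {mpoly 'F_7[2]} -> F7yu := mmap kS (tnth [tuple Yv; Uv]).
HB.instance Definition _ := GRing.RMorphism.on toS.
Definition kM : {rmorphism 'F_7 -> {mpoly 'F_7[2]}} := @mpolyC 2 _.
Definition ofS : F7yu -> {mpoly 'F_7[2]} := ev kM 'X_ord0 'X_(lift ord0 ord0).
HB.instance Definition _ := GRing.RMorphism.on ofS.

Let I2 (i : 'I_2) : i = ord0 \/ i = lift ord0 ord0.
Proof. by case: i => -[|[|//]] lti; [left|right]; apply: val_inj. Qed.

Lemma ofS_toS a : ofS (toS a) = a.
Proof.
apply: (mpoly_rmorph_eq (f := ofS \o toS) (g := idfun)) => i /=.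
rewrite /toS mmapX mmap1U; case: (I2 i) => ->; rewrite (tnth_nth 0) /=.
  exact: evY.
exact: evU.
Qed.

Lemma evalHBE_toS x y a : evalHBE [tuple x; y] a = ev cst x y (toS a).
Proof.
apply: (mpoly_rmorph_eq (f := evalHBE [tuple x; y]) (g := ev cst x y \o toS)) => i /=.
rewrite /toS /evalHBE !mmapX !mmap1U.
case: (I2 i) => ->; rewrite !(tnth_nth 0) /=.
  by rewrite evY.
by rewrite evU.
Qed.

Lemma toS_eq0 a : toS a = 0 -> a = 0.
Proof. by move=> E; rewrite -(ofS_toS a) E rmorph0. Qed.

Lemma toS_ofS P : toS (ofS P) = P.
Proof.
apply: (F7yu_rmorph_eq (f := toS \o ofS) (g := idfun)) => /=.
  by rewrite /ofS evY /toS mmapX mmap1U (tnth_nth 0).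
by rewrite /ofS evU /toS mmapX mmap1U (tnth_nth 0).
Qed.

End MainAlgebra.

(** * Restrictions of the generators to the A_i *)

Section PsiGenerators.
Notation evS := (ev kS).

Lemma psi_y12 k : psi (Some k) y1 = Yv /\ psi (Some k) y2 = kS k * Yv.
Proof. by rewrite psi_y1 psi_y2 /pt1 kS_1 mul1r. Qed.

Lemma psi_V i : psi i V = Uv ^+ 6.
Proof. by rewrite /V rmorphXn /= psi_v. Qed.
Lemma psi_D1 i : psi i D1 = D1p.
Proof. by rewrite /D1 rmorphD rmorphXn /= psi_C psi_V /D1p -exprM. Qed.
Lemma psi_D2 i : psi i D2 = Lp ^+ 6.
Proof. by rewrite /D2 rmorphM /= psi_C psi_V /Lp exprMn. Qed.

Lemma psi_evDA i P : psi i (ev cst D1 D2 P) = sub6 (dic P).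
Proof. by rewrite (rmorph_ev cst kS) /= psi_D1 psi_D2 sub6_dic. Qed.
Lemma psi_evCA i P : psi i (ev cst C V P) = sub6 P.
Proof. by rewrite (rmorph_ev cst kS) /= psi_C psi_V. Qed.

Lemma evDA_dic P : ev cst D1 D2 P = ev cst C V (dic P).
Proof. by apply: psi_eq => i; rewrite psi_evDA psi_evCA. Qed.

Lemma rmorph_gens (R T : comNzRingType) (f : {rmorphism R -> T}) (x1 x2 xC w : R) :
  let a := x1 ^+ 3 + x2 ^+ 3 in let c' := xC + x1 ^+ 3 * x2 ^+ 3 in
  [/\ f (x1 * x2 * w ^+ 2) = f x1 * f x2 * f w ^+ 2,
      f a = f x1 ^+ 3 + f x2 ^+ 3,
      f ((x1 ^+ 3 - x2 ^+ 3) * w ^+ 3) = (f x1 ^+ 3 - f x2 ^+ 3) * f w ^+ 3,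
      f c' = f xC + f x1 ^+ 3 * f x2 ^+ 3
    & f (a ^+ 2 - 2%:R * c') = f a ^+ 2 - 2%:R * f c'].
Proof.
by move=> a c'; split; rewrite ?/a ?/c' !(rmorph_nat, rmorphB, rmorphD, rmorphXn, rmorphM).
Qed.

Lemma psi_gens i : [/\ psi i bb = psi i y1 * psi i y2 * Uv ^+ 2,
  psi i ba = psi i y1 ^+ 3 + psi i y2 ^+ 3,
  psi i bd = (psi i y1 ^+ 3 - psi i y2 ^+ 3) * Uv ^+ 3,
  psi i bc' = Yv ^+ 6 + psi i y1 ^+ 3 * psi i y2 ^+ 3
  & psi i bc'' = psi i ba ^+ 2 - 2%:R * psi i bc'].
Proof. by rewrite -(psi_v i) -(psi_C i); apply: (rmorph_gens (psi i) y1 y2 C v). Qed.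

(** As s is 1 or -1, (1 + s)(1 - s) = 0 kills c'' and a d on the radical subgroups. For s = -1 also
    a and c' vanish. *)
Lemma psi_gens_k k : k ^+ 6 = 1 -> let s := kS k ^+ 3 in
  [/\ psi (Some k) bb = kS k * Lp ^+ 2, psi (Some k) ba ^+ 2 = (1 + s) ^+ 2 * Yv ^+ 6,
      psi (Some k) bc' = (1 + s) * Yv ^+ 6, psi (Some k) bc'' = 0
    & psi (Some k) ba * psi (Some k) bd = 0].
Proof.
move=> k6 s; have s2 : s ^+ 2 = 1 by rewrite /s -exprM -rmorphXn k6 rmorph1.
have [E1 E2] := psi_y12 k; have [Eb E3 Ed E4 E5] := psi_gens (Some k).
have Ec : psi (Some k) bc' = (1 + s) * Yv ^+ 6 by rewrite E4 E1 E2 /s; ring.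
have Ea : psi (Some k) ba = (1 + s) * Yv ^+ 3 by rewrite E3 E1 E2 /s; ring.
have {}Ed : psi (Some k) bd = (1 - s) * (Yv ^+ 3 * Uv ^+ 3) by rewrite Ed E1 E2 /s; ring.
have F : (1 + s) * (1 - s) = 0 by transitivity (1 - s ^+ 2); [ring|rewrite s2 subrr].
clearbody s; rewrite E5 Eb Ec Ea Ed E1 E2 /Lp; split; first by ring.
- by ring.
- by [].
- transitivity (- ((1 + s) * (1 - s)) * Yv ^+ 6); first by ring.
  by rewrite F oppr0 mul0r.
- by rewrite mulrACA F mul0r.
Qed.

(** The nonradical A_0 detects the two generators that the radical subgroups do not see. *)
Lemma psi_gens_0 : [/\ psi (Some 0) bc'' = - Yv ^+ 6
  & psi (Some 0) ba * psi (Some 0) bd = Yv ^+ 6 * Uv ^+ 3].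
Proof.
have [E1 E2] := psi_y12 0; have [_ E3 -> E4 ->] := psi_gens (Some 0).
rewrite E4 E3 E1 E2 rmorph0 mul0r; split; ring.
Qed.
End PsiGenerators.

(** * The span of the eight generators *)

Section ImageAlgebra.
Notation evX := (ev kX).

Lemma sum6 (T : nmodType) (F : 'I_6 -> T) : \sum_i F i =
  F (inord 0) + F (inord 1) + F (inord 2) + F (inord 3) + F (inord 4) + F (inord 5).
Proof.
rewrite !big_ord_recl big_ord0 addr0 !addrA.
by congr (F _ + F _ + F _ + F _ + F _ + F _); apply: val_inj; rewrite /= inordK.
Qed.

Lemma sum2 (T : nmodType) (F : 'I_2 -> T) : \sum_i F i = F (inord 0) + F (inord 1).
Proof.
rewrite !big_ord_recl big_ord0 addr0.
by congr (F _ + F _); apply: val_inj; rewrite /= inordK.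
Qed.

Definition x6 : 6.-tuple HBE :=
  [tuple 1; bb; bb ^+ 2; ba ^+ 2 * V; bc' * bb * V; bc' * bb ^+ 2 * V].
Definition z2 : 2.-tuple HBE := [tuple bc''; ba * bd].

Definition comb (P Q : nat -> F7yu) : HBE :=
  ev cst D1 D2 (P 0) * 1 + ev cst D1 D2 (P 1) * bb + ev cst D1 D2 (P 2) * bb ^+ 2
  + ev cst D1 D2 (P 3) * (ba ^+ 2 * V) + ev cst D1 D2 (P 4) * (bc' * bb * V)
  + ev cst D1 D2 (P 5) * (bc' * bb ^+ 2 * V)
  + (ev cst C V (Q 0) * bc'' + ev cst C V (Q 1) * (ba * bd)).

Lemma combE (a : {ffun 'I_6 -> {mpoly 'F_7[2]}}) (b : {ffun 'I_2 -> {mpoly 'F_7[2]}}) :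
  DA_CA_comb x6 z2 a b = comb (fun i => toS (a (inord i))) (fun i => toS (b (inord i))).
Proof.
by rewrite /DA_CA_comb sum6 sum2 !evalHBE_toS !(tnth_nth 0) !inordK.
Qed.

Lemma combP r : (exists P Q, r = comb P Q) <-> (exists a b, r = DA_CA_comb x6 z2 a b).
Proof.
split=> [[P [Q ->]]|[a [b ->]]]; last first.
  by rewrite combE; eexists; eexists.
exists [ffun i => ofS (P (val i))], [ffun i => ofS (Q (val i))].
rewrite combE; rewrite /comb !ffunE !toS_ofS /= !inordK //.
Qed.

Lemma rmorph_comb (R T : comNzRingType) (f : {rmorphism R -> T})
    (p0 p1 p2 p3 p4 p5 q0 q1 b a c' w c'' d : R) :
  f (p0 * 1 + p1 * b + p2 * b ^+ 2 + p3 * (a ^+ 2 * w) + p4 * (c' * b * w)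
    + p5 * (c' * b ^+ 2 * w) + (q0 * c'' + q1 * (a * d))) =
  f p0 + f p1 * f b + f p2 * f b ^+ 2 + f p3 * (f a ^+ 2 * f w) + f p4 * (f c' * f b * f w)
    + f p5 * (f c' * f b ^+ 2 * f w) + (f q0 * f c'' + f q1 * (f a * f d)).
Proof. by rewrite mulr1 !(rmorphD, rmorphXn, rmorphM). Qed.

Lemma psi_comb k P Q : k ^+ 6 = 1 -> let s := kS k ^+ 3 in psi (Some k) (comb P Q) =
  sub6 (dic (P 0)) + sub6 (dic (P 1)) * (kS k * Lp ^+ 2) + sub6 (dic (P 2)) * (kS k * Lp ^+ 2) ^+ 2
  + Lp ^+ 6 * ((1 + s) ^+ 2 * sub6 (dic (P 3)) + (1 + s) * sub6 (dic (P 4)) * (kS k * Lp ^+ 2)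
  + (1 + s) * sub6 (dic (P 5)) * (kS k * Lp ^+ 2) ^+ 2).
Proof.
move=> k6 s; have [Eb Ea Ec Ec2 Ed] := psi_gens_k k6.
rewrite (rmorph_comb (psi (Some k))) /= Ed Ec2 Eb Ea Ec psi_V !psi_evDA -/s.
have -> : Lp ^+ 6 = Yv ^+ 6 * Uv ^+ 6 by rewrite exprMn.
clearbody s; move: (sub6 (dic (P 0))) (sub6 (dic (P 1))) (sub6 (dic (P 2))) (sub6 (dic (P 3)))
  (sub6 (dic (P 4))) (sub6 (dic (P 5))) (kS k * Lp ^+ 2) (Yv ^+ 6) (Uv ^+ 6) (sub6 (Q 0))
  (psi (Some k) (ev cst C V (Q 0))) (psi (Some k) (ev cst C V (Q 1))) s => *; ring.
Qed.
End ImageAlgebra.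

Section DicksonSpan.
Notation evX := (ev kX).
Notation evS := (ev kS).

(* The A_k with k^6 = 1 are the radical subgroups. *)
Lemma lin_psi_comb (k a b c d : 'F_7) P Q : k ^+ 6 = 1 -> (a * d - b * c) ^+ 2 = 1 ->
  lin a b c d (th (psi (Some k) (comb P Q))) = th (psi (Some k) (comb P Q)).
Proof.
move=> k6 det2; rewrite psi_comb //; set s := kS k ^+ 3.
have [hL _] := lin_th_inv det2.
pose fx x := lin a b c d (th x) = th x.
have fD x y : fx x -> fx y -> fx (x + y) by rewrite /fx !rmorphD /= => -> ->.
have fM x y : fx x -> fx y -> fx (x * y) by rewrite /fx !rmorphM /= => -> ->.
have fX x n : fx x -> fx (x ^+ n) by rewrite /fx !rmorphXn /= => ->.
have fK e : fx (kS e).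
  by rewrite /fx; have h := F7_rmorph_eq (th \o kS) kS e; rewrite /= in h; rewrite h;
    exact: (F7_rmorph_eq (lin a b c d \o kS) kS e).
have f1 : fx 1 by rewrite /fx !rmorph1.
have fL : fx (Lp ^+ 2) by exact: hL.
have fL6 : fx (Lp ^+ 6) by rewrite (exprM _ 2 3); exact: (fX _ 3 fL).
have fd P0 : fx (sub6 (dic P0)) by exact: lin_dic.
have fs : fx (1 + s) := fD _ _ f1 (fX _ 3 (fK k)).
have fkL : fx (kS k * Lp ^+ 2) := fM _ _ (fK k) fL.
have fkL2 : fx ((kS k * Lp ^+ 2) ^+ 2) := fX _ 2 fkL.
exact: (fD _ _ (fD _ _ (fD _ _ (fd _) (fM _ _ (fd _) fkL)) (fM _ _ (fd _) fkL2))
  (fM _ _ fL6 (fD _ _ (fD _ _ (fM _ _ (fX _ 2 fs) (fd _)) (fM _ _ (fM _ _ fs (fd _)) fkL))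
     (fM _ _ (fM _ _ fs (fd _)) fkL2)))).
Qed.

(** The source of the factor V in the last three DA-generators. At C = 0 the element D1 becomes V
    and D2 becomes 0, so an element of DA divisible by C is divisible by D2 = C V. *)
Lemma dic_divY P Q : Yv * P = dic Q -> exists R, P = Uv * dic R.
Proof.
move=> E; have Q0 : evX 'X 0 Q = 0.
  have := congr1 (evX 0 'X) E; rewrite rmorphM /= evY mul0r ev_dic.
  by rewrite expr0n add0r mul0r => <-.
have [R ER] : exists R, Q = R * Uv.
  elim/poly_ind: Q Q0 {E} => [|Q p _]; first by exists 0; rewrite mul0r.
  rewrite rmorphD rmorphM /= evU evP mulr0 add0r ev1_idX => ->.
  by exists Q; rewrite polyC0 addr0.
have dU : dic Uv = Yv * Uv by exact: evU.
by exists R; apply: (mulfI Yv0); rewrite E ER rmorphM /= dU mulrC mulrA.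
Qed.

Lemma sum8 (T : nmodType) (F : 'I_8 -> T) : \sum_i F i =
  F (inord 0) + F (inord 1) + F (inord 2) + F (inord 3) + F (inord 4) + F (inord 5)
  + F (inord 6) + F (inord 7).
Proof.
rewrite !big_ord_recl big_ord0 addr0 !addrA.
by congr (F _ + F _ + F _ + F _ + F _ + F _ + F _ + F _); apply: val_inj; rewrite /= inordK.
Qed.

Lemma rmorph_gen8 (R T : comNzRingType) (g : {rmorphism R -> T})
    (p0 p1 p2 p3 p4 p5 p6 p7 b a c' c'' d : R) :
  g (p0 * 1 + p1 * b + p2 * b ^+ 2 + p3 * a ^+ 2 + p4 * (c' * b) + p5 * (c' * b ^+ 2)
    + p6 * c'' + p7 * (a * d)) =
  g p0 + g p1 * g b + g p2 * g b ^+ 2 + g p3 * g a ^+ 2 + g p4 * (g c' * g b)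
    + g p5 * (g c' * g b ^+ 2) + g p6 * g c'' + g p7 * (g a * g d).
Proof. by rewrite mulr1 !(rmorphD, rmorphXn, rmorphM). Qed.

Lemma sum_gen8 (f : nat -> F7yu) : \sum_(j < 8) ev cst C V (f j) * gen8 j =
    ev cst C V (f 0) * 1 + ev cst C V (f 1) * bb + ev cst C V (f 2) * bb ^+ 2
    + ev cst C V (f 3) * ba ^+ 2 + ev cst C V (f 4) * (bc' * bb) + ev cst C V (f 5) * (bc' * bb ^+ 2)
    + ev cst C V (f 6) * bc'' + ev cst C V (f 7) * (ba * bd).
Proof. by rewrite sum8 !inordK. Qed.

Lemma psi_MCA (f : nat -> F7yu) k : k ^+ 6 = 1 -> let s := kS k ^+ 3 in
  psi (Some k) (\sum_(j < 8) ev cst C V (f j) * gen8 j) =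
  sub6 (f 0 + (1 + s) ^+ 2 * Yv * f 3) + sub6 (kS k * (f 1 + (1 + s) * Yv * f 4)) * Lp ^+ 2
  + sub6 (kS k ^+ 2 * (f 2 + (1 + s) * Yv * f 5)) * Lp ^+ 4.
Proof.
move=> k6 s; have [Eb Ea Ec Ec2 Ed] := psi_gens_k k6.
rewrite sum_gen8.
rewrite (rmorph_gen8 (psi (Some k))) [LHS]/= Ed Ec2 Eb Ea Ec !psi_evCA.
have hk e : sub6 (kS e) = kS e by exact: (F7_rmorph_eq (sub6 \o kS) kS e).
have hs : sub6 (1 + s) = 1 + s by rewrite rmorphD rmorph1 /s rmorphXn /= hk.
have hY : sub6 Yv = Yv ^+ 6 by exact: evY.
have h2 (x t p : F7yu) : sub6 (x + t * Yv * p) = sub6 x + sub6 t * Yv ^+ 6 * sub6 p.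
  by rewrite rmorphD !rmorphM /= hY.
have hM x y : sub6 (x * y) = sub6 x * sub6 y by rewrite rmorphM.
have hX x n : sub6 (x ^+ n) = sub6 x ^+ n by rewrite rmorphXn.
rewrite !h2 (hX (1 + s)) (hM (kS k)) (hM (kS k ^+ 2)) (hX (kS k)) !h2 !hk !hs -/s.
have -> : Lp ^+ 4 = (Lp ^+ 2) ^+ 2 by rewrite -exprM.
move: (sub6 (f 0)) (sub6 (f 1)) (sub6 (f 2)) (sub6 (f 3)) (sub6 (f 4)) (sub6 (f 5))
  (sub6 (f 6)) (sub6 (f 7)) (Lp ^+ 2) (Yv ^+ 6) => *; rewrite /s; move: (kS k) => t; ring.
Qed.
End DicksonSpan.

(** The coefficients of [psi_MCA] at k = -1, where 1 + k^3 is 0, and at k = 1, where it is 2. *)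
Lemma signed_sums (T : comNzRingType) (x y z : T) :
  [/\ x + (1 + (-1) ^+ 3) ^+ 2 * y * z = x,
      -1 * (x + (1 + (-1) ^+ 3) * y * z) = - x
    & (-1) ^+ 2 * (x + (1 + (-1) ^+ 3) * y * z) = x] /\
  [/\ x + (1 + 1 ^+ 3) ^+ 2 * y * z = x + 4%:R * (y * z),
      1 * (x + (1 + 1 ^+ 3) * y * z) = x + 2%:R * (y * z)
    & 1 ^+ 2 * (x + (1 + 1 ^+ 3) * y * z) = x + 2%:R * (y * z)].
Proof. by split; split; ring. Qed.

(** * The combinations that are stable under fusion *)

Section SpanDetermination.
Notation evX := (ev kX).

Let kS1 : kS 1 = 1 := rmorph1 kS.
Let kSN1 : kS (-1) = -1. Proof. by rewrite rmorphN rmorph1. Qed.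
Let p1 : (1 : 'F_7) ^+ 6 = 1. Proof. exact: val_inj. Qed.
Let pN1 : (-1 : 'F_7) ^+ 6 = 1. Proof. exact: val_inj. Qed.

(** A_(-1) shows f0, - f1, f2 alone, so these lie in DA. A_1 shows f0 + 4 C f3, f1 + 2 C f4, f2 + 2
    C f5, so C f3, C f4, C f5 lie in DA and f3, f4, f5 in V DA. The coefficients of c'' and a d
    remain in CA, as both generators die on these subgroups. *)
Lemma MCA_dickson r : MCA r -> sym (psi (Some (-1)) r) -> sym (psi (Some 1) r) ->
  exists P Q, r = comb P Q.
Proof.
case=> f Er; rewrite Er (psi_MCA f pN1) (psi_MCA f p1) kS1 kSN1.
have divY (n m q : nat) (x y g h : F7yu) : (n * m = 7 * q + 1)%N -> x = dic g -> x + n%:R * (Yv * y) = dic h ->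
    exists P, y = Uv * dic P.
  move=> nm xg xh; have [R ER] : exists R, n%:R * y = Uv * dic R.
    apply: (@dic_divY _ (h - g)); rewrite rmorphB /= -xh -xg; ring.
  exists (m%:R * R); rewrite rmorphM rmorph_nat mulrCA -ER mulrA -natrM mulnC nm.
  by rewrite natrD natrM F7yu7 mul0r add0r mul1r.
have [[-> _ _] [F0 _ _]] := signed_sums (f 0) Yv (f 3).
have [[_ -> _] [_ F1 _]] := signed_sums (f 1) Yv (f 4).
have [[_ _ ->] [_ _ F2]] := signed_sums (f 2) Yv (f 5).
rewrite F0 F1 F2 => hN h1 {F0 F1 F2}.
have [g0 [g1 [g2 [E0 E1 E2]]]] := dickson (leqnn _) hN.
have [k0 [k1 [k2 [F0 F1 F2]]]] := dickson (leqnn _) h1.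
have H1 : f 1 = dic (- g1) by rewrite rmorphN /= -E1 opprK.
(* The three numbers record 4 * 2 = 7 * 1 + 1, the inverse modulo 7 of the integer coefficient. *)
have [G3 E3] := divY 4 2 1 _ _ _ _ erefl E0 F0.
have [G4 E4] := divY 2 4 1 _ _ _ _ erefl H1 F1.
have [G5 E5] := divY 2 4 1 _ _ _ _ erefl E2 F2.
exists (nth 0 [:: g0; - g1; g2; G3; G4; G5]), (fun j => f (6 + j)%N).
have hU R : ev cst C V (Uv * dic R) = V * ev cst D1 D2 R.
  by rewrite evDA_dic rmorphM /= evU.
rewrite sum_gen8 E0 H1 E2 E3 E4 E5 !hU -!evDA_dic.
have -> : comb (nth 0 [:: g0; - g1; g2; G3; G4; G5]) (fun j => f (6 + j)%N) =
  ev cst D1 D2 g0 * 1 + ev cst D1 D2 (- g1) * bb + ev cst D1 D2 g2 * bb ^+ 2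
  + ev cst D1 D2 G3 * (ba ^+ 2 * V) + ev cst D1 D2 G4 * (bc' * bb * V)
  + ev cst D1 D2 G5 * (bc' * bb ^+ 2 * V) + (ev cst C V (f 6) * bc'' + ev cst C V (f 7) * (ba * bd)).
  by [].
move: bb ba bc' bc'' bd V (ev cst D1 D2 g0) (ev cst D1 D2 (- g1)) (ev cst D1 D2 g2)
  (ev cst D1 D2 G3) (ev cst D1 D2 G4) (ev cst D1 D2 G5) (ev cst C V (f 6)) (ev cst C V (f 7)) => *.
ring.
Qed.

(** A_(-1) and then A_1 separate the six DA-coefficients. On A_0 the terms of c'' and a d differ in
    the parity of their degree in v. *)
Lemma comb_eq0 P Q : comb P Q = 0 -> (forall i, (i < 6)%N -> P i = 0) /\ (forall j, (j < 2)%N -> Q j = 0).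
Proof.
move=> E; have e1 := congr1 (psi (Some 1)) E; have eN := congr1 (psi (Some (-1))) E.
rewrite rmorph0 (psi_comb P Q p1) kS1 in e1; rewrite rmorph0 (psi_comb P Q pN1) kSN1 in eN.
have n2 (t : F7yu) : t * 0 = 0 by exact: mulr0.
have cN : sub6 (dic (P 0)) + sub6 (- dic (P 1)) * Lp ^+ 2 + sub6 (dic (P 2)) * Lp ^+ 4 = 0.
  have -> : sub6 (- dic (P 1)) = - sub6 (dic (P 1)) by rewrite rmorphN.
  rewrite -[RHS]eN; move: (sub6 _) (sub6 _) (sub6 _) (sub6 _) (sub6 _) (sub6 _) Lp => *; ring.
have [Z0 Z1 Z2] := CA_L2_uniq cN.
have {}Z1 : dic (P 1) = 0 by rewrite -[dic _]opprK Z1 oppr0.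
have c1 : sub6 (4%:R * dic (P 3)) + sub6 (2%:R * dic (P 4)) * Lp ^+ 2
    + sub6 (2%:R * dic (P 5)) * Lp ^+ 4 = 0.
  apply: (mulfI (expf_neq0 6 Lp0)); rewrite mulr0 -[RHS]e1 Z0 Z1 Z2.
  have hM n x : sub6 (n%:R * x) = n%:R * sub6 x by rewrite rmorphM rmorph_nat.
  rewrite !hM rmorph0.
  move: (sub6 _) (sub6 _) (sub6 _) Lp => *; ring.
have [Z3 Z4 Z5] := CA_L2_uniq c1.
have unit (n m q : nat) (x : F7yu) : (n * m = 7 * q + 1)%N -> n%:R * x = 0 -> x = 0.
  move=> nm nx; have : (m * n)%:R * x = 0 by rewrite natrM -mulrA nx mulr0.
  by rewrite mulnC nm natrD natrM F7yu7 mul0r add0r mul1r.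
have P0 i : (i < 6)%N -> P i = 0.
  move=> i6; apply: dic_eq0; case: i i6 => [|[|[|[|[|[|i]]]]]] i6; last exact: (False_ind _ (notF i6)).
  - exact: Z0.
  - exact: Z1.
  - exact: Z2.
  - exact: (unit 4 2 1 _ erefl Z3).
  - exact: (unit 2 4 1 _ erefl Z4).
  - exact: (unit 2 4 1 _ erefl Z5).
split; first exact: P0.
have e0 := congr1 (psi (Some 0)) E; have [g1 g2] := psi_gens_0.
rewrite rmorph0 /comb (P0 0 isT) (P0 1 isT) (P0 2 isT) (P0 3 isT) (P0 4 isT) (P0 5 isT) !rmorph0 !mul0r !add0r in e0.
have e0' : sub6 (Q 0) * - Yv ^+ 6 + sub6 (Q 1) * (Yv ^+ 6 * Uv ^+ 3) = 0.
  rewrite -[RHS]e0 rmorphD rmorphM (rmorphM _ (ev cst C V (Q 1))) (rmorphM _ ba) /= !psi_evCA.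
  by rewrite g1 g2.
have e2 : sub6 (Q 1) * Uv ^+ 3 = sub6 (Q 0).
  apply: (mulfI (expf_neq0 6 Yv0)); apply/eqP; rewrite -subr_eq0 -e0'; apply/eqP; ring.
(* v -> - v fixes v^6 and negates v^3. *)
have e3 : - (sub6 (Q 1) * Uv ^+ 3) = sub6 (Q 0).
  have := congr1 (ev kS Yv (- Uv)) e2; rewrite rmorphM rmorphXn /= !ev_sub6 evU.
  have -> : (- Uv) ^+ 6 = Uv ^+ 6 by rewrite exprNn; ring.
  by rewrite -!/(sub6 _) => <-; ring.
have q0 : sub6 (Q 0) = 0.
  apply: (unit 2 4 1 _ erefl); rewrite mulr_natl mulr2n -{1}e2 -e3 subrr; exact: erefl.
move=> j j2; apply: sub6_eq0; case: j j2 => [|[|j]] j2; last exact: (False_ind _ (notF j2)).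
  exact: q0.
by move/eqP: e2; rewrite q0 mulf_eq0 (negPf (expf_neq0 _ Uv0)) orbF => /eqP.
Qed.
End SpanDetermination.

(** * The grading of HBE and of the span *)

Section Homogeneous.

Lemma HBE_degD m1 m2 : HBE_deg (m1 + m2)%MM = (HBE_deg m1 + HBE_deg m2)%N.
Proof.
rewrite /HBE_deg -big_split; apply: eq_bigr => i _.
by rewrite mnmDE mulnDr.
Qed.

Lemma homog0 n : homogeneous n 0.
Proof. by exists 0; split; [rewrite rmorph0|move=> m; rewrite msupp0]. Qed.

Lemma homogD n r s : homogeneous n r -> homogeneous n s -> homogeneous n (r + s).
Proof.
case=> p [-> hp] [q [-> hq]]; exists (p + q); split; first by rewrite rmorphD.
by move=> m /msuppD_le; rewrite mem_cat => /orP[/hp|/hq].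
Qed.

Lemma homogM n m r s : homogeneous n r -> homogeneous m s -> homogeneous (n + m) (r * s).
Proof.
case=> p [-> hp] [q [-> hq]]; exists (p * q); split; first by rewrite rmorphM.
by move=> u /msuppM_le /allpairsP[[m1 m2] /= [/hp <- /hq <- ->]]; apply: HBE_degD.
Qed.

Lemma homogX n r k : homogeneous n r -> homogeneous (k * n) (r ^+ k).
Proof.
move=> hr; elim: k => [|k IHk]; last by rewrite exprS mulSn; apply: homogM.
exists 1; split; first by rewrite rmorph1.
move=> m; rewrite msupp1 inE => /eqP ->.
by rewrite /HBE_deg big1 // => i _; rewrite mnm0E muln0.
Qed.

Lemma homog_cst a : homogeneous 0 (cst a).
Proof.
exists a%:MP; split=> // m; rewrite msuppC; case: eqP => // _; rewrite inE => /eqP ->.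
by rewrite /HBE_deg big1 // => i _; rewrite mnm0E muln0.
Qed.

Lemma homog_gen (i : 'I_4) : homogeneous (nth 0 [:: 2; 2; 12; 14] i) (cl 'X_i).
Proof.
exists 'X_i; split=> // m; rewrite msuppX inE => /eqP ->.
rewrite /HBE_deg (bigD1 i) //= mnm1E eqxx muln1 big1 ?addn0 // => j /negPf nj.
by rewrite mnm1E eq_sym nj muln0.
Qed.

Lemma homog_y1 : homogeneous 2 y1. Proof. by have := homog_gen (inord 0); rewrite inordK. Qed.
Lemma homog_y2 : homogeneous 2 y2. Proof. by have := homog_gen (inord 1); rewrite inordK. Qed.
Lemma homog_C : homogeneous 12 C. Proof. by have := homog_gen (inord 2); rewrite inordK. Qed.
Lemma homog_v : homogeneous 14 v. Proof. by have := homog_gen (inord 3); rewrite inordK. Qed.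
End Homogeneous.

Section HomogeneousSpan.

Lemma homogZ n a r : homogeneous n r -> homogeneous n (cst a * r).
Proof. by move=> hr; have := homogM (homog_cst a) hr; rewrite add0n. Qed.
Lemma homogN n r : homogeneous n r -> homogeneous n (- r).
Proof. by move=> /(homogZ (-1)); rewrite rmorphN rmorph1 mulN1r. Qed.

Lemma homog_V : homogeneous 84 V. Proof. exact: (homogX 6 homog_v). Qed.
Lemma homog_D1 : homogeneous 84 D1.
Proof. exact: (homogD (homogX 7 homog_C) homog_V). Qed.
Lemma homog_D2 : homogeneous 96 D2. Proof. exact: (homogM homog_C homog_V). Qed.
Lemma homog_ba : homogeneous 6 ba.
Proof. exact: (homogD (homogX 3 homog_y1) (homogX 3 homog_y2)). Qed.
Lemma homog_bb : homogeneous 32 bb.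
Proof. exact: (homogM (homogM homog_y1 homog_y2) (homogX 2 homog_v)). Qed.
Lemma homog_bd : homogeneous 48 bd.
Proof.
exact: (homogM (homogD (homogX 3 homog_y1) (homogN (homogX 3 homog_y2))) (homogX 3 homog_v)).
Qed.
Lemma homog_bc' : homogeneous 12 bc'.
Proof.
exact: (homogD homog_C (homogM (homogX 3 homog_y1) (homogX 3 homog_y2))).
Qed.
Lemma homog_bc'' : homogeneous 12 bc''.
Proof.
have := homogZ 2%:R homog_bc'; rewrite rmorph_nat => h.
exact: (homogD (homogX 2 homog_ba) (homogN h)).
Qed.

Lemma homog_x6 i : (i < 6)%N -> exists n, homogeneous n (nth 0 x6 i).
Proof.
case: i => [|[|[|[|[|[|i]]]]]] i6; last exact: (False_ind _ (notF i6)).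
- by exists 0%N; rewrite -[nth _ _ _](rmorph1 cst); apply: homog_cst.
- by exists 32%N; apply: homog_bb.
- by exists 64%N; apply: (homogX 2 homog_bb).
- by exists 96%N; apply: (homogM (homogX 2 homog_ba) homog_V).
- by exists 128%N; apply: (homogM (homogM homog_bc' homog_bb) homog_V).
- by exists 160%N; apply: (homogM (homogM homog_bc' (homogX 2 homog_bb)) homog_V).
Qed.

Lemma homog_z2 i : (i < 2)%N -> exists n, homogeneous n (nth 0 z2 i).
Proof.
case: i => [|[|i]] i2; last exact: (False_ind _ (notF i2)).
- by exists 12%N; apply: homog_bc''.
- by exists 54%N; apply: (homogM homog_ba homog_bd).
Qed.

Lemma F7yu_ind (Pr : F7yu -> Prop) : Pr 0 -> (forall P Q, Pr P -> Pr Q -> Pr (P + Q)) ->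
  (forall a i j, Pr (a%:P%:P * Yv ^+ i * Uv ^+ j)) -> forall P, Pr P.
Proof.
move=> P0 PD PX; suff h P : forall j, Pr (P * Uv ^+ j) by move=> P; rewrite -[P]mulr1 -(expr0 Uv).
elim/poly_ind: P => [|P p IH] j; first by rewrite mul0r.
rewrite mulrDl -mulrA -exprS; apply: (PD _ _) => //.
suff hp : forall i, Pr ((p * 'X ^+ i)%:P * Uv ^+ j).
  by have := hp 0%N; rewrite expr0 mulr1.
elim/poly_ind: p => [|p a IHp] i; first by rewrite mul0r polyC0 mul0r.
rewrite mulrDl polyCD mulrDl -mulrA -exprS; apply: (PD _ _) => //.
by rewrite polyCM polyC_exp; apply: PX.
Qed.

Lemma combD P Q P' Q' : comb P Q + comb P' Q' = comb (fun i => P i + P' i) (fun i => Q i + Q' i).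
Proof.
rewrite /comb !rmorphD /=; move: bb ba bc' bc'' bd V => *; ring.
Qed.

Let sel (i : nat) (P : F7yu) (k : nat) := if k == i then P else 0.

Lemma comb_single i P : (i < 6)%N -> comb (sel i P) (fun=> 0) = ev cst D1 D2 P * nth 0 x6 i.
Proof.
move=> i6; rewrite /comb /sel !rmorph0 !mul0r addr0 addr0.
case: i i6 => [|[|[|[|[|[|i]]]]]] i6; last exact: (False_ind _ (notF i6));
  rewrite !eqxx ?[_ == _]/= ?rmorph0 ?mul0r ?addr0 ?add0r; exact: erefl.
Qed.

Lemma comb_single' i P : (i < 2)%N -> comb (fun=> 0) (sel i P) = ev cst C V P * nth 0 z2 i.
Proof.
move=> i2; rewrite /comb /sel !rmorph0 !mul0r !add0r.
case: i i2 => [|[|i]] i2; last exact: (False_ind _ (notF i2));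
  rewrite !eqxx ?[_ == _]/= ?rmorph0 ?mul0r ?addr0 ?add0r; exact: erefl.
Qed.

Lemma comb_split P Q : comb P Q =
  comb (sel 0 (P 0)) (fun=> 0) + comb (sel 1 (P 1)) (fun=> 0) + comb (sel 2 (P 2)) (fun=> 0)
  + comb (sel 3 (P 3)) (fun=> 0) + comb (sel 4 (P 4)) (fun=> 0) + comb (sel 5 (P 5)) (fun=> 0)
  + (comb (fun=> 0) (sel 0 (Q 0)) + comb (fun=> 0) (sel 1 (Q 1))).
Proof.
by rewrite !comb_single // !comb_single'.
Qed.

(** [Phi] works in one degree at a time, so membership in the image has to be checked on homogeneous
    elements; monomial coefficients on single generators supply enough of them. *)
Lemma comb_homog_ind (Im : HBE -> Prop) : (forall r s, Im r -> Im s -> Im (r + s)) ->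
  (forall n P Q, homogeneous n (comb P Q) -> Im (comb P Q)) ->
  forall P Q, Im (comb P Q).
Proof.
move=> ID IH P Q.
have c0 : comb (fun=> 0) (fun=> 0) = 0.
  by rewrite /comb !rmorph0 !mul0r !addr0.
have I0 : Im 0 by rewrite -c0; apply: (IH 0%N); rewrite c0; apply: homog0.
have hx i R : (i < 6)%N -> Im (comb (sel i R) (fun=> 0)).
  move=> i6; rewrite comb_single //; move: R; apply: F7yu_ind.
  - by rewrite rmorph0 mul0r.
  - by move=> R1 R2 h1 h2; rewrite rmorphD mulrDl; apply: ID.
  - move=> a k l; rewrite -comb_single //; have [n hn] := homog_x6 i6.
    apply: (IH (k * 84 + l * 96 + n)%N); rewrite comb_single // !rmorphM !rmorphXn /= evC evY evU.
    by apply: homogM => //; apply: homogM; [apply: homogZ|]; apply: homogX;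
      [exact: homog_D1|exact: homog_D2].
have hz i R : (i < 2)%N -> Im (comb (fun=> 0) (sel i R)).
  move=> i6; rewrite comb_single' //; move: R; apply: F7yu_ind.
  - by rewrite rmorph0 mul0r.
  - by move=> R1 R2 h1 h2; rewrite rmorphD mulrDl; apply: ID.
  - move=> a k l; rewrite -comb_single' //; have [n hn] := homog_z2 i6.
    apply: (IH (k * 12 + l * 84 + n)%N); rewrite comb_single' // !rmorphM !rmorphXn /= evC evY evU.
    by apply: homogM => //; apply: homogM; [apply: homogZ|]; apply: homogX;
      [exact: homog_C|exact: homog_V].
rewrite comb_split; apply: (ID _ _ _ (ID _ _ (hz 0 _ isT) (hz 1 _ isT))).
exact: (ID _ _ (ID _ _ (ID _ _ (ID _ _ (ID _ _ (hx 0 _ isT) (hx 1 _ isT)) (hx 2 _ isT))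
  (hx 3 _ isT)) (hx 4 _ isT)) (hx 5 _ isT)).
Qed.
End HomogeneousSpan.

(** * Invariance of the span under 6S3 *)

Section CombInvariance.

(* Both kinds of monomial automorphisms act on y1, y2, v through signs. *)
Lemma comb_fixed (f : {rmorphism HBE -> HBE}) P Q : f C = C -> f V = V ->
  f bb = bb -> f (ba ^+ 2) = ba ^+ 2 -> f bc' = bc' -> f (ba * bd) = ba * bd ->
  f (comb P Q) = comb P Q.
Proof.
move=> fC fV fb fa fc fad.
have fD1 : f D1 = D1 by rewrite /D1 rmorphD rmorphXn fC fV.
have fD2 : f D2 = D2 by rewrite /D2 rmorphM fC fV.
have fc2 : f bc'' = bc'' by rewrite /bc'' rmorphB fa rmorphM rmorph_nat fc.
have fDA R : f (ev cst D1 D2 R) = ev cst D1 D2 R by rewrite (rmorph_ev cst cst) fD1 fD2.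
have fCA R : f (ev cst C V R) = ev cst C V R by rewrite (rmorph_ev cst cst) fC fV.
by rewrite /comb rmorph_comb -(rmorphXn f 2 ba) -(rmorphM f ba) !fDA !fCA fb fa fc fV fc2 fad mulr1.
Qed.

Lemma signed_gens (T : comNzRingType) (s t x1 x2 w : T) : s ^+ 3 = t ^+ 3 -> s ^+ 6 = 1 ->
  [/\ s * x1 * (t * x2) * (s * t * w) ^+ 2 = x1 * x2 * w ^+ 2,
      ((s * x1) ^+ 3 + (t * x2) ^+ 3) ^+ 2 = (x1 ^+ 3 + x2 ^+ 3) ^+ 2,
      (s * x1) ^+ 3 * (t * x2) ^+ 3 = x1 ^+ 3 * x2 ^+ 3
    & ((s * x1) ^+ 3 + (t * x2) ^+ 3) * (((s * x1) ^+ 3 - (t * x2) ^+ 3) * (s * t * w) ^+ 3) =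
      (x1 ^+ 3 + x2 ^+ 3) * ((x1 ^+ 3 - x2 ^+ 3) * w ^+ 3)].
Proof.
move=> st s6; have e6 : s ^+ 3 * s ^+ 3 = 1 by rewrite -exprD.
rewrite !exprMn -!st; split.
- transitivity (s ^+ 3 * t ^+ 3 * (x1 * x2 * w ^+ 2)); first by ring.
  by rewrite -st e6 mul1r.
- transitivity (s ^+ 3 * s ^+ 3 * (x1 ^+ 3 + x2 ^+ 3) ^+ 2); first by ring.
  by rewrite e6 mul1r.
- by rewrite mulrACA e6 mul1r.
- transitivity ((s ^+ 3 * s ^+ 3) * (s ^+ 3 * s ^+ 3) *
    ((x1 ^+ 3 + x2 ^+ 3) * ((x1 ^+ 3 - x2 ^+ 3) * w ^+ 3))); first by ring.
  by rewrite e6 !mul1r.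
Qed.

Lemma gd_comb l m (l6 : l ^+ 6 = 1) (m6 : m ^+ 6 = 1) P Q : cube_pair l m ->
  gd l6 m6 (comb P Q) = comb P Q.
Proof.
case/andP=> /eqP lm _; have st : cst l ^+ 3 = cst m ^+ 3 by rewrite -!rmorphXn lm.
have s6 : cst l ^+ 6 = 1 by rewrite -rmorphXn l6 rmorph1.
have t6 : cst m ^+ 6 = 1 by rewrite -rmorphXn m6 rmorph1.
have [h1 h2 h3 h4] := signed_gens y1 y2 v st s6.
have [g1 g2 g3 g4 g5] := rmorph_gens (gd l6 m6) y1 y2 C v.
rewrite -/bb -/ba -/bd -/bc' /= gd_y1 gd_y2 gd_v gd_C ?(rmorphM cst) in g1 g2 g3 g4.
apply: (comb_fixed (f := gd l6 m6)).
- exact: gd_C.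
- by rewrite /V rmorphXn /= gd_v exprMn rmorphM exprMn s6 t6 !mul1r.
- by rewrite /= g1 h1.
- by rewrite rmorphXn /= g2 h2.
- by rewrite /= g4 h3.
- by rewrite rmorphM /= g2 g3 h4.
Qed.

Lemma gs_comb P Q : gs (comb P Q) = comb P Q.
Proof.
have [g1 g2 g3 g4 g5] := rmorph_gens gs y1 y2 C v.
rewrite -/bb -/ba -/bd -/bc' /= gs_y1 gs_y2 gs_v gs_C in g1 g2 g3 g4.
apply: (comb_fixed (f := gs)).
- exact: gs_C.
- rewrite /V rmorphXn /= gs_v; move: v => w; ring.
- rewrite /= g1 /bb; move: y1 y2 v => *; ring.
- by rewrite rmorphXn /= g2 addrC.
- by rewrite /= g4 mulrC.
- rewrite rmorphM /= g2 g3 /ba /bd; move: y1 y2 v => *; ring.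
Qed.

(** V is not a zero divisor: it restricts to v^6 on every A_i, and these restrictions detect
    [HBE]. *)
Lemma V_cancel z : V * z = bb ^+ 3 <-> z = y1 ^+ 3 * y2 ^+ 3.
Proof.
have E : bb ^+ 3 = V * (y1 ^+ 3 * y2 ^+ 3).
  rewrite /bb /V; move: y1 y2 v => *; ring.
split=> [|->]; last by rewrite E.
rewrite E => Ez; apply: psi_eq => i; apply: (mulfI (expf_neq0 6 Uv0)).
by have := congr1 (psi i) Ez; rewrite !(rmorphM (psi i) V) /= psi_V.
Qed.
End CombInvariance.

(** * Cohomology classes of E as elements of HBE *)

Section PhiBasics.
Variables (gT : finGroupType) (E : {group gT}) (Phi : nat -> cochain gT -> HBE).
Hypothesis iso : graded_ring_iso E Phi.
Implicit Types (F : coch gT) (f : cochain gT).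

Lemma Phi_homog n F : Z E n F -> homogeneous n (Phi n (tot F)).
Proof. by case: iso => h _ _ _ _ /cocycle_tot/h. Qed.

Lemma PhiD n F F' : Z E n F -> Z E n F' ->
  Phi n (tot (F + F')) = Phi n (tot F) + Phi n (tot F').
Proof.
move=> zF zF'; case: iso => _ h _ _ _; rewrite totDE.
by apply: h; apply: cocycle_tot.
Qed.

Lemma PhiM n m F F' : Z E n F -> Z E m F' ->
  Phi (n + m)%N (tot (F * F')) = Phi n (tot F) * Phi m (tot F').
Proof.
move=> zF zF'; case: iso => _ _ [_ h] _ _; rewrite (@tot_mul_hom _ n); last by case: zF.
by apply: h; apply: cocycle_tot.
Qed.

Lemma Phi_eq0 n F : Z E n F -> (Phi n (tot F) = 0 <-> pnil E n F).
Proof.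
move=> zF; case: iso => _ _ _ h _; have [h1 h2] := h n _ (cocycle_tot zF).
have [g1 g2] := in_p_nilP zF.
by split=> [/h1/g1|/g2/h2].
Qed.

Lemma nil0 n : nil_class E n 0.
Proof. by exists 1%N; rewrite expr1 mul1n; apply: cob0. Qed.

Lemma nul_pnil n F : nul E n F -> pnil E n F.
Proof.
case=> F1 zF1 cF; exists F1, 0; split=> //; [exact: Z0|exact: nil0|by rewrite subr0].
Qed.

Lemma Phi_nul n F : nul E n F -> Phi n (tot F) = 0.
Proof. by move=> nF; apply/(Phi_eq0 (nul_Z nF)); apply: nul_pnil. Qed.

Lemma Phi0 n : Phi n (tot 0) = 0. Proof. by apply: Phi_nul; apply: nul0. Qed.

Lemma PhiN n F : Z E n F -> Phi n (tot (- F)) = - Phi n (tot F).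
Proof.
move=> zF; apply: (addrI (Phi n (tot F))); rewrite -PhiD //; last exact: ZN.
by rewrite !subrr Phi0.
Qed.

Lemma PhiB n F F' : Z E n F -> Z E n F' ->
  Phi n (tot (F - F')) = Phi n (tot F) - Phi n (tot F').
Proof. by move=> zF zF'; rewrite PhiD ?PhiN //; apply: ZN. Qed.

Lemma PhiMn n F k : Z E n F -> Phi n (tot (F *+ k)) = Phi n (tot F) *+ k.
Proof.
move=> zF; elim: k => [|k IHk]; first by rewrite !mulr0n Phi0.
by rewrite !mulrS PhiD ?IHk //; apply: ZMn.
Qed.

Lemma Phi_cob n F F' : Z E n F -> Z E n F' -> cob E n (F - F') ->
  Phi n (tot F) = Phi n (tot F').
Proof.
move=> zF zF' cF; apply/eqP; rewrite -subr_eq0 -PhiB //; apply/eqP.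
by apply: Phi_nul; apply: nul_cob.
Qed.

(** [Phi] takes functions on all sequences, so agreement on simplices of [E] does not make its
    arguments equal. The difference is a cocycle in the ideal, and additivity of [Phi] concludes. *)
Lemma Phi_ext n f F : cocycle E n f -> Z E n F ->
  (forall s, simplex E n s -> f s = tot F s) -> Phi n f = Phi n (tot F).
Proof.
move=> cf zF fF; case: iso => _ hD _ h0 _.
pose g s := f s - tot F s.
have cg : cocycle E n g.
  have [cf1 cf2] := cf; have [ct1 ct2] := cocycle_tot zF.
  split=> [x s xE sE|s sE]; first by rewrite /g cf1 // ct1.
  by rewrite /g cobordB cf2 // ct2 // subrr.
have -> : f = fun s => g s + tot F s by apply: funext => s; rewrite /g subrK.
rewrite hD //; last exact: cocycle_tot.
suff -> : Phi n g = 0 by rewrite add0r.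
have [_ h] := h0 n g cg; apply: h; exists (tot 0), (tot 0); split; try exact/cocycle_tot/Z0.
  exists 1%N; apply: (cob_coboundary (cob0 E (1 * n))) => s sE.
  by rewrite /= /cup tot0 mul0r tot0.
apply: (cob_coboundary (cob0 E n)) => s sE.
by rewrite /g fF // !tot0 mulr0 !subrr.
Qed.

Lemma Phi1 : Phi 0 (tot 1) = 1.
Proof.
have [_ _ [h _] _ _] := iso; rewrite -h; symmetry; apply: Phi_ext; last 1 first.
- by move=> s /andP[/eqP Es _]; rewrite tot1 Es.
- split=> // s /andP[/eqP Es _]; rewrite /cobord Es !big_ord_recl big_ord0 /=.
  by rewrite expr0 expr1 !mulr1 addr0 subrr.
- exact: Z1.
Qed.

Lemma PhiX n F k : Z E n F -> Phi (k * n) (tot (F ^+ k)) = Phi n (tot F) ^+ k.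
Proof.
move=> zF; elim: k => [|k IHk]; first exact: Phi1.
by rewrite mulSn !exprS PhiM ?IHk //; apply: ZX.
Qed.

Lemma Phi_surj n r : homogeneous n r -> exists2 F, Z E n F & Phi n (tot F) = r.
Proof.
case: iso => _ _ _ _ h /h[f cf <-]; exists (extend E n f); first exact: Z_extend.
symmetry; apply: Phi_ext => //; first exact: Z_extend.
by move=> s sE; rewrite extend_simplex.
Qed.

(** The generators of [HBE] all have even degree. *)
Lemma Phi_odd k F : Z E k.*2.+1 F -> Phi k.*2.+1 (tot F) = 0.
Proof.
move=> /Phi_homog[q [-> hq]].
suff -> : q = 0 by rewrite rmorph0.
apply/eqP; rewrite -msupp_eq0; case E0: (msupp q) => [//|m s].
have := hq m; rewrite E0 mem_head => /(_ isT).
by rewrite /HBE_deg !big_ord_recl big_ord0 /=; lia.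
Qed.

End PhiBasics.

Section Conjugation.
Variables (gT : finGroupType) (G E : {group gT}) (e1 e2 c : gT) (Phi : nat -> cochain gT -> HBE).
Hypotheses (hE : extraspecial7 E e1 e2 c) (iso : graded_ring_iso E Phi) (eqv : Out_equivariant E e1 e2 c Phi).
Implicit Types (F : coch gT) (f : cochain gT).

Lemma cocycle_ext n f F : Z E n F -> (forall s, simplex E n s -> tot F s = f s) ->
  cocycle E n f.
Proof.
move=> zF Ff; have [c1 c2] := cocycle_tot zF; split=> [x s xE sE|s sE].
  rewrite -!Ff ?c1 //; case/andP: sE => Es /allP sE; apply/andP; split.
    by rewrite size_map.
  by apply/allP => _ /mapP[y /sE yE ->]; apply: groupM.
by rewrite -(tot_restrict_d Ff sE) tot_d c2.
Qed.

Lemma Z_pull k p F : equivar E p -> Z E k F -> Z E k (pull p F).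
Proof.
move=> ep [iF hF dF]; split; [exact: inv_pull|exact: homp_pull|].
by rewrite -pull_d dF rmorph0.
Qed.

(** Conjugating all vertices differs from [act n^-1] by the right translation by n, which is
    E-equivariant and hence homotopic to the identity. *)
Lemma Phi_conj n g k F q : n \in 'N_G(E)%g -> out_matrix e1 e2 c (fun e => e ^ n)%g g ->
  Z E k F -> Phi k (tot F) = cl q ->
  Phi k (tot (act n^-1%g F)) = evalHBE (gstar g) q.
Proof.
move=> nN hout zF Fq; have nNE : n \in 'N(E)%g by case/setIP: nN.
have nE' : (E :^ n^-1)%G = E by apply/val_inj/normP; rewrite groupV.
have zA F' : Z E k F' -> Z E k (act n^-1%g F') by move=> /(Z_act n^-1%g); rewrite nE'.
pose p y := (y * n)%g.
have ep : equivar E p by move=> h y _; rewrite /p mulgA.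
pose H := act n^-1%g (pull p F).
have zH : Z E k H by apply: zA; apply: Z_pull.
have -> : Phi k (tot (act n^-1%g F)) = Phi k (tot H).
  apply: (Phi_cob iso) => //; first exact: zA.
  rewrite /H -rmorphB /= -nE'; apply: cob_act.
  have EF : pull id F = F.
    by apply: tot_inj; apply: funext => s; rewrite tot_pull map_id.
  by have := pull_homotopy ep (@equivar_id _ E) zF; rewrite EF.
have e1E' : forall y, y \in E -> conj_aut E n y = (y ^ n)%g.
  by move=> y yE; rewrite norm_conj_autE.
have Hf s : simplex E k s -> tot H s = tot F (map (conj_aut E n) s).
  case/andP=> _ /allP sE; rewrite tot_act tot_pull -map_comp; congr tot.
  by apply/eq_in_map => y /sE yE; rewrite /= e1E' // /p conjgE mulgA.
rewrite -(Phi_ext iso (cocycle_ext zH Hf) zH); last by move=> s /Hf.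
apply: (eqv (g := g)) => //; last exact: cocycle_tot.
  by rewrite (subsetP (Aut_conj_aut E 'N(E)%g)) // mem_morphim // inE.
by case: hout => h1 h2; split; rewrite e1E' ?(e1E hE) ?(e2E hE).
Qed.
End Conjugation.

Lemma sum4 (T : nmodType) (F : 'I_4 -> T) : \sum_i F i =
  F (inord 0) + F (inord 1) + F (inord 2) + F (inord 3).
Proof.
rewrite !big_ord_recl big_ord0 addr0 !addrA.
by congr (F _ + F _ + F _ + F _); apply: val_inj; rewrite /= inordK.
Qed.

Lemma homog_ind n (P : HBE -> Prop) : P 0 -> (forall r s, P r -> P s -> P (r + s)) ->
  (forall a i j k l, (2 * i + 2 * j + 12 * k + 14 * l = n)%N ->
     P (cst a * v ^+ l * (y1 ^+ i * y2 ^+ j * C ^+ k))) ->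
  forall r, homogeneous n r -> P r.
Proof.
move=> P0 PD PX r [q [-> hq]].
rewrite [q]mpolyE rmorph_sum big_seq_cond; apply: (big_ind P) => // m.
rewrite andbT => /hq hm.
rewrite -mul_mpolyC rmorphM /= -/(cst _) mpolyXE_id; set p0 := mcoeff _ _.
rewrite prod4 !rmorphM !rmorphXn /= -/y1 -/y2 -/C -/v.
have -> : cst p0 * (y1 ^+ m (inord 0) * y2 ^+ m (inord 1) * C ^+ m (inord 2) * v ^+ m (inord 3)) =
  cst p0 * v ^+ m (inord 3) * (y1 ^+ m (inord 0) * y2 ^+ m (inord 1) * C ^+ m (inord 2)) by ring.
apply: PX; rewrite -hm /HBE_deg (sum4 (fun i : 'I_4 => (nth 0 [:: 2; 2; 12; 14] i * m i)%N)).
by rewrite !inordK.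
Qed.

Lemma homog2 r : homogeneous 2 r -> exists a b, r = cst a * y1 + cst b * y2.
Proof.
move: r; apply: homog_ind.
- by exists 0, 0; rewrite rmorph0 !mul0r addr0.
- move=> r s [a [b ->]] [a' [b' ->]]; exists (a + a'), (b + b').
  by rewrite !rmorphD !mulrDl addrACA.
- move=> a i j k l E.
  have [k0 l0] : k = 0%N /\ l = 0%N by lia.
  have : (i = 1 /\ j = 0 \/ i = 0 /\ j = 1)%N by lia.
  rewrite k0 l0 !expr0 !mulr1 => -[[-> ->]|[-> ->]].
    by exists a, 0; rewrite rmorph0 mul0r addr0 expr0 mulr1.
  by exists 0, a; rewrite rmorph0 mul0r add0r expr0 mul1r.
Qed.

Lemma lin_y12_inj a b a' b' : cst a * y1 + cst b * y2 = cst a' * y1 + cst b' * y2 ->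
  a = a' /\ b = b'.
Proof.
have hc i e : psi i (cst e) = kS e by exact: (F7_rmorph_eq (psi i \o cst) kS).
have inj e e' : kS e * Yv = kS e' * Yv -> e = e'.
  by move=> /(mulIf Yv0)/polyC_inj/polyC_inj.
have hp i e f : psi i (cst e * y1 + cst f * y2) = kS e * (kS (pt1 i) * Yv) + kS f * (kS (pt2 i) * Yv).
  by rewrite rmorphD (rmorphM _ (cst e)) (rmorphM _ (cst f)) /= !hc psi_y1 psi_y2.
have e0 (T : comNzRingType) (x z y : T) : x * (0 * y) + z * (1 * y) = z * y by ring.
have e1 (T : comNzRingType) (x z y : T) : x * (1 * y) + z * (0 * y) = x * y by ring.
have hN e f : psi None (cst e * y1 + cst f * y2) = kS f * Yv.
  by rewrite hp /pt1 /pt2 rmorph0 rmorph1; apply: e0.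
have h0 e f : psi (Some 0) (cst e * y1 + cst f * y2) = kS e * Yv.
  by rewrite hp /pt1 /pt2 rmorph0 rmorph1; apply: e1.
move=> E; split; apply: inj.
  by rewrite -(h0 a b) E h0.
by rewrite -(hN a b) E hN.
Qed.

(** The data of the rank two theory in one record: s, t is a basis and chiY, chiU the dual one. *)
Record coords (gT : finGroupType) (A : {group gT}) (s t : gT)
    (chiY Y chiU U : gT -> 'F_7) : Prop := Coords {
  coY : qchar A chiY Y; coU : qchar A chiU U;
  cos : s \in A; coYs : chiY s = 1; coUs : chiU s = 0;
  cot : t \in A; coYt : chiY t = 0; coUt : chiU t = 1;
  coI : forall a, a \in A -> chiY a = 0 -> chiU a = 0 -> a = 1%g }.

Section Coordinates.
Variables (gT : finGroupType) (A : {group gT}) (s t : gT) (chiY Y chiU U : gT -> 'F_7).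
Hypothesis co : coords A s t chiY Y chiU U.

Let a1 := coY co. Let a2 := coU co. Let a3 := cos co. Let a4 := coYs co. Let a5 := coUs co.
Let a6 := cot co. Let a7 := coYt co. Let a8 := coUt co. Let a9 := coI co.

Lemma co_ex (T : comNzRingType) (yT uT : T) k F : Z A k.*2 F -> exists P, reps A Y U yT uT k F P.
Proof. exact: (reps_ex a1 a2 a3 a4 a5 a6 a8 a9). Qed.

Lemma co_uniq (T : comNzRingType) (yT uT : T) k F P : 7%:R = 0 :> T ->
  reps A Y U yT uT k F P -> nul A k.*2 F -> P = 0.
Proof. by move=> T7; apply: (reps_uniq a1 a2 a3 a4 a5 a6 a7 a8 a9 T7). Qed.

Lemma co_inj (T : comNzRingType) (yT uT : T) k F F' P P' : 7%:R = 0 :> T ->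
  reps A Y U yT uT k F P -> reps A Y U yT uT k F' P' -> nul A k.*2 (F - F') -> P = P'.
Proof. by move=> T7; apply: (reps_inj a1 a2 a3 a4 a5 a6 a7 a8 a9 T7). Qed.

(** Nilpotent classes restrict to nilpotent elements of a domain, so the polynomial of a class of E
    on A depends only on its image in [HBE]. *)
Lemma pnil_reps (E : {group gT}) (T : idomainType) (yT uT : T) k F P : 7%:R = 0 :> T ->
  A \subset E -> pnil E k.*2 F -> reps A Y U yT uT k F P -> P = 0.
Proof.
move=> T7 sAE [G [N [zG zN [m cN] cF]]] rF.
have [Q rN] := co_ex yT uT (ZS sAE zN).
have nFN : nul A k.*2 (F - N).
  apply: (nulS sAE); rewrite -(subrK (G *+ 7) (F - N)).
  by apply: nulD; [apply: nul_cob; rewrite addrAC|exact: nul7].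
rewrite (co_inj T7 rF rN nFN).
have rNm := repsX a1 a2 m rN.
have : Q ^+ m = 0.
  apply: (co_uniq T7 rNm).
  by apply: nul_cob; apply: (cobS sAE); rewrite doubleMr.
by move/eqP; rewrite expf_eq0 => /andP[_ /eqP].
Qed.
End Coordinates.

Lemma co_A (gT : finGroupType) (E : {group gT}) (e1 e2 c : gT) i : extraspecial7 E e1 e2 c ->
  exists chiY Y chiU U, coords (A_ e1 e2 c i) (a_ e1 e2 i) c chiY Y chiU U.
Proof.
move=> hE; have [chiY [Y [chiU [U [qY qU [Ya Yc] [Ua Uc] inj]]]]] := A_chars hE i.
by exists chiY, Y, chiU, U; split=> //; [apply: a_A|apply: c_A].
Qed.

Lemma char_A (gT : finGroupType) (e1 e2 c : gT) i chiY Y chiU U chi y h :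
  qchar (A_ e1 e2 c i) chi y -> coords (A_ e1 e2 c i) (a_ e1 e2 i) c chiY Y chiU U ->
  h \in A_ e1 e2 c i -> chi h = chi (a_ e1 e2 i) * chiY h + chi c * chiU h.
Proof.
move=> qy co hA.
rewrite {1}(A_word (coY co) (coU co) (coYs co) (coYt co) (coUs co) (coUt co) (coI co) hA).
rewrite (qcharM qy) ?groupX ?(cos co) ?(cot co) // !(qcharX _ qy) ?(cos co) ?(cot co) //.
by rewrite addrC -!(mulr_natr (chi _)) !natr_Zp.
Qed.

Lemma mulrn_F7 (T : nzRingType) (k : {rmorphism 'F_7 -> T}) (a : 'F_7) (x : T) :
  x *+ a = k a * x.
Proof. by rewrite -{2}[a]natr_Zp rmorph_nat mulr_natl. Qed.

(** * Bockstein classes of E *)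

Section BetaClasses.
Variables (gT : finGroupType) (G E : {group gT}) (e1 e2 c : gT) (Phi : nat -> cochain gT -> HBE).
Hypotheses (hE : extraspecial7 E e1 e2 c)
  (hW : forall g : {'GL_2['F_7]}, W_E G E e1 e2 c (GLval g) <-> g \in W_6S3)
  (iso : graded_ring_iso E Phi) (eqv : Out_equivariant E e1 e2 c Phi).
Variables (ep1 Ep1 ep2 Ep2 : gT -> 'F_7).
Hypotheses (q1 : qchar E ep1 Ep1) (q2 : qchar E ep2 Ep2)
  (E11 : ep1 e1 = 1) (E12 : ep1 e2 = 0) (E21 : ep2 e1 = 0) (E22 : ep2 e2 = 1)
  (Ec : forall x, x \in E -> ep1 x = 0 -> ep2 x = 0 -> x \in <[c]>%g).

Lemma Phi_beta_lin chi y chi1 z1 chi2 z2 (a b : 'F_7) :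
  qchar E chi y -> qchar E chi1 z1 -> qchar E chi2 z2 ->
  (forall h, h \in E -> chi h = a * chi1 h + b * chi2 h) ->
  Phi 2 (tot (beta y)) = cst a * Phi 2 (tot (beta z1)) + cst b * Phi 2 (tot (beta z2)).
Proof.
move=> qy p1 p2 h.
have hl : cob E 2 (beta y - (beta z1 *+ a + beta z2 *+ b)).
  by apply: (beta_lin qy p1 p2) => x xE; rewrite !natr_Zp h.
have zy := Z_beta qy; have w1 := Z_beta p1; have w2 := Z_beta p2.
have w1a : Z E 2 (beta z1 *+ a) by exact: ZMn.
have w2b : Z E 2 (beta z2 *+ b) by exact: ZMn.
rewrite (Phi_cob iso zy (ZD w1a w2b) hl) (PhiD iso w1a w2b) !(PhiMn iso) //.
by rewrite !(mulrn_F7 cst).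
Qed.

Let B1 := Phi 2 (tot (beta Ep1)).

Lemma Phi_beta_conj n (g : 'M['F_7]_2) q : n \in 'N_G(E)%g ->
  out_matrix e1 e2 c (fun e => e ^ n)%g g -> B1 = cl q ->
  evalHBE (gstar g) q = cst (g 0 0) * B1 + cst (g 0 1) * Phi 2 (tot (beta Ep2)).
Proof.
move=> nN hg Eq; rewrite -(Phi_conj hE iso eqv nN hg (Z_beta q1) Eq) act_beta.
apply: (Phi_beta_lin (qchar_conj nN q1) q1 q2) => x xE.
by have [-> _] := out_ep hE q1 q2 E11 E12 E21 E22 Ec hg nN xE.
Qed.

(** Equivariance under diag(2, 1) excludes a y2-part in the class of [Ep1], and the swap gives the
    class of [Ep2] the same scalar. The scalar is not 0 because the class of [Ep1] restricts to y on
    A_0. *)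
Lemma Phi_beta : exists2 lam, lam != 0 & forall chi y, qchar E chi y ->
  Phi 2 (tot (beta y)) = cst lam * (cst (chi e1) * y1 + cst (chi e2) * y2).
Proof.
have [a [b]] := homog2 (Phi_homog iso (Z_beta q1)); rewrite -/B1 => EB.
have [q Eq] := cl_surj B1.
have c2 : (2 : 'F_7) ^+ 3 = 1 by exact: val_inj.
have [n nN hn] := diag_lift hW c2 (expr1n _ 3).
have u2 : (2 : 'F_7) ^+ 6 = 1 by exact: val_inj.
have u1 : (1 : 'F_7) ^+ 6 = 1 by exact: val_inj.
have gc s t (s6 : s ^+ 6 = 1) (t6 : t ^+ 6 = 1) e : gd s6 t6 (cst e) = cst e.
  exact: (F7_rmorph_eq (gd s6 t6 \o cst)).
have gE s t (s6 : s ^+ 6 = 1) (t6 : t ^+ 6 = 1) : gd s6 t6 B1 = cst (a * s) * y1 + cst (b * t) * y2.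
  by rewrite EB rmorphD (rmorphM _ (cst a)) (rmorphM _ (cst b)) /= !gc gd_y1 gd_y2 !mulrA -!rmorphM.
have b0 : b = 0.
  have := Phi_beta_conj nN hn Eq; rewrite (gstar_diag u2 u1) -Eq gE diag2E !mxE /=.
  rewrite rmorph0 mul0r addr0 EB (mulrDr (cst 2)) (mulrA (cst 2) (cst a)) (mulrA (cst 2) (cst b)) -!(rmorphM cst) mulr1 => /lin_y12_inj[_ Eb].
  by apply/esym/(addrI b); rewrite addr0 {1}Eb mulr_natl mulr2n.
have {}EB : B1 = cst a * y1 by rewrite EB b0 rmorph0 mul0r addr0.
have [m mN hm] := swap_lift hW.
have EB2 : Phi 2 (tot (beta Ep2)) = cst a * y2.
  have := Phi_beta_conj mN hm Eq; rewrite (_ : swap2 = anti2 1 1); last by rewrite swap2E.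
  rewrite (gstar_anti u1 u1) -Eq gE !mxE /= b0 mul0r rmorph0 mul0r addr0 rmorph1 mul0r add0r mul1r mulr1.
  move=> <-; rewrite (rmorphM gs) /= gs_y1; congr (_ * _).
  exact: (F7_rmorph_eq (gs \o cst) cst).
have hchi chi y : qchar E chi y ->
    Phi 2 (tot (beta y)) = cst a * (cst (chi e1) * y1 + cst (chi e2) * y2).
  move=> qy; rewrite (Phi_beta_lin (a := chi e1) (b := chi e2) qy q1 q2) => [|x xE].
    by rewrite -/B1 EB EB2 mulrDr !mulrA ![cst a * _]mulrC.
  by rewrite (chi_word hE q1 q2 E11 E12 E21 E22 Ec qy xE) ![_ * chi _]mulrC.
exists a => //; apply/eqP => a0.
have [chiY [Y [chiU [U co]]]] := co_A (Some 0) hE.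
have pB : pnil E 1.*2 (beta Ep1).
  by apply/(Phi_eq0 iso (Z_beta q1)); rewrite (hchi _ _ q1) a0 rmorph0 mul0r.
have sAE := A_sub hE (Some 0).
have rB := @reps_lin _ _ _ _ _ _ (coY co) (coU co) _ Yv Uv ep1 Ep1 1 0 (qcharS sAE q1).
have : (Yv *+ 1 + Uv *+ 0 : F7yu) = 0.
  apply: (pnil_reps co F7yu7 sAE pB); apply: rB => h hA.
  rewrite (char_A (qcharS sAE q1) co hA) (chi_c hE q1) /= expg0 mulg1 E11.
  by rewrite !mul0r.
by move=> /eqP; rewrite addr0 (negPf Yv0).
Qed.
End BetaClasses.

(** * Homogeneous forms in y and u *)

Section RepsForms.
Variables (gT : finGroupType) (A : {group gT}) (s t : gT) (chiY Y chiU U : gT -> 'F_7).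
Hypothesis co : coords A s t chiY Y chiU U.
Notation rp := (reps A Y U Yv Uv).

Lemma reps_form k F P : rp k F P ->
  exists cf : nat -> 'F_7, P = \sum_(j < k.+1) kS (cf j) * Yv ^+ (k - j) * Uv ^+ j.
Proof.
elim=> {k F P} [|k|k F P _ [cf ->]|k F P _ [cf ->]|k F F' P P' _ [cf ->] _ [cf' ->]|k F F' P _ [cf ->] _].
- by exists (fun=> 1); rewrite big_ord1 rmorph1 !mulr1.
- by exists (fun=> 0); rewrite big1 // => j _; rewrite rmorph0 !mul0r.
- exists (fun j => if (j < k.+1)%N then cf j else 0).
  rewrite [RHS]big_ord_recr /= ltnn rmorph0 !mul0r addr0 mulr_sumr; apply: eq_bigr => j _.
  rewrite ltn_ord subSn; last by rewrite -ltnS ltn_ord.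
  by rewrite exprS [kS _ * (Yv * _)]mulrCA -!mulrA.
- exists (fun j => if j is j'.+1 then cf j' else 0).
  rewrite [RHS]big_ord_recl /= rmorph0 !mul0r add0r mulr_sumr; apply: eq_bigr => j _.
  by rewrite subSS exprS [RHS]mulrCA.
- exists (fun j => cf j + cf' j); rewrite -big_split; apply: eq_bigr => j _.
  by rewrite rmorphD !mulrDl.
- by exists cf.
Qed.

Lemma nul_mod7 k F n : (7 %| n)%N -> Z A k F -> nul A k (F *+ n).
Proof. by move=> /dvdnP[q ->] zF; rewrite mulrnA; apply/nul7/ZMn. Qed.

Lemma natF7yu n : n%:R = 0 :> F7yu -> (7 %| n)%N.
Proof.
rewrite -(rmorph_nat kS) => /eqP; rewrite !polyC_eq0.
by rewrite (dvdn_pcharf (pchar_Fp (isT : prime 7))).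
Qed.

(** Converse of [reps_uniq]: at u = 0 the coefficient of y^k is read off, and u cancels in what
    remains. *)
Lemma reps_zero k F : rp k F 0 -> nul A k.*2 F.
Proof.
elim: k F => [|k IH] F rF.
  have [n n0 nF] := reps_decomp (coY co) (coU co) (cos co) (coYs co) (coUs co) (cot co)
    (coYt co) (coUt co) (coI co) rF.
  by rewrite -(subrK n%:R F); apply: nulD => //; apply: nul_mod7 (Z1 A); apply: natF7yu.
have [n [F' [P' [rF' E nF]]]] := reps_decomp (coY co) (coU co) (cos co) (coYs co) (coUs co) (cot co)
    (coYt co) (coUt co) (coI co) rF.
have n7 : (7 %| n)%N.
  have := congr1 (ev kX 'X 0) E; rewrite rmorph0 rmorphD rmorphMn rmorphXn rmorphM /= evY evU.
  rewrite mul0r addr0 -mulr_natr => /esym/eqP; rewrite mulf_eq0 expf_eq0 polyX_eq0 andbF /=.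
  by rewrite -(rmorph_nat kX) polyC_eq0 (dvdn_pcharf (pchar_Fp (isT : prime 7))).
have Y0 : Yv ^+ k.+1 *+ n = 0.
  by have /dvdnP[q ->] := n7; rewrite mulrnA (T7n F7yu7).
have P0 : P' = 0.
  by move/esym/eqP: E; rewrite Y0 add0r mulf_eq0 (negPf Uv0) => /eqP.
rewrite P0 in rF'.
rewrite -(subrK (beta Y ^+ k.+1 *+ n + beta U * F') F); apply: nulD => //; apply: nulD.
  by apply: nul_mod7 => //; apply/ZX2/(Z_beta (coY co)).
by apply: (@nulMl _ _ 2 k.*2) (IH _ rF'); apply: Z_beta (coU co).
Qed.
End RepsForms.

(** Conjugation carries characters to characters and hence acts on forms by a linear
    substitution. *)
Lemma reps_conj (gT : finGroupType) (e1 e2 c x : gT) i (B : {group gT}) s t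
    (chiY Y chiU U chiY' Y' chiU' U' : gT -> 'F_7) k F P :
  coords B s t chiY Y chiU U ->
  coords (A_ e1 e2 c i) (a_ e1 e2 i) c chiY' Y' chiU' U' ->
  A_ e1 e2 c i \subset (B :^ x)%g ->
  reps B Y U Yv Uv k F P ->
  reps (A_ e1 e2 c i) Y' U' Yv Uv k (act x F)
    (lin (chiY (a_ e1 e2 i ^ x^-1)%g) (chiY (c ^ x^-1)%g)
         (chiU (a_ e1 e2 i ^ x^-1)%g) (chiU (c ^ x^-1)%g) P).
Proof.
move=> coB coA sAB rF.
have key chi y : qchar B chi y -> reps (A_ e1 e2 c i) Y' U' Yv Uv 1 (act x (beta y))
    (kS (chi (a_ e1 e2 i ^ x^-1)%g) * Yv + kS (chi (c ^ x^-1)%g) * Uv).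
  move=> qy; rewrite act_beta -!mulrn_F7.
  have qx : qchar (A_ e1 e2 c i) (fun g => chi (g ^ x^-1)%g) (fun g => y (x * g)%g).
    exact: (qcharS (A := (B :^ x)%G) sAB (qchar_act (x := x) qy)).
  apply: (reps_lin (coY coA) (coU coA) _ _ qx) => h hA.
  by rewrite (char_A qx coA hA) !natr_Zp.
apply: (reps_act (phi := lin _ _ _ _) (coY coA) (coU coA) sAB _ _ rF) => /=.
  by rewrite linY; apply: key (coY coB).
by rewrite linU; apply: key (coU coB).
Qed.

(** Minus its value at 0 the polynomial has seven roots but degree below 7. *)
Lemma transl_invariant (p : {poly 'F_7}) : (size p <= 7)%N -> p \Po ('X + 1) = p -> p = (p.[0])%:P.
Proof.
move=> sp hp; have hn (n : nat) : p.[n%:R] = p.[0].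
  elim: n => [//|n IHn]; rewrite -IHn -{2}hp horner_comp hornerD hornerX hornerC.
  by rewrite natr1.
apply/eqP; rewrite -subr_eq0; apply/negPn/negP => nz.
have := max_poly_roots nz (_ : all (root (p - p.[0]%:P)) (enum 'F_7)) (enum_uniq _).
rewrite -cardE card_ord => h.
have : (7 < size (p - (p.[0])%:P)%R)%N.
  apply: h; apply/allP => x _; rewrite rootE hornerD hornerN hornerC.
  by rewrite -[x]natr_Zp hn subrr.
rewrite ltnNge (leq_trans (size_polyD _ _)) // size_polyN geq_max sp.
by rewrite (leq_trans (size_polyC_leq1 _)).
Qed.

(** At y = 1 this concerns polynomials of degree at most 7 invariant under X + 1. Subtracting a
    multiple of the Artin-Schreier polynomial X^7 - X lowers the degree, and [transl_invariant]
    makes the rest constant. *)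
Lemma degree7_invariant (cf : nat -> 'F_7) P :
  P = \sum_(j < 8) kS (cf j) * Yv ^+ (7 - j) * Uv ^+ j -> lin 1 0 1 1 P = P ->
  P = kS (cf 0) * Yv ^+ 7 + kS (cf 7) * th Uv.
Proof.
move=> EP hP; pose p : {poly 'F_7} := \poly_(j < 8) cf j.
have dE Q : ev kX 1 'X (lin 1 0 1 1 Q) = ev kX 1 ('X + 1) Q.
  rewrite /lin (rmorph_ev kS kX) !(rmorphD, rmorphM) /= !evC evY evU.
  by rewrite rmorph0 rmorph1 mul0r addr0 !mul1r [1 + _]addrC.
have pE x : ev kX 1 x P = p \Po x.
  rewrite EP rmorph_sum -ev1_comp /p poly_def rmorph_sum; apply: eq_bigr => j _ /=.
  rewrite !rmorphM !rmorphXn /= evC evY evU expr1n mulr1.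
  by rewrite -mul_polyC rmorphM rmorphXn /= ev1C ev1X.
have hp : p \Po ('X + 1) = p.
  by rewrite -pE -dE hP pE comp_polyXr.
pose r := p - (cf 7)%:P * ('X ^+ 7 - 'X).
have p7 : p`_7 = cf 7 by rewrite coef_poly.
have sr : (size r <= 7)%N.
  apply/leq_sizeP => n; rewrite leq_eqVlt => /orP[/eqP <-|n7].
    by rewrite coefB p7 coefCM coefB coefXn coefX /= subr0 mulr1 subrr.
  rewrite coefB coefCM coefB coefXn coefX coef_poly ltnNge n7 /=.
  by rewrite (gtn_eqF n7) (gtn_eqF (ltn_trans (isT : 1 < 7)%N n7)) subr0 mulr0 subr0.
have hr : r \Po ('X + 1) = r.
  rewrite /r comp_polyB hp comp_polyM comp_polyC comp_polyB comp_polyX rmorphXn /= comp_polyX.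
  have h : 7 \in [pchar {poly 'F_7}].
    by rewrite inE /= -(rmorph_nat kX) pchar_Zp // rmorph0 eqxx.
  rewrite exprDn_pchar ?(pnatE _ (isT : prime 7)) // expr1n; congr (_ - _ * _).
  by rewrite opprD addrACA subrr addr0.
have Er := transl_invariant sr hr.
have Ep : p = (r.[0])%:P + (cf 7)%:P * ('X ^+ 7 - 'X) by rewrite -Er /r subrK.
have cE n : (n < 8)%N -> cf n = (if n == 0 then r.[0] else 0) + cf 7 * ((n == 7)%:R - (n == 1)%:R).
  move=> n8; have : p`_n = cf n by rewrite coef_poly n8.
  by rewrite Ep coefD coefC coefCM coefB coefXn coefX => <-.
have c1 : cf 1 = - cf 7 by rewrite (cE 1 isT) /= mulr0n mulr1n add0r sub0r mulrN mulr1.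
have cz n : (1 < n < 7)%N -> cf n = 0.
  case/andP=> n1 n7; rewrite cE ?(ltn_trans n7) // (gtn_eqF n1) (ltn_eqF n7) (gtn_eqF (ltnW n1)).
  by rewrite subrr mulr0 addr0.
rewrite EP sum8 !inordK // c1 (cz 2) // (cz 3) // (cz 4) // (cz 5) // (cz 6) //.
rewrite (rmorphN kS) (rmorph0 kS) !mul0r !addr0 thU.
have h (T : comNzRingType) (a b x w : T) : a * x ^+ (7 - 0) * w ^+ 0 + - b * x ^+ (7 - 1) * w ^+ 1
    + b * x ^+ (7 - 7) * w ^+ 7 = a * x ^+ 7 + b * (w ^+ 7 - x ^+ 6 * w).
  by rewrite -[(7 - 0)%N]/7%N -[(7 - 1)%N]/6%N -[(7 - 7)%N]/0%N; ring.
exact: h.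
Qed.

(** * The restriction of v to A_i *)

Section ClassV.
Variables (gT : finGroupType) (G E : {group gT}) (e1 e2 c : gT) (Phi : nat -> cochain gT -> HBE).
Hypotheses (hE : extraspecial7 E e1 e2 c)
  (hW : forall g : {'GL_2['F_7]}, W_E G E e1 e2 c (GLval g) <-> g \in W_6S3)
  (iso : graded_ring_iso E Phi) (eqv : Out_equivariant E e1 e2 c Phi).
Variables (ep1 Ep1 ep2 Ep2 : gT -> 'F_7).
Hypotheses (q1 : qchar E ep1 Ep1) (q2 : qchar E ep2 Ep2)
  (E11 : ep1 e1 = 1) (E12 : ep1 e2 = 0) (E21 : ep2 e1 = 0) (E22 : ep2 e2 = 1)
  (Ec : forall x, x \in E -> ep1 x = 0 -> ep2 x = 0 -> x \in <[c]>%g).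
Variables (lam : 'F_7).
Hypotheses (hlam : forall chi y, qchar E chi y ->
  Phi 2 (tot (beta y)) = cst lam * (cst (chi e1) * y1 + cst (chi e2) * y2)).
Variables (i : option 'F_7) (chiY Y chiU U : gT -> 'F_7).
Notation a := (a_ e1 e2 i).
Notation A := (A_ e1 e2 c i).
Hypothesis co : coords A a c chiY Y chiU U.
Notation rp := (reps A Y U Yv Uv).

Let sAE := A_sub hE i.

Lemma conj_fixed_reps k F P y : y \in E -> Z E k.*2 F -> rp k F P ->
  lin (chiY (a ^ y)%g) (chiY (c ^ y)%g) (chiU (a ^ y)%g) (chiU (c ^ y)%g) P = P.
Proof.
move=> yE zF rF; have sAy : A \subset (A :^ y^-1)%g.
  by rewrite (normP _) // (subsetP (normal_norm (A_normal hE i))) // groupV.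
have := reps_conj co co sAy rF; rewrite invgK => r2.
have iF : act y^-1%g F = F by case: zF => iF _ _; apply: iF; rewrite groupV.
rewrite iF in r2; apply: (co_inj co F7yu7 r2 rF); rewrite subrr; exact: nul0.
Qed.

Lemma psi_char chi y : qchar E chi y ->
  psi i (cst (chi e1) * y1 + cst (chi e2) * y2) = kS (chi a) * Yv.
Proof.
move=> qy; have hc e : psi i (cst e) = kS e by exact: (F7_rmorph_eq (psi i \o cst) kS).
rewrite rmorphD (rmorphM _ (cst (chi e1))) (rmorphM _ (cst (chi e2))) /= !hc psi_y1 psi_y2.
rewrite !mulrA -!(rmorphM kS) -mulrDl -(rmorphD kS); congr (kS _ * _).
have [h1 h2] := a_ep hE q1 q2 E11 E12 E21 E22 i.
rewrite (chi_word hE q1 q2 E11 E12 E21 E22 Ec qy (a_E hE i)) h1 h2 /pt1 /pt2.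
by rewrite mulrC [_ * chi e2]mulrC.
Qed.

Variable Fv : coch gT.
Hypotheses (zv : Z E 14 Fv) (Pv : Phi 14 (tot Fv) = v).

(* Otherwise v^2 is divisible by the class of the character with kernel A_i, which
   restricts to 0 on A_i. *)
Lemma v_not_nul : ~ nul A 14 Fv.
Proof.
move=> nv; have cv : cob A 14 Fv.
  exact: (nul_cob2 (coY co) (coU co) (cos co) (coYs co) (coUs co) (cot co) (coUt co) (coI co) (k := 6)).
have [chi [y [qy chib kA]]] := A_kernel hE i.
have kerA g : (g \in A) = (g \in E) && (chi g == 0).
  case: (boolP (g \in E)) => [gE|gE] /=; first by rewrite kA.
  by apply/negP => /(subsetP sAE); apply/negP.
have [w zw cw] := gysin_square qy (b_E hE i) chib kerA (m := 13) zv cv.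
have zb := Z_beta qy.
have Evv : v * v = Phi 2 (tot (beta y)) * Phi 26 (tot w).
  rewrite -Pv -(PhiM iso zv zv) -(PhiM iso zb zw).
  exact: (Phi_cob iso (n := 28) (ZM zv zv) (ZM zb zw) cw).
have a0 : chi a = 0.
  by apply/eqP; rewrite kA ?(a_E hE) // a_A.
have := congr1 (psi i) Evv; rewrite !rmorphM /= psi_v (hlam qy) rmorphM /= (psi_char qy) a0.
rewrite rmorph0 mul0r mulr0 mul0r => /eqP.
by rewrite mulf_eq0 orbb (negPf Uv0).
Qed.

(* Invariance under transvections leaves y^7 and u^7 - y^6 u; conjugation by a lift
   of diag(2, 2) multiplies v by 4, which excludes y^7. *)
Lemma v_reps : exists2 p, p != 0 & rp 7 Fv (kS p * th Uv).
Proof.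
have [P rP] := co_ex co Yv Uv (k := 7) (ZS sAE zv).
have [cf Ecf] := reps_form rP.
have [y yE [cy ay]] := transvection hE i 1.
have {}ay : (a ^ y = a * c)%g by rewrite ay.
have inv1 : lin 1 0 1 1 P = P.
  have := conj_fixed_reps (k := 7) yE zv rP; rewrite cy ay (qcharM (coY co)) ?(cos co) ?groupX ?(cot co) //.
  rewrite (qcharM (coU co)) ?(cos co) ?groupX ?(cot co) // (coYs co) (coUs co) (coYt co) (coUt co).
  by rewrite !addr0 add0r.
have EP := degree7_invariant Ecf inv1.
have c2 : (2 : 'F_7) ^+ 3 = 1 by exact: val_inj.
have u2 : (2 : 'F_7) ^+ 6 = 1 by exact: val_inj.
have [n nN hn] := diag_lift hW c2 c2.
have [q Eq] := cl_surj (Phi 14 (tot Fv)).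
(* 4 is the determinant of diag(2, 2). *)
have Ev4 : Phi 14 (tot (act n^-1%g Fv)) = Phi 14 (tot (Fv *+ 4)).
  rewrite (Phi_conj hE iso eqv nN hn zv Eq) (gstar_diag u2 u2) -Eq Pv gd_v (PhiMn iso) // Pv.
  by rewrite -[RHS]mulr_natl -(rmorph_nat cst); congr (cst _ * v); apply: val_inj.
have ca : (a ^ n)%g \in A /\ chiY (a ^ n)%g = 2.
  have aE := a_E hE i; have anE := NE_conj nN aE.
  have [h1 h2] := out_ep hE q1 q2 E11 E12 E21 E22 Ec hn nN aE.
  have a2E : (a ^+ 2)%g \in E by rewrite groupX.
  have hz : (a ^ n * (a ^+ 2)^-1)%g \in <[c]>%g.
    apply: (ep_eq q1 q2 Ec anE a2E).
      by rewrite h1 (qcharX _ q1) // diag2E !mxE /= mul0r addr0 mulr_natl.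
    by rewrite h2 (qcharX _ q2) // diag2E !mxE /= mul0r add0r mulr_natl.
  case/cycleP: hz => m Em; have -> : (a ^ n = c ^+ m * a ^+ 2)%g by rewrite -Em mulgKV.
  split; first by rewrite groupM ?groupX ?(cos co) ?(cot co).
  rewrite (qcharM (coY co)) ?groupX ?(cos co) ?(cot co) // !(qcharX _ (coY co)) ?(cos co) ?(cot co) //.
  by rewrite (coYt co) (coYs co) mul0rn add0r.
have [can Ya] := ca.
have cc : (c ^ n)%g \in <[c]>%g := c_conj hE nN.
have Yc : chiY (c ^ n)%g = 0.
  by case/cycleP: cc => m ->; rewrite (qcharX _ (coY co)) ?(cot co) // (coYt co) mul0rn.
have EA : (A :^ n)%g = A := A_conj hE nN can.
have sAn : A \subset (A :^ n^-1)%g by rewrite -{2}EA conjsgK.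
have := reps_conj co co sAn rP; rewrite invgK Ya Yc; set ua := chiU _; set uc := chiU _ => r2.
have zE : (E :^ n^-1)%G = E by apply/val_inj/normP; rewrite groupV; case/setIP: nN.
have zn : Z E 14 (act n^-1%g Fv) by rewrite -{1}zE; apply: Z_act.
have zv4 : Z E 14 (Fv *+ 4) by apply: ZMn.
have Elin : lin 2 0 ua uc P = P *+ 4.
  apply/eqP; rewrite -subr_eq0; apply/eqP.
  have r3 : rp 7 (act n^-1%g Fv - Fv *+ 4) (lin 2 0 ua uc P - P *+ 4).
    by apply: (repsB (coY co) (coU co) F7yu7 r2); apply: repsMn.
  apply: (pnil_reps co F7yu7 sAE (E := E) _ r3).
  by apply/(Phi_eq0 iso (ZB zn zv4)); rewrite (PhiB iso) // Ev4 subrr.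
(* At y = 1, u = 0 the v-terms vanish on both sides, and y^7 contributes 2^7 = 2 on the left against
   4 on the right. *)
have cf0 : cf 0 = 0.
  have thU0' : ev kX 1 0 (th Uv) = 0.
    by rewrite thU !(rmorphB, rmorphXn, rmorphM) /= evU expr0n mulr0 subr0.
  have e1' b : ev kX 1 0 (kS b * Yv ^+ 7) = b%:P.
    by rewrite rmorphM rmorphXn /= evC evY expr1n mulr1.
  have c1 e : ev kX 1 0 (kS e) = kX e by rewrite /= evC.
  have ev2 : ev kX 1 0 (kS 2 * Yv + kS 0 * Uv) = kX 2 by rewrite rmorphD !rmorphM /= !evC evY evU mulr1 mulr0 addr0.
  have ev3 : ev kX 1 0 (kS ua * Yv + kS uc * Uv) = kX ua by rewrite rmorphD !rmorphM /= !evC evY evU mulr1 mulr0 addr0.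
  have lth : ev kX 1 0 (lin 2 0 ua uc (th Uv)) = 0.
    rewrite thU !(rmorphB, rmorphXn, rmorphM) /= linY linU ev2 ev3 -!(rmorphXn kX) u2 F7_exp7.
    by rewrite rmorph1 mul1r subrr.
  have lc e : lin 2 0 ua uc (kS e) = kS e by exact: (F7_rmorph_eq (lin 2 0 ua uc \o kS) kS).
  have rE (h : {rmorphism F7yu -> {poly 'F_7}}) r s z w : h (r * s ^+ 7 + z * w) = h r * h s ^+ 7 + h z * h w.
    by rewrite rmorphD (rmorphM h r) (rmorphM h z) (rmorphXn h).
  have := congr1 (ev kX 1 0) Elin; rewrite EP rmorphMn rE.
  rewrite [LHS](rE (ev kX 1 0 \o lin 2 0 ua uc)) /= lth thU0' linY ev2 lc !c1 evY expr1n !mulr0 !addr0 mulr1.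
  rewrite -(rmorphXn kX) F7_exp7 -[RHS]mulr_natr -(rmorph_nat kX) -!(rmorphM kX).
  move/polyC_inj => E4; apply/eqP; have : cf 0 * 2 = 0.
    have : cf 0 * 4 - cf 0 * 2 = 0 by rewrite -E4 subrr.
    by rewrite -mulrBr; have -> : 4 - 2 = 2 :> 'F_7 by exact: val_inj.
  by move/eqP; rewrite mulf_eq0 orbF.
have p0 : cf 7 != 0.
  apply/eqP => p0; apply: v_not_nul; apply: (reps_zero co (k := 7)).
  by have := rP; rewrite EP cf0 p0 rmorph0 !mul0r addr0.
by exists (cf 7) => //; have := rP; rewrite {1}EP cf0 rmorph0 mul0r add0r.
Qed.
End ClassV.

(** * The restriction of all of HBE to A_i *)

Section LinkStep.
Variables (gT : finGroupType) (E A : {group gT}) (Phi : nat -> cochain gT -> HBE).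
Variables (s t : gT) (chiY Y chiU U : gT -> 'F_7).
Hypotheses (iso : graded_ring_iso E Phi) (co : coords A s t chiY Y chiU U) (sAE : A \subset E).
Variable f : {rmorphism HBE -> F7yu}.
Notation rp := (reps A Y U Yv Uv).

(** Compatible with sums and products, so that a ring morphism [f] gives the restriction as soon as
    it is right on the four generators. *)
Definition linked k F r := [/\ Z E k.*2 F, Phi k.*2 (tot F) = r & rp k F (f r)].

Let f_cst a : f (cst a) = kS a. Proof. exact: (F7_rmorph_eq (f \o cst) kS). Qed.

Lemma linkedD k F r F' r' : linked k F r -> linked k F' r' -> linked k (F + F') (r + r').
Proof.
case=> zF <- rF [zF' <- rF']; split; [exact: ZD|exact: (PhiD iso)|].
by rewrite rmorphD; apply: repsD.
Qed.

Lemma linkedM k F r k' F' r' : linked k F r -> linked k' F' r' -> linked (k + k') (F * F') (r * r').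
Proof.
case=> zF <- rF [zF' <- rF']; split; rewrite ?doubleD; [exact: ZM|exact: (PhiM iso)|].
rewrite rmorphM.
exact: (repsM (coY co) (coU co) rF rF').
Qed.

Lemma linkedX k F r n : linked k F r -> linked (n * k) (F ^+ n) (r ^+ n).
Proof.
move=> LF; elim: n => [|n IHn]; last by rewrite mulSn !exprS; apply: linkedM.
by split; [exact: Z1|exact: (Phi1 iso)|rewrite rmorph1; apply: reps1].
Qed.

Lemma linkedZ k F r (a : 'F_7) : linked k F r -> linked k (F *+ a) (cst a * r).
Proof.
case=> zF <- rF; split; [exact: ZMn|by rewrite (PhiMn iso) // (mulrn_F7 cst)|].
by rewrite rmorphM f_cst -(mulrn_F7 kS); apply: repsMn.
Qed.

Variables (F1 F2 FC Fv : coch gT).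
Hypotheses (L1 : linked 1 F1 y1) (L2 : linked 1 F2 y2) (LC : linked 6 FC C) (Lv : linked 7 Fv v).

Lemma linked_ex k r : homogeneous k.*2 r -> exists F, linked k F r.
Proof.
move: r; apply: homog_ind => [|r' s' [F LF] [F' LF']|a i j k' l Ek].
- by exists 0; split; [exact: Z0|exact: (Phi0 iso)|rewrite rmorph0; apply: reps0].
- by exists (F + F'); apply: linkedD.
- have -> : k = (l * 7 + (i * 1 + j * 1 + k' * 6))%N by lia.
  exists ((Fv ^+ l *+ a) * (F1 ^+ i * F2 ^+ j * FC ^+ k')).
  by apply: linkedM; [apply: linkedZ; apply: linkedX|do 2?apply: linkedM; apply: linkedX].
Qed.

(** [F] differs from a linked cochain with the same value under [Phi] by a class in the ideal, which
    restricts to 0 by [pnil_reps]. *)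
Lemma reps_linked k F : Z E k.*2 F -> rp k F (f (Phi k.*2 (tot F))).
Proof.
move=> zF; have [F' [zF' EF' rF']] := linked_ex (Phi_homog iso zF).
have [P rP] := co_ex co Yv Uv (ZS sAE zF).
suff -> : f (Phi k.*2 (tot F)) = P by [].
apply/eqP; rewrite -subr_eq0; apply/eqP.
have r3 := repsB (coY co) (coU co) F7yu7 rF' rP.
apply: (pnil_reps co F7yu7 sAE _ r3).
by apply/(Phi_eq0 iso (ZB zF' zF)); rewrite (PhiB iso) // EF' subrr.
Qed.
End LinkStep.

Section Link.
Variables (gT : finGroupType) (G E : {group gT}) (e1 e2 c : gT) (Phi : nat -> cochain gT -> HBE).
Hypotheses (hE : extraspecial7 E e1 e2 c)
  (hW : forall g : {'GL_2['F_7]}, W_E G E e1 e2 c (GLval g) <-> g \in W_6S3)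
  (iso : graded_ring_iso E Phi) (eqv : Out_equivariant E e1 e2 c Phi).
Variables (ep1 Ep1 ep2 Ep2 : gT -> 'F_7).
Hypotheses (q1 : qchar E ep1 Ep1) (q2 : qchar E ep2 Ep2)
  (E11 : ep1 e1 = 1) (E12 : ep1 e2 = 0) (E21 : ep2 e1 = 0) (E22 : ep2 e2 = 1)
  (Ec : forall x, x \in E -> ep1 x = 0 -> ep2 x = 0 -> x \in <[c]>%g).
Variables (i : option 'F_7) (chiY Y chiU U : gT -> 'F_7).
Notation a := (a_ e1 e2 i).
Notation A := (A_ e1 e2 c i).
Hypothesis co : coords A a c chiY Y chiU U.
Notation rp := (reps A Y U Yv Uv).

(** Restriction up to the scalars that equivariance leaves open: [reps_res] takes for [l] the
    inverse of the Bockstein scalar and for [p] the coefficient from [v_reps]. *)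
Definition res (l p : 'F_7) : HBE -> F7yu := lin l 0 0 p \o th \o psi i.
HB.instance Definition _ l p := GRing.RMorphism.on (res l p).

Let lin_c a1 b1 c1 d1 e : lin a1 b1 c1 d1 (kS e) = kS e.
Proof. exact: (F7_rmorph_eq (lin a1 b1 c1 d1 \o kS) kS). Qed.
Let th_c e : th (kS e) = kS e.
Proof. exact: (F7_rmorph_eq (th \o kS) kS). Qed.

Lemma resE l p : [/\ res l p y1 = kS (pt1 i) * (kS l * Yv), res l p y2 = kS (pt2 i) * (kS l * Yv),
  res l p C = (kS l * Yv) ^+ 6 & res l p v = (kS p * Uv) ^+ 7 - (kS l * Yv) ^+ 6 * (kS p * Uv)].
Proof.
have lY : lin l 0 0 p Yv = kS l * Yv by rewrite linY rmorph0 mul0r addr0.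
have lU : lin l 0 0 p Uv = kS p * Uv by rewrite linU rmorph0 mul0r add0r.
have thM x y : th (x * y) = th x * th y by exact: rmorphM.
have thX x n : th (x ^+ n) = th x ^+ n by exact: rmorphXn.
have lM x y : lin l 0 0 p (x * y) = lin l 0 0 p x * lin l 0 0 p y by exact: rmorphM.
have lX x n : lin l 0 0 p (x ^+ n) = lin l 0 0 p x ^+ n by exact: rmorphXn.
have lB x y : lin l 0 0 p (x - y) = lin l 0 0 p x - lin l 0 0 p y by exact: rmorphB.
have rD r : res l p r = lin l 0 0 p (th (psi i r)) by [].
split; rewrite rD.
- by rewrite psi_y1 thM lM th_c lin_c thY lY.
- by rewrite psi_y2 thM lM th_c lin_c thY lY.
- by rewrite psi_C thX lX thY lY.
by rewrite psi_v thU lB lM !lX lY lU.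
Qed.

Lemma reps_res : exists l p, [/\ l != 0, p != 0 &
  forall k F, Z E k.*2 F -> rp k F (res l p (Phi k.*2 (tot F)))].
Proof.
have [lam lam0 hlam] := Phi_beta hE hW iso eqv q1 q2 E11 E12 E21 E22 Ec.
have [Fv zv Pv] := Phi_surj iso homog_v.
have [FC zC PC] := Phi_surj iso homog_C.
have [p p0 rv] := v_reps hE hW iso eqv q1 q2 E11 E12 E21 E22 Ec hlam co zv Pv.
have sAE := A_sub hE i.
pose l := lam^-1; have l0 : l != 0 by rewrite invr_eq0.
have l6 : l ^+ 6 = 1.
  by apply: (mulfI l0); rewrite -exprS F7_exp7 mulr1.
have [ry1 ry2 rC rV] := resE l p.
have [h1 h2] : ep1 a = pt1 i /\ ep2 a = pt2 i := a_ep hE q1 q2 E11 E12 E21 E22 i.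
have gen chi y : qchar E chi y ->
    rp 1 (beta y *+ l) (kS (chi a) * (kS l * Yv)) /\
    Phi 2 (tot (beta y *+ l)) = cst (chi e1) * y1 + cst (chi e2) * y2.
  move=> qy; split; last first.
    rewrite (PhiMn iso) ?(hlam _ _ qy) ?(mulrn_F7 cst) ?mulrA -?(rmorphM cst); last exact: Z_beta qy.
    by rewrite mulVf // rmorph1 mul1r.
  have -> : kS (chi a) * (kS l * Yv) = (Yv *+ chi a + Uv *+ 0%N) *+ l :> F7yu.
    by rewrite mulr0n addr0 !(mulrn_F7 kS) mulrCA.
  apply: repsMn; apply: (reps_lin (coY co) (coU co)); first exact: qcharS sAE qy.
  move=> h hA; rewrite (char_A (qcharS sAE qy) co hA) (chi_c hE qy) natr_Zp.
  by rewrite !mul0r.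
have L1 : linked E A Phi Y U (res l p) 1 (beta Ep1 *+ l) y1.
  have [g1 g2] := gen _ _ q1; split; first exact/ZMn/(Z_beta q1).
    by rewrite g2 E11 E12 rmorph1 rmorph0 mul0r mul1r addr0.
  by rewrite h1 -ry1 in g1.
have L2 : linked E A Phi Y U (res l p) 1 (beta Ep2 *+ l) y2.
  have [g1 g2] := gen _ _ q2; split; first exact/ZMn/(Z_beta q2).
    by rewrite g2 E21 E22 rmorph1 rmorph0 mul0r mul1r add0r.
  by rewrite h2 -ry2 in g1.
have Lv : linked E A Phi Y U (res l p) 7 Fv v.
  have EV : res l p v = kS p * th Uv.
    have key (T : comNzRingType) (q m y u : T) : q ^+ 7 = q -> m ^+ 6 = 1 ->
        (q * u) ^+ 7 - (m * y) ^+ 6 * (q * u) = q * (u ^+ 7 - y ^+ 6 * u).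
      by move=> q7 m6; rewrite !exprMn q7 m6 mul1r; ring.
    by rewrite rV thU; apply: key; rewrite -(rmorphXn kS) ?F7_exp7 ?l6 ?kS_1.
  by split; [exact: zv|exact: Pv|rewrite -EV in rv; exact: rv].
(* C is pinned by C x = x^7 with x the one of y1, y2 that restricts to [kS l * Yv]; this nonzero
   factor cancels. *)
have LC : linked E A Phi Y U (res l p) 6 FC C.
  split=> //; have [Q rQ] := co_ex co Yv Uv (k := 6) (ZS sAE zC).
  suff EQ : Q = (kS l * Yv) ^+ 6 by rewrite EQ -rC in rQ.
  have [x [F [Lx Cx Ex]]] : exists x F, [/\ linked E A Phi Y U (res l p) 1 F x, C * x = x ^+ 7
      & res l p x = kS l * Yv].
    have [_ eC1 eC2 _] := HBE_relE.
    have [p1|p2] : pt1 i = 1 \/ pt2 i = 1 by case: (i) => [k|]; [left|right].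
      exists y1, (beta Ep1 *+ l); split; [exact: L1|exact: eC1|rewrite ry1 p1 kS_1 mul1r; reflexivity].
    exists y2, (beta Ep2 *+ l); split; [exact: L2|exact: eC2|rewrite ry2 p2 kS_1 mul1r; reflexivity].
  have [zF PF rF'] := Lx.
  have rF : rp 1 F (kS l * Yv) by rewrite -Ex; exact: rF'.
  have r7 := repsX (coY co) (coU co) 7 rF.
  have r1 := repsM (coY co) (coU co) rQ rF.
  have z7 : Z E 14 (F ^+ 7) := ZX 7 zF.
  have z1 : Z E 14 (FC * F) := ZM zC zF.
  have r3 := repsB (coY co) (coU co) F7yu7 r1 r7.
  have Z0 : kS l * Yv != 0 by rewrite mulf_neq0 ?Yv0 ?polyC_eq0 ?polyC_eq0.
  apply: (mulIf Z0); rewrite -exprSr; apply/eqP; rewrite -subr_eq0; apply/eqP.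
  apply: (pnil_reps co F7yu7 sAE _ r3).
  apply/(Phi_eq0 iso (ZB z1 z7)); rewrite (PhiB iso z1 z7) (PhiM iso (n := 12) (m := 2) zC zF).
  by rewrite (PhiX iso 7 zF) PC PF Cx subrr.
exists l, p; split=> // k F zF.
exact: (reps_linked iso co sAE L1 L2 LC Lv zF).
Qed.
End Link.

(** * Fusion and the image of restriction *)
Section DiagonalSubstitution.
Variables (l p : 'F_7).
Hypotheses (l0 : l != 0) (p0 : p != 0).

Lemma lin_comp a b c d a' b' c' d' P : lin a b c d (lin a' b' c' d' P) =
  lin (a' * a + b' * c) (a' * b + b' * d) (c' * a + d' * c) (c' * b + d' * d) P.
Proof.
have lin_c a1 b1 c1 d1 e : lin a1 b1 c1 d1 (kS e) = kS e.
  exact: (F7_rmorph_eq (lin a1 b1 c1 d1 \o kS) kS).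
have lD x y : lin a b c d (x + y) = lin a b c d x + lin a b c d y by exact: rmorphD.
have lM x y : lin a b c d (x * y) = lin a b c d x * lin a b c d y by exact: rmorphM.
have kD x y : kS (x + y) = kS x + kS y by exact: rmorphD.
have kM x y : kS (x * y) = kS x * kS y by exact: rmorphM.
have key s t : lin a b c d (kS s * Yv + kS t * Uv) =
    kS (s * a + t * c) * Yv + kS (s * b + t * d) * Uv.
  rewrite lD !lM !lin_c linY linU !kD !kM.
  move: (kS _) (kS _) (kS _) (kS _) (kS _) (kS _) Yv Uv => x1 x2 x3 x4 x5 x6 Y U; ring.
apply: (F7yu_rmorph_eq (f := lin a b c d \o lin a' b' c' d') (g := lin _ _ _ _)) => /=.
  by rewrite !linY.
by rewrite !linU.
Qed.

Lemma lin_id P : lin 1 0 0 1 P = P.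
Proof.
have e1 : lin 1 0 0 1 Yv = Yv by rewrite linY kS_1 kS_0 mul1r mul0r addr0.
have e2 : lin 1 0 0 1 Uv = Uv by rewrite linU kS_1 kS_0 mul1r mul0r add0r.
exact: (F7yu_rmorph_eq (f := lin 1 0 0 1) (g := idfun) e1 e2).
Qed.

Lemma lin_diag_inj : injective (lin l 0 0 p).
Proof.
apply: (can_inj (g := lin l^-1 0 0 p^-1)) => P.
rewrite lin_comp !(mulr0, mul0r, addr0, add0r) !mulfV //.
exact: lin_id.
Qed.

(** The diagonal scalars change a substitution without changing its determinant. *)
Lemma lin_diagC a b c d P : lin a b c d (lin l 0 0 p P) =
  lin l 0 0 p (lin a (l * b / p) (p * c / l) d P).
Proof.
rewrite !lin_comp !(mulr0, mul0r, addr0, add0r) !divfK // ![_ * l]mulrC.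
by rewrite [d * p]mulrC.
Qed.
End DiagonalSubstitution.

Section FusionInvariance.
Variables (gT : finGroupType) (G E : {group gT}) (e1 e2 c : gT) (Phi : nat -> cochain gT -> HBE).
Hypotheses (hE : extraspecial7 E e1 e2 c) (sylE : 7.-Sylow(G)%g E)
  (hW : forall g : {'GL_2['F_7]}, W_E G E e1 e2 c (GLval g) <-> g \in W_6S3)
  (iso : graded_ring_iso E Phi) (eqv : Out_equivariant E e1 e2 c Phi).
Variables (ep1 Ep1 ep2 Ep2 : gT -> 'F_7).
Hypotheses (q1 : qchar E ep1 Ep1) (q2 : qchar E ep2 Ep2)
  (E11 : ep1 e1 = 1) (E12 : ep1 e2 = 0) (E21 : ep2 e1 = 0) (E22 : ep2 e2 = 1)
  (Ec : forall x, x \in E -> ep1 x = 0 -> ep2 x = 0 -> x \in <[c]>%g).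

Lemma fusion_MCA n F : Z E n F -> inv G F -> MCA (Phi n (tot F)).
Proof.
move=> zF iF; have [q Eq] := cl_surj (Phi n (tot F)).
have fixN x g : x \in 'N_G(E)%g -> out_matrix e1 e2 c (fun e => e ^ x)%g g ->
    evalHBE (gstar g) q = Phi n (tot F).
  move=> xN hg; rewrite -(Phi_conj hE iso eqv xN hg zF Eq) iF //.
  by rewrite groupV; case/setIP: xN.
have cube l m (l6 : l ^+ 6 = 1) (m6 : m ^+ 6 = 1) : l ^+ 3 = 1 -> m ^+ 3 = 1 ->
    gd l6 m6 (Phi n (tot F)) = Phi n (tot F).
  move=> l3 m3; have [x xN hx] := diag_lift hW l3 m3.
  by have := fixN _ _ xN hx; rewrite (gstar_diag l6 m6) -Eq.
have i6 : (-1 : 'F_7) ^+ 6 = 1 by exact: val_inj.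
have neg : gd i6 i6 (Phi n (tot F)) = Phi n (tot F).
  have [x xN hx] := neg_lift hW.
  by have := fixN _ _ xN hx; rewrite (gstar_diag i6 i6) -Eq.
apply: MCA_inv => [l m l6 m6 /andP[/eqP Elm /orP[/eqP l3|/eqP l3]]|].
- by apply: (cube l m l6 m6 l3); rewrite -Elm; exact: l3.
(* A pair with cubes -1 acts as -1 followed by a pair with cubes 1, and both are among the
   generators of 6S3. *)
- have l6' : (- l) ^+ 6 = 1 by rewrite -mulN1r exprMn i6 mul1r.
  have m6' : (- m) ^+ 6 = 1 by rewrite -mulN1r exprMn i6 mul1r.
  have i3 : (-1 : 'F_7) ^+ 3 = -1 by exact: val_inj.
  have l3' : (- l) ^+ 3 = 1 by rewrite -mulN1r exprMn l3 i3 mulrNN mul1r.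
  have m3' : (- m) ^+ 3 = 1 by rewrite -mulN1r exprMn -Elm l3 i3 mulrNN mul1r.
  rewrite -[RHS](cube _ _ l6' m6' l3' m3') -[in RHS]neg.
  have gc a b (a6 : a ^+ 6 = 1) (b6 : b ^+ 6 = 1) e : gd a6 b6 (cst e) = cst e.
    exact: (F7_rmorph_eq (gd a6 b6 \o cst)).
  have gM a b (a6 : a ^+ 6 = 1) (b6 : b ^+ 6 = 1) x y : gd a6 b6 (x * y) = gd a6 b6 x * gd a6 b6 y.
    exact: rmorphM.
  move: (Phi _ _); apply: (HBE_rmorph_eq (f := gd _ _) (g := gd l6' m6' \o gd i6 i6)) => /=.
  + by rewrite !gd_y1 gM gc gd_y1 mulrA -(rmorphM cst) mulN1r opprK.
  + by rewrite !gd_y2 gM gc gd_y2 mulrA -(rmorphM cst) mulN1r opprK.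
  + by rewrite !gd_C.
  + by rewrite !gd_v gM gc gd_v mulrA -(rmorphM cst) mulrNN mulr1 mul1r mulrNN.
- have o6 : (1 : 'F_7) ^+ 6 = 1 by exact: expr1n.
  have [x xN hx] := swap_lift hW.
  have := fixN _ _ xN hx; rewrite (_ : swap2 = anti2 1 1); last by rewrite swap2E.
  by rewrite (gstar_anti o6 o6) -Eq cube ?expr1n.
Qed.

Section Radical.
Variables (i : option 'F_7) (chiY Y chiU U : gT -> 'F_7).
Notation A := (A_ e1 e2 c i).
Hypothesis co : coords A (a_ e1 e2 i) c chiY Y chiU U.

Lemma fusion_lin k F P x : Z E k.*2 F -> inv G F -> x \in 'N_G(A)%g ->
  reps A Y U Yv Uv k F P ->
  lin (chiY (a_ e1 e2 i ^ x)%g) (chiY (c ^ x)%g)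
    (chiU (a_ e1 e2 i ^ x)%g) (chiU (c ^ x)%g) P = P.
Proof.
move=> zF iF xN rP; case/setIP: (xN) => xG xA.
have sA : A \subset (A :^ x^-1)%g by rewrite (normP _) // groupV.
have := reps_conj co co sA rP; rewrite invgK iF ?groupV // => r2.
by apply: (co_inj co F7yu7 r2 rP); rewrite subrr; apply: nul0.
Qed.

Hypothesis hR : forall g : 'M['F_7]_2, W_A G e1 e2 c i g <-> \det g = 1 \/ \det g = -1.

(** The antidiagonal matrix with entries l / p and p / l has determinant -1, and in the scaled
    coordinates of [res] it becomes the swap. *)
Lemma fusion_sym k F : Z E k.*2 F -> inv G F -> sym (psi i (Phi k.*2 (tot F))).
Proof.
move=> zF iF; have [l [p [l0 p0 rF]]] := reps_res hE hW iso eqv q1 q2 E11 E12 E21 E22 Ec co.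
have dg : \det (mx2 0 (l / p) (p / l) 0) = -1.
  by rewrite det_mx2 mul0r sub0r mulrA divfK // divff.
have /hR/W_AP := or_intror (\det (mx2 0 (l / p) (p / l) 0) = 1) dg.
case/(_ _ _ _ _ (coY co) (coU co) (coYs co) (coYt co) (coUs co) (coUt co) (coI co)) => x xN Ex.
have := fusion_lin zF iF xN (rF _ _ zF).
have [<- <- <- <-] : [/\ 0 = chiY (a_ e1 e2 i ^ x)%g, p / l = chiY (c ^ x)%g,
    l / p = chiU (a_ e1 e2 i ^ x)%g & 0 = chiU (c ^ x)%g].
  by have h s t := congr1 (fun g : 'M['F_7]_2 => g s t) Ex; have := (h 0 0, h 0 1, h 1 0, h 1 1);
    rewrite !mxE /= => -[[[-> ->] ->] ->].
rewrite -[res i l p _]/(lin l 0 0 p (th (psi i _))) lin_diagC //.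
have k1 s t : s != 0 -> t != 0 -> s * (t / s) / t = 1 :> 'F_7.
  by move=> s0 t0; rewrite mulrCA mulfV // mulr1 mulfV.
rewrite (k1 l p) // (k1 p l) //.
exact: lin_diag_inj.
Qed.
End Radical.

Lemma fusion_comb n F : Z E n F -> inv G F ->
  (forall i, i \in [:: Some 1; Some (-1)] -> forall g : 'M['F_7]_2,
     W_A G e1 e2 c i g <-> \det g = 1 \/ \det g = -1) ->
  exists P Q, Phi n (tot F) = comb P Q.
Proof.
move=> zF iF hR; case: (boolP (odd n)) => on.
  have Ek : n = (n./2).*2.+1 by rewrite -[LHS]odd_double_half on.
  exists (fun=> 0), (fun=> 0); move: zF; rewrite Ek => zF; rewrite (Phi_odd iso zF).
  by rewrite /comb !rmorph0 !mul0r !addr0.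
have Ek : n = (n./2).*2 by rewrite -[LHS]odd_double_half (negPf on).
move: zF; rewrite Ek => zF; apply: MCA_dickson; first exact: fusion_MCA.
  have [chiY [Y [chiU [U co]]]] := co_A (Some (-1)) hE.
  by apply: (fusion_sym co) => //; apply: hR; rewrite !inE eqxx orbT.
have [chiY [Y [chiU [U co]]]] := co_A (Some 1) hE.
by apply: (fusion_sym co) => //; apply: hR; rewrite !inE eqxx.
Qed.

Lemma cocycleS (H : {group gT}) n (f : cochain gT) : (H \subset G)%g -> cocycle G n f -> cocycle H n f.
Proof.
move=> /subsetP sH [h1 h2].
have sS m s : simplex H m s -> simplex G m s.
  by case/andP=> Es /allP sE; apply/andP; split=> //; apply/allP => y /sE /sH.
by split=> [x s /sH xG /sS|s /sS]; [exact: h1|exact: h2].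
Qed.

Lemma image_sub r : 
  (forall i, i \in [:: Some 1; Some (-1)] -> forall g : 'M['F_7]_2,
     W_A G e1 e2 c i g <-> \det g = 1 \/ \det g = -1) ->
  HBG_image G Phi r -> exists P Q, r = comb P Q.
Proof.
move=> hR [N [f [cf ->]]]; have sE := sEG sylE.
elim: N => [|N [P [Q IH]]].
  by exists (fun=> 0), (fun=> 0); rewrite big_ord0 /comb !rmorph0 !mul0r !addr0.
have zG := Z_extend (cf N); have zE := ZS sE zG.
have [iG _ _] := zG; have [P' [Q' E']] := fusion_comb zE iG hR.
exists (fun j => P j + P' j), (fun j => Q j + Q' j); rewrite big_ord_recr /= IH.
rewrite -combD; congr (_ + _); rewrite -E'; apply: (Phi_ext iso) => //.
  exact: cocycleS.
move=> s /andP[Es sS]; rewrite extend_simplex //; apply/andP; split=> //.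
by apply/allP => y /(allP sS) /(subsetP sE).
Qed.
End FusionInvariance.

(** * Restriction of a transfer to A *)

Section Mackey.
Variables (gT : finGroupType) (G E A : {group gT}).
Variables (s t : gT) (chiY Y chiU U : gT -> 'F_7).
Hypotheses (sAG : A \subset G) (co : coords A s t chiY Y chiU U) (oA : (7.-group A)%g).
Notation rp := (reps A Y U Yv Uv).

(** The contribution of one double coset E x A to the Mackey formula; by [stab_rcoset] the
    stabilizer is the intersection of A with E^x. *)
Lemma orbit_sum F x : inv E F ->
  \sum_(C in orbit 'Rs A (E :* x)%g) act (repr C) F =
  tr 'C_A[(E :* x)%g | 'Rs] A (act x F).
Proof.
move=> iF; have Eo := orbit_stabilizer 'Rs (E :* x)%g (subsetT A).
have inj : {in rcosets 'C_A[(E :* x)%g | 'Rs] A &, injective (fun B => 'Rs%act (E :* x)%g (repr B))}.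
  by apply/imset_injP; rewrite -Eo card_orbit.
rewrite Eo big_imset //; apply: eq_bigr => B _ /=.
by rewrite rcosetE -rcosetM (act_repr _ iF) actM.
Qed.

Lemma stab_rcoset x : 'C_A[(E :* x)%g | 'Rs]%g = (A :&: E :^ x)%g.
Proof. by rewrite -[(E :* x)%g]rcosetE -[rcoset _ _]/('Rs%act (E : {set gT}) x) astab1_act astab1Rs. Qed.

(* A coset not fixed by A contributes the transfer from some D < A of a class that
   extends to A, a multiple of |A : D|. *)
Lemma reps_transfer k F P : Z E k.+1.*2 F ->
  (forall x, x \in G -> A \subset (E :^ x)%g -> rp k.+1 (act x F) P) ->
  rp k.+1 (tr E G F) (P *+ #|G : E|%g).
Proof.
move=> zF rF; have [iF _ _] := zF.
have aR : [acts A, on rcosets E G | 'Rs].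
  exact: subset_trans sAG (actsRs_rcosets E G).
have pR := orbit_partition aR.
rewrite /tr (set_partition_big _ pR) /indexg (card_partition pR) -sumrMnr.
apply: reps_sum => _ /imsetP[_ /rcosetsP[x xG ->] ->].
rewrite (orbit_sum _ iF) card_orbit; set D := 'C_A[_ | _]%G.
have sDA : D \subset A by apply: subsetIl.
have sDE : D \subset (E :^ x)%g by rewrite /= stab_rcoset subsetIr.
have zx : Z (E :^ x)%G k.+1.*2 (act x F) by apply: Z_act.
have zD : Z D k.+1.*2 (act x F) by apply: ZS zx.
case: (boolP (A \subset D)) => [sAD|nAD].
  have sAE : A \subset (E :^ x)%g := subset_trans sAD sDE.
  have [ix _ _] := ZS (K := (E :^ x)%G) sAE zx.
  by rewrite (tr_inv sDA ix); apply/repsMn/rF.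
have pDA : D \proper A by rewrite properE sDA.
have d7 : (7 %| #|A : D|%g)%N.
  have /p_natP[[|m] Em] : pnat 7%N #|A : D|%g.
  - by apply: pnat_dvd oA; apply: dvdn_indexg.
  - by move/eqP: Em; rewrite expn0 indexg_eq1 (negPf nAD).
  - by rewrite Em expnS dvdn_mulr.
have [H zH cH] := ext_class (coY co) (coU co) (coI co) pDA zD.
have iH : inv A H by case: zH.
have -> : tr D A (act x F) = tr D A (act x F - H) + H *+ #|A : D|%g.
  by rewrite trB (tr_inv sDA iH) subrK.
have -> : P *+ #|A : D|%g = 0.
  by case/dvdnP: d7 => m ->; rewrite mulrnA (T7n F7yu7).
apply: nul_reps0; apply: nulD; first exact/nul_cob/cob_tr.
exact: nul_mod7.
Qed.
End Mackey.

(** * Transfers of classes in the span *)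

Section ImageContains.
Variables (gT : finGroupType) (G E : {group gT}) (e1 e2 c : gT) (Phi : nat -> cochain gT -> HBE).
Hypotheses (hE : extraspecial7 E e1 e2 c) (sylE : 7.-Sylow(G)%g E)
  (hW : forall g : {'GL_2['F_7]}, W_E G E e1 e2 c (GLval g) <-> g \in W_6S3)
  (hR : forall i, i \in [:: Some 1; Some 2; Some 3; Some 4; Some 5; Some 6] ->
     forall g : 'M['F_7]_2, W_A G e1 e2 c i g <-> \det g = 1 \/ \det g = - 1)
  (hN : forall i, i \in [:: Some 0; None] -> ~ radical G e1 e2 c i)
  (hC : forall i j, (exists2 x, x \in G & A_ e1 e2 c j :=: (A_ e1 e2 c i :^ x)%g)
        <-> has (fun cls => (i \in cls) && (j \in cls)) A_classes)
  (iso : graded_ring_iso E Phi) (eqv : Out_equivariant E e1 e2 c Phi).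
Variables (ep1 Ep1 ep2 Ep2 : gT -> 'F_7).
Hypotheses (q1 : qchar E ep1 Ep1) (q2 : qchar E ep2 Ep2)
  (E11 : ep1 e1 = 1) (E12 : ep1 e2 = 0) (E21 : ep2 e1 = 0) (E22 : ep2 e2 = 1)
  (Ec : forall x, x \in E -> ep1 x = 0 -> ep2 x = 0 -> x \in <[c]>%g).

Lemma cube_pair6 l m : cube_pair l m -> l ^+ 6 = 1 /\ m ^+ 6 = 1.
Proof.
have h (x : 'F_7) : (x ^+ 3 == 1) || (x ^+ 3 == -1) -> x ^+ 6 = 1.
  by rewrite (exprM x 3 2) => /orP[/eqP ->|/eqP ->]; rewrite ?sqrrN expr1n.
by case/andP=> /eqP E3 h3; split; apply: h; rewrite -?E3.
Qed.

Lemma Phi_normalizer m F P Q n : Z E m F -> n \in 'N_G(E)%g -> Phi m (tot F) = comb P Q ->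
  Z E m (act n^-1%g F) /\ Phi m (tot (act n^-1%g F)) = comb P Q.
Proof.
move=> zF nN EF; split.
  have nE : (E :^ n^-1)%G = E.
    by apply/val_inj/normP; rewrite groupV; case/setIP: nN.
  by rewrite -[X in Z X]nE; apply: Z_act.
have [q Eq] := cl_surj (Phi m (tot F)).
have [l [u [clu hout]]] := NE_W hE hW q1 q2 E11 E12 E21 E22 Ec nN.
have [l6 u6] := cube_pair6 clu.
case: hout => hout; rewrite (Phi_conj hE iso eqv nN hout zF Eq).
  by rewrite (gstar_diag l6 u6) -Eq EF gd_comb.
by rewrite (gstar_anti l6 u6) -Eq EF gd_comb // gs_comb.
Qed.

Section Restricted.
Variables (i : option 'F_7) (chiY Y chiU U : gT -> 'F_7).
Notation A := (A_ e1 e2 c i).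
Notation a := (a_ e1 e2 i).
Hypothesis co : coords A a c chiY Y chiU U.
Notation rp := (reps A Y U Yv Uv).

(** On a radical A_i the restriction is a Dickson invariant, fixed by determinants 1 and -1. On A_0
    and A_inf, [frattini_A] writes z as an element of N_G(E), which fixes the class, times one that
    centralizes A_i. *)
Lemma reps_normalizer k F P Q l p z : l != 0 -> p != 0 ->
  (forall k F, Z E k.*2 F -> rp k F (res i l p (Phi k.*2 (tot F)))) ->
  Z E k.*2 F -> Phi k.*2 (tot F) = comb P Q -> z \in 'N_G(A)%g ->
  rp k (act z F) (res i l p (comb P Q)).
Proof.
move=> l0 p0 hres zF EF zN.
have move_ x F' : x \in 'N(A)%g -> rp k F' (res i l p (comb P Q)) -> rp k (act x F')
    (lin (chiY (a ^ x^-1)%g) (chiY (c ^ x^-1)%g) (chiU (a ^ x^-1)%g) (chiU (c ^ x^-1)%g)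
       (res i l p (comb P Q))).
  by move=> nx rF'; apply: (reps_conj co co) => //; rewrite (normP nx).
have [/hN nr|iR] : i \in [:: Some 0; None] \/
    i \in [:: Some 1; Some 2; Some 3; Some 4; Some 5; Some 6].
- by case: (i) => [[[|[|[|[|[|[|[|//]]]]]]] j]|]; rewrite !inE; [left|right..|left].
- have [n [z' [nN zC Ez]]] := frattini_A hE sylE (coY co) (coU co) (coYs co) (coYt co)
    (coUs co) (coUt co) (coI co) nr zN.
  have nV : n^-1%g \in 'N_G(E)%g by rewrite groupV.
  have [] := Phi_normalizer zF nV EF; rewrite invgK => zF' EF'.
  rewrite Ez -actM.
  have z'N : z' \in 'N(A)%g by apply: (subsetP (cent_sub _)).
  have := move_ z' (act n F) z'N; rewrite -{1}EF' => /(_ (hres _ _ zF')).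
  have z'c y : y \in A -> (y ^ z'^-1 = y)%g.
    by move=> yA; apply/conjg_fixP/commgP/commute_sym/(centP _ _ yA); rewrite groupV.
  rewrite !z'c ?(cot co) ?(cos co) // (coYs co) (coYt co) (coUs co) (coUt co).
  by rewrite lin_id.
have hi := hR iR; have zV : z^-1%g \in 'N_G(A)%g by rewrite groupV.
have zA : z \in 'N(A)%g by case/setIP: zN.
have := move_ z F zA; rewrite -{1}EF => /(_ (hres _ _ zF)).
suff -> : lin (chiY (a ^ z^-1)%g) (chiY (c ^ z^-1)%g) (chiU (a ^ z^-1)%g) (chiU (c ^ z^-1)%g)
    (res i l p (comb P Q)) = res i l p (comb P Q) by [].
have [k0 [Ei k6]] : exists k0, i = Some k0 /\ k0 ^+ 6 = 1.
  case: (i) iR => [k0|] //; rewrite !inE => h; exists k0; split=> //.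
  by move: h; do 5?[case/orP]; rewrite (inj_eq (@Some_inj _)) => /eqP ->; apply: val_inj.
have hpsi a1 b1 c1 d1 : (a1 * d1 - b1 * c1) ^+ 2 = 1 ->
    lin a1 b1 c1 d1 (th (psi i (comb P Q))) = th (psi i (comb P Q)).
  by move=> h1; rewrite Ei; exact: (lin_psi_comb P Q k6 h1).
have /hi dz : W_A G e1 e2 c i (NA_mx e1 e2 c i chiY chiU z^-1%g).
  apply: (proj2 (W_AP G (coY co) (coU co) (coYs co) (coYt co) (coUs co) (coUt co) (coI co) _)).
  by exists z^-1%g.
rewrite -[res i l p _]/(lin l 0 0 p (th (psi i _))) lin_diagC // hpsi //.
move: dz; rewrite det_mx2; move: (chiU _) (chiU _) (chiY _) (chiY _) => x1 x2 x3 x4.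
have -> : x4 * x2 - l * x3 / p * (p * x1 / l) = x2 * x4 - x1 * x3 :> 'F_7.
  by field; rewrite l0 p0.
by case=> ->; rewrite ?sqrrN expr1n.
Qed.

(** The conjugate of A_i by x^-1 lies in E, hence is some A_j, and N_G(E) already fuses A_j to A_i
    by an n as in [class_conj]. Replacing x by n x lands in N_G(A_i). *)
Lemma reps_fixed_coset k F P Q l p x : l != 0 -> p != 0 ->
  (forall k F, Z E k.*2 F -> rp k F (res i l p (Phi k.*2 (tot F)))) ->
  Z E k.*2 F -> Phi k.*2 (tot F) = comb P Q -> x \in G -> A \subset (E :^ x)%g ->
  rp k (act x F) (res i l p (comb P Q)).
Proof.
move=> l0 p0 hres zF EF xG sAx.
have sBE : (A :^ x^-1)%G \subset E by rewrite /= sub_conjgV.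
have cB : #|(A :^ x^-1)%G| = 49%N by rewrite /= cardJg (card_A hE).
have [j Ej] := ord49_A hE q1 q2 E11 E12 E21 E22 Ec sBE cB.
have /hC/(class_conj hE hW q1 q2 E11 E12 E21 E22 Ec)[n nN En] :
    exists2 y, y \in G & A_ e1 e2 c j :=: (A :^ y)%g.
  by exists x^-1%g; rewrite ?groupV // -Ej.
have [nG _] := setIP nN.
have zN : (n * x)%g \in 'N_G(A)%g.
  by rewrite inE groupM //=; apply/normP; rewrite conjsgM En -Ej /= conjsgKV.
have [zF' EF'] := Phi_normalizer zF nN EF.
have -> : act x F = act (n * x)%g (act n^-1%g F) by rewrite actM mulKg.
exact: reps_normalizer l0 p0 hres zF' EF' zN.
Qed.
End Restricted.

Lemma th_inj : injective th.
Proof.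
move=> P Q E0; apply/eqP; rewrite -subr_eq0; apply/eqP.
apply: (alg_indep (T' := {poly 'F_7}) (k := kS) (k' := kX) (f := ev kX 'X 0) (x := Yv) (y := th Uv)).
- exact: thU0.
- by rewrite thU !(rmorphB, rmorphXn, rmorphM) /= evU expr0n mulr0 subr0.
- by move=> p; rewrite /= evY ev1_idX.
- by rewrite thU -[LHS]/(th (P - Q)) rmorphB /= E0 subrr.
Qed.

Lemma transfer_comb k F P Q : Z E k.+1.*2 F -> Phi k.+1.*2 (tot F) = comb P Q ->
  Phi k.+1.*2 (tot (tr E G F)) = comb P Q *+ #|G : E|%g.
Proof.
move=> zF EF; have sE := sEG sylE; apply: psi_eq => i.
have [chiY [Y [chiU [U co]]]] := co_A i hE.
have [l [p [l0 p0 hres]]] := reps_res hE hW iso eqv q1 q2 E11 E12 E21 E22 Ec co.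
have zT : Z E k.+1.*2 (tr E G F) by apply/(ZS sE)/Z_tr.
have oA : (7.-group (A_ e1 e2 c i))%g by rewrite /pgroup (card_A hE).
have sAG := subset_trans (A_sub hE i) sE.
have r1 := reps_transfer sAG co oA zF (fun x => reps_fixed_coset co l0 p0 hres zF EF (x := x)).
have E2 := co_inj co F7yu7 (hres _ _ zT) r1.
apply: th_inj; apply: (lin_diag_inj l0 p0).
rewrite -[LHS]/(res i l p _) -[RHS]/(res i l p _) rmorphMn; apply: E2.
by rewrite subrr; apply: nul0.
Qed.
End ImageContains.

Section PowerCongruence.
Variables (gT : finGroupType) (H : {group gT}) (I : nat -> coch gT -> Prop).
Hypotheses (I0 : forall n, I n 0) (ID : forall n F F', I n F -> I n F' -> I n (F + F'))
  (IMr : forall n m F F', I n F -> Z H m F' -> I (n + m) (F * F'))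
  (IMl : forall n m F F', Z H n F -> I m F' -> I (n + m) (F * F')).

(** Congruence modulo a two-sided ideal passes to powers without commutativity; it is applied with
    [nul] and with [cob]. *)
Lemma exp_congr n F F' k : Z H n F -> Z H n F' -> I n (F - F') ->
  I (k * n) (F ^+ k - F' ^+ k).
Proof.
move=> zF zF' h; elim: k => [|k IHk]; first by rewrite subrr; apply: I0.
have -> : F ^+ k.+1 - F' ^+ k.+1 = F * (F ^+ k - F' ^+ k) + (F - F') * F' ^+ k.
  by rewrite !exprS mulrBr mulrBl addrA subrK.
by rewrite mulSn; apply: ID; [apply: IMl|apply: IMr => //; apply: ZX].
Qed.
End PowerCongruence.

Lemma HBE7 (x : HBE) n : x *+ (n * 7) = 0.
Proof.
by rewrite mulrnA -[LHS]mulr_natr -(rmorph_nat cst) (_ : 7%:R = 0 :> 'F_7) ?rmorph0 ?mulr0 //; apply: val_inj.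
Qed.

(** * Injectivity of restriction *)
Section RestrictionInjective.
Variables (gT : finGroupType) (G E : {group gT}) (Phi : nat -> cochain gT -> HBE).
Hypotheses (sylE : 7.-Sylow(G)%g E) (oE : #|E| = 343%N) (iso : graded_ring_iso E Phi).

Let sE : E \subset G. Proof. exact: pHall_sub sylE. Qed.

(** Fermat's theorem; the index of a Sylow 7-subgroup is prime to 7. *)
Lemma index_pow6 : exists q, (#|G : E|%g ^ 6 = q * 7 + 1)%N.
Proof.
have co7 : coprime #|G : E|%g 7.
  by case/and3P: sylE => _ _; rewrite coprime_sym prime_coprime // p'natE.
have := Euler_exp_totient co7; rewrite totient_prime //= => E7.
by exists (#|G : E|%g ^ 6 %/ 7)%N; rewrite {1}(divn_eq (#|G : E|%g ^ 6) 7) E7.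
Qed.

(* |E| = 7^3 annihilates the positive-degree cohomology of E. *)
Lemma pnil_exp_cob n F : Z E n.+1 F -> pnil E n.+1 F ->
  exists k, cob E (k.+1 * n.+1) (F ^+ k.+1).
Proof.
move=> zF [G1 [N [zG zN [m cN] cF]]].
have nFN : nul E n.+1 (F - N).
  by exists G1 => //; rewrite addrAC.
have cN1 : cob E (m.+1 * n.+1) (N ^+ m.+1) by rewrite exprS mulSn; apply: cobMl.
have [G2 zG2 cG2] : nul E (m.+1 * n.+1) (F ^+ m.+1).
  rewrite -(subrK (N ^+ m.+1) (F ^+ m.+1)); apply: nulD; last exact: nul_cob.
  apply: (exp_congr (H := E) (I := nul E)) => //.
  - exact: nul0.
  - by move=> *; apply: nulD.
  - by move=> *; apply: nulMr.
  - by move=> *; apply: nulMl.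
(* F^(m+1) is 7 times a class up to a coboundary, so its cube is a multiple of 7^3 = |E|. The
   exponent m + 1 keeps the degree positive even for m = 0. *)
exists (3 * m.+1).-1; rewrite prednK ?muln_gt0 // exprM -mulnA.
have -> : F ^+ 3 ^+ m.+1 = F ^+ m.+1 ^+ 3 by rewrite -!exprM mulnC.
rewrite -(subrK ((G2 *+ 7) ^+ 3) (F ^+ m.+1 ^+ 3)); apply: cobD.
  apply: (exp_congr (H := E) (I := cob E)) => //.
  - exact: cob0.
  - by move=> *; apply: cobD.
  - by move=> *; apply: cobMr.
  - by move=> *; apply: cobMl.
  - exact: ZX.
  - exact: ZMn.
have -> : (G2 *+ 7) ^+ 3 = (G2 ^+ 3) *+ #|E| by rewrite oE exprMn_n.
have -> : (3 * (m.+1 * n.+1) = (3 * (m.+1 * n.+1)).-1.+1)%N by rewrite prednK // !muln_gt0.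
by apply: cob_order; rewrite prednK ?muln_gt0 //; apply: ZX.
Qed.

Lemma pnil_transfer n F : Z G n.+1 F -> pnil E n.+1 F -> pnil G n.+1 F.
Proof.
move=> zF /(pnil_exp_cob (ZS sE zF))[k ck].
have [q Eq] := index_pow6; pose M := (#|G : E|%g ^ 6)%N.
(* M is a power of the index and M = 7 q + 1, so F is M F minus 7 q F. A power of M F is a multiple
   of the index times F^(k+1), which is the transfer of a coboundary of E. *)
exists (- (F *+ q)), (F *+ M); split.
- exact/ZN/ZMn.
- exact: ZMn.
- exists k.+1; rewrite exprMn_n.
  have -> : (M ^ k.+1 = #|G : E|%g * (#|G : E|%g ^ 5 * M ^ k))%N by rewrite mulnA -expnS -expnS.
  rewrite mulrnA; apply: cobMn.
  have [iF _ _] := ZX k.+1 zF.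
  by rewrite -(tr_inv sE iF); apply: cob_tr.
- have -> : F - (- (F *+ q)) *+ 7 - F *+ M = 0; last exact: cob0.
  by rewrite /M Eq mulrnDr mulr1n mulNrn opprK mulrnA [F + _]addrC subrr.
Qed.

(** Degree 0 is separate because |E| annihilates only positive degrees. Here classes are integers,
    and n%:R = 0 in [HBE] forces 7 to divide n. *)
Lemma pnil0_transfer F : Z G 0 F -> pnil E 0 F -> pnil G 0 F.
Proof.
move=> zF pF; have [m Em] := deg0_const zF; have [n [q Emq]] := int_mod7 m.
have EF : F = n%:R + q%:~R *+ 7 by rewrite Em Emq rmorphD /= -pmulrn rmorphMn.
have zE := ZS sE zF; have zn : Z E 0 n%:R by exact: ZMn n (Z1 E).
have n7 : (7 %| n)%N.
  have : Phi 0%N (tot F) = 0 by apply/(Phi_eq0 iso zE).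
  rewrite EF (PhiD iso) //; last exact/ZMn/Z_int.
  rewrite (Phi_nul iso (nul7 (Z_int E q))) addr0 (PhiMn iso n (Z1 E)) (Phi1 iso).
  move/(congr1 (psi None)); rewrite rmorph0 rmorph_nat; exact: natF7yu.
have /dvdnP[u Eu] := n7.
exists (u%:R + q%:~R), 0; split.
- by apply: ZD; [apply: ZMn (Z1 G)|apply: Z_int].
- exact: Z0.
- by exists 1%N; rewrite expr1; apply: cob0.
- by rewrite subr0 EF Eu mulrnDl mulrnA subrr; apply: cob0.
Qed.

Lemma restriction_injectiveP : restriction_injective G Phi.
Proof.
move=> n f cf P0; have zF := Z_extend cf; have zE := ZS sE zF.
have EP : Phi n (tot (extend G n f)) = 0.
  rewrite -P0; symmetry; apply: (Phi_ext iso) zE _; first exact: cocycleS cf.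
  move=> s /andP[Es sS]; rewrite extend_simplex //; apply/andP; split=> //.
  by apply/allP => y /(allP sS) /(subsetP sE).
have pE : pnil E n (extend G n f) by apply/(Phi_eq0 iso zE).
have pG : pnil G n (extend G n f).
  by case: n {cf P0 EP} zF zE pE => [|n] zF zE pE; [exact: pnil0_transfer|exact: pnil_transfer].
have [_ /(_ pG)[g [h [cg ch nh E1]]]] := in_p_nilP zF.
exists g, h; split=> //; apply: coboundary_ext E1 => s sG.
by rewrite extend_simplex.
Qed.

Lemma image_Z n F : Z G n F -> HBG_image G Phi (Phi n (tot F)).
Proof.
move=> zF; exists n.+1, (fun m => tot (if m == n then F else 0)); split=> [m|].
  by case: eqP => [->|_]; apply: cocycle_tot => //; apply: Z0.
rewrite big_ord_recr /= eqxx big1 ?add0r // => m _.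
by rewrite ltn_eqF ?ltn_ord // (Phi0 iso).
Qed.

(** The families of r and s may have different lengths; both are extended by 0 to the longer one. *)
Lemma image_add r s : HBG_image G Phi r -> HBG_image G Phi s -> HBG_image G Phi (r + s).
Proof.
case=> N [f [cf ->]] [M [g [cg ->]]].
pose F n := if (n < N)%N then extend G n (f n) else 0.
pose K n := if (n < M)%N then extend G n (g n) else 0.
have zF n : Z G n (F n) by rewrite /F; case: ifP => _; [exact: Z_extend|exact: Z0].
have zK n : Z G n (K n) by rewrite /K; case: ifP => _; [exact: Z_extend|exact: Z0].
exists (maxn N M), (fun n => tot (F n + K n)); split=> [n|]; first exact/cocycle_tot/ZD.
have ext n h : cocycle G n h -> Phi n h = Phi n (tot (extend G n h)).
  move=> ch; apply: (Phi_ext iso); first exact: cocycleS ch.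
    exact/(ZS sE)/Z_extend.
  move=> x /andP[Es sS]; rewrite extend_simplex //; apply/andP; split=> //.
  by apply/allP => y /(allP sS) /(subsetP sE).
have wide L (W : nat -> coch gT) h : (L <= maxn N M)%N -> (forall n, cocycle G n (h n)) ->
    W = (fun n => if (n < L)%N then extend G n (h n) else 0) ->
    \sum_(n < L) Phi n (h n) = \sum_(n < maxn N M) Phi n (tot (W n)).
  move=> leL ch EW; rewrite (big_ord_widen _ (fun n => Phi n (h n)) leL) big_mkcond.
  by apply: eq_bigr => n _; rewrite EW; case: ifP => _; [exact: ext|rewrite (Phi0 iso)].
rewrite (wide N F f) ?leq_maxl // (wide M K g) ?leq_maxr // -big_split.
by apply: eq_bigr => n _; rewrite (PhiD iso) //; apply: (ZS sE).
Qed.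
End RestrictionInjective.

(** * The image of restriction *)

Section Image.
Variables (gT : finGroupType) (G E : {group gT}) (e1 e2 c : gT) (Phi : nat -> cochain gT -> HBE).
Hypotheses (hE : extraspecial7 E e1 e2 c) (sylE : 7.-Sylow(G)%g E)
  (hloc : Fi24'_local G E e1 e2 c)
  (iso : graded_ring_iso E Phi) (eqv : Out_equivariant E e1 e2 c Phi).

Lemma image_comb P Q : HBG_image G Phi (comb P Q).
Proof.
have [hW hR hN hC] := hloc.
have [ep1 [Ep1 [ep2 [Ep2 [q1 q2 [E11 E12] [E21 E22] Ec]]]]] := eps_ex hE.
move: P Q; apply: comb_homog_ind => [r s|n P Q hn]; first exact: (image_add sylE iso).
have [F zF EF] := Phi_surj iso hn; rewrite -EF.
case: (boolP (odd n)) => on.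
  have En : n = (n./2).*2.+1 by rewrite -[LHS]odd_double_half on.
  move: zF; rewrite En => zF; rewrite (Phi_odd iso zF) -(Phi0 iso 0).
  by apply: (image_Z iso); apply: Z0.
have En : n = (n./2).*2 by rewrite -[LHS]odd_double_half (negPf on).
case: (n./2) En => [|k] En.
  (* In degree 0 the cochain is an integer constant and already a cocycle of G; [transfer_comb]
     concerns positive degrees. *)
  rewrite {hn on}En in zF *; apply: (image_Z iso).
  by have [m ->] := deg0_const zF; apply: Z_int.
rewrite {hn on}En in zF EF *.
(* The transfer multiplies the class by the index; the fifth power completes this to index^6, which
   is 1 modulo 7. *)
have zT : Z G k.+1.*2 (tr E G F *+ (#|G : E|%g ^ 5)) by apply/ZMn/Z_tr.
have zTE : Z E k.+1.*2 (tr E G F) by apply/(ZS (sEG sylE))/Z_tr.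
suff -> : Phi k.+1.*2 (tot F) = Phi k.+1.*2 (tot (tr E G F *+ (#|G : E|%g ^ 5))).
  exact: (image_Z iso).
rewrite (PhiMn iso) // (transfer_comb hE sylE hW hR hN hC iso eqv q1 q2 E11 E12 E21 E22 Ec zF EF).
have [q Eq] := index_pow6 sylE.
by rewrite EF -mulrnA -expnS Eq mulrnDr HBE7 add0r.
Qed.

Lemma imageP r : HBG_image G Phi r <-> exists P Q, r = comb P Q.
Proof.
have [hW hR hN hC] := hloc.
have [ep1 [Ep1 [ep2 [Ep2 [q1 q2 [E11 E12] [E21 E22] Ec]]]]] := eps_ex hE.
split=> [|[P [Q ->]]]; last exact: image_comb.
apply: (image_sub hE sylE hW iso eqv q1 q2 E11 E12 E21 E22 Ec) => i.
by rewrite !inE => i1; apply: hR; rewrite !inE; case/orP: i1 => /eqP ->.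
Qed.
End Image.

Lemma DA_CA_comb_inj a b a' b' :
  DA_CA_comb x6 z2 a b = DA_CA_comb x6 z2 a' b' -> a = a' /\ b = b'.
Proof.
rewrite !combE; set A := fun i => _; set B := fun i => _; set A' := fun i => _; set B' := fun i => _.
move=> EAB; have := combD (fun i => A i - A' i) (fun i => B i - B' i) A' B'.
have -> : (fun i => A i - A' i + A' i) = A by apply: funext => i; rewrite subrK.
have -> : (fun i => B i - B' i + B' i) = B by apply: funext => i; rewrite subrK.
rewrite EAB -[RHS]add0r => /addIr/comb_eq0[hA hB].
have inj x y : toS x - toS y = 0 -> x = y.
  by rewrite -rmorphB => /toS_eq0/eqP; rewrite subr_eq0 => /eqP.
split; apply/ffunP => i; apply: inj.
  by have := hA i (ltn_ord i); rewrite /A /A' inord_val.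
by have := hB i (ltn_ord i); rewrite /B /B' inord_val.
Qed.

Theorem theorem8p6 (gT : finGroupType) (G E : {group gT}) (e1 e2 c : gT)
    (Phi : nat -> cochain gT -> HBE) :
  is_Fi24' G ->
  7.-Sylow(G)%g E ->
  extraspecial7 E e1 e2 c ->
  Fi24'_local G E e1 e2 c ->
  graded_ring_iso E Phi ->
  Out_equivariant E e1 e2 c Phi ->
  let a := y1 ^+ 3 + y2 ^+ 3 in
  let b := y1 * y2 * v ^+ 2 in
  let d := (y1 ^+ 3 - y2 ^+ 3) * v ^+ 3 in
  let c' := C + y1 ^+ 3 * y2 ^+ 3 in
  let c'' := a ^+ 2 - 2%:R * c' in
  (* b^3 / V = y1^3 y2^3 *)
  (forall z, V * z = b ^+ 3 <-> z = y1 ^+ 3 * y2 ^+ 3) /\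
  restriction_injective G Phi /\
  free_DA_CA
    [tuple 1; b; b ^+ 2; a ^+ 2 * V; c' * b * V; c' * b ^+ 2 * V]
    [tuple c''; a * d]
    (HBG_image G Phi).
Proof.
move=> _ sylE hE hloc iso eqv a b d c' c''; split; first exact: V_cancel.
have oE : #|E| = 343%N by case: hE.
split; first exact: restriction_injectiveP sylE oE iso.
split; last exact: DA_CA_comb_inj.
move=> r; have [h1 h2] := imageP hE sylE hloc iso eqv r; have [g1 g2] := combP r.
by split=> [/h1/g1|/g2/h2].
Qed.
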